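(* Let $a,b>0$, $N\in\{1,2,3\}$, $0<p<2^*-2$ and $c>0$. Assume that $$\text{either } p>\frac{8}{N},\quad\text{or } p=\frac{8}{N}\ \text{ and }\ c>c_*:=\Big(\frac{b|Q|_{L^2}^{8/N}}{2}\Big)^{\frac{N}{8-2N}}.$$ Let $\bar t_p$ be the unique maximum point in $(0,+\infty)$ of the function $$f_p(t)=\frac{a}{2}t+\frac{b}{4}t^2-\frac{c^{\frac{2(p+2)-Np}{2}}}{2|Q|_{L^2}^p}t^{\frac{Np}{4}},$$ and let $\gamma(c)$ be the mountain pass level of $E$ on $S_c$. Then $\gamma(c)=f_p(\bar t_p)$, and it is attained by $$\bar u_c(x)=\frac{c\bar\lambda_p^{N/2}}{|Q|_{L^2}}Q(\bar\lambda_p x),\qquad \bar\lambda_p=\frac{(\bar t_p)^{1/2}}{c},$$ that is, $E(\bar u_c)=\gamma(c)$. Also, $\bar u_c$ is a solution of $$-\Big(a+b\int_{\mathbb{R}^N}|\nabla u|^2dx\Big)\Delta u-|u|^pu=\mu u\quad\text{in }\mathbb{R}^N$$ for some $\mu<0$. Moreover, $\bar u_c$ is unique in the following sense: if $\bar u\in S_c$ is a critical point of $E$ on $S_c$ whose energy equals $\gamma(c)$, namely $E'(\bar u)|_{S_c}=0$ and $E(\bar u)=\gamma(c)$, then, up to translations, $\bar u=\bar u_c$.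
   Context: Here $2^*=+\infty$ if $N=1,2$ and $2^*=6$ if $N=3$. For $0<p<2^*-2$, $Q=Q(|x|)$ denotes the unique (up to translations) radially symmetric positive solution in $H^1(\mathbb{R}^N)$ of $$-\Delta u+\frac{4+2p-Np}{Np}u-\frac{4}{Np}|u|^pu=0\quad\text{in }\mathbb{R}^N,$$ and $|Q|_{L^2}$ is its $L^2(\mathbb{R}^N)$ norm. The functional and the constraint set are $$E(u)=\frac{a}{2}\int_{\mathbb{R}^N}|\nabla u|^2dx+\frac{b}{4}\Big(\int_{\mathbb{R}^N}|\nabla u|^2dx\Big)^2-\frac{1}{p+2}\int_{\mathbb{R}^N}|u|^{p+2}dx,\qquad S_c=\Big\{u\in H^1(\mathbb{R}^N):\int_{\mathbb{R}^N}|u|^2dx=c^2\Big\}.$$ Mountain pass geometry: given $c>0$, $E$ is said to have mountain pass geometry on $S_c$ if there exists $K(c)>0$ such that $$\gamma(c):=\inf_{h\in\Gamma(c)}\max_{t\in[0,1]}E(h(t))>\max\{E(h(0)),E(h(1))\}$$ holds for all $h$ in the set $$\Gamma(c)=\big\{h\in C([0,1];S_c): h(0)\in A_{K(c)}\text{ and }E(h(1))<0\big\},$$ where $A_{K(c)}=\{u\in S_c:|\nabla u|_{L^2}^2\le K(c)\}$. Under the assumption on $(p,c)$ in the theorem it is known (Ye) that $E$ has mountain pass geometry on $S_c$; the number $\gamma(c)$ in the theorem is the one defined by such a $K(c)$. $E'(\bar u)|_{S_c}=0$ means that $\bar u$ is a critical point of $E$ constrained to $S_c$, i.e. there exists $\mu\in\mathbb{R}$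 with $E'(\bar u)=\mu\bar u$ (in the dual of $H^1(\mathbb{R}^N)$). Equality ''up to translations'' means $\bar u=\bar u_c(\cdot+y)$ for some $y\in\mathbb{R}^N$.
   Formalization: The uniqueness clause is stated up to sign: up to translations, ū = ū_c or −ū = ū_c. The literal claim fails because −ū_c also lies in S_c, is a critical point of E on S_c and has energy γ(c). *)

(* Defs.v *)
From HB Require Import structures.
From mathcomp Require Import all_boot all_order all_algebra.
From mathcomp Require Import all_classical all_reals all_analysis.

Set Implicit Arguments.
Unset Strict Implicit.
Unset Printing Implicit Defensive.
Import Order.TTheory GRing.Theory Num.Theory.
Import numFieldNormedType.Exports.

Local Open Scope classical_set_scope.
Local Open Scope ring_scope.

(* The Borel sigma-algebra of R^n = 'rV[R]_n, generated by the coordinates. *)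

Definition rV_display : measure_display -> measure_display.
Proof. exact. Qed.

Section measurable_rV.
Context {R : realType}.
Variable n : nat.

Definition rV_coord (i : 'I_n) (x : 'rV[R]_n) : R := x ord0 i.

Let rV_set0 : g_sigma_preimage rV_coord set0.
Proof. exact: sigma_algebra0. Qed.

Let rV_setC A : g_sigma_preimage rV_coord A -> g_sigma_preimage rV_coord (~` A).
Proof. exact: sigma_algebraC. Qed.

Let rV_bigcup (F : (set 'rV[R]_n)^nat) :
  (forall i, g_sigma_preimage rV_coord (F i)) ->
  g_sigma_preimage rV_coord (\bigcup_i (F i)).
Proof. exact: sigma_algebra_bigcup. Qed.

HB.instance Definition _ := @isMeasurable.Build (rV_display default_measure_display)
  'rV[R]_n (g_sigma_preimage rV_coord) rV_set0 rV_setC rV_bigcup.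

End measurable_rV.

Section measurable_rV_theory.
Context {R : realType}.

Lemma measurable_rV_coord n (i : 'I_n) :
  measurable_fun [set: 'rV[R]_n] (rV_coord i).
Proof.
move=> _ Y mY; rewrite setTI; apply: sub_sigma_algebra => /=.
rewrite -bigcup_seq/=; exists i => /=; first by rewrite mem_index_enum.
by exists Y => //; rewrite setTI.
Qed.

Lemma measurable_fun_rV d (T : measurableType d) n (f : T -> 'rV[R]_n) :
  (forall i, measurable_fun [set: T] (fun x => f x ord0 i)) ->
  measurable_fun [set: T] f.
Proof.
move=> mf.
have : g_sigma_preimage (fun i => rV_coord i \o f) `<=` measurable.
  apply: smallest_sub; first exact: sigma_algebra_measurable.
  rewrite -bigcup_seq => A [i /= _ [B mB <-]]; exact: mf.
rewrite g_sigma_preimage_comp => sub _ A mA.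
by apply: sub; exists A.
Qed.

End measurable_rV_theory.

Section lebesgue_rV.
Context {R : realType}.

Definition rV_cons n (p : R * 'rV[R]_n) : 'rV[R]_n.+1 :=
  \row_j (if unlift ord0 j is Some k then p.2 ord0 k else p.1).

Definition rV_uncons n (x : 'rV[R]_n.+1) : R * 'rV[R]_n :=
  (x ord0 ord0, \row_k x ord0 (lift ord0 k)).

Lemma rV_consK n : cancel (@rV_cons n) (@rV_uncons n).
Proof.
move=> [x t]; rewrite /rV_uncons /rV_cons !mxE unlift_none; congr (_, _).
by apply/rowP => k; rewrite !mxE liftK.
Qed.

Lemma measurable_rV_cons n : measurable_fun setT (@rV_cons n).
Proof.
apply: measurable_fun_rV => i.
case: (unliftP ord0 i) => [k ->|->].
  apply: (eq_measurable_fun (rV_coord k \o snd)).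
    by move=> x _; rewrite mxE liftK.
  by apply: measurableT_comp => //; exact: measurable_rV_coord.
apply: (eq_measurable_fun fst) => // x _.
by rewrite mxE unlift_none.
Qed.

Lemma measurable_rV_uncons n : measurable_fun setT (@rV_uncons n).
Proof.
apply: measurable_fun_pair; first exact: (measurable_rV_coord ord0).
apply: measurable_fun_rV => i.
apply: (eq_measurable_fun (rV_coord (lift ord0 i))).
  by move=> x _; rewrite mxE.
exact: measurable_rV_coord.
Qed.

#[local] Hint Extern 0 (measurable_fun _ (@rV_cons _)) =>
  solve [exact: measurable_rV_cons] : core.

Section lebesgue_step.
Variables (n : nat) (mu : {sigma_finite_measure set 'rV[R]_n -> \bar R}).

Definition lebesgue_step : set 'rV[R]_n.+1 -> \bar R :=
  pushforward (@lebesgue_measure R \x mu)%E (@rV_cons n).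

Let lebesgue_step0 : lebesgue_step set0 = 0%E.
Proof. exact: measure0. Qed.

Let lebesgue_step_ge0 A : (0 <= lebesgue_step A)%E.
Proof. exact: measure_ge0. Qed.

Let lebesgue_step_sigma_additive : semi_sigma_additive lebesgue_step.
Proof. exact: measure_semi_sigma_additive. Qed.

HB.instance Definition _ := isMeasure.Build _ _ _ lebesgue_step
  lebesgue_step0 lebesgue_step_ge0 lebesgue_step_sigma_additive.

Let lebesgue_step_sigma_finite : sigma_finite setT lebesgue_step.
Proof.
have /sigma_finiteP[F [TF ndF Foo]] := sigma_finiteT (@lebesgue_measure R).
have /sigma_finiteP[G [TG ndG Goo]] := sigma_finiteT mu.
exists (fun k => @rV_uncons n @^-1` (F k `*` G k)).
  rewrite -preimage_bigcup -(preimage_setT (@rV_uncons n)) -setXTT TF TG.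
  congr (_ @^-1` _); rewrite predeqE => -[x y]; split.
    move=> [/= [k _ Fkx] [l _ Gly]]; exists (maxn k l) => //; split.
    - by move: x Fkx; exact/subsetPset/ndF/leq_maxl.
    - by move: y Gly; exact/subsetPset/ndG/leq_maxr.
  by move=> [k _ []/= ? ?]; split; exists k.
move=> k; have [mF Fk] := Foo k; have [mG Gk] := Goo k; split.
  rewrite -[X in measurable X]setTI.
  by apply: measurable_rV_uncons => //; exact: measurableX.
rewrite /lebesgue_step /pushforward -comp_preimage (_ : _ \o _ = id).
  by rewrite /preimage/= product_measure1E// lte_mul_pinfty// ge0_fin_numE.
by apply/funext => x; exact: rV_consK.
Qed.

HB.instance Definition _ := Measure_isSigmaFinite.Build _ _ _ lebesgue_step
  lebesgue_step_sigma_finite.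

End lebesgue_step.

Fixpoint lebesgue_rV n : {sigma_finite_measure set 'rV[R]_n -> \bar R} :=
  match n with
  | 0 => [the {sigma_finite_measure set 'rV[R]_0 -> \bar R} of \d_ (0 : 'rV[R]_0)]
  | m.+1 =>
    [the {sigma_finite_measure set 'rV[R]_m.+1 -> \bar R} of
      lebesgue_step (lebesgue_rV m)]
  end.

Lemma lebesgue_rV_box n (A : 'I_n -> set R) : (forall i, measurable (A i)) ->
  lebesgue_rV n [set x | forall i, A i (x ord0 i)] =
  (\prod_(i < n) lebesgue_measure (A i))%E.
Proof.
elim: n A => [|n IH] A mA /=.
  by rewrite big_ord0 diracE mem_set// => -[].
pose B := \bigcap_(i in [set: 'I_n]) (rV_coord i @^-1` A (lift ord0 i)).
have mB : measurable B.
  apply: fin_bigcap_measurable => // i _.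
  by rewrite -[X in measurable X]setTI; exact: measurable_rV_coord.
have BE : B = [set x : 'rV[R]_n | forall i, A (lift ord0 i) (x ord0 i)].
  by apply/seteqP; split => x /= xA i; [|move=> _]; exact: xA.
rewrite /lebesgue_step /pushforward big_ord_recl.
rewrite (_ : _ @^-1` _ = A ord0 `*` B).
  rewrite product_measure1E//; last exact: mA.
  rewrite BE; congr mule.
  by apply: (IH (fun i => A (lift ord0 i))) => i; exact: mA.
apply/seteqP; split => -[x t] /=.
  move=> H; split => [|i _]; first by have := H ord0; rewrite mxE unlift_none.
  by have := H (lift ord0 i); rewrite mxE liftK.
move=> [Hx Ht] i; rewrite mxE.
by case: unliftP => [k ->|->]//; exact: Ht.
Qed.

End lebesgue_rV.

Section sobolev.
Context {R : realType} {N : nat}.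
Local Notation leb := (@lebesgue_rV R N).
Implicit Types (phi u v w : 'rV[R]_N -> R) (x y : 'rV[R]_N).

Definition partial (i : 'I_N) phi : 'rV[R]_N -> R :=
  fun x => 'D_(delta_mx ord0 i) phi x.

Definition smooth phi := forall s : seq 'I_N,
  let f := foldr partial phi s in
  continuous f /\ forall i x, derivable f x (delta_mx ord0 i).

Definition test_function phi :=
  smooth phi /\ compact (closure [set x | phi x != 0]).

Definition dotv x y : R := \sum_(i < N) x ord0 i * y ord0 i.

Definition enorm x : R := Num.sqrt (dotv x x).

Definition weak_gradient u (g : 'rV[R]_N -> 'rV[R]_N) := forall i : 'I_N,
  (fun x => g x ord0 i) \in Lfun leb 2%:E /\
  forall phi, test_function phi ->
    \int[leb]_x (u x * partial i phi x) = - \int[leb]_x (g x ord0 i * phi x).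

(* Elements of H^1 are represented by Borel functions; all the notions below
   only depend on their a.e. class. *)
Definition H1 u := u \in Lfun leb 2%:E /\ exists g, weak_gradient u g.

(* a weak gradient of u, when there is one (unique up to a.e. equality) *)
Definition grad u : 'rV[R]_N -> 'rV[R]_N := xget (fun=> 0) (weak_gradient u).

Definition normL2_sq u : R := \int[leb]_x (u x ^+ 2).
Definition normL2 u : R := Num.sqrt (normL2_sq u).
Definition dirichlet u : R := \int[leb]_x (dotv (grad u x) (grad u x)).
Definition normH1 u : R := Num.sqrt (dirichlet u + normL2_sq u).

(* u is a weak solution of - A Delta u + F(u) = 0 in R^N *)
Definition weak_solution (A : R) (F : R -> R) u :=
  forall phi, test_function phi ->
    A * (\int[leb]_x (\sum_(i < N) grad u x ord0 i * partial i phi x))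
    + \int[leb]_x (F (u x) * phi x) = 0.

Definition positive_radial_solution (p : R) u :=
  [/\ H1 u,
      weak_solution 1 (fun s =>
        (4 + 2 * p - N%:R * p) / (N%:R * p) * s
        - 4 / (N%:R * p) * `|s| `^ p * s) u,
      {ae leb, forall x, 0 < u x} &
      exists q : R -> R, {ae leb, forall x, u x = q (enorm x)}].

Definition is_translate u v := exists y, {ae leb, forall x, u x = v (x + y)}.

(* Q is "the" positive radial solution: existence and uniqueness up to
   translations are both part of the definite description *)
Definition is_Q (p : R) (Q : 'rV[R]_N -> R) :=
  positive_radial_solution p Q /\
  forall u, positive_radial_solution p u -> is_translate u Q.

Section functional.
Variables (a b p c : R).

Definition energy u : R :=
  a / 2 * dirichlet u + b / 4 * dirichlet u ^+ 2
  - 1 / (p + 2) * \int[leb]_x (`|u x| `^ (p + 2)).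

Definition sphere u := H1 u /\ \int[leb]_x (u x ^+ 2) = c ^+ 2.

Definition path_in_sphere (h : R -> 'rV[R]_N -> R) :=
  (forall t, t \in `[0, 1] -> sphere (h t)) /\
  forall t0, t0 \in `[0, 1] ->
    normH1 (h t \- h t0) @[t --> within `[0, 1]%classic (nbhs t0)] --> (0 : R).

Definition mp_paths (K : R) (h : R -> 'rV[R]_N -> R) :=
  [/\ path_in_sphere h, dirichlet (h 0) <= K & energy (h 1) < 0].

(* The maximum over [0, 1] is written as a supremum: it is attained, E being
   continuous along h.  Extended reals make the infimum and supremum genuine
   even when they are infinite. *)
Definition mp_level (K : R) : \bar R :=
  ereal_inf [set ereal_sup [set (energy (h t))%:E | t in `[0, 1]%classic]
            | h in mp_paths K].

Definition mp_geometry (K : R) :=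
  0 < K /\
  forall h, mp_paths K h ->
    ((Num.max (energy (h 0)) (energy (h 1)))%:E < mp_level K)%E.

(* u is constrained critical: the Frechet derivative E'(u), as an element of
   the dual of H^1, equals mu u, i.e. phi |-> mu * \int u phi *)
Definition constrained_critical u :=
  sphere u /\
  exists mu : R, forall e, 0 < e -> exists2 d, 0 < d &
    forall phi, H1 phi -> normH1 phi < d ->
      `|energy (u \+ phi) - energy u - mu * \int[leb]_x (u x * phi x)|
        <= e * normH1 phi.

Definition kirchhoff_solution (mu : R) u :=
  weak_solution (a + b * dirichlet u)
    (fun s => - (`|s| `^ p * s) - mu * s) u.

End functional.
End sobolev.

Definition critical_exponent (R : realType) (N : nat) : \bar R :=
  if (N <= 2)%N then +oo%E else 6%:E.

Section explicit.
Context {R : realType} (N : nat).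

(* below, [m] stands for |Q|_{L^2} *)
Definition c_star (b m : R) : R :=
  (b * m `^ (8 / N%:R) / 2) `^ (N%:R / (8 - 2 * N%:R)).

Definition f_p (a b p c m t : R) : R :=
  a / 2 * t + b / 4 * t ^+ 2
  - c `^ ((2 * (p + 2) - N%:R * p) / 2) / (2 * m `^ p)
    * t `^ (N%:R * p / 4).

Definition ubar (c t : R) (Q : 'rV[R]_N -> R) : 'rV[R]_N -> R :=
  let lambda := Num.sqrt t / c in
  fun x => c * lambda `^ (N%:R / 2) / normL2 Q * Q (lambda *: x).

End explicit.

Definition unique_maximum_point (R : realType) (f : R -> R) (t : R) :=
  0 < t /\ forall s, 0 < s -> s != t -> f s < f t.

(* Main.v *)
(**
Put q = p+2, k = Np/4 >= 2 and beta = q/2 - k > 0.  On S_c the Gagliardo-Nirenberg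
inequality int |u|^q <= C (int |grad u|^2)^k (int u^2)^beta bounds the energy from below
by f_p(int |grad u|^2), with equality exactly at the optimizers of the inequality.

Optimizers exist by compactness up to translations (a non-vanishing lemma and the
Brezis-Lieb lemma).  The absolute value of an optimizer is positive by the strong maximum
principle; comparing it with its polarization across hyperplanes, which is again an
optimizer, shows that it is symmetric about every hyperplane halving its mass, hence
radial after a translation.  Suitably rescaled it is a positive radial solution of the
equation of Q, hence a translate of Q.  Therefore Q is an optimizer, C = q / (2 |Q|^p),
and every optimizer is, up to sign, a translate of a rescaling of Q.

The dilations of u_c form a path along which E is f_p(int |grad u|^2), while every
admissible path crosses the set int |grad u|^2 = t; this gives the level.  By the Pohozaev
identity the energy of a critical point u is maximal among the dilations of u; comparing
with the dilation whose gradient has square norm t shows that u is an optimizer.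
*)
From HB Require Import structures.
Require Import Defs.
From mathcomp Require Import all_boot all_order all_algebra ring lra.
From mathcomp Require Import all_classical all_reals all_analysis.
From mathcomp Require Import measurable_realfun.
Set Implicit Arguments.
Unset Strict Implicit.
Unset Printing Implicit Defensive.
Import Order.TTheory GRing.Theory Num.Theory.
Import numFieldNormedType.Exports.
Local Open Scope classical_set_scope.
Local Open Scope ring_scope.

(** * Integrable and square-integrable functions *)

Section integrals.
Context d (T : measurableType d) (R : realType) (mu : {measure set T -> \bar R}).
Implicit Types (f g : T -> R).

(** All estimates live in H^1 and are written for increments [u (x + y) - u x]. Optimizers and
    critical points are only weak solutions, so the multipliers of the classical arguments
    ([x . grad u] for Pohozaev, the logarithm of a supersolution for the maximum principle) are
    replaced by discrete counterparts: an inequality for increments is proved pointwise, integrated,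
    and only then is the step sent to 0. In the Euler-Lagrange equations the power integral enters
    through convexity: its tangent lower bound is compared with a differentiable expression in a
    parameter [s] of either sign, and the two slopes must agree. The condition [2 <= k] acts at two
    places. If [x] and [y] are the Dirichlet energy and the mass kept by the weak limit of a
    maximizing sequence, it turns the splitting of the inequality into
    [1 - (1 - x)^2 <= x^2 y^beta], and for [x] and [y] in []0, 1]] this forces [x = y = 1]: nothing
    escapes. On the fibers of dilations it lets Bernoulli's inequality be applied with the exponents
    [k] and [k / 2], which controls the gradient term and its square at once. *)

Definition itg f := mu.-integrable setT (EFin \o f).

Lemma itg_meas f : itg f -> measurable_fun setT f.
Proof. by move=> /integrableP[/measurable_EFinP]. Qed.

Lemma itgD f g : itg f -> itg g -> itg (f + g).
Proof. by move=> hf hg; exact: (integrableD measurableT hf hg). Qed.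

Lemma itgZ a f : itg f -> itg (a *: f).
Proof. by move=> hf; exact: (integrableZl measurableT a hf). Qed.

Lemma itgN f : itg f -> itg (- f).
Proof. by move=> hf; rewrite -scaleN1r; exact: itgZ. Qed.

Lemma itgB f g : itg f -> itg g -> itg (f - g).
Proof. by move=> hf hg; apply: itgD => //; exact: itgN. Qed.

Lemma itg0 : itg 0.
Proof. exact: (integrable0 mu setT). Qed.

Lemma itg_le f g : measurable_fun setT f -> (forall x, `|f x| <= g x) -> itg g ->
  itg f.
Proof.
move=> mf fg ig; apply: (@le_integrable _ _ _ mu setT measurableT _ (EFin \o g)) => //.
  exact/measurable_EFinP.
by move=> x _ /=; rewrite lee_fin (le_trans (fg x))// ler_norm.
Qed.

Lemma itg_abs f : itg f -> itg (fun x => `|f x|).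
Proof. by move=> hf; exact: (integrable_norm hf). Qed.

Lemma itg_sum (I : finType) (f : I -> T -> R) :
  (forall i, itg (f i)) -> itg (fun x => \sum_i f i x).
Proof.
move=> hf; have := @integrable_sum _ _ _ mu setT measurableT _ (index_enum I) xpredT
  (fun i => EFin \o f i) (fun i _ => hf i).
by congr (integrable _ _ _); apply/funext => x /=; rewrite sumEFin.
Qed.

Lemma itg_ae f g : measurable_fun setT g -> {ae mu, forall x, f x = g x} -> itg f ->
  itg g.
Proof.
move=> mg fg hf; apply/integrableP; split; first exact/measurable_EFinP.
have /integrableP[mf] := hf; rewrite (ae_eq_integral (fun x => `|(EFin \o g) x|%E)) => //.
- exact: measurableT_comp.
- by apply: measurableT_comp => //; exact/measurable_EFinP.
by apply: filterS fg => x /= ->.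
Qed.

Lemma int_ae f g : measurable_fun setT f -> measurable_fun setT g ->
  {ae mu, forall x, f x = g x} -> \int[mu]_x f x = \int[mu]_x g x.
Proof.
move=> mf mg fg; rewrite /Rintegral; congr fine; apply: ae_eq_integral => //.
- exact/measurable_EFinP.
- exact/measurable_EFinP.
by apply: filterS fg => x /= ->.
Qed.

Lemma intD f g : itg f -> itg g ->
  \int[mu]_x (f x + g x) = \int[mu]_x f x + \int[mu]_x g x.
Proof. exact: RintegralD. Qed.

Lemma intB f g : itg f -> itg g ->
  \int[mu]_x (f x - g x) = \int[mu]_x f x - \int[mu]_x g x.
Proof. exact: RintegralB. Qed.

Lemma intZ a f : itg f -> \int[mu]_x (a * f x) = a * \int[mu]_x f x.
Proof. exact: RintegralZl. Qed.

Lemma int0 : \int[mu]_x (0 : R) = 0.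
Proof. by rewrite /Rintegral integral0. Qed.

Lemma int_sum (I : finType) (f : I -> T -> R) : (forall i, itg (f i)) ->
  \int[mu]_x (\sum_i f i x) = \sum_i \int[mu]_x f i x.
Proof.
move=> hf; rewrite /Rintegral.
under eq_integral do rewrite -sumEFin.
rewrite (@integral_sum _ _ _ mu setT measurableT _ (fun i => EFin \o f i) hf).
rewrite -sum_fine//; last by move=> i _; apply: (integrable_fin_num measurableT); exact: hf.
Qed.

Lemma int_le f g : itg f -> itg g -> (forall x, f x <= g x) ->
  \int[mu]_x f x <= \int[mu]_x g x.
Proof. by move=> hf hg fg; apply: le_Rintegral. Qed.

Lemma int_ge0 f : (forall x, 0 <= f x) -> 0 <= \int[mu]_x f x.
Proof. by move=> f0; apply: Rintegral_ge0. Qed.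

Lemma int_fin f : itg f -> (\int[mu]_x (f x)%:E = (\int[mu]_x f x)%:E)%E.
Proof. by move=> hf; rewrite /Rintegral fineK//; exact: integrable_fin_num. Qed.

Lemma int_eq0 f : itg f -> (forall x, 0 <= f x) -> \int[mu]_x f x = 0 ->
  {ae mu, forall x, f x = 0}.
Proof.
move=> hf f0 h0.
have /integrableP[mf _] := hf.
have /(ae_eq_integral_abs mu measurableT mf) : (\int[mu]_x `|(EFin \o f) x| = 0)%E.
  under eq_integral do rewrite /= ger0_norm//.
  by rewrite int_fin// h0.
by apply: filterS => x /= /(_ I) [].
Qed.

Lemma dominated_int (f : nat -> T -> R) (g h : T -> R) :
  (forall n, measurable_fun setT (f n)) ->
  (forall x, f n x @[n --> \oo] --> g x) ->
  itg h -> (forall n x, `|f n x| <= h x) ->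
  itg g /\ \int[mu]_x f n x @[n --> \oo] --> \int[mu]_x g x.
Proof.
move=> mf fg hh fh.
have H := @dominated_convergence _ _ _ mu setT measurableT (fun n => EFin \o f n)
  (EFin \o g) (EFin \o h).
have mg : measurable_fun setT g.
  apply: (@measurable_fun_cvg _ _ _ _ f) => //; by move=> x _; exact: fg.
have [||||| H1 _ H3] := H.
- by move=> n; exact/measurable_EFinP.
- exact/measurable_EFinP.
- by apply/aeW => x _ /=; apply: cvg_EFin; [exact: nearW|exact: fg].
- exact: hh.
- by apply/aeW => x n _ /=; rewrite lee_fin.
split => //; apply: (fine_cvg (f := fun n => (\int[mu]_x (EFin \o f n) x)%E)).
by rewrite fineK//; exact: (integrable_fin_num measurableT).
Qed.

End integrals.

(** * Nonnegative quadratic polynomials *)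

Section quadratic.
Variable R : realType.
Implicit Types a b c s e : R.

Lemma quad_ge0_lin b c : (forall s, 0 <= 2 * b * s + c * s ^+ 2) -> b = 0.
Proof.
move=> H; apply/eqP; apply/negPn/negP => b0.
have c0 : 0 <= c.
  have := H 1; have := H (-1); rewrite sqrrN expr1n !mulr1 mulrN1 => *; lra.
(* The [+ 1] keeps the witness defined when [c = 0]. *)
have := H (- b / (c + 1)).
have c1 : c + 1 != 0 by rewrite gt_eqF// ltr_wpDl.
have -> : 2 * b * (- b / (c + 1)) + c * (- b / (c + 1)) ^+ 2 =
   - (b ^+ 2 / (c + 1) ^+ 2) * (c + 2) by field.
have : 0 < b ^+ 2 / (c + 1) ^+ 2 by rewrite divr_gt0// exprn_even_gt0.
by move=> h h2; nra.
Qed.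

(** Source of both Cauchy-Schwarz inequalities, [dot_CS] and [dotD_CS], with [s] the coefficient of
    a linear combination. *)
Lemma quad_ge0_disc a b c : 0 <= c -> (forall s, 0 <= a + 2 * b * s + c * s ^+ 2) ->
  b ^+ 2 <= a * c.
Proof.
rewrite le_eqVlt => /predU1P[<- H|c0 H].
  suff -> : b = 0 by rewrite expr0n mulr0.
  apply/eqP/negPn/negP => b0; have := H ((- a - 1) / (2 * b)).
  have -> : a + 2 * b * ((- a - 1) / (2 * b)) + 0 * ((- a - 1) / (2 * b)) ^+ 2 = - 1.
    by field.
  by rewrite oppr_ge0 ler10.
have := H (- b / c); have -> : a + 2 * b * (- b / c) + c * (- b / c) ^+ 2 =
   (a * c - b ^+ 2) / c by field; rewrite gt_eqF.
by rewrite pmulr_lge0 ?invr_gt0// subr_ge0.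
Qed.
End quadratic.

Section pointwise.
Context (T : Type) (R : realType).
Implicit Types (f g : T -> R) (a : R).
Let faddE f g x : (f + g) x = f x + g x. Proof. by []. Qed.
Let foppE f x : (- f) x = - f x. Proof. by []. Qed.
Let fmulE f g x : (f * g) x = f x * g x. Proof. by []. Qed.
Let fscaleE a f x : (a *: f) x = a * f x. Proof. by []. Qed.
Let fexpE f n x : (f ^+ n) x = f x ^+ n. Proof. by elim: n => // n IH; rewrite !exprS -IH. Qed.
Let fzeroE x : (0 : T -> R) x = 0. Proof. by []. Qed.
Let fsumE (I : finType) (F : I -> T -> R) x : (\sum_i F i) x = \sum_i F i x.
Proof. by elim/big_ind2: _ => // f1 y1 f2 y2 <- <-. Qed.
(** One [!fE] turns an identity between functions, for the pointwise ring structure, into an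
    identity between real numbers. *)
Definition fE := (faddE, foppE, fmulE, fscaleE, fexpE, fzeroE, fsumE).
End pointwise.

Section square_integrable.
Context d (T : measurableType d) (R : realType) (mu : {measure set T -> \bar R}).
Implicit Types (f g h u v w : T -> R).
Local Notation itg := (itg mu).

Definition L2 f := measurable_fun setT f /\ itg (fun x => f x ^+ 2).
Definition l2dot f g : R := \int[mu]_x (f x * g x).
Definition l2sq f : R := \int[mu]_x (f x ^+ 2).
Local Notation dot := l2dot.
Local Notation nsq := l2sq.

Lemma L2P f : L2 f <-> f \in Lfun mu 2%:E.
Proof.
split => [[mf hf]|hf].
  rewrite inE; apply/andP; split; rewrite inE/=; first exact: mf.
  rewrite /finite_norm unlock /Lnorm poweR_lty//.
  have /integrableP[_] := hf; congr (_ < _)%E; apply: eq_integral => x _ /=.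
  by rewrite powR_mulrn// normrX.
split; last exact: Lfun2_integrable_sqr.
by move: hf; rewrite inE => /andP[]; rewrite inE.
Qed.

Lemma L2_meas f : L2 f -> measurable_fun setT f. Proof. by case. Qed.

Lemma itg_mul f g : L2 f -> L2 g -> itg (f * g).
Proof.
move=> [mf hf] [mg hg].
apply: (@itg_le _ _ _ mu _ ((fun x => f x ^+ 2) + (fun x => g x ^+ 2))).
- exact: measurable_funM.
- move=> x; rewrite normrM; change (`|f x| * `|g x| <= f x ^+ 2 + g x ^+ 2).
  by rewrite -(real_normK (num_real (f x))) -(real_normK (num_real (g x))); nra.
- exact: itgD.
Qed.

Lemma L2_le f g : measurable_fun setT f -> (forall x, `|f x| <= `|g x|) -> L2 g -> L2 f.
Proof.
move=> mf fg [mg hg]; split => //.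
apply: (@itg_le _ _ _ mu _ (fun x => g x ^+ 2)) => //; first exact: measurable_funX.
by move=> x; rewrite normrX -(real_normK (num_real (g x))) lerXn2r// nnegrE.
Qed.

Lemma L2Z a f : L2 f -> L2 (a *: f).
Proof.
move=> [mf hf]; split; first exact: (measurable_funM (measurable_cst a) mf).
rewrite (_ : (fun _ => _) = (a ^+ 2) *: (fun x => f x ^+ 2)); first exact: itgZ.
by apply/funext => x; rewrite /= !fE exprMn.
Qed.

Lemma L2D f g : L2 f -> L2 g -> L2 (f + g).
Proof.
move=> [mf hf] [mg hg]; split; first exact: measurable_funD.
rewrite (_ : (fun _ => _) = (fun x => f x ^+ 2) + 2 *: (f * g) + (fun x => g x ^+ 2)).
  by apply: itgD => //; apply: itgD => //; apply: itgZ; exact: itg_mul.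
by apply/funext => x; rewrite !fE; ring.
Qed.

Lemma L2N f : L2 f -> L2 (- f).
Proof. by move=> hf; rewrite -scaleN1r; exact: L2Z. Qed.

Lemma L2B f g : L2 f -> L2 g -> L2 (f - g).
Proof. by move=> hf hg; apply: L2D => //; exact: L2N. Qed.

Lemma L20 : L2 0.
Proof.
split; first exact: measurable_cst.
by rewrite (_ : (fun _ => _) = 0) ?itg0//; apply/funext => x; rewrite !fE expr0n.
Qed.

Lemma L2_abs f : L2 f -> L2 (fun x => `|f x|).
Proof.
move=> hf; apply: (L2_le _ _ hf) => [|x]; last by rewrite normr_id.
by apply: measurableT_comp => //; case: hf.
Qed.

Lemma L2_sum (I : finType) (F : I -> T -> R) : (forall i, L2 (F i)) -> L2 (\sum_i F i).
Proof. by move=> hF; elim/big_ind: _ => //; [exact: L20|exact: L2D]. Qed.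

Lemma dotC f g : dot f g = dot g f.
Proof. by apply: eq_Rintegral => x _; rewrite mulrC. Qed.

Lemma dotff f : dot f f = nsq f.
Proof. by apply: eq_Rintegral => x _; rewrite expr2. Qed.

Lemma dotDl f g h : L2 f -> L2 g -> L2 h -> dot (f + g) h = dot f h + dot g h.
Proof.
move=> hf hg hh; rewrite /dot -(intD (itg_mul hf hh) (itg_mul hg hh)).
by apply: eq_Rintegral => x _; rewrite -mulrDl.
Qed.

Lemma dotDr f g h : L2 f -> L2 g -> L2 h -> dot f (g + h) = dot f g + dot f h.
Proof. by move=> *; rewrite dotC dotDl// (dotC f) (dotC f). Qed.

Lemma dotZl a f g : L2 f -> L2 g -> dot (a *: f) g = a * dot f g.
Proof.
move=> hf hg; rewrite /dot -(intZ a (itg_mul hf hg)).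
by apply: eq_Rintegral => x _; rewrite mulrA.
Qed.

Lemma dotZr a f g : L2 f -> L2 g -> dot f (a *: g) = a * dot f g.
Proof. by move=> *; rewrite dotC dotZl// dotC. Qed.

Lemma dotNl f g : L2 f -> L2 g -> dot (- f) g = - dot f g.
Proof. by move=> *; rewrite -scaleN1r dotZl// mulN1r. Qed.

Lemma dotNr f g : L2 f -> L2 g -> dot f (- g) = - dot f g.
Proof. by move=> *; rewrite dotC dotNl// dotC. Qed.

Lemma dotBl f g h : L2 f -> L2 g -> L2 h -> dot (f - g) h = dot f h - dot g h.
Proof. by move=> *; rewrite dotDl ?dotNl//; exact: L2N. Qed.

Lemma dotBr f g h : L2 f -> L2 g -> L2 h -> dot f (g - h) = dot f g - dot f h.
Proof. by move=> *; rewrite dotC dotBl// (dotC f) (dotC f). Qed.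

Lemma nsq_ge0 f : 0 <= nsq f.
Proof. by apply: int_ge0 => x; exact: sqr_ge0. Qed.

Lemma nsqD f g : L2 f -> L2 g -> nsq (f + g) = nsq f + 2 * dot f g + nsq g.
Proof.
move=> hf hg; have hfg := L2D hf hg.
by rewrite -!dotff dotDl// !dotDr// (dotC g f); ring.
Qed.

Lemma nsqZ a f : L2 f -> nsq (a *: f) = a ^+ 2 * nsq f.
Proof. by move=> hf; rewrite -!dotff dotZl ?dotZr//; [ring|exact: L2Z]. Qed.

Lemma nsqN f : nsq (- f) = nsq f.
Proof. by apply: eq_Rintegral => x _; rewrite !fE sqrrN. Qed.

Lemma nsqB f g : L2 f -> L2 g -> nsq (f - g) = nsq f - 2 * dot f g + nsq g.
Proof. by move=> hf hg; rewrite nsqD ?dotNr ?nsqN//; [ring|exact: L2N]. Qed.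

Lemma nsqBC f g : nsq (f - g) = nsq (g - f).
Proof. by rewrite -nsqN opprB. Qed.

Lemma nsq0 : nsq 0 = 0.
Proof. by rewrite -(int0 mu); apply: eq_Rintegral => x _; rewrite expr0n. Qed.

Lemma nsq_le f g : L2 g -> measurable_fun setT f -> (forall x, `|f x| <= `|g x|) ->
  nsq f <= nsq g.
Proof.
move=> hg mf fg; apply: int_le; [exact: (L2_le mf fg hg).2|exact: hg.2|] => x.
rewrite -(real_normK (num_real (g x))) -(real_normK (num_real (f x))).
by rewrite lerXn2r// nnegrE.
Qed.

Lemma dot_CS f g : L2 f -> L2 g -> dot f g ^+ 2 <= nsq f * nsq g.
Proof.
move=> hf hg; apply: quad_ge0_disc => [|s]; first exact: nsq_ge0.
have := nsq_ge0 (f + s *: g); rewrite nsqD ?nsqZ ?dotZr//; last exact: L2Z.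
by congr (_ <= _); ring.
Qed.

Lemma nsqD_le f g : L2 f -> L2 g -> nsq (f + g) <= 2 * nsq f + 2 * nsq g.
Proof.
move=> hf hg; have := nsq_ge0 (f - g); rewrite nsqB// nsqD//; lra.
Qed.

Lemma L2_ae f g : measurable_fun setT g -> {ae mu, forall x, f x = g x} -> L2 f -> L2 g.
Proof.
move=> mg fg [mf hf]; split => //; apply: (itg_ae _ _ hf); first exact: measurable_funX.
by apply: filterS fg => x ->.
Qed.

Lemma dot_ae f g f' g' : L2 f -> L2 g -> L2 f' -> L2 g' ->
  {ae mu, forall x, f x = f' x} -> {ae mu, forall x, g x = g' x} -> dot f g = dot f' g'.
Proof.
move=> hf hg hf' hg' ff' gg'; apply: int_ae.
- exact: itg_meas (itg_mul hf hg).
- exact: itg_meas (itg_mul hf' hg').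
by apply: filterS2 ff' gg' => x -> ->.
Qed.

Lemma nsq_ae f g : L2 f -> L2 g -> {ae mu, forall x, f x = g x} -> nsq f = nsq g.
Proof. by move=> hf hg fg; rewrite -!dotff; exact: dot_ae. Qed.

Lemma nsq_eq0 f : L2 f -> nsq f = 0 -> {ae mu, forall x, f x = 0}.
Proof.
move=> [mf hf] h; have := int_eq0 hf (fun x => sqr_ge0 _) h.
by apply: filterS => x /eqP; rewrite sqrf_eq0 => /eqP.
Qed.

Lemma nsqB_eq0 f g : L2 f -> L2 g -> nsq (f - g) = 0 -> {ae mu, forall x, f x = g x}.
Proof.
move=> hf hg /(nsq_eq0 (L2B hf hg)); apply: filterS => x.
by rewrite !fE => /subr0_eq.
Qed.

Lemma nsq0_ae f : L2 f -> {ae mu, forall x, f x = 0} -> nsq f = 0.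
Proof. by move=> hf h; rewrite (nsq_ae hf L20 h) nsq0. Qed.

End square_integrable.

(** * Limits along filters and ultrafilters *)

Section filters.
Variable R : realType.

Lemma sqr_squeeze0 (I : Type) (F : set_system I) (FF : Filter F) (u v : I -> R) :
  (\forall i \near F, u i ^+ 2 <= v i) -> v i @[i --> F] --> 0 -> u i @[i --> F] --> 0.
Proof.
move=> uv v0; apply/cvgr0Pnorm_lt => e e0.
have e2 : 0 < e ^+ 2 by rewrite exprn_gt0.
move/cvgr0Pnorm_lt : v0 => /(_ _ e2) v0.
near=> i; have h1 : `|v i| < e ^+ 2 by near: i.
have h2 : u i ^+ 2 <= v i by near: i.
rewrite -ltr_sqr ?nnegrE// ?ltW//.
by rewrite real_normK ?num_real// (le_lt_trans h2)// (le_lt_trans _ h1)// ler_norm.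
Unshelve. all: by end_near. Qed.

Lemma squeeze0 (I : Type) (F : set_system I) (FF : Filter F) (u v : I -> R) :
  (\forall i \near F, `|u i| <= v i) -> v i @[i --> F] --> 0 -> u i @[i --> F] --> 0.
Proof.
move=> uv v0; apply/cvgr0Pnorm_lt => e e0.
move/cvgr0Pnorm_lt : v0 => /(_ _ e0) v0.
near=> i; have h1 : `|v i| < e by near: i.
have h2 : `|u i| <= v i by near: i.
by rewrite (le_lt_trans h2)// (le_lt_trans _ h1)// ler_norm.
Unshelve. all: by end_near. Qed.

Lemma cvg_eqr (I : Type) (F : set_system I) (FF : Filter F) (u v : I -> R) (l : R) :
  (forall i, u i = v i) -> u i @[i --> F] --> l -> v i @[i --> F] --> l.
Proof. by move=> /funext ->. Qed.

Lemma inv_succ_cvg0 : (n.+1%:R^-1 : R) @[n --> \oo] --> 0.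
Proof. exact: cvg_harmonic. Qed.

(** Compactness of the segment [[- C, C]]. A single ultrafilter serves all bounded families at once,
    so no subsequence has to be extracted for each of them. *)
Lemma ultra_bounded_cvg (I : Type) (U : set_system I) (UU : UltraFilter U) (u : I -> R) (C : R) :
  (forall i, `|u i| <= C) -> exists l : R, u i @[i --> U] --> l.
Proof.
move=> uC.
have H : (u @ U) `[- C, C]%classic.
  apply: (@filterS _ U _ setT) (@filterT _ U _) => i _ /=.
  by rewrite in_itv/= -ler_norml.
have [l [_ cl]] := @segment_compact R (- C) C (u @ U) _ H; exists l.
move=> B nB; have [//|nUB] := in_ultra_setVsetC (u @^-1` B) UU.
have [y [y1 y2]] := cl (~` B) B nUB nB.
by exfalso.
Qed.

End filters.

(** * Strong limits and completeness in L^2 *)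

Section L2_limits.
Context d (T : measurableType d) (R : realType) (mu : {measure set T -> \bar R}).
Implicit Types (f g h u v w : T -> R).
Local Notation itg := (itg mu).
Local Notation L2 := (L2 mu).
Local Notation dot := (l2dot mu).
Local Notation nsq := (l2sq mu).

Section filter.
Context (I : Type) (F : set_system I) (FF : Filter F).

Lemma dot_cvgl (f : I -> T -> R) g h : (forall i, L2 (f i)) -> L2 g -> L2 h ->
  nsq (f i - g) @[i --> F] --> 0 -> dot (f i) h @[i --> F] --> dot g h.
Proof.
move=> hf hg hh f0; apply/(subr_cvg0 (fun i => dot (f i) h)).
apply: (@sqr_squeeze0 _ _ _ _ _ (fun i => nsq (f i - g) * nsq h)).
  by apply: nearW => i; rewrite -dotBl//; apply: dot_CS => //; exact: L2B.
by rewrite -(mul0r (nsq h)); apply: cvgMr_tmp.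
Qed.

Lemma dot_cvg (f h : I -> T -> R) g k : (forall i, L2 (f i)) -> L2 g ->
  (forall i, L2 (h i)) -> L2 k ->
  nsq (f i - g) @[i --> F] --> 0 -> nsq (h i - k) @[i --> F] --> 0 ->
  dot (f i) (h i) @[i --> F] --> dot g k.
Proof.
move=> hf hg hh hk f0 h0.
have E i : dot (f i) (h i) = dot (f i) k + dot g (h i) - dot g k + dot (f i - g) (h i - k).
  by rewrite dotBl ?dotBr//; [ring|exact: L2B..].
rewrite (_ : (fun i => _) = fun i => dot (f i) k + dot g (h i) - dot g k + dot (f i - g) (h i - k));
  last exact/funext.
rewrite -[X in _ --> X]addr0; apply: cvgD; last first.
  apply: (@sqr_squeeze0 _ _ _ _ _ (fun i => nsq (f i - g) * nsq (h i - k))).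
    by apply: nearW => i; apply: dot_CS; exact: L2B.
  by rewrite -(mul0r (0 : R)); apply: cvgM.
rewrite -[X in _ --> X](addrK (dot g k)); apply: cvgB; last exact: cvg_cst.
apply: cvgD; first exact: dot_cvgl.
rewrite dotC; under eq_fun do rewrite dotC; exact: dot_cvgl.
Qed.

Lemma nsq_cvg (f : I -> T -> R) g : (forall i, L2 (f i)) -> L2 g ->
  nsq (f i - g) @[i --> F] --> 0 -> nsq (f i) @[i --> F] --> nsq g.
Proof.
by move=> hf hg f0; rewrite -dotff; under eq_fun do rewrite -dotff; exact: dot_cvg.
Qed.

Lemma nsq_cvgD (f h : I -> T -> R) g k : (forall i, L2 (f i)) -> L2 g ->
  (forall i, L2 (h i)) -> L2 k ->
  nsq (f i - g) @[i --> F] --> 0 -> nsq (h i - k) @[i --> F] --> 0 ->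
  nsq ((f i + h i) - (g + k)) @[i --> F] --> 0.
Proof.
move=> hf hg hh hk f0 h0.
apply: (@squeeze0 _ _ _ _ _ (fun i => 2 * nsq (f i - g) + 2 * nsq (h i - k))).
  apply: nearW => i; rewrite ger0_norm ?nsq_ge0//.
  have -> : f i + h i - (g + k) = (f i - g) + (h i - k) by rewrite opprD addrACA.
  by apply: nsqD_le; exact: L2B.
rewrite -[X in _ --> X]addr0 -[X in X + _](mulr0 2) -[X in _ + X](mulr0 2).
by apply: cvgD; apply: cvgMl_tmp.
Qed.

Lemma nsq_cvgZ (f : I -> T -> R) g (a : R) : (forall i, L2 (f i)) -> L2 g ->
  nsq (f i - g) @[i --> F] --> 0 -> nsq (a *: f i - a *: g) @[i --> F] --> 0.
Proof.
move=> hf hg f0; apply: (@cvg_eqr _ _ _ _ (fun i => a ^+ 2 * nsq (f i - g))).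
  by move=> i; rewrite -scalerBr nsqZ//; exact: L2B.
by rewrite -(mulr0 (a ^+ 2)); apply: cvgMl_tmp.
Qed.

End filter.

(** The weights [4 ^+ k] are still summable against the decay [8^-1 ^+ k], so the series of
    [4 ^+ k * D k x ^+ 2] has an integrable sum [S]; being finite almost everywhere, it dominates
    each of its terms there. *)
Lemma L2_rapid (D : nat -> T -> R) : (forall k, L2 (D k)) ->
  (forall k, nsq (D k) <= 8^-1 ^+ k) ->
  exists S : T -> R, [/\ itg S, (forall x, 0 <= S x) &
    {ae mu, forall x, forall k, D k x ^+ 2 <= S x * 4^-1 ^+ k}].
Proof.
move=> hD D8; pose E x := (\sum_(0 <= k <oo) (4 ^+ k * D k x ^+ 2)%:E)%E.
have t0 k x : (0 <= (4 ^+ k * D k x ^+ 2)%:E)%E.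
  by rewrite lee_fin mulr_ge0 ?sqr_ge0// exprn_ge0// ler0n.
have mt k : measurable_fun setT (fun x => (4 ^+ k * D k x ^+ 2)%:E).
  apply/measurable_EFinP; apply: measurable_funM; first exact: measurable_cst.
  by apply: measurable_funX; exact: L2_meas (hD k).
have E0 x : (0 <= E x)%E by exact: nneseries_ge0.
have mE : measurable_fun setT E by by apply: ge0_emeasurable_sum => // k x _ _; exact: t0.
have intE : (\int[mu]_x E x <= 2%:E)%E.
  rewrite integral_nneseries//; apply: lime_le; first by apply: is_cvg_nneseries => n _ _; apply: integral_ge0.
  apply: nearW => n.
  apply: (@le_trans _ _ (\sum_(0 <= k < n) (2^-1 ^+ k)%:E)%E).
    apply: lee_sum => k _; rewrite int_fin; last exact: (itgZ (4 ^+ k) (hD k).2).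
    rewrite (intZ _ (hD k).2) lee_fin; apply: (le_trans (ler_wpM2l _ (D8 k))).
      by rewrite exprn_ge0// ler0n.
    by rewrite -exprMn lerXn2r ?nnegrE//; lra.
  rewrite sumEFin lee_fin big_mkord.
  have H m : \sum_(i < m) (2^-1 : R) ^+ i = 2 - 2 * 2^-1 ^+ m.
    elim: m => [|m IHm]; first by rewrite big_ord0 expr0 mulr1 subrr.
    by rewrite big_ord_recr/= IHm exprS; lra.
  by rewrite H lerBlDr lerDl mulr_ge0// exprn_ge0.
have iE : mu.-integrable setT E.
  apply/integrableP; split => //; under eq_integral do rewrite gee0_abs//.
  by rewrite (le_lt_trans intE)// ltry.
exists (fine \o E); split.
- apply: (@le_integrable _ _ _ mu setT measurableT _ E) => //.
    by apply/measurable_EFinP; apply: measurableT_comp.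
  move=> x _ /=; rewrite gee0_abs// ger0_norm ?fine_ge0//.
  by have := E0 x; case: (E x) => //= *; rewrite leey.
- by move=> x /=; exact: fine_ge0.
have := integrable_ae measurableT iE; apply: filterS => x /(_ I) fx k /=.
rewrite exprVn ler_pdivlMr ?exprn_gt0// mulrC -lee_fin fineK//.
have := @nneseries_lim_ge R (fun k => (4 ^+ k * D k x ^+ 2)%:E) xpredT 0 k.+1 (fun n _ _ => t0 n x).
apply: le_trans; rewrite big_mkord big_ord_recr/= leeDr//.
exact: sume_ge0.
Qed.

Lemma L2_rapid_ae (f : nat -> T -> R) g : (forall k, L2 (f k)) -> L2 g ->
  (forall k, nsq (f k - g) <= 8^-1 ^+ k) ->
  {ae mu, forall x, f k x @[k --> \oo] --> g x}.
Proof.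
move=> hf hg h; have [|S [_ _]] := L2_rapid _ h; first by move=> k; exact: L2B.
apply: filterS => x hx; apply/(subr_cvg0 (fun k => f k x)).
apply: (@sqr_squeeze0 _ _ _ _ _ (fun k => S x * 4^-1 ^+ k)); first exact: nearW.
rewrite -(mulr0 (S x)); apply: cvgMl_tmp; apply: cvg_expr.
by rewrite ger0_norm//; lra.
Qed.

(** Riesz-Fischer. A subsequence with rapidly decreasing increments converges pointwise on a set [A]
    of full measure, at a geometric rate governed by [S]; integrating this rate gives L^2
    convergence, and the Cauchy property carries it over to the whole sequence. *)
Lemma L2_complete (f : nat -> T -> R) : (forall k, L2 (f k)) ->
  (forall e : R, 0 < e -> exists N, forall m n, (N <= m)%N -> (N <= n)%N -> nsq (f m - f n) <= e) ->
  exists g, L2 g /\ nsq (f k - g) @[k --> \oo] --> 0.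
Proof.
move=> hf cf.
have /choice[N hN] : forall k, exists N, forall m n, (N <= m)%N -> (N <= n)%N ->
    nsq (f m - f n) <= 8^-1 ^+ k.
  by move=> k; apply: cf; rewrite exprn_gt0.
(* The successor makes [nk] strictly increasing, so it also reaches past any given index. *)
pose fix nk k := if k is k'.+1 then maxn (nk k').+1 (N k) else N 0.
have nkN k : (N k <= nk k)%N by case: k => //= k; rewrite leq_maxr.
have nkS k : (nk k < nk k.+1)%N by rewrite /= leq_maxl.
have nkk k : (k <= nk k)%N by elim: k => // k IH; exact: leq_ltn_trans (nkS k).
pose g k := f (nk k).
have hg k : L2 (g k) by exact: hf.
have [||S [iS S0 hS]] := @L2_rapid (fun k => g k.+1 - g k).
- by move=> k; exact: L2B.
- by move=> k; apply: hN; rewrite ?(leq_trans (nkN k))// ltnW.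
pose A := [set x | forall k, (g k.+1 x - g k x) ^+ 2 <= S x * 4^-1 ^+ k].
have mA : measurable A.
  have -> : A = \bigcap_k [set x | (g k.+1 x - g k x) ^+ 2 <= S x * 4^-1 ^+ k].
    by apply/seteqP; split => x /= h k; [move=> _|]; exact: h.
  apply: bigcapT_measurable => k.
  rewrite -[X in measurable X]setTI; apply: measurable_fun_le => //.
    by apply: measurable_funX; apply: measurable_funB; exact: L2_meas.
  by apply: measurable_funM => //; exact: itg_meas iS.
have bnd x k m : A x -> `|g (k + m)%N x - g k x| <= 2 * Num.sqrt (S x) * 2^-1 ^+ k.
  move=> Ax.
  suff : `|g (k + m)%N x - g k x| <= 2 * Num.sqrt (S x) * (2^-1 ^+ k - 2^-1 ^+ (k + m)).
    move=> /le_trans; apply; apply: ler_wpM2l; first by rewrite mulr_ge0.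
    by rewrite lerBlDr lerDl exprn_ge0.
  elim: m => [|m IH]; first by rewrite addn0 !subrr normr0 mulr0.
  have h : `|g (k + m.+1)%N x - g (k + m)%N x| <= Num.sqrt (S x) * 2^-1 ^+ (k + m).
    rewrite addnS -(ler_sqr (x := `|_|)) ?nnegrE ?mulr_ge0 ?exprn_ge0//.
    rewrite real_normK ?num_real// exprMn sqr_sqrtr// -exprM mulnC exprM.
    by rewrite (_ : 2^-1 ^+ 2 = 4^-1 :> R) ?Ax//; field.
  have -> : g (k + m.+1)%N x - g k x = (g (k + m.+1)%N x - g (k + m)%N x) + (g (k + m)%N x - g k x).
    by rewrite addrA subrK.
  rewrite (le_trans (ler_normD _ _))// (le_trans (lerD h IH))//.
  by rewrite addnS exprS; lra.
(* Multiplied by the indicator of [A] the sequence converges at every point, which makes its limit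
   measurable. *)
pose gA k := g k \* \1_A.
have cA x : gA k x @[k --> \oo] --> lim (gA k x @[k --> \oo]).
  apply/cauchy_cvgP; apply: cauchy_exP => e e0 /=.
  have [Ax|nAx] := pselect (A x); last first.
    exists 0; exists 0%N => // k _; rewrite /= /ball/= /gA/=.
    by rewrite indicE memNset// mulr0 subrr normr0.
  have C0 : 2 * Num.sqrt (S x) * 2^-1 ^+ k @[k --> \oo] --> (0 : R).
    rewrite -(mulr0 (2 * Num.sqrt (S x))); apply: cvgMl_tmp; apply: cvg_expr.
    by rewrite ger0_norm//; lra.
  move/cvgr0Pnorm_lt : C0 => /(_ _ e0)[k0 _ hk0].
  exists (gA k0 x); exists k0 => // k /= k0k; rewrite /ball/= distrC.
  rewrite /gA/= indicE mem_set// !mulr1 -(subnKC k0k).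
  apply: (le_lt_trans (bnd _ _ _ Ax)); apply: (le_lt_trans (ler_norm _)).
  exact: (hk0 k0 (leqnn _)).
pose G x := lim (gA k x @[k --> \oo]).
have mgA k : measurable_fun setT (gA k).
  by apply: measurable_funM; [exact: L2_meas|exact: measurable_indic].
have mG : measurable_fun setT G by apply: (@measurable_fun_cvg _ _ _ _ gA) => // x _; exact: cA.
have bndG x k : A x -> (g k x - G x) ^+ 2 <= 4 * S x * 4^-1 ^+ k.
  move=> Ax; have -> : 4 * S x * 4^-1 ^+ k = (2 * Num.sqrt (S x) * 2^-1 ^+ k) ^+ 2.
    rewrite !exprMn sqr_sqrtr// -[2^-1 ^+ k ^+ 2]exprM mulnC exprM.
    by rewrite (_ : 2^-1 ^+ 2 = 4^-1 :> R); field.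
  rewrite -(real_normK (num_real (_ - _))) lerXn2r// ?nnegrE ?mulr_ge0 ?exprn_ge0//.
  have c : `|g k x - gA n x| @[n --> \oo] --> `|g k x - G x|.
    by apply: cvg_norm; apply: cvgB; [exact: cvg_cst|exact: cA].
  rewrite -(cvg_lim _ c)//; apply: limr_le; first by apply/cvg_ex; eexists; exact: c.
  near=> n; have kn : (k <= n)%N by near: n; exact: nbhs_infty_ge.
  by rewrite /gA/= indicE mem_set// mulr1 distrC -(subnKC kn) bnd.
have aeA : {ae mu, forall x, A x} by apply: filterS hS.
have hbd k : L2 (g k - G) /\ nsq (g k - G) <= 4 * 4^-1 ^+ k * \int[mu]_x S x.
  have m1 : measurable_fun setT (g k - G) by apply: measurable_funB => //; exact: L2_meas.
  pose w := (g k - G) \* \1_A.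
  have mw : measurable_fun setT w by apply: measurable_funM => //; exact: measurable_indic.
  have aw : {ae mu, forall x, w x = (g k - G) x}.
    by apply: filterS aeA => x Ax; rewrite /w/= indicE mem_set// mulr1.
  have wS x : `|w x ^+ 2| <= (4 * 4^-1 ^+ k) * S x.
    rewrite ger0_norm ?sqr_ge0// /w/= indicE.
    case: (pselect (A x)) => Ax; last by rewrite memNset// mulr0 expr0n mulr_ge0// mulr_ge0// exprn_ge0.
    by rewrite mem_set// mulr1 mulrAC bndG.
  have Lw : L2 w.
    split => //; apply: itg_le wS _; first exact: measurable_funX.
    exact: (itgZ (4 * 4^-1 ^+ k) iS).
  have LgG := L2_ae m1 aw Lw; split => //.
  rewrite -(nsq_ae Lw LgG aw) -(intZ _ iS); apply: int_le; [exact: Lw.2|exact: itgZ|].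
  by move=> x; rewrite (le_trans (ler_norm _))// wS.
exists G; split.
  have -> : G = g 0 - (g 0 - G) by rewrite opprB addrC subrK.
  by apply: L2B => //; exact: (hbd 0).1.
apply/cvgr0Pnorm_le => e e0.
have [|N1 hN1] := cf (e / 4); first by rewrite divr_gt0.
have C0 : 4 * 4^-1 ^+ k * \int[mu]_x S x @[k --> \oo] --> (0 : R).
  rewrite -(mul0r (\int[mu]_x S x)); apply: cvgMr_tmp; rewrite -(mulr0 4); apply: cvgMl_tmp.
  by apply: cvg_expr; rewrite ger0_norm//; lra.
have e4 : 0 < e / 4 by rewrite divr_gt0.
move/cvgr0Pnorm_le : C0 => /(_ _ e4)[k0 _ hk0].
near=> n; rewrite ger0_norm ?nsq_ge0//.
near \oo => k.
have hk : nsq (g k - G) <= e / 4.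
  apply: (le_trans (hbd k).2); rewrite (le_trans (ler_norm _))//; apply: hk0 => /=.
  by near: k; exact: nbhs_infty_ge.
have h2 : nsq (f n - g k) <= e / 4.
  apply: hN1; first by near: n; exact: nbhs_infty_ge.
  by apply: leq_trans (nkk k); near: k; exact: nbhs_infty_ge.
have -> : f n - G = (f n - g k) + (g k - G) by rewrite addrA subrK.
apply: (le_trans (nsqD_le _ (hbd k).1)); first exact: L2B.
lra.
Unshelve. all: by end_near. Qed.

End L2_limits.

(** * Riesz representation and weak limits *)

Section riesz.
Context d (T : measurableType d) (R : realType) (mu : {measure set T -> \bar R}).
Implicit Types (f g h u v w : T -> R).
Local Notation L2 := (L2 mu).
Local Notation dot := (l2dot mu).
Local Notation nsq := (l2sq mu).

(* The representative minimizes [nsq v - 2 l v]; the parallelogram identity makes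
   minimizing sequences Cauchy. *)
Lemma riesz (V : (T -> R) -> Prop) (l : (T -> R) -> R) (C : R) :
  (forall v, V v -> L2 v) -> V 0 ->
  (forall a u v, V u -> V v -> V (a *: u + v)) ->
  (forall a u v, V u -> V v -> l (a *: u + v) = a * l u + l v) ->
  (forall v, V v -> l v ^+ 2 <= C * nsq v) ->
  exists p, [/\ L2 p, (forall v, V v -> dot p v = l v) &
    exists2 v : nat -> T -> R, (forall n, V (v n)) &
      nsq (v n - p) @[n --> \oo] --> 0].
Proof.
move=> VL V0 VD lD lC.
pose J v := nsq v - 2 * l v.
(* With [n = nsq v], the square of [l v] is at most [|C| n], hence at most the square of
   [(n + |C|) / 2]; so [J v] is bounded below by [- |C|]. *)
have C0 v : V v -> - (1 + `|C|) <= J v.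
  move=> Vv; have := lC _ Vv; rewrite /J; have := nsq_ge0 mu v.
  have : C * nsq v <= `|C| * nsq v by rewrite ler_wpM2r ?nsq_ge0// ler_norm.
  have := normr_ge0 C; set c := `|C|; set n := nsq v; set y := l v => c0 h1 n0 h2.
  have h4 := sqr_ge0 ((n - c) / 2).
  have : y ^+ 2 <= ((n + c) / 2) ^+ 2 by lra.
  have nc : 0 <= (n + c) / 2 by lra.
  rewrite -(real_normK (num_real y)) ler_sqr ?nnegrE// => h3.
  by have := ler_norm y; lra.
pose A := [set J v | v in [set v | V v]].
have hA : has_inf A by split; [exists (J 0), 0|exists (- (1 + `|C|)) => _ [v Vv <-]; exact: C0].
pose m := inf A.
have mJ v : V v -> m <= J v by move=> Vv; apply: ge_inf; [exact: hA.2|exists v].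
have /choice[v hv] : forall n : nat, exists v, V v /\ J v < m + n.+1%:R^-1.
  move=> n; have [|_ [w Vw <-] hw] := @inf_adherent _ A n.+1%:R^-1 _ hA; first by rewrite invr_gt0.
  by exists w.
have VvL n : L2 (v n) by apply: VL; exact: (hv n).1.
have VZ a u : V u -> V (a *: u) by move=> Vu; rewrite -[_ *: _]addr0; exact: VD.
have l0 : l 0 = 0.
  have := lD 1 0 0 V0 V0; rewrite scaler0 addr0 mul1r => h.
  by apply: (addrI (l 0)); rewrite addr0 -h.
have lZ a u : V u -> l (a *: u) = a * l u.
  by move=> Vu; rewrite -[a *: u]addr0 lD// l0 addr0.
have par a b : nsq (v a - v b) <= 2 * (a.+1%:R^-1 + b.+1%:R^-1).
  have [Va Ja] := hv a; have [Vb Jb] := hv b.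
  have Vm : V (2^-1 *: (1 *: v a + v b)) by apply: VZ; exact: VD.
  rewrite nsqB//; have := mJ _ Vm; rewrite /J lZ ?lD//; last exact: VD.
  rewrite nsqZ scale1r ?nsqD//; last exact: L2D.
  move: Ja Jb; rewrite /J mul1r expr2; move: (a.+1%:R^-1) (b.+1%:R^-1) => xa xb; lra.
have [|p [Lp hp]] := L2_complete VvL.
  move=> e e0.
  have := @inv_succ_cvg0 R => /cvgr0Pnorm_le /(_ (e / 4) ltac:(by rewrite divr_gt0))[N _ hN].
  exists N => i j /hN /= hi /hN /= hj; apply: (le_trans (par i j)).
  by move: hi hj; rewrite !ger0_norm ?invr_ge0//; move: (i.+1%:R^-1) (j.+1%:R^-1) => x y; lra.
exists p; split => //; last by exists v => // n; exact: (hv n).1.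
move=> w Vw; have Lw := VL _ Vw.
(* The limit [p] need not lie in [V]: minimality is tested at [v n], with the defect [n.+1%:R^-1],
   and then passed to the limit. *)
have E s : 0 <= 2 * (dot p w - l w) * s + nsq w * s ^+ 2.
  have c : (n.+1%:R^-1 + 2 * (dot (v n) w - l w) * s + nsq w * s ^+ 2) @[n --> \oo] -->
     (0 + 2 * (dot p w - l w) * s + nsq w * s ^+ 2).
    apply: cvgD; last exact: cvg_cst.
    apply: cvgD; first exact: inv_succ_cvg0.
    apply: cvgMr_tmp; apply: cvgMl_tmp; apply: cvgB; last exact: cvg_cst.
    exact: dot_cvgl.
  rewrite add0r in c; rewrite -(cvg_lim _ c)//; apply: limr_ge.
    by apply/cvg_ex; eexists; exact: c.
  apply: nearW => n; have [Vn Jn] := hv n.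
  have := mJ _ (VD s _ _ Vw Vn); rewrite /J lD// nsqD ?nsqZ ?dotZl//; last exact: L2Z.
  by move: Jn; rewrite /J (dotC _ w); move: (n.+1%:R^-1) => xn; lra.
by apply/eqP; rewrite -subr_eq0; apply/eqP; exact: quad_ge0_lin E.
Qed.

(** Along the ultrafilter every pairing [dot (f i) v] converges; the limit is a bounded linear
    functional of [v], which [riesz] represents. *)
Lemma L2_weak_limit (I : Type) (U : set_system I) (UU : UltraFilter U)
    (f : I -> T -> R) (C : R) :
  (forall i, L2 (f i)) -> (forall i, nsq (f i) <= C) ->
  exists g, L2 g /\ forall v, L2 v -> dot (f i) v @[i --> U] --> dot g v.
Proof.
move=> hf fC.
have /choice[l hl] : forall v, exists y : R, L2 v -> dot (f i) v @[i --> U] --> y.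
  move=> v; case: (pselect (L2 v)) => hv; last by exists 0.
  have [y hy] : exists y : R, dot (f i) v @[i --> U] --> y.
    apply: (@ultra_bounded_cvg _ _ _ _ _ (1 + C * nsq v)) => i.
    have h := dot_CS (hf i) hv.
    have h2 : nsq (f i) * nsq v <= C * nsq v by rewrite ler_wpM2r ?nsq_ge0.
    have h3 : `|dot (f i) v| ^+ 2 <= C * nsq v by rewrite real_normK ?num_real// (le_trans h).
    by have := normr_ge0 (dot (f i) v); nra.
  by exists y.
have [|||||p [Lp hp _]] := @riesz L2 l C.
- by [].
- exact: L20.
- by move=> a u v hu hv; apply: L2D => //; exact: L2Z.
- move=> a u v hu hv.
  have h1 : dot (f i) (a *: u + v) @[i --> U] --> a * l u + l v.
    apply: (@cvg_eqr _ _ _ _ (fun i => a * dot (f i) u + dot (f i) v)).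
      by move=> i; rewrite dotDr ?dotZr//; exact: L2Z.
    apply: cvgD; last exact: hl.
    by apply: cvgMl_tmp; exact: hl.
  have h2 : dot (f i) (a *: u + v) @[i --> U] --> l (a *: u + v).
    by apply: hl; apply: L2D => //; exact: L2Z.
  by rewrite -(cvg_lim _ h1)// (cvg_lim _ h2).
- move=> v hv; have c : (dot (f i) v ^+ 2) @[i --> U] --> l v ^+ 2.
    by rewrite expr2; under eq_fun do rewrite expr2; apply: cvgM; exact: hl.
  rewrite -(cvg_lim _ c)//; apply: limr_le; first by apply/cvg_ex; eexists; exact: c.
  apply: nearW => i; apply: (le_trans (dot_CS (hf i) hv)).
  by rewrite ler_wpM2r ?nsq_ge0.
by exists p; split => // v hv; rewrite hp//; exact: hl.
Qed.

End riesz.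

(** * Changes of variables in R^N *)

Section rV_measurable.
Context {R : realType} {N : nat}.
Local Notation E := 'rV[R]_N.
Local Notation leb := (@lebesgue_rV R N).

Definition box (A : 'I_N -> set R) : set E := [set x | forall i, A i (x ord0 i)].

Lemma box_measurable A : (forall i, measurable (A i)) -> measurable (box A).
Proof.
move=> mA; have -> : box A = \bigcap_(i in [set: 'I_N]) (rV_coord i @^-1` A i).
  by apply/seteqP; split => x /= h i; [move=> _|]; exact: h.
apply: fin_bigcap_measurable => // i _.
by rewrite -[X in measurable X]setTI; exact: measurable_rV_coord.
Qed.

Definition boxes : set (set E) := [set box A | A in [set A | forall i, measurable (A i)]].

Lemma measurable_boxes : @measurable _ E = <<s boxes >>.
Proof.
apply/seteqP; split; last first.
  apply: smallest_sub; first exact: sigma_algebra_measurable.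
  by move=> _ [A mA <-]; exact: box_measurable.
apply: smallest_sub; first exact: smallest_sigma_algebra.
rewrite -bigcup_seq => _ [i /= _ [B mB <-]]; apply: sub_sigma_algebra.
exists (fun j => if j == i then B else setT); first by move=> j /=; case: ifP.
apply/seteqP; split => x /=.
  by move=> /(_ i); rewrite eqxx; split.
by move=> [_ h] j; case: ifP => // /eqP ->.
Qed.

Lemma boxesI : setI_closed boxes.
Proof.
move=> _ _ [A mA <-] [B mB <-]; exists (fun i => A i `&` B i).
  by move=> i /=; exact: measurableI.
by apply/seteqP; split => x /=; [move=> h; split => i; case: (h i)|move=> [h1 h2] i; split].
Qed.

Definition cube (r : R) : set E := box (fun=> `[- r, r]%classic).

Lemma cube_measurable r : measurable (cube r).
Proof. by apply: box_measurable => i; exact: measurable_itv. Qed.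

Lemma cubeP r x : cube r x <-> forall i, `|x ord0 i| <= r.
Proof. by split => h i; have := h i; rewrite /= in_itv/= ler_norml. Qed.

Lemma leb_cube (r : R) : 0 <= r -> leb (cube r) = ((2 * r) ^+ N)%:E.
Proof.
move=> r0; rewrite /cube lebesgue_rV_box//.
under eq_bigr do rewrite lebesgue_measure_itv/= lte_fin.
have -> : (if (- r < r)%R then r%:E + (- - r)%:E else 0)%E = (2 * r)%:E.
  case: ifPn; first by rewrite opprK -EFinD => _; congr EFin; ring.
  by rewrite -leNgt => h; congr EFin; lra.
by rewrite prodEFin prodr_const card_ord.
Qed.

Lemma cube_cover : \bigcup_(n : nat) cube n%:R = setT.
Proof.
apply/seteqP; split => // x _; exists (Num.truncn (\sum_i `|x ord0 i|)).+1 => //.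
apply/cubeP => i; apply/ltW; apply: (@le_lt_trans _ _ (\sum_i `|x ord0 i|)).
  by rewrite (bigD1 i)//= lerDl sumr_ge0.
by rewrite truncnS_gt// sumr_ge0.
Qed.

Lemma leb_unique (m : {measure set E -> \bar R}) :
  (forall A, (forall i, measurable (A i)) -> m (box A) = (\prod_(i < N) lebesgue_measure (A i))%E) ->
  forall A, measurable A -> m A = leb A.
Proof.
move=> mE A mA; apply: (measure_unique boxes (fun n => cube n%:R)) => //.
- exact: measurable_boxes.
- exact: boxesI.
- by move=> n; exists (fun=> `[- n%:R, n%:R]%classic) => //= i; exact: measurable_itv.
- exact: cube_cover.
- by move=> _ [B mB <-]; rewrite mE// -lebesgue_rV_box.
move=> k; rewrite mE; last by move=> i; exact: measurable_itv.
by rewrite -lebesgue_rV_box//; rewrite -/(box _) -/(cube _) leb_cube// ltry.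
Qed.

Lemma measurable_coord (i : 'I_N) : measurable_fun setT (fun x : E => x ord0 i).
Proof. exact: measurable_rV_coord. Qed.

Lemma measurable_addl (y : E) : measurable_fun setT (fun x : E => x + y).
Proof.
apply: measurable_fun_rV => i.
apply: (eq_measurable_fun (fun x : E => x ord0 i + y ord0 i)) => [x _|]; first by rewrite mxE.
by apply: measurable_funD; [exact: measurable_coord|exact: measurable_cst].
Qed.

Lemma measurable_oppv : measurable_fun setT (fun x : E => - x).
Proof.
apply: measurable_fun_rV => i.
apply: (eq_measurable_fun (fun x : E => - x ord0 i)) => [x _|]; first by rewrite mxE.
by apply: measurableT_comp => //; exact: measurable_coord.
Qed.

Lemma measurable_scalev (a : R) : measurable_fun setT (fun x : E => a *: x).
Proof.
apply: measurable_fun_rV => i.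
apply: (eq_measurable_fun (fun x : E => a * x ord0 i)) => [x _|]; first by rewrite mxE.
by apply: measurable_funM; [exact: measurable_cst|exact: measurable_coord].
Qed.

Lemma lebesgue1_translation (a : R) (A : set R) : measurable A ->
  lebesgue_measure ((fun x : R => x + a) @^-1` A) = lebesgue_measure A.
Proof.
move=> mA.
have ma : measurable_fun [set: measurableTypeR R] (fun x : measurableTypeR R => x + a : measurableTypeR R).
  exact: (measurable_funD (@measurable_id _ _ setT) (measurable_cst a)).
pose f : {mfun measurableTypeR R >-> measurableTypeR R} := 
  HB.pack (fun x : measurableTypeR R => x + a : measurableTypeR R) (isMeasurableFun.Build _ _ _ _ _ ma).
apply/esym; rewrite -[RHS]/(pushforward lebesgue_measure f A).
apply: (lebesgue_measure_unique (mu := pushforward lebesgue_measure f)) => //= _ [[u v]] _ <-.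
rewrite /pushforward /=.
have -> : (fun x : R => x + a) @^-1` `]u, v] = `](u - a), (v - a)]%classic.
  by apply/seteqP; split => x /=; rewrite !in_itv/= ltrBlDr lerBrDr.
by rewrite !lebesgue_measure_itv/= !lte_fin ltrD2r; case: ifP => // _; rewrite -!EFinD; congr EFin; ring.
Qed.

Lemma leb_translation (y : E) (A : set E) : measurable A ->
  leb ((fun x => x + y) @^-1` A) = leb A.
Proof.
move=> mA.
pose f : {mfun E >-> E} := HB.pack (fun x : E => x + y) (isMeasurableFun.Build _ _ _ _ _ (measurable_addl y)).
apply: (@leb_unique (pushforward leb f)) => // B mB.
transitivity (leb (box (fun i => (fun s : R => s + y ord0 i) @^-1` B i))).
  by congr (leb _); apply/seteqP; split => x /= h i; have := h i; rewrite /= mxE.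
rewrite lebesgue_rV_box; last first.
  move=> i; rewrite -[X in measurable X]setTI.
  exact: (measurable_funD (@measurable_id _ _ setT) (measurable_cst (y ord0 i))).
by apply: eq_bigr => i _; exact: lebesgue1_translation.
Qed.

Lemma measurable_addv d (T : measurableType d) (f g : T -> E) :
  measurable_fun setT f -> measurable_fun setT g -> measurable_fun setT (fun x => f x + g x).
Proof.
move=> mf mg; apply: measurable_fun_rV => i.
apply: (eq_measurable_fun (fun x => f x ord0 i + g x ord0 i)) => [x _|]; first by rewrite mxE.
by apply: measurable_funD; apply: (measurableT_comp (measurable_coord i)).
Qed.

(* Both sides equal the double integral of 1_A(x + T y) 1_B(T y). *)
Lemma leb_linear_haar (T S : E -> E) (A B : set E) : measurable_fun setT T ->
  (forall x, T (S x) = x) -> (forall x y, T (x + y) = T x + T y) ->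
  measurable A -> measurable B ->
  (leb A * leb (T @^-1` B) = leb (T @^-1` A) * leb (-%R @^-1` B))%E.
Proof.
move=> mT TS TD mA mB.
have mTB C : measurable C -> measurable (T @^-1` C).
  by move=> mC; rewrite -[X in measurable X]setTI; exact: mT.
have mind (C : set E) d (X : measurableType d) (f : X -> E) : measurable C -> measurable_fun setT f ->
    measurable_fun setT (fun x => (\1_C (f x) : R)%:E).
  move=> mC mf; apply/measurable_EFinP.
  by apply: (measurableT_comp (f := \1_C : E -> R)) => //; exact: measurable_indic.
have shiftI (C : set E) y : measurable C -> (\int[leb]_x (\1_C (x + y) : R)%:E = leb C)%E.
  move=> mC; rewrite -(leb_translation y mC).
  rewrite (_ : (fun x => _) = fun x => (\1_((fun x => x + y) @^-1` C) x : R)%:E).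
    by rewrite integral_indic// ?setIT//; rewrite -[X in measurable X]setTI; exact: measurable_addl.
  by apply/funext => x; rewrite !indicE.
pose F (p : E * E) : \bar R := (\1_A (p.1 + T p.2) * \1_B (T p.2))%:E.
have mF : measurable_fun setT F.
  rewrite /F; under eq_fun do rewrite EFinM; apply: emeasurable_funM; apply: mind => //.
    by apply: measurable_addv => //; apply: measurableT_comp.
  by apply: measurableT_comp.
have F0 p : (0 <= F p)%E by rewrite lee_fin mulr_ge0.
have mind0 (C : set E) : measurable C -> measurable_fun setT (fun x => (\1_C x : R)%:E).
  by move=> mC; apply/measurable_EFinP; exact: measurable_indic.
have L : (\int[leb]_y \int[leb]_x F (x, y) = leb A * leb (T @^-1` B))%E.
  transitivity (\int[leb]_y (leb A * (\1_(T @^-1` B) y : R)%:E))%E.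
    apply: eq_integral => y _; rewrite /F /=.
    rewrite -(shiftI A (T y) mA) muleC -ge0_integralZl//.
    - by apply: eq_integral => x _; rewrite -EFinM mulrC.
    - by apply: mind => //; exact: measurable_addl.
  rewrite ge0_integralZl//; last by apply: mind0; exact: mTB.
  by rewrite integral_indic ?setIT//; exact: mTB.
rewrite -L -fubini_tonelli//.
(* The translation by [S x], which [T] sends to the translation by [x], moves [x] from the argument
   of [A] to that of [B]. *)
transitivity (\int[leb]_x \int[leb]_y (\1_A (T y) * \1_B (T y - x))%:E)%E.
  apply: eq_integral => x _; rewrite /F /=.
  have mG : measurable_fun setT (fun y : E => (\1_A (T y) * \1_B (T y - x) : R)%:E).
    under eq_fun do rewrite EFinM; apply: emeasurable_funM; apply: mind => //.
    by apply: (measurableT_comp (measurable_addl (- x))).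
  pose f : {mfun E >-> E} := HB.pack (fun z : E => z + S x) (isMeasurableFun.Build _ _ _ _ _ (measurable_addl (S x))).
  rewrite -[RHS](@eq_measure_integral _ _ _ _ _ (pushforward leb f)); last first.
    by move=> C mC _; exact: (leb_translation (S x) mC).
  rewrite (ge0_integral_pushforward (measurable_addl (S x)))//= preimage_setT.
  by apply: eq_integral => y _ /=; rewrite TD TS addrK (addrC (T y)).
have mH : measurable_fun setT (fun p : E * E => (\1_A (T p.2) * \1_B (T p.2 - p.1) : R)%:E).
  under eq_fun do rewrite EFinM; apply: emeasurable_funM; apply: mind => //.
    by apply: measurableT_comp.
  apply: measurable_addv; first by apply: measurableT_comp.
  by apply: (measurableT_comp measurable_oppv).
rewrite (@fubini_tonelli _ _ _ _ _ leb leb _ mH); last first.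
  by move=> p; rewrite lee_fin mulr_ge0.
transitivity (\int[leb]_y ((\1_(T @^-1` A) y : R)%:E * leb (-%R @^-1` B)))%E.
  apply: eq_integral => y _ /=.
  have mNB : measurable (-%R @^-1` B) by rewrite -[X in measurable X]setTI; exact: measurable_oppv.
  rewrite -(shiftI _ (- T y) mNB) -ge0_integralZl//.
  - by apply: eq_integral => x _; rewrite -EFinM -(opprB x).
  - by apply: mind => //; exact: measurable_addl.
rewrite ge0_integralZr//; last by apply: mind0; exact: mTB.
by rewrite integral_indic ?setIT//; exact: mTB.
Qed.

End rV_measurable.

(** * Maps that multiply the Lebesgue measure by a constant *)

Section change_of_variables.
Context {R : realType} {N : nat}.
Local Notation E := 'rV[R]_N.
Local Notation leb := (@lebesgue_rV R N).
Local Notation itg := (itg leb).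
Local Notation L2 := (L2 leb).
Local Notation dot := (l2dot leb).
Local Notation nsq := (l2sq leb).
Implicit Types (f g : E -> R) (x y z : E).

(** [c] is the factor for preimages, that is, the inverse of the Jacobian: 1 for translations and
    isometries, [a^-1 ^+ N] for the dilation by [a]. In this form it is also the factor by which
    integrals of [f \o T] change. *)
Definition mpres (c : R) (T : E -> E) := [/\ 0 <= c, measurable_fun setT T &
  forall A, measurable A -> (leb (T @^-1` A) = c%:E * leb A)%E].

Lemma mpres_shift y : mpres 1 (fun x => x + y).
Proof.
split => //; first exact: measurable_addl.
by move=> A mA; rewrite mul1e leb_translation.
Qed.

(** In [leb_linear_haar] take for [B] the unit cube: its preimage is a cube of known measure, which
    determines the factor for every [A]. *)
Lemma mpres_scale (a : R) : 0 < a -> mpres (a^-1 ^+ N) (fun x => a *: x).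
Proof.
move=> a0; split; [by rewrite exprn_ge0// invr_ge0 ltW|exact: measurable_scalev|] => A mA.
have := @leb_linear_haar R N (fun x => a *: x) (fun x => a^-1 *: x) A (cube 1)
  (measurable_scalev a) _ _ mA (cube_measurable 1).
have -> : (fun x : E => a *: x) @^-1` cube 1 = cube a^-1.
  apply/seteqP; split => x /= /cubeP h; apply/cubeP => i; have := h i.
    by rewrite mxE normrM gtr0_norm// -ler_pdivlMl// mulr1.
  by rewrite mxE normrM gtr0_norm// -ler_pdivlMl// mulr1.
have -> : -%R @^-1` cube 1 = cube 1 :> set E.
  by apply/seteqP; split => x /= /cubeP h; apply/cubeP => i; have := h i; rewrite mxE normrN.
rewrite !leb_cube ?invr_ge0 ?ltW// mulr1 exprMn.
move=> H; have {H} : (leb A * (2 ^+ N * a^-1 ^+ N)%:E = leb ((fun x : E => a *: x) @^-1` A) * (2 ^+ N)%:E)%E.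
  by apply: H; [move=> x; rewrite scalerA divff ?scale1r// gt_eqF|move=> x y; exact: scalerDr].
move=> /(congr1 (fun z : \bar R => z * ((2 ^+ N)^-1)%:E)%E).
rewrite -!muleA -!EFinM divff ?gt_eqF ?exprn_gt0// mule1 => <-.
by rewrite muleC; congr (_%:E * _)%E; field; rewrite gt_eqF// exprn_gt0.
Qed.

Lemma measurable_dotv e : measurable_fun setT (fun x : E => dotv x e).
Proof.
apply: measurable_sum => i; apply: measurable_funM; first exact: measurable_coord.
exact: measurable_cst.
Qed.

Lemma measurable_enorm : measurable_fun setT (fun x : E => enorm x).
Proof.
apply: (measurableT_comp (f := @Num.sqrt R)); first by apply: continuous_measurable_fun; exact: sqrt_continuous.
apply: measurable_sum => i; apply: measurable_funM; exact: measurable_coord.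
Qed.

Lemma dotvC x y : dotv x y = dotv y x.
Proof. by apply: eq_bigr => i _; rewrite mulrC. Qed.
Lemma dotvDl x y z : dotv (x + y) z = dotv x z + dotv y z.
Proof. by rewrite -big_split; apply: eq_bigr => i _; rewrite mxE mulrDl. Qed.
Lemma dotvZl (a : R) x z : dotv (a *: x) z = a * dotv x z.
Proof. by rewrite mulr_sumr; apply: eq_bigr => i _; rewrite mxE mulrA. Qed.
Lemma dotvNl x z : dotv (- x) z = - dotv x z.
Proof. by rewrite -scaleN1r dotvZl mulN1r. Qed.
Lemma dotvBl x y z : dotv (x - y) z = dotv x z - dotv y z.
Proof. by rewrite dotvDl dotvNl. Qed.
Lemma dotvBr x y z : dotv z (x - y) = dotv z x - dotv z y.
Proof. by rewrite dotvC dotvBl !(dotvC z). Qed.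
Lemma dotvZr (a : R) x z : dotv z (a *: x) = a * dotv z x.
Proof. by rewrite dotvC dotvZl dotvC. Qed.
Lemma dotv_ge0 x : 0 <= dotv x x.
Proof. by apply: sumr_ge0 => i _; rewrite -expr2 sqr_ge0. Qed.
Lemma dotv_eq0 x : dotv x x = 0 -> x = 0.
Proof.
move=> /eqP; rewrite psumr_eq0 => [/allP h|i _]; last by rewrite -expr2 sqr_ge0.
apply/rowP => i; have := h i (mem_index_enum i); rewrite mxE mulf_eq0.
by rewrite orbb => /eqP.
Qed.

Lemma enorm_ge0 x : 0 <= enorm x. Proof. exact: sqrtr_ge0. Qed.
Lemma enormN x : enorm (- x) = enorm x.
Proof. by rewrite /enorm dotvNl dotvC dotvNl opprK. Qed.
Lemma enorm_sqr x : enorm x ^+ 2 = dotv x x.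
Proof. by rewrite sqr_sqrtr// dotv_ge0. Qed.

Lemma coord_le_enorm x i : `|x ord0 i| <= enorm x.
Proof.
rewrite -(ler_sqr (x := `|_|)) ?nnegrE ?enorm_ge0// enorm_sqr real_normK ?num_real//.
rewrite /dotv (bigD1 i)//= -expr2 lerDl; apply: sumr_ge0 => j _.
by rewrite -expr2 sqr_ge0.
Qed.

Definition eball (r : R) : set E := [set x | enorm x < r].

Lemma eball_measurable r : measurable (eball r).
Proof.
have := @measurable_enorm measurableT _ (measurable_itv `]-oo, r[).
by rewrite setTI; congr measurable; apply/seteqP; split => x; rewrite /= in_itv.
Qed.

Lemma eball_finite (r : R) : (leb (eball r) < +oo)%E.
Proof.
apply: (@le_lt_trans _ _ (leb (cube `|r|))); last by rewrite leb_cube// ltry.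
apply: le_measure; rewrite ?inE; [exact: eball_measurable|exact: cube_measurable|].
move=> x /= h; apply/cubeP => i; rewrite (le_trans (coord_le_enorm x i))// ltW//.
by rewrite (lt_le_trans h)// ler_norm.
Qed.

Lemma eball_gt0 (r : R) : 0 < r -> (0 < leb (eball r))%E.
Proof.
(* The divisor [N.+1] makes the sum of [N] squares [s ^+ 2] strictly smaller than [r ^+ 2], also for
   [N = 0]. *)
move=> r0; pose s := r / N.+1%:R.
have s0 : 0 < s by rewrite divr_gt0.
apply: (@lt_le_trans _ _ (leb (cube s))).
  by rewrite leb_cube ?ltW// lte_fin exprn_gt0// mulr_gt0.
apply: le_measure; rewrite ?inE; [exact: cube_measurable|exact: eball_measurable|].
move=> x /cubeP h; change (enorm x < r).
rewrite -ltr_sqr ?nnegrE ?enorm_ge0 ?ltW//= enorm_sqr.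
apply: (@le_lt_trans _ _ (\sum_(i < N) s ^+ 2)).
  apply: ler_sum => i _; rewrite -expr2 -(real_normK (num_real (x _ _))).
  by rewrite ler_sqr ?nnegrE ?(ltW s0)//; exact: h.
rewrite sumr_const card_ord -mulr_natr /s exprMn -mulrA.
rewrite gtr_pMr ?exprn_gt0// exprVn mulrC ltr_pdivrMr ?exprn_gt0// mul1r -natrX ltr_nat.
by rewrite expnS expn1 mulSn ltn_addr.
Qed.

(** In [leb_linear_haar] the unit ball is its own preimage and its own opposite; its measure is
    positive and finite, so it cancels. *)
Lemma mpres_isometry (T S : E -> E) : measurable_fun setT T ->
  (forall x, T (S x) = x) -> (forall x y, T (x + y) = T x + T y) ->
  (forall x, enorm (T x) = enorm x) -> mpres 1 T.
Proof.
move=> mT TS TD Tn; split => // A mA; rewrite mul1e.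
have := leb_linear_haar mT TS TD mA (eball_measurable 1).
have -> : T @^-1` eball 1 = eball 1 by apply/seteqP; split => x; rewrite /preimage /eball/= Tn.
have -> : -%R @^-1` eball 1 = eball 1 by apply/seteqP; split => x; rewrite /preimage /eball/= enormN.
have := eball_finite 1; have := @eball_gt0 1 ltr01.
case: (leb (eball 1)) => // r; rewrite lte_fin => r0 _.
move=> /(congr1 (fun z : \bar R => z * (r^-1)%:E)%E).
by rewrite -!muleA -!EFinM divff ?gt_eqF// !mule1.
Qed.

(** For a unit vector [e], the orthogonal reflection across the hyperplane normal to [e]. *)
Definition refl e x : E := x - (2 * dotv x e) *: e.

Lemma reflD e x y : refl e (x + y) = refl e x + refl e y.
Proof. by rewrite /refl dotvDl mulrDr scalerDl opprD addrACA. Qed.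

Lemma reflZ e (a : R) x : refl e (a *: x) = a *: refl e x.
Proof. by rewrite /refl dotvZl scalerBr scalerA; congr (_ - _ *: _); ring. Qed.

Lemma reflK e : dotv e e = 1 -> involutive (refl e).
Proof.
move=> e1 x; rewrite /refl dotvBl dotvZl e1 -addrA -opprD -scalerDl.
set s := (X in X *: e); have -> : s = 0 by rewrite /s; ring.
by rewrite scale0r subr0.
Qed.

Lemma dotv_refl e x y : dotv e e = 1 -> dotv (refl e x) (refl e y) = dotv x y.
Proof.
move=> e1; rewrite /refl !dotvBl !dotvBr !dotvZl !dotvZr e1 (dotvC e y); ring.
Qed.

Lemma enorm_refl e x : dotv e e = 1 -> enorm (refl e x) = enorm x.
Proof. by move=> e1; rewrite /enorm dotv_refl. Qed.

Lemma measurable_refl e : measurable_fun setT (refl e).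
Proof.
apply: measurable_addv; first exact: measurable_id.
apply: (measurableT_comp measurable_oppv); apply: measurable_fun_rV => i.
apply: (eq_measurable_fun (fun x : E => 2 * dotv x e * e ord0 i)) => [x _|]; first by rewrite mxE.
apply: measurable_funM; last exact: measurable_cst.
by apply: measurable_funM; [exact: measurable_cst|exact: measurable_dotv].
Qed.

Lemma mpres_refl e : dotv e e = 1 -> mpres 1 (refl e).
Proof.
move=> e1; apply: (@mpres_isometry _ (refl e)); first exact: measurable_refl.
- exact: reflK.
- exact: reflD.
- by move=> x; exact: enorm_refl.
Qed.

Lemma mpres_opp : mpres 1 (fun x => - x).
Proof.
apply: (@mpres_isometry _ (fun x => - x)); first exact: measurable_oppv.
- exact: opprK.
- exact: opprD.
- exact: enormN.
Qed.

Lemma mpres_comp a b T S : mpres a T -> mpres b S -> mpres (a * b) (S \o T).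
Proof.
move=> [a0 mT hT] [b0 mS hS]; split; [exact: mulr_ge0|exact: measurableT_comp|].
move=> A mA; rewrite comp_preimage hT ?hS//; first by rewrite muleA EFinM.
by rewrite -[X in measurable X]setTI; exact: mS.
Qed.

Lemma mpres_ge0_int c T (F : E -> \bar R) : mpres c T -> measurable_fun setT F ->
  (forall x, 0 <= F x)%E -> (\int[leb]_x F (T x) = c%:E * \int[leb]_x F x)%E.
Proof.
move=> [c0 mT hT] mF F0.
pose f : {mfun E >-> E} := HB.pack T (isMeasurableFun.Build _ _ _ _ _ mT).
have -> : (\int[leb]_x F (T x) = \int[pushforward leb f]_x F x)%E.
  by rewrite (ge0_integral_pushforward mT)//= => x _.
rewrite (eq_measure_integral (mscale (NngNum c0) leb)); first by rewrite ge0_integral_mscale.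
by move=> A mA _; exact: hT.
Qed.

Lemma mpres_meas c T f : mpres c T -> measurable_fun setT f -> measurable_fun setT (f \o T).
Proof. by move=> [_ mT _] mf; exact: measurableT_comp. Qed.

Lemma mpres_itg c T f : mpres c T -> itg f -> itg (f \o T).
Proof.
move=> pT fi; have mf := itg_meas fi; apply/integrableP; split.
  by apply/measurable_EFinP; exact: mpres_meas pT mf.
rewrite /= (mpres_ge0_int (F := fun x => `|f x|%:E) pT)//.
  have /integrableP[_ h] := fi; apply: lte_mul_pinfty => //; case: pT => //.
by apply/measurable_EFinP; apply: measurableT_comp.
Qed.

Lemma mpres_int c T f : mpres c T -> itg f -> \int[leb]_x f (T x) = c * \int[leb]_x f x.
Proof.
move=> pT fi.
have H g : itg g -> (forall x, 0 <= g x) -> \int[leb]_x g (T x) = c * \int[leb]_x g x.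
  move=> gi g0; have mg := itg_meas gi.
  rewrite {1}/Rintegral (mpres_ge0_int (F := fun x => (g x)%:E) pT)//; last first.
    exact/measurable_EFinP.
  by rewrite int_fin// -EFinM.
have ai := itg_abs fi.
pose g := (fun x => `|f x|) + f.
have gi : itg g by exact: itgD.
have g0 x : 0 <= g x by rewrite /g fE; have := ler_norm (- f x); rewrite normrN; lra.
have E1 : \int[leb]_x f (T x) = \int[leb]_x (g (T x)) - \int[leb]_x `|f (T x)|.
  rewrite -intB; [|exact: mpres_itg pT gi|exact: mpres_itg pT ai].
  by apply: eq_Rintegral => x _; rewrite /g fE addrAC subrr add0r.
rewrite E1 H// (H (fun x => `|f x|))// -mulrBr -intB//; congr (_ * _).
by apply: eq_Rintegral => x _; rewrite /g fE addrAC subrr add0r.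
Qed.

Lemma mpres_ae c T (P : E -> Prop) : mpres c T -> {ae leb, forall x, P x} ->
  {ae leb, forall x, P (T x)}.
Proof.
move=> [c0 mT hT] [A [mA A0 PA]]; exists (T @^-1` A); split.
- by rewrite -[X in measurable X]setTI; exact: mT.
- by rewrite hT// A0 mule0.
- by move=> x /= nP; apply: PA.
Qed.

Lemma mpres_L2 c T f : mpres c T -> L2 f -> L2 (f \o T).
Proof. by move=> pT [mf hf]; split; [exact: mpres_meas pT mf|exact: mpres_itg pT hf]. Qed.

Lemma mpres_dot c T f g : mpres c T -> L2 f -> L2 g -> dot (f \o T) (g \o T) = c * dot f g.
Proof. by move=> pT hf hg; exact: (mpres_int pT (itg_mul hf hg)). Qed.

Lemma mpres_nsq c T f : mpres c T -> L2 f -> nsq (f \o T) = c * nsq f.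
Proof. by move=> pT hf; exact: (mpres_int pT hf.2). Qed.

End change_of_variables.

(** * Measurability of continuous functions *)

Section continuous_measurable.
Context {R : realType} {N : nat}.
Local Notation E := 'rV[R]_N.

(** The sigma-algebra is generated by the coordinates, hence the passage through the countably many
    rational boxes contained in [U]. *)
Lemma open_measurable_rV (U : set E) : open U -> measurable U.
Proof.
move=> oU.
pose q (z : 'rV[rat]_N * nat) : E := \row_i ratr (z.1 ord0 i).
pose B (z : 'rV[rat]_N * nat) : set E := 
  box (fun i => ball (ratr (z.1 ord0 i) : R) (z.2.+1%:R^-1)).
have mB z : measurable (B z) by apply: box_measurable => i; exact: measurable_ball.
pose F z := if `[< B z `<=` U >] then B z else set0.
have -> : U = \bigcup_z F z.
  apply/seteqP; split; last first.
    by move=> x [z _]; rewrite /F; case: asboolP => // h; exact: h.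
  move=> x Ux; have /nbhs_ballP[e /= e0 he] : nbhs x U by exact: open_nbhs_nbhs.
  have [n hn] : exists n : nat, 2 * n.+1%:R^-1 < e.
    have /cvgr0Pnorm_lt/(_ _ (divr_gt0 e0 (ltr0Sn R 1)))[n _ h] := @inv_succ_cvg0 R.
    exists n; have := h n (leqnn n); rewrite ger0_norm ?invr_ge0//.
    by rewrite ltr_pdivlMr// mulrC.
  have /choice[r hr] : forall i : 'I_N, exists r : rat, `|ratr r - x ord0 i| < n.+1%:R^-1.
    move=> i; have [r] := @rat_in_itvoo R (x ord0 i - n.+1%:R^-1) (x ord0 i + n.+1%:R^-1)
      ltac:(by rewrite ltrD2l gtrN ?invr_gt0).
    by rewrite in_itv/= => h; exists r; rewrite ltr_distl.
  exists (\row_i r i, n) => //; rewrite /F.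
  have Bx : B (\row_i r i, n) x by move=> i; rewrite /ball/= mxE.
  case: asboolP => // [[]] y hy; apply: he; split => // i j; rewrite ord1 /ball/=.
  have := hy j; rewrite /ball/= mxE => h1.
  have -> : x ord0 j - y ord0 j = - (ratr (r j) - x ord0 j) + (ratr (r j) - y ord0 j) by ring.
  rewrite (le_lt_trans (ler_normD _ _))// normrN (lt_trans _ hn)// mulr_natl mulr2n.
  by apply: ltrD => //; exact: hr.
apply: countable_bigcupT_measurable; first exact: countableP.
by move=> z; rewrite /F; case: ifP.
Qed.

Lemma continuous_measurable (f : E -> R) : continuous f -> measurable_fun setT f.
Proof.
move=> cf; apply: (measurability _ (RGenOInfty.measurableE R)).
move=> _ [_ [a ->] <-]; rewrite setTI; apply: open_measurable_rV.
by move/continuousP : cf; apply; exact: rray_open.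
Qed.

End continuous_measurable.

(** * Test functions *)

Section real_line.
Variable R : realType.
Implicit Types (f g : R -> R) (x y : R).

Lemma is_derive_cvg f x l :
  (h^-1 * (f (h + x) - f x)) @[h --> 0^'] --> l -> is_derive x 1 f l.
Proof.
move=> H; have H' : (h^-1 *: ((f \o shift x) (h *: 1) - f x)) @[h --> (0:R)^'] --> l.
  by move: H; apply: cvg_trans; under eq_fun do rewrite /= /GRing.scale/= mulr1.
by apply: DeriveDef; [apply/cvg_ex; exists l|exact: cvg_lim H'].
Qed.

Lemma cvg_is_derive f x l : is_derive x 1 f l ->
  (h^-1 * (f (h + x) - f x)) @[h --> 0^'] --> l.
Proof.
move=> [H <-]; rewrite /derive; move: H => /cvg_ex[k hk]; rewrite (cvg_lim _ hk)//.
have <- : (fun h => h^-1 *: ((f \o shift x) (h *: 1) - f x)) = (fun h => h^-1 * (f (h + x) - f x)).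
  by apply/funext => h; rewrite /= /GRing.scale/= mulr1.
exact: hk.
Qed.

Lemma is_derive_continuous f x l : is_derive x 1 f l -> {for x, continuous f}.
Proof. by move=> [H _]; apply/differentiable_continuous/derivable1_diffP. Qed.

Lemma lipschitz_derive f df C : (forall x, is_derive x 1 f (df x)) ->
  (forall x, `|df x| <= C) -> forall x y, `|f x - f y| <= C * `|x - y|.
Proof.
move=> hf hC.
have H x y : x < y -> `|f y - f x| <= C * `|y - x|.
  move=> xy; have [|c _ ->] := @MVT R f df x y xy (fun z _ => hf z).
    apply: derivable_within_continuous => z _; by case: (hf z).
  by rewrite normrM ler_wpM2r.
move=> x y; have [xy|yx|->] := ltgtP x y; last by rewrite !subrr normr0 mulr0.
  by rewrite distrC (distrC x); exact: H.
exact: H.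
Qed.

(* The functions P(1/x) exp(-c/x) on x > 0, extended by 0: a family closed under
   differentiation. *)
Definition flat (c : R) (P : {poly R}) x :=
  if 0 < x then P.[x^-1] * expR (- (c / x)) else 0.

(** The derivative of P(1/x) exp(-c/x) is x^-2 (c P - P')(1/x) exp(-c/x), and x^-2 is the value of
    the monomial of degree 2 at 1/x. *)
Definition flatD (c : R) (P : {poly R}) : {poly R} := 'X^2 * (c *: P - P^`()).

Lemma poly_bound (P : {poly R}) : exists2 K : R, 0 <= K &
  forall y, 1 <= y -> `|P.[y]| <= K * y ^+ size P.
Proof.
exists (\sum_(i < size P) `|P`_i|); first exact: sumr_ge0.
move=> y y1; rewrite horner_coef mulr_suml; apply: (le_trans (ler_norm_sum _ _ _)).
apply: ler_sum => i _; rewrite normrM ler_wpM2l// normrX ger0_norm; last lra.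
by rewrite ler_weXn2l// ltnW.
Qed.

(** One term of the exponential series, of order [n.+2] with [n = size P], beats the growth of [P]
    and leaves a factor [h ^+ 2]; this makes the difference quotient at 0 vanish in the limit. *)
Lemma flat_small c P : 0 < c -> exists2 K : R, 0 <= K &
  forall h, 0 < h <= 1 -> `|flat c P h| <= K * h ^+ 2.
Proof.
move=> c0; have [K K0 hK] := poly_bound P; set n := size P in hK.
exists (K * (n.+2`!%:R / c ^+ n.+2)); first by rewrite mulr_ge0// divr_ge0// exprn_ge0// ltW.
move=> h /andP[h0 h1]; rewrite /flat h0 normrM (ger0_norm (expR_ge0 _)).
have hi : 1 <= h^-1 by rewrite invf_ge1.
have e1 : c ^+ n.+2 / h ^+ n.+2 / n.+2`!%:R <= expR (c / h).
  have ch : 0 <= c / h by rewrite divr_ge0// ltW.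
  by have := expR_ge1Dxn n.+1 ch; rewrite expr_div_n; lra.
have e2 : expR (- (c / h)) <= n.+2`!%:R / c ^+ n.+2 * h ^+ n.+2.
  have -> : n.+2`!%:R / c ^+ n.+2 * h ^+ n.+2 = (c ^+ n.+2 / h ^+ n.+2 / n.+2`!%:R)^-1.
    by field; rewrite !gt_eqF ?exprn_gt0// ltr0n fact_gt0.
  rewrite expRN lef_pV2// posrE ?expR_gt0//.
  by rewrite !divr_gt0 ?exprn_gt0// ltr0n fact_gt0.
apply: (le_trans (ler_pM _ _ (hK _ hi) e2)); rewrite ?expR_ge0//.
have -> : K * h^-1 ^+ n * (n.+2`!%:R / c ^+ n.+2 * h ^+ n.+2) = K * (n.+2`!%:R / c ^+ n.+2) * h ^+ 2.
  have -> : h ^+ n.+2 = h ^+ n * h ^+ 2 by rewrite -exprD addn2.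
  by set F := _ / _; rewrite exprVn; field; rewrite !gt_eqF ?exprn_gt0.
exact: lexx.
Qed.

Lemma flat_derive c P x : 0 < c -> is_derive x 1 (flat c P) (flat c (flatD c P) x).
Proof.
move=> c0; have [x0|x0|->] := ltgtP x 0.
- rewrite {2}/flat ltNge (ltW x0)/=.
  have D0 : is_derive x 1 (cst 0 : R -> R) 0 by exact: is_derive_cst.
  apply: (near_eq_is_derive _ D0).
  near=> y; rewrite /flat ltNge ifF//; apply/negbTE; rewrite negbK ltW//.
  by near: y; exact: lt_nbhsl.
- rewrite {2}/flat x0.
  have xn0 : x != 0 by rewrite gt_eqF.
  have dV : is_derive x 1 (fun y : R => y^-1) (- x ^- 2).
    have H := @is_deriveV R id x 1 1 xn0 (is_derive_id x 1).
    by apply: (is_derive_eq H); rewrite /GRing.scale/= mulr1.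
  have dP : is_derive x 1 (fun y => P.[y^-1]) (P^`().[x^-1] * - x ^- 2).
    by apply: (@is_derive1_comp _ (horner P) (fun y => y^-1)).
  have dE : is_derive x 1 (fun y => expR (- (c * y^-1))) (expR (- (c * x^-1)) * (- (c * - x ^- 2))).
    by apply: (@is_derive1_comp _ expR (fun y => - (c * y^-1))).
  have H := is_deriveM dP dE.
  apply: (@near_eq_is_derive _ _ _ ((fun y => P.[y^-1]) * (fun y => expR (- (c * y^-1))))).
    near=> y; rewrite /flat ifT//; near: y; exact: lt_nbhsr.
  apply: (is_derive_eq H); rewrite /GRing.scale/=.
  rewrite /flatD hornerM hornerXn hornerD hornerN hornerZ.
  by move: (expR _) (P^`().[_]) P.[_] => e p' p; field; rewrite gt_eqF.
rewrite {2}/flat ltxx.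
have [K K0 hK] := flat_small P c0.
apply: is_derive_cvg; apply: (@squeeze0 _ _ _ _ _ (fun h => K * `|h|)); last first.
  have c1 : `|h| @[h --> (0 : R)^'] --> (0 : R).
    apply/cvgr0Pnorm_lt => e e0; near=> h; rewrite normr_id; near: h.
    exact: dnbhs0_lt.
  have c2 := @cvgMl_tmp R R (0:R)^' _ _ K _ c1; rewrite mulr0 in c2; exact: c2.
near=> h; rewrite addr0 (_ : flat c P 0 = 0) ?subr0; last by rewrite /flat ltxx.
have hn0 : h != 0 by near: h; exact: nbhs_dnbhs_neq.
have [h0|h0] := ltP 0 h; last by rewrite /flat ltNge h0/= mulr0 normr0 mulr_ge0.
rewrite normrM normfV ler_pdivrMl ?normr_gt0//.
have := hK h; rewrite h0/= => /(_ _)/le_trans; apply.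
  by apply: ltW; near: h; apply: nbhs_dnbhs; exact: lt_nbhsl.
by rewrite gtr0_norm// expr2 mulrCA.
Unshelve. all: by end_near. Qed.

(* A family of smooth functions supported in [a, b], closed under differentiation. *)
Definition bumps := seq ({poly R} * {poly R}).
Definition bump1 (c a b : R) (s : bumps) x :=
  \sum_(PQ <- s) flat c PQ.1 (x - a) * flat c PQ.2 (b - x).
Definition bump1D (c : R) (s : bumps) : bumps :=
  flatten [seq [:: (flatD c PQ.1, PQ.2); (PQ.1, - flatD c PQ.2)] | PQ <- s].

Lemma bump1_derive c a b s x : 0 < c ->
  is_derive x 1 (bump1 c a b s) (bump1 c a b (bump1D c s) x).
Proof.
move=> c0; elim: s => [|[P Q] s IH].
  rewrite /bump1 big_nil (_ : (fun _ => _) = cst 0); last by apply/funext => y; rewrite big_nil.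
  exact: is_derive_cst.
have flatN y : flat c (- flatD c Q) y = - flat c (flatD c Q) y.
  by rewrite /flat; case: ifP; rewrite ?oppr0// hornerN mulNr.
have -> : bump1 c a b ((P, Q) :: s) =
   (fun y => flat c P (y - a)) * (fun y => flat c Q (b - y)) + bump1 c a b s.
  by apply/funext => y; rewrite /bump1 big_cons.
rewrite /bump1 /bump1D/= !big_cons/= -/(bump1D c s) -/(bump1 c a b (bump1D c s) x).
rewrite flatN addrA; apply: is_deriveD => //.
have d1 : is_derive x 1 (fun y => flat c P (y - a)) (flat c (flatD c P) (x - a) * 1).
  apply: (@is_derive1_comp _ (flat c P) (fun y => y - a)); first exact: flat_derive.
  by apply: is_derive_eq; rewrite subr0.
have d2 : is_derive x 1 (fun y => flat c Q (b - y)) (flat c (flatD c Q) (b - x) * -1).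
  apply: (@is_derive1_comp _ (flat c Q) (fun y => b - y)); first exact: flat_derive.
  by have := is_deriveB (is_derive_cst b x 1) (is_derive_id x 1); rewrite sub0r.
by have := is_deriveM d1 d2; rewrite /GRing.scale/= => H; apply: (is_derive_eq H); ring.
Qed.

Lemma bump1_supp c a b s x : ~~ (a < x < b) -> bump1 c a b s x = 0.
Proof.
move=> h; rewrite /bump1 big1// => PQ _; rewrite /flat !subr_gt0.
by move: h; case: ifP => //= _; rewrite ?mul0r//; case: ifP; rewrite ?mulr0.
Qed.

(** The parameter [c = n.+1%:R^-1] tends to 0, so the exponentials tend to 1 inside the interval and
    the bumps tend pointwise to the indicator of []a, b[]. *)
Definition bump0 (n : nat) (a b x : R) := bump1 n.+1%:R^-1 a b [:: (1, 1)] x.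

Lemma bump0_bound n a b x : 0 <= bump0 n a b x <= 1.
Proof.
have H (y : R) : 0 <= flat n.+1%:R^-1 1 y <= 1.
  rewrite /flat; case: ifP => y0; last by rewrite lexx ler01.
  by rewrite hornerC mul1r expR_ge0 expR_le1 oppr_le0 divr_ge0 ?invr_ge0// ltW.
rewrite /bump0 /bump1 big_seq1/=; have /andP[h1 h2] := H (x - a); have /andP[h3 h4] := H (b - x).
by rewrite mulr_ge0//= -[leRHS](mulr1 1) ler_pM.
Qed.

Lemma bump0_cvg a b x : bump0 n a b x @[n --> \oo] --> ((a < x < b)%R%:R : R).
Proof.
have H (y : R) : flat n.+1%:R^-1 1 y @[n --> \oo] --> ((0 < y)%R%:R : R).
  rewrite /flat; case: (0 < y); last exact: cvg_cst.
  under eq_fun do rewrite hornerC mul1r.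
  rewrite (_ : true%:R = expR (0 : R)); last by rewrite expR0.
  have y0 : - (n.+1%:R^-1 / y) @[n --> \oo] --> (0 : R).
    by rewrite -oppr0 -(mul0r y^-1); apply: cvgN; apply: cvgMr_tmp; exact: inv_succ_cvg0.
  exact: (cvg_comp _ _ y0 (@continuous_expR R 0)).
have -> : (a < x < b)%R%:R = (0 < x - a)%R%:R * (0 < b - x)%R%:R :> R.
  by rewrite !subr_gt0 -natrM mulnb.
rewrite /bump0 /bump1; under eq_fun do rewrite big_seq1/=.
by apply: cvgM; exact: H.
Qed.

End real_line.

(** * Calculus and density of test functions *)

Section test_functions.
Context {R : realType} {N : nat}.
Local Notation E := 'rV[R]_N.
Local Notation leb := (@lebesgue_rV R N).
Local Notation itg := (itg leb).
Local Notation L2 := (L2 leb).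
Local Notation dot := (l2dot leb).
Local Notation nsq := (l2sq leb).
Implicit Types (f g u v phi psi : E -> R) (x y z : E) (i j : 'I_N).

Definition ei i : E := delta_mx ord0 i.
Definition sh y f : E -> R := fun x => f (x + y).

Lemma derivable_cvg f x y (l : R) :
  (h^-1 * (f (h *: y + x) - f x)) @[h --> 0^'] --> l -> derivable f x y /\ 'D_y f x = l.
Proof. by move=> H; split; [apply/cvg_ex; exists l|exact: cvg_lim H]. Qed.

Lemma derivable_cvgE f x y : derivable f x y ->
  (h^-1 * (f (h *: y + x) - f x)) @[h --> 0^'] --> 'D_y f x.
Proof. by move=> /cvg_ex[l hl]; rewrite /derive (cvg_lim _ hl). Qed.

Lemma derive_line f x y (r : R) : derivable f (x + r *: y) y ->
  is_derive r 1 (fun s => f (x + s *: y)) ('D_y f (x + r *: y)).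
Proof.
move=> /derivable_cvgE H; apply: is_derive_cvg; move: H; apply: cvg_trans.
have <- : (fun h => h^-1 * (f (h *: y + (x + r *: y)) - f (x + r *: y))) =
  (fun h => h^-1 * (f (x + (h + r) *: y) - f (x + r *: y))).
  by apply/funext => h; rewrite scalerDl addrCA.
by [].
Qed.

Lemma coord_le_norm x i : `|x ord0 i| <= `|x|.
Proof.
rewrite [`|x|]mx_normrE.
exact: (le_bigmax _ (fun ij : 'I_1 * 'I_N => `|x ij.1 ij.2|) (ord0, i)).
Qed.

Lemma cube_compact (r : R) : compact (cube r : set E).
Proof. by apply: rV_compact => i; exact: segment_compact. Qed.

Lemma cube_closed (r : R) : closed (cube r : set E).
Proof. by apply: compact_closed; [exact: norm_hausdorff|exact: cube_compact]. Qed.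

Lemma test_functionP phi : test_function phi <->
  smooth phi /\ exists r, forall x, ~ cube r x -> phi x = 0.
Proof.
split=> [[sm cp]|[sm [r hr]]]; split=> //.
  have [M [_ hM]] := compact_bounded cp.
  exists (M + 1) => x nx; apply/eqP/negPn/negP => px; apply: nx; apply/cubeP => i.
  apply: (le_trans (coord_le_norm x i)); apply: hM; first by rewrite ltrDl.
  by apply: subset_closure.
apply: (@subclosed_compact _ _ (cube r)); [exact: closed_closure|exact: cube_compact|].
rewrite (closure_id (cube r)).1; last exact: cube_closed.
apply: closure_subset => x /eqP px; apply: contrapT => nx; exact/px/hr.
Qed.

Lemma smooth_foldr phi s : smooth phi -> smooth (foldr partial phi s).
Proof. by move=> sm t; rewrite -foldr_cat; exact: sm. Qed.

Lemma test_partial phi i : test_function phi -> test_function (partial i phi).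
Proof.
move=> /test_functionP[sm [r hr]]; apply/test_functionP; split.
  exact: (@smooth_foldr phi [:: i]).
exists r => x nx; rewrite /partial.
rewrite (@near_eq_derive _ _ _ phi (cst 0)).
  by rewrite derive_cst.
have : nbhs x (~` cube r) by apply: open_nbhs_nbhs; split => //; exact/closed_openC/cube_closed.
by apply: filterS => y; exact: hr.
Qed.

Lemma smooth_cont phi : smooth phi -> continuous phi.
Proof. by move=> sm; case: (sm [::]). Qed.

Lemma smooth_derivable phi i x : smooth phi -> derivable phi x (ei i).
Proof. by move=> sm; case: (sm [::]) => _; exact. Qed.

Lemma smooth_lin (a : R) phi psi : smooth phi -> smooth psi -> smooth (a *: phi + psi).
Proof.
move=> sp sq s.
have -> : foldr partial (a *: phi + psi) s = a *: foldr partial phi s + foldr partial psi s.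
  elim: s => //= i s ->; apply/funext => x; rewrite /partial.
  have [[_ d1] [_ d2]] := (sp s, sq s).
  rewrite deriveD; [|exact: derivableZ|exact: d2].
  by rewrite deriveZ//; exact: d1.
have [[c1 d1] [c2 d2]] := (sp s, sq s); split => [|i x].
  by move=> x; exact: (cvgD (cvgMl_tmp (a := a) (c1 x)) (c2 x)).
by apply: derivableD; [apply: derivableZ; exact: d1|exact: d2].
Qed.

Lemma test_lin (a : R) phi psi : test_function phi -> test_function psi ->
  test_function (a *: phi + psi).
Proof.
move=> /test_functionP[sp [r hr]] /test_functionP[sq [r' hr']]; apply/test_functionP.
split; first exact: smooth_lin.
exists (Num.max r r') => x nx; rewrite !fE hr ?hr' ?mulr0 ?addr0// => /cubeP cx;
  by apply: nx; apply/cubeP => i; rewrite le_max cx ?orbT.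
Qed.

Lemma partial_sh y phi i : partial i (sh y phi) = sh y (partial i phi).
Proof.
apply/funext => x; rewrite /partial /sh /derive; congr lim.
by apply: (congr1 (fun F : R -> R => F @ 0^')); apply/funext => h; rewrite /= addrA.
Qed.

Lemma smooth_sh y phi : smooth phi -> smooth (sh y phi).
Proof.
move=> sm s; have -> : foldr partial (sh y phi) s = sh y (foldr partial phi s).
  by elim: s => //= i s ->; rewrite partial_sh.
have [c1 d1] := sm s; split => [|i x].
  move=> x; apply: (@continuous_comp _ _ _ (fun x => x + y)); last exact: c1.
  by apply: continuousD; [exact: cvg_id|exact: cst_continuous].
suff [] : derivable (sh y (foldr partial phi s)) x (ei i) /\
  'D_(ei i) (sh y (foldr partial phi s)) x = 'D_(ei i) (foldr partial phi s) (x + y) by [].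
apply: derivable_cvg; have H := derivable_cvgE (d1 i (x + y)).
by apply: (cvg_eqr _ _ H) => h; rewrite /sh addrA.
Qed.

Lemma test_sh y phi : test_function phi -> test_function (sh y phi).
Proof.
move=> /test_functionP[sp [r hr]]; apply/test_functionP; split; first exact: smooth_sh.
exists (r + \sum_i `|y ord0 i|) => x nx; apply: hr => /cubeP cx; apply: nx; apply/cubeP => i.
have -> : x ord0 i = (x + y) ord0 i - y ord0 i by rewrite mxE addrK.
rewrite (le_trans (ler_normB _ _))// lerD//.
by rewrite (bigD1 i)//= lerDl sumr_ge0.
Qed.

Lemma cubeS (r r' : R) : r <= r' -> cube r `<=` (cube r' : set E).
Proof. by move=> rr x /cubeP h; apply/cubeP => i; exact: le_trans (h i) rr. Qed.

Lemma itg_indic_cube (r : R) : itg (\1_(cube r) : E -> R).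
Proof.
apply/integrableP; split.
  by apply/measurable_EFinP; apply: measurable_indic; exact: cube_measurable.
under eq_integral do rewrite /= ger0_norm//.
rewrite integral_indic ?setIT; [|by []|exact: cube_measurable].
apply: (@le_lt_trans _ _ (leb (cube `|r|))); last by rewrite leb_cube// ltry.
by apply: le_measure; rewrite ?inE; [exact: cube_measurable..|apply: cubeS; exact: ler_norm].
Qed.

Lemma L2_indic_cube (r : R) : L2 (\1_(cube r) : E -> R).
Proof.
split; first by apply: measurable_indic; exact: cube_measurable.
rewrite (_ : (fun _ => _) = \1_(cube r)); first exact: itg_indic_cube.
by apply/funext => x; rewrite indicE; case: (x \in _); rewrite ?expr1n ?expr0n.
Qed.

Lemma bounded_supp_L2 f (C r : R) : measurable_fun setT f -> (forall x, `|f x| <= C) ->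
  (forall x, ~ cube r x -> f x = 0) -> L2 f.
Proof.
move=> mf fC fr; apply: (L2_le mf _ (L2Z C (L2_indic_cube r))) => x.
rewrite fE indicE; case: (pselect (cube r x)) => h.
  by rewrite mem_set// mulr1 (le_trans (fC x))// ler_norm.
by rewrite fr// normr0.
Qed.

Lemma test_bounded phi : test_function phi -> exists C, forall x, `|phi x| <= C.
Proof.
move=> /test_functionP[sp [r hr]].
have cp : compact [set phi x | x in cube r].
  by apply: continuous_compact; [apply: continuous_subspaceT; exact: smooth_cont|exact: cube_compact].
have [M [_ hM]] := compact_bounded cp; exists (`|M| + 1) => x.
case: (pselect (cube r x)) => h; last by rewrite hr// normr0 addr_ge0.
by apply: (hM (`|M| + 1)); [rewrite ltr_pwDr// ler_norm|exists x].
Qed.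

Lemma test_meas phi : test_function phi -> measurable_fun setT phi.
Proof. by move=> [sp _]; apply: continuous_measurable; exact: smooth_cont. Qed.

Lemma test_L2 phi : test_function phi -> L2 phi.
Proof.
move=> tp; have [C hC] := test_bounded tp; have /test_functionP[_ [r hr]] := tp.
exact: bounded_supp_L2 (test_meas tp) hC hr.
Qed.

Lemma test_lipschitz phi i : test_function phi ->
  exists C, forall x (h : R), `|phi (x + h *: ei i) - phi x| <= C * `|h|.
Proof.
move=> tp; have [C hC] := test_bounded (test_partial i tp); exists C => x h.
have := @lipschitz_derive R (fun s => phi (x + s *: ei i)) (fun s => partial i phi (x + s *: ei i)) C.
move=> /(_ _ _ h 0); rewrite scale0r addr0 subr0; apply => //.
by move=> s; apply: derive_line; apply: smooth_derivable; case: tp.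
Qed.

Lemma test_dq_pt phi i x (h : nat -> R) : test_function phi -> (forall n, h n != 0) ->
  h n @[n --> \oo] --> 0 ->
  ((h n)^-1 * (phi (x + h n *: ei i) - phi x)) @[n --> \oo] --> partial i phi x.
Proof.
move=> [sp _] hn h0; have := derivable_cvgE (@smooth_derivable _ i x sp).
move/cvgr_dnbhsP => /(_ h (conj hn h0)) H.
by apply: (cvg_eqr _ _ H) => n; rewrite (addrC x).
Qed.

(** Dominated convergence: the quotients are bounded by a Lipschitz constant, and for steps of size
    at most 1 they vanish outside a common cube. *)
Lemma test_dq_cvg phi i (h : nat -> R) : test_function phi -> (forall n, h n != 0) ->
  h n @[n --> \oo] --> 0 -> (forall n, `|h n| <= 1) ->
  nsq ((h n)^-1 *: (sh (h n *: ei i) phi - phi) - partial i phi) @[n --> \oo] --> 0.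
Proof.
move=> tp hn h0 h1; have tpi := test_partial i tp.
have [C hC] := test_lipschitz i tp; have [C' hC'] := test_bounded tpi.
have /test_functionP[_ [r hr]] := tp; have /test_functionP[_ [r' hr']] := tpi.
pose F n x := ((h n)^-1 *: (sh (h n *: ei i) phi - phi) - partial i phi) x ^+ 2.
have C0 : 0 <= C by have := hC 0 1; rewrite normr1 mulr1; apply: le_trans.
have C'0 : 0 <= C' by have := hC' 0; apply: le_trans.
have mF n : measurable_fun setT (F n).
  apply: measurable_funX; apply: measurable_funB; last exact: test_meas.
  apply: measurable_funM; first exact: measurable_cst.
  apply: measurable_funB; last exact: test_meas.
  by apply: test_meas; exact: test_sh.
pose s := Num.max (`|r| + 1) r'.
have Fz n x : `|F n x| <= ((C + C') ^+ 2 *: \1_(cube s)) x.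
  rewrite /F !fE indicE; case: (pselect (cube s x)) => cx.
    rewrite mem_set// mulr1 normrX lerXn2r ?nnegrE ?addr_ge0//.
    rewrite (le_trans (ler_normB _ _))// lerD// normrM normfV.
    by rewrite ler_pdivrMl ?normr_gt0// mulrC; exact: hC.
  have ncr t : t <= s -> ~ cube t x by move=> ts /(cubeS ts).
  rewrite (hr' x) ?subr0; last by apply: ncr; rewrite le_max lexx orbT.
  rewrite (hr x) ?subr0; last by apply: ncr; rewrite le_max (le_trans (ler_norm r)) ?lerDl.
  rewrite /sh hr ?mulr0 ?expr0n ?normr0 ?mulr_ge0 ?sqr_ge0 ?addr_ge0//= => /cubeP cr.
  apply: (ncr (`|r| + 1)); first by rewrite le_max lexx.
  apply/cubeP => j; have -> : x ord0 j = (x + h n *: ei i) ord0 j - (h n *: ei i) ord0 j.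
    by rewrite [X in X - _]mxE addrK.
  rewrite (le_trans (ler_normB _ _))// lerD//; first by rewrite (le_trans (cr j))// ler_norm.
  rewrite !mxE eqxx/= normrM; case: (j == i); rewrite /= ?normr1 ?mulr1 ?normr0 ?mulr0 ?ler01//.
have F0 x : F n x @[n --> \oo] --> (0 : R).
  pose G n := ((h n)^-1 *: (sh (h n *: ei i) phi - phi) - partial i phi) x.
  have c : G n @[n --> \oo] --> partial i phi x - partial i phi x.
    by apply: cvgB; [exact: test_dq_pt|exact: cvg_cst].
  rewrite subrr in c.
  have H : (G n * G n) @[n --> \oo] --> (0 : R) * 0 by apply: cvgM; exact: c.
  rewrite mulr0 in H.
  by apply: (cvg_eqr _ _ H) => n; rewrite /F expr2.
have [_] := dominated_int mF F0 (itgZ ((C + C') ^+ 2) (itg_indic_cube s)) Fz.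
by rewrite int0.
Qed.

Definition bump (c : R) (a b : 'I_N -> R) (s : 'I_N -> bumps R) x :=
  \prod_i bump1 c (a i) (b i) (s i) (x ord0 i).

Lemma bump_partial c a b s j x : 0 < c ->
  let s' := fun i => if i == j then bump1D c (s i) else s i in
  derivable (bump c a b s) x (ei j) /\ partial j (bump c a b s) x = bump c a b s' x.
Proof.
move=> c0 s'; apply: derivable_cvg.
have hd := cvg_is_derive (bump1_derive (a j) (b j) (s j) (x ord0 j) c0).
pose P := \prod_(i | i != j) bump1 c (a i) (b i) (s i) (x ord0 i).
rewrite [X in _ --> X](_ : _ = bump1 c (a j) (b j) (bump1D c (s j)) (x ord0 j) * P); last first.
  rewrite /bump (bigD1 j)//= /s' eqxx; congr (_ * _); apply: eq_bigr => i ij.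
  by rewrite (negbTE ij).
apply: (cvg_eqr _ _ (cvgMr_tmp (b := P) hd)) => h.
rewrite /bump (bigD1 j)//= [X in _ = _ * (_ - X)](bigD1 j)//= -mulrA mulrBl.
rewrite !mxE !eqxx/= mulr1; congr (_ * (_ * _ - _)); apply: eq_bigr => i ij.
by rewrite !mxE (negbTE ij) mulr0 add0r.
Qed.

Lemma bump_continuous c a b s : 0 < c -> continuous (bump c a b s).
Proof.
move=> c0; apply: (@continuous_big R 'I_N *%R 1 xpredT (@mul_continuous R) E).
move=> i _ x; apply: (@continuous_comp _ _ _ (fun x : E => x ord0 i)); first exact: coord_continuous.
exact: is_derive_continuous (bump1_derive _ _ _ _ c0).
Qed.

Definition obox (a b : 'I_N -> R) : set E := box (fun i => `]a i, b i[%classic).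

Lemma obox_cube a b : obox a b `<=` cube (\sum_i (`|a i| + `|b i|)).
Proof.
move=> x h; apply/cubeP => i; have /andP[h1 h2] : a i < x ord0 i < b i.
  by have := h i; rewrite /= in_itv/=.
rewrite (bigD1 i)//= ler_norml.
have h3 : 0 <= \sum_(j | j != i) (`|a j| + `|b j|) by apply: sumr_ge0 => j _; rewrite addr_ge0.
have := ler_norm (b i); have := ler_norm (- a i); rewrite normrN.
have := normr_ge0 (a i); have := normr_ge0 (b i); move=> *; apply/andP; split; lra.
Qed.

Lemma not_oboxP a b x : ~ obox a b x -> exists i, ~~ (a i < x ord0 i < b i).
Proof.
move=> nx; apply: contrapT => h; apply: nx => i; rewrite /= in_itv/=.
by apply: contrapT => /negP k; apply: h; exists i.
Qed.

Lemma bump_supp c a b s x : ~ obox a b x -> bump c a b s x = 0.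
Proof. by move=> /not_oboxP[i hi]; rewrite /bump (bigD1 i)//= bump1_supp// mul0r. Qed.

Lemma bump_test c a b s : 0 < c -> test_function (bump c a b s).
Proof.
move=> c0; apply/test_functionP; split.
  move=> l; have [s' ->] : exists s', foldr partial (bump c a b s) l = bump c a b s'.
    elim: l => [|j l [s' IH]]; first by exists s.
    rewrite /= IH; exists (fun i => if i == j then bump1D c (s' i) else s' i).
    by apply/funext => x; exact: (bump_partial a b s' j x c0).2.
  split; first exact: bump_continuous.
  by move=> i x; exact: (bump_partial a b s' i x c0).1.
exists (\sum_i (`|a i| + `|b i|)) => x nx.
by apply: bump_supp => /obox_cube.
Qed.

Lemma bump_cvg a b x : (\prod_i bump0 n (a i) (b i) (x ord0 i)) @[n --> \oo] --> (\1_(obox a b) x : R).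
Proof.
have -> : \1_(obox a b) x = \prod_(i < N) ((a i < x ord0 i < b i)%R%:R : R).
  rewrite indicE; case: (pselect (obox a b x)) => h.
    rewrite mem_set// big1// => i _; have := h i; rewrite /= in_itv/= => -> //.
  rewrite memNset//; have [i hi] := not_oboxP h.
  by rewrite (bigD1 i)//= (negbTE hi) mul0r.
apply: (@cvg_big R 'I_N *%R 1 xpredT (@mul_continuous R)) => i _.
exact: bump0_cvg.
Qed.

Lemma obox_measurable a b : measurable (obox a b).
Proof. by apply: box_measurable => i; exact: measurable_itv. Qed.

Definition oboxes : set (set E) := [set A | exists a b, A = obox a b].

Lemma measurable_oboxes : @measurable _ E = <<s oboxes >>.
Proof.
apply/seteqP; split; last first.
  apply: smallest_sub; first exact: sigma_algebra_measurable.
  by move=> _ [a [b ->]]; exact: obox_measurable.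
pose X : measurableType _ := g_sigma_algebraType oboxes.
have mX (i : 'I_N) : measurable_fun [set: X] (fun x : E => x ord0 i : R).
  apply: (measurability _ (RGenOInfty.measurableE R)) => _ [_ [a ->] <-]; rewrite setTI.
  have -> : (fun x : E => x ord0 i) @^-1` `]a, +oo[ =
     \bigcup_n obox (fun j => if j == i then a else - n%:R) (fun=> n%:R).
    apply/seteqP; split => x /=.
      rewrite in_itv/= andbT => ax; have : [set: E] x by [].
      rewrite -cube_cover => -[n _ /cubeP cx]; exists n.+1 => // j.
      have := cx j; rewrite ler_norml => /andP[h1 h2]; rewrite /= in_itv/=.
      rewrite (le_lt_trans h2) ?ltr_nat// andbT; case: eqP => [->//|_].
      by rewrite (lt_le_trans _ h1)// ltrN2 ltr_nat.
    by move=> [n _ /(_ i)]; rewrite /= !in_itv/= eqxx andbT => /andP[].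
  apply: bigcupT_measurable => n; apply: sub_sigma_algebra; by do 2 eexists.
apply: smallest_sub; first exact: smallest_sigma_algebra.
rewrite -bigcup_seq => _ [i /= _ [B mB <-]].
by apply: (mX i) => //; rewrite /measurable/= /measurable.
Qed.

Lemma oboxesI : setI_closed oboxes.
Proof.
move=> _ _ [a [b ->]] [a' [b' ->]].
exists (fun i => Num.max (a i) (a' i)), (fun i => Num.min (b i) (b' i)).
apply/seteqP; split => x /=.
  move=> [h1 h2] i; have := h1 i; have := h2 i; rewrite /= !in_itv/= gt_max lt_min.
  by move=> /andP[-> ->] /andP[-> ->].
move=> h; split => i; have := h i; rewrite /= !in_itv/= gt_max lt_min.
  by move=> /andP[/andP[-> _] /andP[-> _]].
by move=> /andP[/andP[_ ->] /andP[_ ->]].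
Qed.

(** Bumps with values in [[0, 1]] converge to indicators of open boxes, so the integral of [f] over
    each such box vanishes; Dynkin's argument extends this to all Borel sets, in particular to the
    set where [f] is nonnegative and to its complement. *)
Lemma test_orth0 f : L2 f -> (forall phi, test_function phi -> dot f phi = 0) ->
  {ae leb, forall x, f x = 0}.
Proof.
move=> hf H; have mf := L2_meas hf.
have Lbox a b : L2 (\1_(obox a b) : E -> R).
  apply: (@bounded_supp_L2 _ 1 (\sum_i (`|a i| + `|b i|))).
  - by apply: measurable_indic; exact: obox_measurable.
  - by move=> x; rewrite ger0_norm// indicE; case: (_ \in _).
  - by move=> x nx; rewrite indicE memNset// => /obox_cube.
have Hbox a b : \int[leb]_x (f x * \1_(obox a b) x) = 0.
  pose B n := bump n.+1%:R^-1 a b (fun=> [:: (1, 1)]).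
  have tn n : test_function (B n) by apply: bump_test; rewrite invr_gt0.
  have bnd n x : 0 <= B n x <= 1.
    rewrite /B /bump; elim/big_ind: _ => [|u v /andP[u0 u1] /andP[v0 v1]|i _].
    - by rewrite ler01 lexx.
    - by rewrite mulr_ge0//= -[leRHS](mulr1 1) ler_pM.
    - exact: bump0_bound.
  have mF n : measurable_fun setT (fun x => f x * B n x).
    by apply: measurable_funM => //; exact: test_meas.
  have cF x : (f x * B n x) @[n --> \oo] --> f x * \1_(obox a b) x.
    by apply: cvgMl_tmp; exact: bump_cvg.
  have bF n x : `|f x * B n x| <= `|(f * \1_(obox a b)) x|.
    rewrite fE !normrM ler_wpM2l// indicE; have /andP[h1 h2] := bnd n x.
    case: (pselect (obox a b x)) => h; last by rewrite /B bump_supp// normr0.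
    by rewrite mem_set// normr1 ger0_norm.
  have [_] := dominated_int mF cF (itg_abs (itg_mul hf (Lbox a b))) bF.
  have -> : (fun n => \int[leb]_x (f x * B n x)) = fun=> 0.
    by apply/funext => n; exact: H.
  by move=> c; rewrite -(cvg_lim _ c)// lim_cst.
pose O k := obox (fun=> - k%:R) (fun=> k%:R).
(* [f] is only square integrable; cut to a bounded box it becomes integrable, so that its integral
   over any Borel set makes sense. *)
pose g k := f * \1_(O k).
have ig k : itg (g k) by exact: (itg_mul hf (Lbox _ _)).
have iA (h : E -> R) A : itg h -> measurable A -> itg (h * \1_A).
  move=> ih mA; apply: (itg_le _ _ (itg_abs ih)).
    by apply: measurable_funM; [exact: itg_meas ih|exact: measurable_indic].
  move=> x; rewrite fE normrM -[leRHS]mulr1 ler_wpM2l// indicE ger0_norm//.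
  by case: (_ \in _).
have Hg k A : measurable A -> \int[leb]_x ((g k * \1_A) x) = 0.
  (* [G] is a lambda-system, and the open boxes form a generating pi-system. *)
  pose G := [set A : set E | measurable A /\ \int[leb]_x ((g k * \1_A) x) = 0].
  rewrite measurable_oboxes => mA.
  suff : G A by case.
  apply: (@lambda_system_subset _ oboxes oboxesI setT G _ _ _ _ mA) => //.
    split => //.
    - split => //; rewrite -[RHS](Hbox (fun=> - k%:R) (fun=> k%:R)).
      by apply: eq_Rintegral => x _; rewrite !fE indicT mulr1.
    - move=> C D DC [mC hC] [mD hD]; split; first exact: measurableD.
      rewrite -[RHS](subrr 0) -{1}hC -hD -intB; [|exact: iA|exact: iA].
      apply: eq_Rintegral => x _; rewrite !fE -mulrBr; congr (_ * _).
      rewrite !indicE; case: (pselect (C x)) => hCx; case: (pselect (D x)) => hDx.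
      + by rewrite (mem_set hCx) (mem_set hDx) memNset ?subrr// => -[].
      + by rewrite (mem_set hCx) (memNset hDx) mem_set ?subr0.
      + by have := DC _ hDx.
      + by rewrite (memNset hCx) (memNset hDx) memNset ?subr0// => -[].
    - move=> F ndF hF; split; first by apply: bigcupT_measurable => n; exact: (hF n).1.
      have mF n : measurable_fun setT (g k * \1_(F n)).
        by exact: itg_meas (iA _ _ (ig k) (hF n).1).
      have bF n x : `|(g k * \1_(F n)) x| <= `|g k x|.
        by rewrite fE normrM -[leRHS]mulr1 ler_wpM2l// indicE ger0_norm//; case: (_ \in _).
      have cF x : (g k * \1_(F n)) x @[n --> \oo] --> (g k * \1_(\bigcup_n F n)) x.
        apply: cvgMl_tmp; rewrite indicE; case: (pselect ((\bigcup_n F n) x)) => hx.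
          rewrite mem_set//; case: (hx) => n0 _ hn0; apply: cvg_near_cst.
          exists n0 => // n /= n0n; rewrite indicE mem_set//.
          by have /subsetPset := ndF _ _ n0n; exact.
        rewrite memNset//; apply: cvg_near_cst; apply: nearW => n.
        by rewrite indicE memNset// => hn; apply: hx; exists n.
      have [_] := dominated_int mF cF (itg_abs (ig k)) bF.
      have -> : (fun n => \int[leb]_x ((g k * \1_(F n)) x)) = fun=> 0.
        by apply/funext => n; exact: (hF n).2.
      by move=> c; rewrite -(cvg_lim _ c)// lim_cst.
  move=> _ [a [b ->]]; split; first exact: obox_measurable.
  have [a' [b' e]] : oboxes (O k `&` obox a b) by apply: oboxesI; do 2 eexists.
  rewrite -[RHS](Hbox a' b') -e; apply: eq_Rintegral => x _.
  by rewrite !fE -mulrA indicI.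
have g0 k : {ae leb, forall x, g k x = 0}.
  pose A := [set x | 0 <= g k x].
  have mA : measurable A.
    have := itg_meas (ig k) measurableT (measurable_itv `[0, +oo[).
    by rewrite setTI; congr measurable; apply/seteqP; split => x; rewrite /= in_itv/= andbT.
  have h1 : {ae leb, forall x, (g k * \1_A) x = 0}.
    apply: int_eq0; [exact: iA|move=> x|exact: Hg].
    rewrite fE indicE; case: (pselect (A x)) => hx; first by rewrite mem_set// mulr1.
    by rewrite memNset// mulr0.
  have h2 : {ae leb, forall x, (- (g k * \1_(~` A))) x = 0}.
    apply: int_eq0; [by apply: itgN; apply: iA => //; exact: measurableC|move=> x|].
      rewrite !fE indicE; case: (pselect (A x)) => hx; first by rewrite memNset ?mulr0 ?oppr0.
      rewrite mem_set// mulr1 oppr_ge0; apply: ltW; rewrite ltNge; exact/negP.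
    rewrite -[RHS](mulr0 (-1)) -(Hg k (~` A)); last exact: measurableC.
    rewrite -intZ; last by apply: iA => //; exact: measurableC.
    by apply: eq_Rintegral => x _; rewrite !fE mulN1r.
  apply: filterS2 h1 h2 => x; rewrite !fE !indicE; case: (pselect (A x)) => hx.
    by rewrite mem_set// mulr1.
  by rewrite (mem_set (A := ~` A))// mulr1 => _ /eqP; rewrite oppr_eq0 => /eqP.
have := ae_foralln g0; apply: filterS => x hx.
have : [set: E] x by [].
rewrite -cube_cover => -[n _ /cubeP cx]; have := hx n.+1.
rewrite /g fE indicE mem_set ?mulr1// => i /=; rewrite in_itv/=.
have := cx i; rewrite ler_norml => /andP[c1 c2].
by rewrite (le_lt_trans c2) ?ltr_nat// (lt_le_trans _ c1)// ltrN2 ltr_nat.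
Qed.

(** Riesz on the space of test functions represents [phi |-> dot f phi] by a limit [p] of test
    functions; [p - f] is orthogonal to all of them, so [p = f] almost everywhere by
    [test_orth0]. *)
Lemma test_dense f e : L2 f -> 0 < e -> exists2 phi, test_function phi & nsq (phi - f) <= e.
Proof.
move=> hf e0.
have t0 : test_function (0 : E -> R).
  have := @bump_test 1 (fun=> 0) (fun=> 0) (fun=> [::]) ltr01.
  by move=> t; have := test_lin (-1) t t; rewrite scaleN1r addNr.
have [|||||p [Lp hp [v vt vp]]] := @riesz _ _ _ leb (@test_function R N) (fun phi => dot f phi) (nsq f).
- exact: test_L2.
- exact: t0.
- exact: test_lin.
- by move=> a u v /test_L2 hu /test_L2 hv; rewrite dotDr ?dotZr//; exact: L2Z.
- by move=> v /test_L2 hv; exact: dot_CS.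
have pf : {ae leb, forall x, p x = f x}.
  apply: nsqB_eq0 => //; apply: nsq0_ae; first exact: L2B.
  apply: test_orth0; first exact: L2B.
  by move=> phi tp; have hphi := test_L2 tp; rewrite dotBl// hp// subrr.
move/cvgr0Pnorm_le : vp => /(_ e e0)[n _ /(_ n (leqnn n)) /=].
rewrite ger0_norm ?nsq_ge0// => h; exists (v n); first exact: vt.
rewrite (nsq_ae _ _ (g := v n - p))//; [exact: L2B (test_L2 (vt n)) hf|exact: L2B (test_L2 (vt n)) Lp|].
by apply: filterS pf => x hx; rewrite !fE hx.
Qed.

End test_functions.

(** * The space H^1 through difference quotients *)

Ltac gen_atoms := repeat match goal with
  | |- context [dirichlet ?u] => move: (dirichlet u) => ?
  | |- context [@l2dot ?a ?b ?c ?d ?u ?v] => move: (@l2dot a b c d u v) => ?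
  | |- context [@l2sq ?a ?b ?c ?d ?u] => move: (@l2sq a b c d u) => ?
  end.

Section sobolev_theory.
Context {R : realType} {N : nat}.
Local Notation E := 'rV[R]_N.
Local Notation leb := (@lebesgue_rV R N).
Local Notation L2 := (L2 leb).
Local Notation dot := (l2dot leb).
Local Notation nsq := (l2sq leb).
Implicit Types (f g u v w phi psi : E -> R) (x y z : E) (i j : 'I_N) (h : nat -> R).

Lemma shB y f g : sh y (f - g) = sh y f - sh y g. Proof. by []. Qed.
Lemma sh_sh y z f : sh y (sh z f) = sh (y + z) f.
Proof. by apply/funext => x; rewrite /sh addrA. Qed.
Lemma sh0 f : sh 0 f = f. Proof. by apply/funext => x; rewrite /sh addr0. Qed.

Lemma L2_sh y f : L2 f -> L2 (sh y f). Proof. exact: (mpres_L2 (mpres_shift y)). Qed.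
Lemma nsq_sh y f : L2 f -> nsq (sh y f) = nsq f.
Proof. by move=> hf; rewrite (mpres_nsq (mpres_shift y) hf) mul1r. Qed.
Lemma dot_sh y f g : L2 f -> L2 g -> dot (sh y f) (sh y g) = dot f g.
Proof. by move=> hf hg; rewrite (mpres_dot (mpres_shift y) hf hg) mul1r. Qed.
Lemma dot_shl y f g : L2 f -> L2 g -> dot (sh y f) g = dot f (sh (- y) g).
Proof.
by move=> hf hg; rewrite -(dot_sh (- y) (L2_sh y hf) hg) sh_sh addNr sh0.
Qed.
Definition dq (t : R) i f := t^-1 *: (sh (t *: ei i) f - f).

Lemma L2_dq t i f : L2 f -> L2 (dq t i f).
Proof. by move=> hf; apply: L2Z; apply: L2B => //; exact: L2_sh. Qed.

Lemma dot_dq t i f g : L2 f -> L2 g -> dot (dq t i f) g = - dot f (dq (- t) i g).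
Proof.
move=> hf hg; rewrite /dq dotZl ?dotZr//; [|exact: L2B (L2_sh _ hg) hg|exact: L2B (L2_sh _ hf) hf].
rewrite dotBl ?dotBr//; [|exact: L2_sh..].
by rewrite dot_shl// scaleNr invrN; ring.
Qed.

Lemma test_dq_cvg' phi i h : test_function phi -> (forall n, h n != 0) ->
  h n @[n --> \oo] --> 0 -> nsq (dq (h n) i phi - partial i phi) @[n --> \oo] --> 0.
Proof.
move=> tp hn h0; have [n0 _ hn0] := (cvgr0Pnorm_le h).1 h0 1 ltr01.
rewrite -(cvg_shiftn n0); apply: test_dq_cvg => //.
- by rewrite (cvg_shiftn n0).
- by move=> n; apply: hn0; rewrite /= leq_addl.
Qed.

Definition gr i u : E -> R := fun x => grad u x ord0 i.

Lemma H1_L2 u : H1 u -> L2 u. Proof. by case=> /L2P. Qed.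

Lemma H1_weak u : H1 u -> weak_gradient u (grad u).
Proof. by move=> [_ h]; rewrite /grad; exact: xgetPex. Qed.

Lemma gr_L2 i u : H1 u -> L2 (gr i u).
Proof. by move=> /H1_weak/(_ i)[/L2P]. Qed.

Lemma gr_test i u phi : H1 u -> test_function phi ->
  dot u (partial i phi) = - dot (gr i u) phi.
Proof. by move=> /H1_weak/(_ i)[_]; exact. Qed.

Lemma H1_intro u : L2 u -> (forall i, exists G, L2 G /\
   forall phi, test_function phi -> dot u (partial i phi) = - dot G phi) -> H1 u.
Proof.
move=> hu /choice[G hG]; split; first exact/L2P.
exists (fun x => \row_i G i x) => i.
have -> : (fun x => (\row_i0 G i0 x) ord0 i) = G i by apply/funext => x; rewrite mxE.
split; first by apply/L2P; exact: (hG i).1.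
move=> phi tp; rewrite -[LHS]/(dot u (partial i phi)) (hG i).2//; congr (- _).
by apply: eq_Rintegral => x _; rewrite mxE.
Qed.

Opaque gr grad H1.

Lemma gr_unique i u G : H1 u -> L2 G ->
  (forall phi, test_function phi -> dot u (partial i phi) = - dot G phi) ->
  {ae leb, forall x, gr i u x = G x}.
Proof.
move=> hu hG H; have hg := gr_L2 i hu.
have : {ae leb, forall x, (gr i u - G) x = 0}.
  apply: test_orth0; first exact: L2B.
  move=> phi tp; have hp := test_L2 tp; rewrite dotBl//; apply/eqP; rewrite subr_eq0.
  by rewrite -eqr_opp -gr_test// -H.
by apply: filterS => x; rewrite !fE => /subr0_eq.
Qed.

(** Moved onto [phi], the translation acts on a function whose difference quotients converge in L^2;
    so the pairing is differentiable although [u] need not be. *)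
Lemma dot_sh_derive i u phi (s : R) : H1 u -> test_function phi ->
  is_derive s 1 (fun s => dot (sh (s *: ei i) u) phi) (dot (gr i u) (sh (- (s *: ei i)) phi)).
Proof.
move=> hu tp; have Lu := H1_L2 hu; have tpsi := test_sh (- (s *: ei i)) tp.
set psi := sh _ phi in tpsi *; have Lpsi := test_L2 tpsi.
apply: is_derive_cvg; apply/cvgr_dnbhsP => h [hn h0].
have hN0 : - h n @[n --> \oo] --> (0 : R) by rewrite -oppr0; exact: cvgN.
have hNn n : - h n != 0 by rewrite oppr_eq0.
have H : (- dot (dq (- h n) i psi) u) @[n --> \oo] --> - dot (partial i psi) u.
  apply: cvgN; apply: dot_cvgl => //; [by move=> n; exact: L2_dq|exact/test_L2/test_partial|].
  exact: test_dq_cvg'.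
rewrite (dotC _ (partial i psi)) (gr_test i hu tpsi) opprK in H.
apply: (cvg_eqr _ _ H) => n /=.
have -> : - dot (dq (- h n) i psi) u = dot (dq (h n) i u) psi.
  by rewrite (dot_dq _ _ Lpsi Lu) opprK (dotC _ (dq (h n) i u)) opprK.
rewrite dot_shl ?(dot_shl (s *: ei i))//; [|exact: test_L2..].
rewrite /dq dotZl//; [|exact: L2B (L2_sh _ Lu) Lu]; congr (_ * _).
rewrite dotBl ?dot_shl//; [|exact: L2_sh].
by congr (dot u _ - _); rewrite /psi sh_sh scalerDl opprD.
Qed.

Lemma dot_sh_le i u phi (s : R) : H1 u -> test_function phi ->
  dot (sh (s *: ei i) u - u) phi ^+ 2 <= s ^+ 2 * (nsq (gr i u) * nsq phi).
Proof.
move=> hu tp; have Lu := H1_L2 hu; have Lp := test_L2 tp; have Lg := gr_L2 i hu.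
have B t : `|dot (gr i u) (sh (- (t *: ei i)) phi)| <= Num.sqrt (nsq (gr i u) * nsq phi).
  rewrite -ler_sqr ?nnegrE ?sqrtr_ge0// sqr_sqrtr ?mulr_ge0 ?nsq_ge0//.
  rewrite real_normK ?num_real// -[X in _ * X](nsq_sh (- (t *: ei i)))//.
  by apply: dot_CS => //; exact: L2_sh.
have := lipschitz_derive (fun t => dot_sh_derive i t hu tp) B s 0.
rewrite scale0r sh0 subr0 -dotBl//; last exact: L2_sh.
rewrite -ler_sqr ?nnegrE ?mulr_ge0 ?sqrtr_ge0// exprMn sqr_sqrtr ?mulr_ge0 ?nsq_ge0//.
by rewrite !real_normK ?num_real// mulrC.
Qed.

Lemma test_seq f : L2 f -> exists phi : nat -> E -> R, (forall n, test_function (phi n)) /\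
  nsq (phi n - f) @[n --> \oo] --> 0.
Proof.
move=> hf; have /choice[phi hphi] : forall n : nat, exists phi, test_function phi /\ nsq (phi - f) <= n.+1%:R^-1.
  by move=> n; have [|phi tp hp] := @test_dense R N f n.+1%:R^-1 hf; [rewrite invr_gt0|exists phi].
exists phi; split=> [n|]; first exact: (hphi n).1.
apply: (@squeeze0 _ _ _ _ _ (fun n => n.+1%:R^-1)); last exact: inv_succ_cvg0.
by apply: nearW => n; rewrite ger0_norm ?nsq_ge0//; exact: (hphi n).2.
Qed.

(** The mean value theorem, applied to the pairings with test functions, bounds [dot w phi]; letting
    [phi] tend to the increment [w] itself gives [nsq w ^+ 2] on the left, and one factor
    cancels. *)
Lemma H1_dq_le i u (s : R) : H1 u -> nsq (sh (s *: ei i) u - u) <= s ^+ 2 * nsq (gr i u).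
Proof.
move=> hu; have Lu := H1_L2 hu; set w := sh _ u - u.
have Lw : L2 w by apply: L2B => //; exact: L2_sh.
have [phi [tp hp]] := test_seq Lw.
have Lp n := test_L2 (tp n).
have c1 : (s ^+ 2 * (nsq (gr i u) * nsq (phi n)) - dot w (phi n) ^+ 2) @[n --> \oo] -->
   s ^+ 2 * (nsq (gr i u) * nsq w) - nsq w ^+ 2.
  have c2 : dot w (phi n) @[n --> \oo] --> nsq w.
    by rewrite -dotff; under eq_fun do rewrite dotC; exact: dot_cvgl.
  apply: cvgB; last by rewrite expr2; under eq_fun do rewrite expr2; apply: cvgM.
  by apply: cvgMl_tmp; apply: cvgMl_tmp; apply: nsq_cvg.
have : 0 <= s ^+ 2 * (nsq (gr i u) * nsq w) - nsq w ^+ 2.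
  rewrite -(cvg_lim _ c1)//; apply: limr_ge; first by apply/cvg_ex; eexists; exact: c1.
  by apply: nearW => n; rewrite subr_ge0; exact: dot_sh_le.
have := nsq_ge0 leb w; rewrite le_eqVlt => /predU1P[<- _|w0].
  by rewrite mulr_ge0 ?sqr_ge0 ?nsq_ge0.
by rewrite subr_ge0 mulrA expr2 ler_pM2r.
Qed.

Lemma nsq_dq_le i u (s : R) : H1 u -> s != 0 -> nsq (dq s i u) <= nsq (gr i u).
Proof.
move=> hu s0; have Lu := H1_L2 hu; rewrite /dq nsqZ; last by apply: L2B => //; exact: L2_sh.
by rewrite exprVn ler_pdivrMl ?exprn_even_gt0//; exact: H1_dq_le.
Qed.

Lemma weak_cvg_dense (I : Type) (F : set_system I) (FF : Filter F) (f : I -> E -> R) g (C : R) w :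
  (forall n, L2 (f n)) -> L2 g -> L2 w -> (forall n, nsq (f n) <= C) ->
  (forall phi, test_function phi -> dot (f n) phi @[n --> F] --> dot g phi) ->
  dot (f n) w @[n --> F] --> dot g w.
Proof.
move=> hf hg hw fC H; apply/(subr_cvg0 (fun n => dot (f n) w)); apply/cvgr0Pnorm_lt => e e0.
pose K := 2 * `|C| + 2 * nsq g + 1.
have K0 : 0 < K by rewrite ltr_wpDl// addr_ge0// mulr_ge0// nsq_ge0.
have [phi tp hp] := test_dense hw (divr_gt0 (exprn_gt0 2 e0) (mulr_gt0 (ltr0Sn R 3) K0)).
have Lp := test_L2 tp.
have c0 : (dot (f n) phi - dot g phi) @[n --> F] --> (0 : R).
  by apply/(subr_cvg0 (fun n => dot (f n) phi)); exact: H.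
move/cvgr0Pnorm_lt : c0 => /(_ (e / 2) (divr_gt0 e0 (ltr0Sn R 1))); apply: filterS => n hn.
have -> : dot (f n) w - dot g w = (dot (f n) phi - dot g phi) - dot (f n - g) (phi - w).
  by rewrite dotBl ?dotBr//; [ring|exact: L2B].
rewrite (le_lt_trans (ler_normB _ _))// [ltRHS](splitr e); apply: ltr_leD; first exact: hn.
have e2 : 0 <= e / 2 by rewrite divr_ge0// ltW.
rewrite -ler_sqr ?nnegrE// real_normK ?num_real//.
apply: (le_trans (dot_CS (L2B (hf n) hg) (L2B Lp hw))).
have h1 : nsq (f n - g) <= K.
  rewrite /K; have := nsqD_le (hf n) (L2N hg); rewrite nsqN; have := fC n; have := ler_norm C; lra.
apply: (le_trans (ler_pM (nsq_ge0 _ _) (nsq_ge0 _ _) h1 hp)).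
by rewrite le_eqVlt; apply/orP; left; apply/eqP; field; rewrite gt_eqF.
Qed.

(** Weak convergence of the quotients together with [nsq_dq_le], which keeps their norms below that
    of the limit, gives strong convergence. *)
Lemma H1_dq_cvg i u h : H1 u -> (forall n, h n != 0) -> h n @[n --> \oo] --> 0 ->
  nsq (dq (h n) i u - gr i u) @[n --> \oo] --> 0.
Proof.
move=> hu hn h0; have Lu := H1_L2 hu; have Lg := gr_L2 i hu.
have c : dot (dq (h n) i u) (gr i u) @[n --> \oo] --> dot (gr i u) (gr i u).
  apply: (weak_cvg_dense _ (C := nsq (gr i u))) => //.
  - by move=> n; exact: L2_dq.
  - by move=> n; exact: nsq_dq_le.
  move=> phi tp; have Lp := test_L2 tp.
  have := cvg_is_derive (dot_sh_derive i 0 hu tp); rewrite scale0r oppr0 !sh0.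
  move/cvgr_dnbhsP => /(_ h (conj hn h0)); apply: cvg_eqr => n.
  rewrite addr0 /dq dotZl; [by rewrite dotBl//; exact: L2_sh|exact: L2B (L2_sh _ Lu) Lu|exact: Lp].
have c2 : (2 * (nsq (gr i u) - dot (dq (h n) i u) (gr i u))) @[n --> \oo] --> (0 : R).
  rewrite -(mulr0 2) -(subrr (nsq (gr i u))) -[X in _ - X]dotff; apply: cvgMl_tmp.
  by apply: cvgB; [exact: cvg_cst|].
apply: (@squeeze0 _ _ _ _ _ _ _ c2); apply: nearW => n.
rewrite ger0_norm ?nsq_ge0// nsqB//; last exact: L2_dq.
have := nsq_dq_le i hu (hn n); lra.
Qed.

Definition hs (n : nat) : R := n.+1%:R^-1.
Lemma hs_neq0 n : hs n != 0. Proof. by rewrite invr_eq0. Qed.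
Lemma hs_cvg0 : hs n @[n --> \oo] --> 0. Proof. exact: inv_succ_cvg0. Qed.
Lemma hsN_neq0 n : - hs n != 0. Proof. by rewrite oppr_eq0 hs_neq0. Qed.
Lemma hsN_cvg0 : - hs n @[n --> \oo] --> 0.
Proof. by rewrite -oppr0; apply: cvgN; exact: hs_cvg0. Qed.

(** Bounded difference quotients have a weak limit along an ultrafilter, and discrete integration by
    parts shows that this limit is the weak derivative. Membership in H^1 thus reduces to an
    estimate of increments. *)
Lemma H1_of_bound u : L2 u ->
  (forall i, exists C, forall s : R, nsq (sh (s *: ei i) u - u) <= C * s ^+ 2) -> H1 u.
Proof.
move=> hu H; apply: H1_intro => // i; have [C hC] := H i.
have [U [UU sU]] := @ultraFilterLemma _ (\oo : set_system nat) _.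
have Lf n := L2_dq (hs n) i hu.
have fC n : nsq (dq (hs n) i u) <= C.
  rewrite /dq nsqZ; last by apply: L2B => //; exact: L2_sh.
  have s2 : 0 < hs n ^+ 2 by rewrite exprn_even_gt0// hs_neq0.
  by rewrite exprVn ler_pdivrMl// mulrC; exact: hC.
have [G [LG hG]] := L2_weak_limit UU Lf fC.
exists G; split => // phi tp; have Lp := test_L2 tp.
have c1 := hG phi Lp.
have c2 : dot (dq (hs n) i u) phi @[n --> U] --> - dot u (partial i phi).
  apply: cvg_trans; first by apply: cvg_app; exact: sU.
  apply: (@cvg_eqr _ _ _ _ (fun n => - dot u (dq (- hs n) i phi))).
    by move=> n; rewrite dot_dq.
  apply: cvgN; rewrite dotC; under eq_fun do rewrite dotC.
  apply: dot_cvgl => //; [by move=> n; exact: L2_dq|exact/test_L2/test_partial|].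
  by apply: test_dq_cvg' => //; [exact: hsN_neq0|exact: hsN_cvg0].
apply/eqP; rewrite -eqr_opp opprK; apply/eqP.
by rewrite -(cvg_lim _ c1)// -(cvg_lim _ c2).
Qed.

Definition dotD u v : R := \sum_i dot (gr i u) (gr i v).

Lemma dirichletE u : H1 u -> dirichlet u = \sum_i nsq (gr i u).
Proof.
move=> hu; rewrite /dirichlet -int_sum; last by move=> i; exact: (gr_L2 i hu).2.
by apply: eq_Rintegral => x _; apply: eq_bigr => i _; rewrite expr2.
Qed.

Lemma dirichlet_ge0 u : 0 <= dirichlet u.
Proof. by apply: int_ge0 => x; exact: dotv_ge0. Qed.

Lemma dotDff u : H1 u -> dotD u u = dirichlet u.
Proof. by move=> hu; rewrite dirichletE//; apply: eq_bigr => i _; rewrite dotff. Qed.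

Lemma dotDC u v : dotD u v = dotD v u.
Proof. by apply: eq_bigr => i _; rewrite dotC. Qed.

(** [grad] is a choice among almost everywhere equal weak gradients, so its linearity holds only
    almost everywhere. *)
Lemma H1_lin (a : R) u v : H1 u -> H1 v -> H1 (a *: u + v) /\
  forall i, {ae leb, forall x, gr i (a *: u + v) x = (a *: gr i u + gr i v) x}.
Proof.
move=> hu hv; have [Lu Lv] := (H1_L2 hu, H1_L2 hv).
have LG i : L2 (a *: gr i u + gr i v) by apply: L2D; [apply: L2Z|]; exact: gr_L2.
have HG i phi : test_function phi -> dot (a *: u + v) (partial i phi) = - dot (a *: gr i u + gr i v) phi.
  move=> tp; have Lp := test_L2 tp; have Ldp := test_L2 (test_partial i tp).
  have [Lgu Lgv] := (gr_L2 i hu, gr_L2 i hv).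
  rewrite !dotDl ?dotZl//; [|exact: L2Z..].
  rewrite (gr_test i hu tp) (gr_test i hv tp).
  by move: (dot (gr i u) phi) (dot (gr i v) phi) => p q; ring.
have hl : H1 (a *: u + v).
  apply: H1_intro; first by apply: L2D => //; exact: L2Z.
  by move=> i; exists (a *: gr i u + gr i v); split; [exact: LG|exact: HG].
by split => // i; apply: gr_unique => //; exact: HG.
Qed.

Lemma H1_0 : H1 (0 : E -> R).
Proof.
apply: H1_intro; first exact: L20; move=> i; exists 0; split; first exact: L20.
move=> phi tp; rewrite /dot (_ : (fun _ => _) = fun=> 0); last by apply/funext => x; rewrite mul0r.
by rewrite (_ : (fun x => 0 x * phi x) = fun=> 0) ?int0 ?oppr0//; apply/funext => x; rewrite mul0r.
Qed.

Lemma H1Z (a : R) u : H1 u -> H1 (a *: u).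
Proof. by move=> hu; have [] := H1_lin a hu H1_0; rewrite addr0. Qed.
Lemma H1D u v : H1 u -> H1 v -> H1 (u + v).
Proof. by move=> hu hv; have [] := H1_lin 1 hu hv; rewrite scale1r. Qed.
Lemma H1N u : H1 u -> H1 (- u).
Proof. by move=> hu; rewrite -scaleN1r; exact: H1Z. Qed.
Lemma H1B u v : H1 u -> H1 v -> H1 (u - v).
Proof. by move=> hu hv; apply: H1D => //; exact: H1N. Qed.

Lemma addR_continuous : continuous (fun x : R * R => x.1 + x.2).
Proof. by move=> x; apply: cvgD; [exact: cvg_fst|exact: cvg_snd]. Qed.

Lemma dotD_cvg u v h : H1 u -> H1 v -> (forall n, h n != 0) -> h n @[n --> \oo] --> 0 ->
  (\sum_i dot (dq (h n) i u) (dq (h n) i v)) @[n --> \oo] --> dotD u v.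
Proof.
move=> hu hv hn h0; have [Lu Lv] := (H1_L2 hu, H1_L2 hv).
apply: (@cvg_big R 'I_N +%R 0 xpredT addR_continuous) => i _.
apply: dot_cvg; [by move=> n; exact: L2_dq|exact: gr_L2|by move=> n; exact: L2_dq|exact: gr_L2|
  exact: H1_dq_cvg|exact: H1_dq_cvg].
Qed.

Lemma dirichlet_cvg u h : H1 u -> (forall n, h n != 0) -> h n @[n --> \oo] --> 0 ->
  (\sum_i nsq (dq (h n) i u)) @[n --> \oo] --> dirichlet u.
Proof.
move=> hu hn h0; rewrite -dotDff//; have := dotD_cvg hu hu hn h0; apply: cvg_eqr => n.
by apply: eq_bigr => i _; rewrite dotff.
Qed.

Lemma dotD_lin (a : R) u v w : H1 u -> H1 v -> H1 w -> dotD (a *: u + v) w = a * dotD u w + dotD v w.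
Proof.
move=> hu hv hw; rewrite /dotD mulr_sumr -big_split; apply: eq_bigr => i _.
have [hl hg] := H1_lin a hu hv; have [[Lu Lv] Lw] := (gr_L2 i hu, gr_L2 i hv, gr_L2 i hw).
rewrite /= -(dotZl a Lu Lw) -(dotDl (L2Z a Lu) Lv Lw).
apply: dot_ae; [exact: gr_L2|exact: Lw|exact: L2D (L2Z a Lu) Lv|exact: Lw|exact: hg|exact: aeW].
Qed.

Lemma dotDDl u v w : H1 u -> H1 v -> H1 w -> dotD (u + v) w = dotD u w + dotD v w.
Proof. by move=> hu hv hw; rewrite -[in LHS](scale1r u) (dotD_lin 1 hu hv hw) mul1r. Qed.
Lemma dotD0l w : H1 w -> dotD 0 w = 0.
Proof.
move=> hw; have := dotDDl H1_0 H1_0 hw; rewrite addr0 => h.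
by apply: (addrI (dotD 0 w)); rewrite addr0 -h.
Qed.
Lemma dotDZl (a : R) u w : H1 u -> H1 w -> dotD (a *: u) w = a * dotD u w.
Proof.
move=> hu hw; rewrite -[in LHS](addr0 (a *: u)) (dotD_lin a hu H1_0 hw).
by rewrite (dotD0l hw) addr0.
Qed.
Lemma dotDNl u w : H1 u -> H1 w -> dotD (- u) w = - dotD u w.
Proof. by move=> hu hw; rewrite -[in LHS](scaleN1r u) (dotDZl (-1) hu hw) mulN1r. Qed.
Lemma dotDBl u v w : H1 u -> H1 v -> H1 w -> dotD (u - v) w = dotD u w - dotD v w.
Proof. by move=> hu hv hw; rewrite (dotDDl hu (H1N hv) hw) (dotDNl hv hw). Qed.
Lemma dotDDr u v w : H1 u -> H1 v -> H1 w -> dotD w (u + v) = dotD w u + dotD w v.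
Proof. by move=> hu hv hw; rewrite dotDC (dotDDl hu hv hw) (dotDC u) (dotDC v). Qed.
Lemma dotDZr (a : R) u w : H1 u -> H1 w -> dotD w (a *: u) = a * dotD w u.
Proof. by move=> hu hw; rewrite dotDC (dotDZl a hu hw) (dotDC u). Qed.
Lemma H1_ae u v : measurable_fun setT v -> {ae leb, forall x, u x = v x} -> H1 u -> H1 v.
Proof.
move=> mv uv hu; have Lu := H1_L2 hu; have Lv := L2_ae mv uv Lu.
apply: H1_intro => // i; exists (gr i u); split; first exact: gr_L2.
move=> phi tp; rewrite -gr_test//; apply: dot_ae => //; try exact/test_L2/test_partial.
  by apply: filterS uv => x ->.
exact: aeW.
Qed.

Lemma gr_ae i u v : H1 u -> H1 v -> {ae leb, forall x, u x = v x} ->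
  {ae leb, forall x, gr i u x = gr i v x}.
Proof.
move=> hu hv uv; apply: gr_unique => //; first exact: gr_L2.
move=> phi tp; rewrite -gr_test//; apply: dot_ae => //; try exact: H1_L2.
- exact/test_L2/test_partial.
- exact/test_L2/test_partial.
- exact: aeW.
Qed.

Lemma dotD_ae u v w : H1 u -> H1 v -> H1 w -> {ae leb, forall x, u x = v x} ->
  dotD u w = dotD v w.
Proof.
move=> hu hv hw uv; apply: eq_bigr => i _; apply: dot_ae; try exact: gr_L2.
  exact: gr_ae.
exact: aeW.
Qed.

Ltac gen_dotD := repeat match goal with
  | |- context [dotD ?u ?v] => move: (dotD u v) => ?
  end; gen_atoms.
Opaque dotD dirichlet.

Lemma dirichletD u v : H1 u -> H1 v ->
  dirichlet (u + v) = dirichlet u + 2 * dotD u v + dirichlet v.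
Proof.
move=> hu hv; have huv := H1D hu hv.
rewrite -(dotDff huv) -(dotDff hu) -(dotDff hv) (dotDDl hu hv huv).
by rewrite (dotDDr hu hv hu) (dotDDr hu hv hv) (dotDC v u); gen_dotD; ring.
Qed.
Lemma dirichletZ (a : R) u : H1 u -> dirichlet (a *: u) = a ^+ 2 * dirichlet u.
Proof.
move=> hu; have hau := H1Z a hu.
by rewrite -(dotDff hau) -(dotDff hu) (dotDZl a hu hau) (dotDZr a hu hu) mulrA expr2.
Qed.
Lemma dirichletN u : H1 u -> dirichlet (- u) = dirichlet u.
Proof. by move=> hu; rewrite -(scaleN1r u) (dirichletZ _ hu) sqrrN expr1n mul1r. Qed.
Lemma dirichletB u v : H1 u -> H1 v ->
  dirichlet (u - v) = dirichlet u - 2 * dotD u v + dirichlet v.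
Proof.
move=> hu hv; rewrite (dirichletD hu (H1N hv)) (dirichletN hv) (dotDC u (- v)).
by rewrite (dotDNl hv hu) (dotDC v); gen_dotD; ring.
Qed.

Lemma dirichlet_ae u v : H1 u -> H1 v -> {ae leb, forall x, u x = v x} ->
  dirichlet u = dirichlet v.
Proof.
move=> hu hv uv; rewrite -(dotDff hu) -(dotDff hv) (dotD_ae hu hv hu uv) dotDC.
exact: dotD_ae.
Qed.

Lemma dotD_CS u v : H1 u -> H1 v -> dotD u v ^+ 2 <= dirichlet u * dirichlet v.
Proof.
move=> hu hv; apply: quad_ge0_disc => [|s]; first exact: dirichlet_ge0.
have := dirichlet_ge0 (u + s *: v).
rewrite (dirichletD hu (H1Z s hv)) (dirichletZ s hv) (dotDZr s hv hu).
by gen_dotD => h; apply: (le_trans h); rewrite le_eqVlt; apply/orP; left; apply/eqP; ring.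
Qed.

(** Substitute for the chain rule with a Lipschitz function: the pointwise comparison of increments
    passes to the difference quotients, whose norms converge to the Dirichlet energies. It handles
    absolute values and truncations alike. *)
Lemma H1_increment_le u v (K : R) : H1 u -> L2 v ->
  (forall x y, `|v (x + y) - v x| <= K * `|u (x + y) - u x|) ->
  H1 v /\ dirichlet v <= K ^+ 2 * dirichlet u.
Proof.
move=> hu Lv H; have Lu := H1_L2 hu.
have Hn y : nsq (sh y v - v) <= K ^+ 2 * nsq (sh y u - u).
  rewrite -nsqZ; last by apply: L2B => //; exact: L2_sh.
  apply: nsq_le.
  - by apply: L2Z; apply: L2B => //; exact: L2_sh.
  - exact: L2_meas (L2B (L2_sh _ Lv) Lv).
  - by move=> x; rewrite !fE /sh normrM (le_trans (H x y))// ler_wpM2r// ler_norm.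
have hv : H1 v.
  apply: H1_of_bound => // i; exists (K ^+ 2 * nsq (gr i u)) => s.
  apply: (le_trans (Hn _)); rewrite -mulrA ler_wpM2l ?sqr_ge0//.
  by rewrite mulrC; exact: H1_dq_le.
split => //.
have c1 := dirichlet_cvg hv hs_neq0 hs_cvg0.
have c2 : (K ^+ 2 * \sum_i nsq (dq (hs n) i u)) @[n --> \oo] --> K ^+ 2 * dirichlet u.
  by apply: cvgMl_tmp; exact: dirichlet_cvg hu hs_neq0 hs_cvg0.
rewrite -(cvg_lim _ c1)// -(cvg_lim _ c2)//; apply: ler_lim.
- by apply/cvg_ex; eexists; exact: c1.
- by apply/cvg_ex; eexists; exact: c2.
apply: nearW => n; rewrite mulr_sumr; apply: ler_sum => i _.
rewrite /dq !nsqZ; [|by apply: L2B => //; exact: L2_sh..].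
by rewrite mulrCA ler_wpM2l ?sqr_ge0.
Qed.

Lemma H1_abs u : H1 u -> H1 (fun x => `|u x|) /\ dirichlet (fun x => `|u x|) <= dirichlet u.
Proof.
move=> hu; rewrite -[X in _ <= X]mul1r -[X in _ <= X * _](expr1n _ 2).
apply: H1_increment_le => //; first exact/L2_abs/H1_L2.
by move=> x y; rewrite mul1r ler_dist_dist.
Qed.

Lemma dirichlet_sh y u : H1 u -> H1 (sh y u) /\ forall i, {ae leb, forall x, gr i (sh y u) x = sh y (gr i u) x}.
Proof.
move=> hu; have Lu := H1_L2 hu.
have HG i phi : test_function phi -> dot (sh y u) (partial i phi) = - dot (sh y (gr i u)) phi.
  move=> tp; rewrite dot_shl//; last exact/test_L2/test_partial.
  rewrite -partial_sh gr_test//; last exact: test_sh.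
  by rewrite -dot_shl//; [exact: gr_L2|exact: test_L2].
have hv : H1 (sh y u).
  apply: H1_intro; first exact: L2_sh; move=> i; exists (sh y (gr i u)); split; last exact: HG.
  by apply: L2_sh; exact: gr_L2.
by split => // i; apply: gr_unique => //; [apply: L2_sh; exact: gr_L2|exact: HG].
Qed.

End sobolev_theory.

Ltac gen_dotD := repeat match goal with
  | |- context [dotD ?u ?v] => move: (dotD u v) => ?
  end; gen_atoms.

(** * Composition and products in H^1 *)

Section sobolev_maps.
Context {R : realType} {N : nat}.
Local Notation E := 'rV[R]_N.
Local Notation leb := (@lebesgue_rV R N).
Local Notation L2 := (L2 leb).
Local Notation dot := (l2dot leb).
Local Notation hs := (@hs R).
Local Notation nsq := (l2sq leb).
Implicit Types (f g u v w : E -> R) (x y z : E) (i j : 'I_N) (h : nat -> R).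
Opaque dotD dirichlet gr grad H1.

Lemma nsqD_sqr f g (A B : R) : 0 <= A -> 0 <= B -> L2 f -> L2 g ->
  nsq f <= A ^+ 2 -> nsq g <= B ^+ 2 -> nsq (f + g) <= (A + B) ^+ 2.
Proof.
move=> A0 B0 hf hg hA hB; rewrite nsqD//.
have h : dot f g <= A * B.
  rewrite (le_trans (ler_norm _))// -ler_sqr ?nnegrE ?mulr_ge0// real_normK ?num_real//.
  by rewrite (le_trans (dot_CS hf hg))// exprMn ler_pM ?nsq_ge0.
move: h hA hB; gen_atoms; nra.
Qed.

Lemma continuous_seq (f : E -> R) (u : nat -> E) x : continuous f ->
  u n @[n --> \oo] --> x -> f (u n) @[n --> \oo] --> f x.
Proof. by move=> cf ux; apply: (cvg_comp _ _ ux); exact: cf. Qed.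

(** For a test function this is dominated convergence, the hypothesis on cubes providing a common
    bounded support. The bound [C] on the measure factors makes the compositions uniformly bounded
    on L^2, so density of test functions gives the general case. *)
Lemma L2_comp_cvg (S : nat -> E -> E) (T : E -> E) (C : R) f :
  (forall n, exists2 c, c <= C & mpres c (S n)) -> (exists2 c, c <= C & mpres c T) ->
  (forall x, S n x @[n --> \oo] --> T x) ->
  (forall r : R, exists r' : R, forall x, (exists n, cube r (S n x)) \/ cube r (T x) -> cube r' x) ->
  L2 f -> nsq ((f \o S n) - (f \o T)) @[n --> \oo] --> 0.
Proof.
move=> hS hT ST supp hf.
have LS n g : L2 g -> L2 (g \o S n) by move=> hg; have [c _ h] := hS n; exact: mpres_L2 h hg.
have LT g : L2 g -> L2 (g \o T) by move=> hg; have [c _ h] := hT; exact: mpres_L2 h hg.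
have bS n g : L2 g -> nsq (g \o S n) <= C * nsq g.
  move=> hg; have [c cC h] := hS n; rewrite (mpres_nsq h hg) ler_wpM2r ?nsq_ge0//.
have bT g : L2 g -> nsq (g \o T) <= C * nsq g.
  move=> hg; have [c cC h] := hT; rewrite (mpres_nsq h hg) ler_wpM2r ?nsq_ge0//.
have C0 : 0 <= C by have [c cC [c0 _ _]] := hT; exact: le_trans cC.
have test phi : test_function phi -> nsq ((phi \o S n) - (phi \o T)) @[n --> \oo] --> 0.
  move=> tp; have [M hM] := test_bounded tp.
  have [_ [r hr]] := (test_functionP phi).1 tp; have [r' hr'] := supp r.
  have Lp := test_L2 tp.
  have [|||n x|_] := @dominated_int _ _ _ leb (fun n x => ((phi \o S n) - (phi \o T)) x ^+ 2) (fun=> 0)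
     ((2 * M) ^+ 2 *: \1_(cube r')); last 1 first.
  - by rewrite Rintegral_cst// mul0r.
  - move=> n; apply: measurable_funX; exact: (L2_meas (L2B (LS n phi Lp) (LT phi Lp))).
  - move=> x; have c : (phi (S n x) - phi (T x)) @[n --> \oo] --> (0 : R).
      by apply/(subr_cvg0 (fun n => phi (S n x))); apply: continuous_seq => //; exact: smooth_cont tp.1.
    have c2 : ((phi (S n x) - phi (T x)) * (phi (S n x) - phi (T x))) @[n --> \oo] --> (0 * 0 : R) by apply: cvgM.
    by move: c2; rewrite mulr0; apply: cvg_eqr => n; rewrite expr2.
  - by apply: itgZ; exact: itg_indic_cube.
  - rewrite !fE /= ger0_norm ?sqr_ge0// indicE.
    have M0 : 0 <= M by exact: le_trans (hM x).
    have [xr|xr] := pselect (cube r' x).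
      rewrite mem_set//= mulr1 -ler_sqrt ?sqr_ge0// !sqrtr_sqr (ger0_norm (mulr_ge0 _ M0))//.
      by rewrite (le_trans (ler_normB _ _))// mulr_natl mulr2n lerD.
    rewrite memNset//= mulr0 !hr ?subr0 ?expr0n//.
    + by move=> h; apply/xr/hr'; right.
    + by move=> h; apply/xr/hr'; left; exists n.
apply/cvgr0Pnorm_lt => e e0.
have d0 : 0 < e / (8 * C + 8) / 2 by rewrite divr_gt0// divr_gt0// ltr_wpDl// mulr_ge0.
have [phi tp hp] := test_dense hf d0; have Lp := test_L2 tp.
have e4 : 0 < e / 4 by rewrite divr_gt0.
move/cvgr0Pnorm_lt : (test _ tp) => /(_ (e / 4) e4); apply: filterS => n.
rewrite !ger0_norm ?nsq_ge0// => hn.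
have -> : (f \o S n) - (f \o T) = ((phi \o S n) - (phi \o T)) + (((f - phi) \o S n) - ((f - phi) \o T)).
  by apply/funext => x; rewrite !fE /= !fE; ring.
have Ld := L2B hf Lp.
have h1 := nsqD_le (L2B (LS n _ Lp) (LT _ Lp)) (L2B (LS n _ Ld) (LT _ Ld)).
have h2 := nsqD_le (LS n _ Ld) (L2N (LT _ Ld)); rewrite nsqN in h2.
have h3 := bS n _ Ld; have h4 := bT _ Ld.
rewrite nsqBC in hp.
have h5 : C * nsq (f - phi) <= e / 16.
  have C1 : C + 1 != 0 by rewrite gt_eqF// ltr_wpDl.
  rewrite (le_trans (ler_wpM2l C0 hp))//.
  have -> : C * (e / (8 * C + 8) / 2) = (e / 16) * (C / (C + 1)).
    by field; rewrite C1 /=; apply: contra_neq C1 => h; lra.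
  by rewrite ger_pMr ?divr_gt0// ler_pdivrMr ?ltr_wpDl// mul1r lerDl.
move: h1 h2 h3 h4 h5 hn; gen_atoms; lra.
Qed.

Lemma rV_cvg (u : nat -> E) x : (forall i, u n ord0 i @[n --> \oo] --> x ord0 i) ->
  u n @[n --> \oo] --> x.
Proof.
move=> H; apply/cvgrPdist_lt => e e0.
have : \forall n \near \oo, forall i, `|x ord0 i - u n ord0 i| < e / 2.
  by apply: filter_forall => i; apply: (cvgrPdist_lt _ _).1 (H i) _ _; rewrite divr_gt0.
apply: filterS => n hn; rewrite (le_lt_trans _ (_ : e / 2 < e))//; last by rewrite ltr_pdivrMr// ltr_pMr// ltr1n.
rewrite /Num.norm/= mx_normrE; apply: bigmax_le => [|[a b] _]; first by rewrite divr_ge0// ltW.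
by rewrite !mxE/= (ord1 a) ltW.
Qed.

Lemma shift_cvg y h : h n @[n --> \oo] --> (0 : R) -> (forall n, `|h n| <= 1) ->
  forall f, L2 f -> nsq (sh (h n *: y) f - f) @[n --> \oo] --> 0.
Proof.
move=> h0 h1 f hf.
apply: (@L2_comp_cvg (fun n x => x + h n *: y) id 1) => //.
- by move=> n; exists 1 => //; exact: mpres_shift.
- exists 1 => //; have := mpres_shift (0 : E); rewrite (_ : (fun x => x + 0) = id)//.
  by apply/funext => x; rewrite addr0.
- move=> x; apply: rV_cvg => i; under eq_fun do rewrite !mxE.
  have c : (x ord0 i + h n * y ord0 i) @[n --> \oo] --> x ord0 i + 0 * y ord0 i.
    by apply: cvgD; [exact: cvg_cst|exact: cvgMr_tmp].
  by move: c; rewrite mul0r addr0.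
- move=> r; exists (r + `|y|) => x [[n]|] /cubeP hx; apply/cubeP => i; have := hx i.
    rewrite !mxE => {}hx; rewrite -(addrK (h n * y ord0 i) (x ord0 i)) (le_trans (ler_normB _ _))// lerD//.
    by rewrite normrM -[leRHS]mul1r ler_pM// coord_le_norm.
  by move=> {}hx; rewrite (le_trans hx)// lerDl.
Qed.

(** Criterion for the transforms that follow: the strong limit of the quotients along the single
    sequence [hs] gives both membership in H^1 and the gradient. *)
Lemma H1_of_dq u (G : 'I_N -> E -> R) : L2 u -> (forall i, L2 (G i)) ->
  (forall i, nsq (dq (hs n) i u - G i) @[n --> \oo] --> 0) ->
  H1 u /\ forall i, {ae leb, forall x, gr i u x = G i x}.
Proof.
move=> Lu LG H.
have T i phi : test_function phi -> dot u (partial i phi) = - dot (G i) phi.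
  move=> tp; have Lp := test_L2 tp; have Ldp := test_L2 (test_partial i tp).
  have c1 : dot (dq (hs n) i u) phi @[n --> \oo] --> dot (G i) phi.
    by apply: dot_cvgl => //; move=> n; exact: L2_dq.
  have c2 : dot (dq (hs n) i u) phi @[n --> \oo] --> - dot u (partial i phi).
    apply: (@cvg_eqr _ _ _ _ (fun n => - dot (dq (- hs n) i phi) u)).
      by move=> n; rewrite (dot_dq _ _ Lu Lp) dotC.
    rewrite (dotC _ u); apply: cvgN; apply: dot_cvgl => //; first by move=> n; exact: L2_dq.
    by apply: test_dq_cvg' => //; [exact: hsN_neq0|exact: hsN_cvg0].
  by rewrite -(cvg_lim _ c1)// (cvg_lim _ c2)// opprK.
have hu : H1 u by apply: H1_intro => // i; exists (G i); split; [exact: LG|exact: T].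
by split => // i; apply: gr_unique => //; exact: T.
Qed.

Lemma hs_le1 n : `|hs n| <= 1.
Proof. by rewrite /hs ger0_norm ?invr_ge0// invf_le1// ler1n. Qed.
Lemma hs_gt0 n : 0 < hs n. Proof. by rewrite /hs invr_gt0. Qed.

Definition dg y u : E -> R := fun x => dotv y (grad u x).

Lemma dgE y u : dg y u = \sum_i y ord0 i *: gr i u.
Proof. by apply/funext => x; rewrite fct_sumE; apply: eq_bigr. Qed.

Lemma L2_dg y u : H1 u -> L2 (dg y u).
Proof. by move=> hu; rewrite dgE; apply: L2_sum => i; apply: L2Z; exact: gr_L2. Qed.

Definition dqv (t : R) y f := t^-1 *: (sh (t *: y) f - f).

Lemma L2_dqv t y f : L2 f -> L2 (dqv t y f).
Proof. by move=> hf; apply: L2Z; apply: L2B => //; exact: L2_sh. Qed.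

Lemma nsq_shB_le (f g : E -> R) z (A : R) : L2 f -> L2 g -> nsq (sh z f - g) <= 2 * nsq (f - g) + 2 * nsq (sh z g - g).
Proof.
move=> hf hg; have -> : sh z f - g = sh z (f - g) + (sh z g - g).
  by apply/funext => x; rewrite !fE /sh !fE; ring.
rewrite (le_trans (nsqD_le _ _))//; [exact/L2_sh/L2B|exact: L2B (L2_sh _ hg) hg|].
by rewrite nsq_sh//; exact: L2B.
Qed.

(** The displacement is made one coordinate at a time. Each later piece is evaluated at a slightly
    translated point, and continuity of translations in L^2 removes that shift in the limit. *)
Lemma dqv_cvg y u : H1 u -> nsq (dqv (hs n) y u - dg y u) @[n --> \oo] --> 0.
Proof.
move=> hu; have Lu := H1_L2 hu.
suff H (s : seq 'I_N) : nsq (dqv (hs n) (\sum_(j <- s) y ord0 j *: ei j) u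
    - \sum_(j <- s) y ord0 j *: gr j u) @[n --> \oo] --> 0.
  have e : y = \sum_(j <- index_enum 'I_N) y ord0 j *: ei j by exact: row_sum_delta.
  by rewrite dgE; have := H (index_enum _); rewrite -e.
elim: s => [|j s IH].
  apply: (@cvg_eqr _ _ _ _ (fun=> 0)); last exact: cvg_cst.
  by move=> n; rewrite !big_nil /dqv scaler0 sh0 subrr scaler0 subr0 nsq0.
(* A vanishing coordinate is set aside because the step [hs n * y ord0 j] must be nonzero. *)
have [S0|y0] := eqVneq (y ord0 j) 0.
  by under eq_fun do rewrite !big_cons S0 !scale0r !add0r.
set Y := \sum_(j <- s) _ in IH; set G := \sum_(j <- s) y ord0 j *: gr j u in IH.
have LG : L2 G.
  by rewrite /G; elim: (s) => [|k t IHt]; rewrite ?big_nil ?big_cons; [exact: L20|apply: L2D => //; apply/L2Z/gr_L2].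
set c := y ord0 j in y0 *; have Lg := gr_L2 j hu.
pose X n := c *: dq (hs n * c) j u.
have LX n : L2 (X n) by apply/L2Z/L2_dq.
have cX : nsq (X n - c *: gr j u) @[n --> \oo] --> 0.
  apply: nsq_cvgZ => //; [by move=> n; exact: L2_dq|].
  apply: (@H1_dq_cvg _ _ j u (fun n => hs n * c)) => //.
    by move=> n; rewrite mulf_neq0// hs_neq0.
  by rewrite -(mul0r c); apply: cvgMr_tmp; exact: hs_cvg0.
have Lcg : L2 (c *: gr j u) by exact: L2Z.
have cS : nsq (sh (hs n *: Y) (X n) - c *: gr j u) @[n --> \oo] --> 0.
  apply: (@squeeze0 _ _ _ _ _ (fun n => 2 * nsq (X n - c *: gr j u) + 2 * nsq (sh (hs n *: Y) (c *: gr j u) - c *: gr j u))).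
    by apply: nearW => n; rewrite ger0_norm ?nsq_ge0//; exact: nsq_shB_le.
  rewrite -[X in _ --> X](addr0 0) -{1}(mulr0 2) -{2}(mulr0 2); apply: cvgD; apply: cvgMl_tmp => //.
  by apply: shift_cvg => //; [exact: hs_cvg0|exact: hs_le1].
have Ld n := L2_dqv (hs n) Y Lu.
have cc : nsq ((sh (hs n *: Y) (X n) + dqv (hs n) Y u) - (c *: gr j u + G)) @[n --> \oo] --> 0.
  by apply: nsq_cvgD => // n; exact: L2_sh.
move: cc; apply: cvg_eqr => n; congr nsq; rewrite !big_cons -/Y -/G -/c; congr (_ - _).
apply/funext => x; rewrite /X /dqv /dq /sh !fE /sh scalerDr scalerA invfM.
have hn : hs n != 0 by exact: hs_neq0.
have -> : x + hs n *: Y + (hs n * c) *: ei j = x + ((hs n * c) *: ei j + hs n *: Y).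
  by rewrite -addrA (addrC (hs n *: Y)).
move: (u _) (u _) (u _) => p q r; field; exact/andP.
Qed.

Lemma dotD_shE y u v : H1 u -> H1 v -> dotD (sh y u) (sh y v) = dotD u v.
Proof.
move=> hu hv; have [[hsu gu] [hsv gv]] := (dirichlet_sh y hu, dirichlet_sh y hv).
apply: eq_bigr => i _; rewrite -(dot_sh y (gr_L2 i hu) (gr_L2 i hv)).
apply: dot_ae => //; first [exact: gr_L2|exact/L2_sh/gr_L2].
Qed.

Lemma dirichlet_shE y u : H1 u -> dirichlet (sh y u) = dirichlet u.
Proof.
by move=> hu; have [hsu _] := dirichlet_sh y hu; rewrite -(dotDff hsu) -(dotDff hu) (dotD_shE y hu hu).
Qed.

Lemma H1_dil (l : R) u : 0 < l -> H1 u -> H1 (u \o ( *:%R l)) /\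
  forall i, {ae leb, forall x, gr i (u \o ( *:%R l)) x = (l *: (gr i u \o ( *:%R l))) x}.
Proof.
move=> l0 hu; have Lu := H1_L2 hu; have mp := mpres_scale (N := N) l0.
apply: H1_of_dq => [|i|i]; [exact: mpres_L2 mp Lu|exact: (L2Z l (mpres_L2 mp (gr_L2 i hu)))|].
have Lg := gr_L2 i hu.
have c : nsq (dq (hs n * l) i u - gr i u) @[n --> \oo] --> 0.
  apply: (@H1_dq_cvg _ _ i u (fun n => hs n * l)) => //.
    by move=> n; rewrite mulf_neq0 ?hs_neq0// gt_eqF.
  by rewrite -(mul0r l); apply: cvgMr_tmp; exact: hs_cvg0.
have c2 : (l ^+ 2 * (l^-1 ^+ N * nsq (dq (hs n * l) i u - gr i u))) @[n --> \oo] --> l ^+ 2 * (l^-1 ^+ N * 0).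
  by apply: cvgMl_tmp; apply: cvgMl_tmp.
rewrite !mulr0 in c2; move: c2; apply: cvg_eqr => n.
have Ld := L2B (L2_dq (hs n * l) i Lu) Lg.
rewrite -(mpres_nsq mp Ld) -(nsqZ l (mpres_L2 mp Ld)); congr nsq.
apply/funext => x; rewrite !fE /= /dq /sh !fE /= scalerDr scalerA invfM (mulrC l (hs n)).
have hn : hs n != 0 by exact: hs_neq0.
have ln : l != 0 by rewrite gt_eqF.
by move: (u _) (u _) (gr _ _ _) => p q r; field; exact/andP.
Qed.

Lemma dirichlet_dil (l : R) u : 0 < l -> H1 u ->
  dirichlet (u \o ( *:%R l)) = l ^+ 2 * (l^-1 ^+ N * dirichlet u).
Proof.
move=> l0 hu; have [hv gv] := H1_dil l0 hu; have mp := mpres_scale (N := N) l0.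
rewrite (dirichletE hv) (dirichletE hu) !mulr_sumr; apply: eq_bigr => i _; have Lg := gr_L2 i hu.
rewrite (nsq_ae (gr_L2 i hv) (L2Z l (mpres_L2 mp Lg)) (gv i)).
by rewrite (nsqZ l (mpres_L2 mp Lg)) (mpres_nsq mp Lg).
Qed.

Lemma H1_refl e u : dotv e e = 1 -> H1 u -> H1 (u \o refl e) /\
  forall i, {ae leb, forall x, gr i (u \o refl e) x = (dg (refl e (ei i)) u \o refl e) x}.
Proof.
move=> e1 hu; have Lu := H1_L2 hu; have mp := mpres_refl e1.
apply: H1_of_dq => [|i|i]; [exact: mpres_L2 mp Lu|exact: mpres_L2 mp (L2_dg _ hu)|].
have := dqv_cvg (refl e (ei i)) hu; apply: cvg_eqr => n.
rewrite -[LHS]mul1r -(mpres_nsq mp (L2B (L2_dqv _ _ Lu) (L2_dg _ hu))); congr nsq.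
by apply/funext => x; rewrite /dqv /dq /sh !fE /= reflD reflZ.
Qed.

(** The gradient of the composition is the reflected gradient, and a reflection preserves the
    Euclidean scalar product. *)
Lemma dotD_refl e u v : dotv e e = 1 -> H1 u -> H1 v ->
  dotD (u \o refl e) (v \o refl e) = dotD u v.
Proof.
move=> e1 hu hv; have mp := mpres_refl e1.
have [[hu' gu] [hv' gv]] := (H1_refl e1 hu, H1_refl e1 hv).
transitivity (\sum_i dot (dg (refl e (ei i)) u) (dg (refl e (ei i)) v)).
  apply: eq_bigr => i _; rewrite -[RHS]mul1r -(mpres_dot mp (L2_dg _ hu) (L2_dg _ hv)).
  by apply: dot_ae; [exact: gr_L2|exact: gr_L2|exact: mpres_L2 mp (L2_dg _ hu)|
    exact: mpres_L2 mp (L2_dg _ hv)|exact: gu|exact: gv].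
have -> : dotD u v = \sum_i dot (gr i u) (gr i v) by [].
rewrite /l2dot -!int_sum; [|by move=> i; apply: itg_mul; first [exact: gr_L2|exact: L2_dg]..].
apply: eq_Rintegral => x _.
have h w i : dg (refl e (ei i)) w x = refl e (grad w x) ord0 i.
  rewrite /dg -[grad w x in LHS](reflK e1) dotv_refl// /dotv (bigD1 i)//= big1 ?addr0.
    by rewrite mxE !eqxx mul1r.
  by move=> j ji; rewrite mxE (negPf ji) andbF mul0r.
under eq_bigr => i _ do rewrite !h.
exact: (dotv_refl (grad u x) (grad v x) e1).
Qed.

Lemma H1_mul (f : E -> R) (T : 'I_N -> E -> R) u (C : R) : H1 u -> 0 <= C ->
  measurable_fun setT f -> (forall i, measurable_fun setT (T i)) ->
  (forall x, `|f x| <= C) -> (forall i x, `|T i x| <= C) ->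
  (forall i x (s : R), `|f (x + s *: ei i) - f x| <= C * `|s|) ->
  (forall i x, (hs n)^-1 * (f (x + hs n *: ei i) - f x) @[n --> \oo] --> T i x) ->
  H1 (f * u) /\ forall i, {ae leb, forall x, gr i (f * u) x = (f * gr i u + T i * u) x}.
Proof.
move=> hu C0 mf mT fC TC fL fT; have Lu := H1_L2 hu.
have LM (g k : E -> R) (D : R) : measurable_fun setT g -> (forall x, `|g x| <= D) -> L2 k ->
    L2 (g * k) /\ nsq (g * k) <= D ^+ 2 * nsq k.
  move=> mg gD Lk; have mgk : measurable_fun setT (g * k) by apply: measurable_funM => //; exact: L2_meas Lk.
  have b x : `|(g * k) x| <= `|(D *: k) x|.
    by rewrite !fE !normrM ler_wpM2r// (le_trans (gD x))// ler_norm.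
  split; first exact: L2_le mgk b (L2Z D Lk).
  by rewrite -nsqZ//; apply: nsq_le => //; exact: L2Z.
have msh y : measurable_fun setT (sh y f) by exact: mpres_meas (mpres_shift y) mf.
apply: H1_of_dq => [|i|i]; [exact: (LM f u C mf fC Lu).1| |].
  by apply: L2D; [exact: (LM _ _ C mf fC (gr_L2 i hu)).1|exact: (LM _ _ C (mT i) (TC i) Lu).1].
have Lg := gr_L2 i hu; pose y n := hs n *: ei i.
(* Discrete Leibniz rule: the quotient of [f * u] minus its expected limit is [A n + B n + D n], and
   each summand tends to 0 for its own reason: convergence of the quotients of [u], the Lipschitz
   bound on [f], dominated convergence. *)
pose A n := sh (y n) f * (dq (hs n) i u - gr i u).
pose B n := (sh (y n) f - f) * gr i u.
pose D n := (dq (hs n) i f - T i) * u.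
have LA n : L2 (A n) /\ nsq (A n) <= C ^+ 2 * nsq (dq (hs n) i u - gr i u).
  by apply: LM => //; [move=> x; exact: fC|exact: L2B (L2_dq _ _ Lu) Lg].
have LB n : L2 (B n) /\ nsq (B n) <= (C * hs n) ^+ 2 * nsq (gr i u).
  apply: LM => //; first exact: measurable_funB.
  by move=> x; rewrite !fE (le_trans (fL _ _ _))// ger0_norm// ltW// hs_gt0.
have mdq n : measurable_fun setT (dq (hs n) i f - T i).
  by apply: measurable_funB => //; apply: measurable_funM => //; apply: measurable_funB.
have bdq n x : `|(dq (hs n) i f - T i) x| <= 2 * C.
  rewrite !fE (le_trans (ler_normB _ _))// mulr_natl mulr2n lerD//.
  rewrite normrM normfV ler_pdivrMl ?normr_gt0 ?hs_neq0// mulrC; exact: fL.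
have LD n : L2 (D n) by exact: (LM _ _ _ (mdq n) (bdq n) Lu).1.
have cA : nsq (A n) @[n --> \oo] --> 0.
  apply: (@squeeze0 _ _ _ _ _ (fun n => C ^+ 2 * nsq (dq (hs n) i u - gr i u))).
    by apply: nearW => n; rewrite ger0_norm ?nsq_ge0//; exact: (LA n).2.
  by rewrite -(mulr0 (C ^+ 2)); apply: cvgMl_tmp; apply: H1_dq_cvg => //; [exact: hs_neq0|exact: hs_cvg0].
have cB : nsq (B n) @[n --> \oo] --> 0.
  apply: (@squeeze0 _ _ _ _ _ (fun n => (C ^+ 2 * nsq (gr i u)) * hs n)).
    apply: nearW => n; rewrite ger0_norm ?nsq_ge0// (le_trans (LB n).2)// exprMn mulrAC.
    rewrite ler_wpM2l ?mulr_ge0 ?sqr_ge0 ?nsq_ge0// expr2 ger_pMl ?hs_gt0//.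
    by have := hs_le1 n; rewrite ger0_norm// ltW// hs_gt0.
  by rewrite -(mulr0 (C ^+ 2 * nsq (gr i u))); apply: cvgMl_tmp; exact: hs_cvg0.
have cD : nsq (D n) @[n --> \oo] --> 0.
  have [|||n x|_] := @dominated_int _ _ _ leb (fun n x => D n x ^+ 2) (fun=> 0) ((2 * C) ^+ 2 *: (fun x => u x ^+ 2)).
  - by move=> n; apply: measurable_funX; exact: L2_meas (LD n).
  - move=> x.
    have c1 : ((dq (hs n) i f - T i) x * u x) @[n --> \oo] --> (T i x - T i x) * u x.
      by apply: cvgMr_tmp; apply: cvgB; [exact: fT|exact: cvg_cst].
    have c2 : (((dq (hs n) i f - T i) x * u x) * ((dq (hs n) i f - T i) x * u x)) @[n --> \oo] -->
      ((T i x - T i x) * u x) * ((T i x - T i x) * u x) by apply: cvgM.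
    by move: c2; rewrite subrr !mul0r; apply: cvg_eqr => n; rewrite expr2.
  - by apply: itgZ; exact: Lu.2.
  - rewrite ger0_norm ?sqr_ge0// /D !fE exprMn ler_wpM2r ?sqr_ge0//.
    by rewrite -real_normK ?num_real// lerXn2r ?nnegrE ?mulr_ge0// (le_trans _ (bdq n x))// !fE.
  - by rewrite Rintegral_cst// mul0r.
have cAB := nsq_cvgD _ (fun n => (LA n).1) (L20 leb) (fun n => (LB n).1) (L20 leb).
have {}cAB : nsq ((A n + B n) - (0 + 0)) @[n --> \oo] --> 0.
  by apply: cAB; under eq_fun do rewrite subr0.
have {cAB}cABD : nsq ((A n + B n + D n) - (0 + 0 + 0)) @[n --> \oo] --> 0.
  apply: nsq_cvgD => //.
  - by move=> n; exact: L2D (LA n).1 (LB n).1.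
  - exact: L2D (L20 _) (L20 _).
  - exact: L20.
  - by under eq_fun do rewrite subr0.
move: cABD; apply: cvg_eqr => n; congr nsq; apply/funext => x.
rewrite /A /B /D /y /dq /sh !fE.
have hn : hs n != 0 by exact: hs_neq0.
by move: (f _) (f _) (u _) (u _) (gr _ _ _) (T _ _) => p q r s t a; field.
Qed.

End sobolev_maps.

(** * Averages, level sets and powers *)

Section averages.
Context {R : realType} {N : nat}.
Local Notation E := 'rV[R]_N.
Local Notation leb := (@lebesgue_rV R N).
Local Notation itg := (itg leb).
Local Notation L2 := (L2 leb).
Local Notation dot := (l2dot leb).
Local Notation nsq := (l2sq leb).
Implicit Types (f g u v w : E -> R) (x y z : E) (i j : 'I_N) (A : set E).
Opaque dotD dirichlet gr grad H1.

Lemma itg_fin f (C : R) : measurable_fun setT f -> (forall x, 0 <= f x) ->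
  (\int[leb]_x (f x)%:E <= C%:E)%E -> itg f /\ \int[leb]_x f x <= C.
Proof.
move=> mf f0 fC.
have h : itg f.
  apply/integrableP; split; first exact/measurable_EFinP.
  under eq_integral => x _ do rewrite /= ger0_norm//.
  by rewrite (le_lt_trans fC)// ltry.
by split => //; rewrite -lee_fin -int_fin.
Qed.

Definition lm A : R := fine (leb A).

Lemma itg_indic A : measurable A -> (leb A < +oo)%E ->
  itg (\1_A : E -> R) /\ \int[leb]_x (\1_A x : R) = lm A.
Proof.
move=> mA Afin; split; last by rewrite /Rintegral integral_indic// setIT.
apply/integrableP; split; first by apply/measurable_EFinP; exact: measurable_indic.
by under eq_integral do rewrite /= ger0_norm//; rewrite integral_indic ?setIT.
Qed.

Lemma L2_indic A : measurable A -> (leb A < +oo)%E -> L2 (\1_A : E -> R) /\ nsq (\1_A : E -> R) = lm A.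
Proof.
move=> mA Afin; have [h1 h2] := itg_indic mA Afin.
have e : (fun x => (\1_A x : R) ^+ 2) = (\1_A : E -> R).
  by apply/funext => x; rewrite indicE; case: (_ \in _); rewrite ?expr1n ?expr0n.
by split; [split; [exact: measurable_indic|rewrite e]|rewrite /l2sq e].
Qed.

Lemma L2_mul_indic f A : measurable A -> L2 f -> L2 (f * \1_A) /\ nsq (f * \1_A) <= nsq f.
Proof.
move=> mA hf; have m : measurable_fun setT (f * \1_A).
  by apply: measurable_funM; [exact: (L2_meas hf)|exact: measurable_indic].
have b x : `|(f * \1_A) x| <= `|f x|.
  by rewrite !fE indicE; case: (_ \in _); rewrite ?mulr1 ?mulr0 ?normr0.
by split; [exact: L2_le m b hf|exact: nsq_le].
Qed.

Lemma lm_ge0 A : 0 <= lm A. Proof. by rewrite /lm fine_ge0. Qed.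

Lemma lm_cube (r : R) : 0 <= r -> lm (cube r) = (2 * r) ^+ N.
Proof. by move=> r0; rewrite /lm leb_cube. Qed.

Lemma le_lm A B : measurable A -> measurable B -> (leb B < +oo)%E -> A `<=` B -> lm A <= lm B.
Proof.
move=> mA mB fB AB; have h : (leb A <= leb B)%E by apply: le_measure; rewrite ?inE.
by apply: fine_le => //; rewrite ge0_fin_numE//; exact: le_lt_trans fB.
Qed.

Lemma chebyshev_nsq f A (k : R) : 0 < k -> L2 f -> measurable A -> (forall x, A x -> k <= `|f x|) ->
  (leb A < +oo)%E /\ k ^+ 2 * lm A <= nsq f.
Proof.
move=> k0 hf mA Ak; have k2 : 0 < k ^+ 2 by rewrite exprn_gt0.
have h : ((k ^+ 2)%:E * leb A <= (nsq f)%:E)%E.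
  rewrite -(int_fin hf.2) -[X in leb X](setIT A) -integral_indic// -ge0_integralZl_EFin//; [|by apply/measurable_EFinP; exact: measurable_indic|exact: ltW].
  apply: ge0_le_integral => //.
  - by move=> x _; rewrite -EFinM lee_fin mulr_ge0 ?(ltW k2)// indicE.
  - by apply/measurable_EFinP; apply: measurable_funM => //; exact: measurable_indic.
  - apply/measurable_EFinP; exact: itg_meas hf.2.
  - move=> x _; rewrite -EFinM lee_fin indicE; case: (boolP (x \in A)); rewrite ?mulr0 ?sqr_ge0// inE => Ax.
    by rewrite mulr1 -[X in _ <= X]real_normK ?num_real// lerXn2r ?nnegrE ?(ltW k0)// Ak.
have Afin : (leb A < +oo)%E.
  rewrite ltey; apply/negP => /eqP Ay; move: h.
  move: Ay; case: (leb A) => [r| |]//.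
  by rewrite gt0_muley ?lte_fin// leye_eq.
by split => //; rewrite -lee_fin EFinM /lm fineK// ge0_fin_numE.
Qed.

(** The mean of [u] over [x + A]: cubes serve the quantitative estimates, balls the radial
    symmetry. *)
Definition avg A u x : R := (lm A)^-1 * dot (sh x u) (\1_A).

Lemma measurable_add2 (u : E -> R) : measurable_fun setT u -> measurable_fun setT (fun p : E * E => u (p.1 + p.2)).
Proof. by move=> mu; apply: (measurableT_comp mu); apply: measurable_addv. Qed.

Lemma meas_avg A u : measurable A -> (leb A < +oo)%E -> L2 u -> measurable_fun setT (avg A u).
Proof.
move=> mA Afin hu; apply: measurable_funM => //; have mu := L2_meas hu.
have mi : measurable_fun setT (fun p : E * E => (\1_A p.2 : R)).
  by apply: (measurableT_comp (f := \1_A : E -> R)) => //; exact: measurable_indic.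
(* The values [s = 1] and [s = -1] give the positive and the negative part, to which Tonelli's
   theorem applies. *)
have H (s : R) : measurable_fun setT (fun x => (\int[leb]_y (Num.max (s * u (x + y)) 0 * \1_A y)%:E)%E).
  pose F (p : E * E) := (Num.max (s * u (p.1 + p.2)) 0 * \1_A p.2)%:E.
  apply: (@measurable_fun_fubini_tonelli_F _ _ _ _ _ leb F).
    apply/measurable_EFinP; apply: measurable_funM => //; apply: measurable_maxr => //.
    by apply: measurable_funM => //; exact: measurable_add2.
  by move=> p; rewrite lee_fin mulr_ge0// le_max lexx orbT.
pose G (s : R) x := \int[leb]_y (Num.max (s * u (x + y)) 0 * \1_A y).
have mG s : measurable_fun setT (G s) by apply: (measurableT_comp (f := @fine R)) => //; exact: H.
have -> : (fun x => dot (sh x u) (\1_A : E -> R)) = G 1 \- G (-1).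
  apply/funext => x; rewrite /G /= -intB.
  - apply: eq_Rintegral => y _; rewrite /sh (addrC y) mul1r mulN1r -mulrBl; congr (_ * _).
    rewrite /Num.max; case: ltrP => h1; case: ltrP => h2; lra.
  - have [L _] := L2_indic mA Afin.
    apply: (itg_mul (f := fun y => Num.max (1 * u (x + y)) 0)) => //.
    apply: (L2_le _ _ (L2_sh x hu)); last first.
      by move=> y; rewrite /sh (addrC y) mul1r /Num.max; case: ltrP => // _; rewrite normr0.
    apply: measurable_maxr => //; apply: measurable_funM => //; apply: (measurableT_comp mu); exact: measurable_addv.
  - have [L _] := L2_indic mA Afin.
    apply: (itg_mul (f := fun y => Num.max (-1 * u (x + y)) 0)) => //.
    apply: (L2_le _ _ (L2_sh x hu)); last first.
      by move=> y; rewrite /sh (addrC y) mulN1r /Num.max; case: ltrP => // _; rewrite ?normr0 ?normrN.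
    apply: measurable_maxr => //; apply: measurable_funM => //; apply: (measurableT_comp mu); exact: measurable_addv.
exact: measurable_funB.
Qed.

Lemma avgB A u (x : E) : measurable A -> (leb A < +oo)%E -> 0 < lm A -> L2 u ->
  (avg A u x - u x) ^+ 2 <= (lm A)^-1 * \int[leb]_y ((u (x + y) - u x) ^+ 2 * \1_A y).
Proof.
move=> mA Afin A0 hu; have [L1 n1] := L2_indic mA Afin; have Ls := L2_sh x hu.
have [LsA _] := L2_mul_indic mA Ls.
pose g := sh x u * \1_A - u x *: (\1_A : E -> R).
have Lg : L2 g by apply: L2B => //; exact: L2Z.
have e1 : avg A u x - u x = (lm A)^-1 * dot g (\1_A).
  rewrite /g dotBl//; last exact: L2Z.
  rewrite dotZl// dotff n1 mulrBr mulrCA mulVf ?gt_eqF// mulr1; congr (_ * _ - _).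
  by apply: eq_Rintegral => y _; rewrite !fE indicE; case: (_ \in _); rewrite ?mulr1 ?mulr0.
have -> : \int[leb]_y ((u (x + y) - u x) ^+ 2 * \1_A y) = nsq g.
  apply: eq_Rintegral => y _; rewrite /g /sh !fE indicE (addrC x).
  by case: (_ \in _); rewrite ?mulr1 ?mulr0 ?subr0// expr0n.
rewrite e1 exprMn; have := dot_CS Lg L1; rewrite n1 => h.
rewrite (le_trans (ler_wpM2l (sqr_ge0 _) h))// expr2 -mulrA ler_wpM2l ?invr_ge0 ?lm_ge0//.
by rewrite mulrCA mulVf ?gt_eqF// mulr1.
Qed.

(** Cauchy-Schwarz on [A] followed by Tonelli: the squared distance of [u] to its averages is at
    most the mean over [y] in [A] of the squared norm of [sh y u - u]. *)
Lemma nsq_avg_le A u (C : R) : measurable A -> (leb A < +oo)%E -> 0 < lm A -> L2 u ->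
  (forall y, A y -> nsq (sh y u - u) <= C) -> L2 (avg A u) /\ nsq (avg A u - u) <= C.
Proof.
move=> mA Afin A0 hu HC; have ma := meas_avg mA Afin hu; have mu := L2_meas hu.
have m1 : measurable_fun setT (avg A u - u) by exact: measurable_funB.
pose F (p : E * E) : \bar R := ((u (p.1 + p.2) - u p.1) ^+ 2 * \1_A p.2)%:E.
have mF : measurable_fun setT F.
  apply/measurable_EFinP; apply: measurable_funM.
    apply: measurable_funX; apply: measurable_funB; first exact: measurable_add2.
    by apply: measurableT_comp.
  by apply: (measurableT_comp (f := \1_A : E -> R)) => //; exact: measurable_indic.
have F0 p : (0 <= F p)%E by rewrite lee_fin mulr_ge0 ?sqr_ge0// indicE.
have V0 : 0 <= (lm A)^-1 by rewrite invr_ge0 lm_ge0.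
have [] := @itg_fin (fun x => (avg A u - u) x ^+ 2) C.
- exact: measurable_funX.
- by move=> x; exact: sqr_ge0.
- apply: (@le_trans _ _ (\int[leb]_x ((lm A)^-1%:E * fubini_F leb F x))%E).
    apply: ge0_le_integral => //.
    + by move=> x _; rewrite lee_fin sqr_ge0.
    + by apply/measurable_EFinP; exact: measurable_funX.
    + by apply: measurable_funeM; exact: measurable_fun_fubini_tonelli_F.
    + move=> x _; have Lg : itg (fun y => (u (x + y) - u x) ^+ 2 * \1_A y).
        have [L1 _] := L2_indic mA Afin; have [LsA _] := L2_mul_indic mA (L2_sh x hu).
        have [_] := L2B LsA (L2Z (u x) L1); congr itg; apply/funext => y.
        by rewrite /sh !fE indicE (addrC x); case: (_ \in _); rewrite ?mulr1 ?mulr0 ?subr0// expr0n.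
      by rewrite /fubini_F /F /= int_fin// -EFinM lee_fin !fE; exact: avgB.
  rewrite ge0_integralZl//=; [|exact: measurable_fun_fubini_tonelli_F|by move=> x _; apply: integral_ge0].
  rewrite /fubini_F fubini_tonelli//.
  apply: (@le_trans _ _ ((lm A)^-1%:E * \int[leb]_y (C%:E * (\1_A y)%:E))%E); last first.
    have C0 : 0 <= C.
      suff [y Ay] : A !=set0 by exact: (le_trans (nsq_ge0 _ _) (HC y Ay)).
      by apply/set0P/eqP => A0'; move: A0; rewrite A0' /lm measure0 ltxx.
    rewrite ge0_integralZl_EFin//; last by apply/measurable_EFinP; exact: measurable_indic.
    have [I1 e1] := itg_indic mA Afin; rewrite (int_fin I1) e1 -!EFinM lee_fin.
    by rewrite mulrCA mulVf ?mulr1// gt_eqF.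
  apply: lee_wpmul2l; first by rewrite lee_fin.
  apply: ge0_le_integral => //.
  + by move=> y _; exact: integral_ge0.
  + exact: measurable_fun_fubini_tonelli_G.
  + apply: measurable_funeM; apply/measurable_EFinP; exact: measurable_indic.
  move=> y _; rewrite /F /=; have LL := L2B (L2_sh y hu) hu.
  rewrite indicE; case: (boolP (y \in A)); rewrite ?inE => Ay; last first.
    by rewrite mule0 integral0_eq// => x _; rewrite mulr0.
  rewrite mule1 (_ : (fun x => _) = fun x => ((sh y u - u) x ^+ 2)%:E).
    by rewrite (int_fin LL.2) lee_fin; exact: HC.
  by apply/funext => x; rewrite mulr1 /sh !fE.
move=> h1 h2; split => //.
have -> : avg A u = (avg A u - u) + u by rewrite subrK.
by apply: L2D.
Qed.

Lemma avg_le A u x : measurable A -> (leb A < +oo)%E -> 0 < lm A -> L2 u ->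
  avg A u x ^+ 2 <= (lm A)^-1 * nsq u.
Proof.
move=> mA Afin A0 hu; have [L1 n1] := L2_indic mA Afin.
rewrite exprMn; have := dot_CS (L2_sh x hu) L1; rewrite n1 nsq_sh// => h.
rewrite (le_trans (ler_wpM2l (sqr_ge0 _) h))// expr2 -mulrA ler_wpM2l ?invr_ge0 ?lm_ge0//.
by rewrite mulrCA mulVf ?gt_eqF// mulr1.
Qed.

(** A displacement in the cube is a succession of [N] moves along the axes, each costing at most [h]
    times the root of the Dirichlet energy. *)
Lemma nsq_sh_cube u y (h : R) : H1 u -> 0 <= h -> cube h y ->
  nsq (sh y u - u) <= (N%:R * h) ^+ 2 * dirichlet u.
Proof.
move=> hu h0 /cubeP yh; have Lu := H1_L2 hu.
have D0 := dirichlet_ge0 u.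
have S (s : seq 'I_N) : nsq (sh (\sum_(j <- s) y ord0 j *: ei j) u - u) <= ((size s)%:R * (h * Num.sqrt (dirichlet u))) ^+ 2.
  elim: s => [|j s IH]; first by rewrite big_nil sh0 subrr nsq0 mul0r expr0n.
  rewrite big_cons; set z := \sum_(_ <- _) _ in IH *.
  have -> : sh (y ord0 j *: ei j + z) u - u = sh z (sh (y ord0 j *: ei j) u - u) + (sh z u - u).
    by rewrite shB sh_sh (addrC z) addrA subrK.
  rewrite [size _]/= -[(size s).+1]add1n natrD mulrDl mul1r.
  have LL := L2B (L2_sh (y ord0 j *: ei j) Lu) Lu.
  apply: nsqD_sqr => //; [by rewrite mulr_ge0 ?sqrtr_ge0|by rewrite mulr_ge0 ?mulr_ge0 ?sqrtr_ge0|
    exact: L2_sh|exact: L2B (L2_sh _ Lu) Lu|].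
  rewrite (nsq_sh z LL) (le_trans (H1_dq_le _ _ hu))// exprMn (sqr_sqrtr D0).
  apply: ler_pM; [exact: sqr_ge0|exact: nsq_ge0| |].
    by rewrite -real_normK ?num_real// lerXn2r ?nnegrE.
  rewrite (dirichletE hu) (bigD1 j)//= lerDl; apply: sumr_ge0 => i _; exact: nsq_ge0.
have := S (index_enum 'I_N).
have -> : \sum_(j <- index_enum 'I_N) y ord0 j *: ei j = y by rewrite [RHS]row_sum_delta.
have -> : size (index_enum 'I_N) = N by rewrite -[RHS](card_ord N) cardT /= enumT.
by rewrite mulrA exprMn (sqr_sqrtr D0).
Qed.

Lemma avg_cube_le u (h : R) : H1 u -> 0 < h ->
  L2 (avg (cube h) u) /\ nsq (avg (cube h) u - u) <= (N%:R * h) ^+ 2 * dirichlet u.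
Proof.
move=> hu h0; apply: nsq_avg_le.
- exact: cube_measurable.
- by rewrite leb_cube ?ltry// ltW.
- by rewrite lm_cube ?(ltW h0)// exprn_gt0// mulr_gt0.
- exact: H1_L2.
by move=> y; apply: nsq_sh_cube => //; exact: ltW.
Qed.

End averages.

(** * Decay of the level sets of an H^1 function *)

Section level_sets.
Context {R : realType} {N : nat}.
Local Notation E := 'rV[R]_N.
Local Notation leb := (@lebesgue_rV R N).
Local Notation L2 := (L2 leb).
Local Notation nsq := (l2sq leb).
Implicit Types (f g u v w : E -> R) (x y z : E) (i j : 'I_N) (A : set E).
Opaque dotD dirichlet gr grad H1.

Definition lev u (k : R) : set E := [set x | k < `|u x|].
Definition la u (k : R) : R := lm (lev u k).

Lemma lev_meas u k : measurable_fun setT u -> measurable (lev u k).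
Proof.
move=> mu; have -> : lev u k = (fun x => `|u x|) @^-1` `]k, +oo[.
  by apply/seteqP; split => x; rewrite /lev /= in_itv/= andbT.
rewrite -[X in measurable X]setTI.
have m : measurable_fun setT (fun x => `|u x|) by exact: measurableT_comp.
by apply: m.
Qed.

Lemma lev_fin u k : 0 < k -> L2 u -> (leb (lev u k) < +oo)%E /\ k ^+ 2 * la u k <= nsq u.
Proof.
move=> k0 hu; apply: chebyshev_nsq => //; first exact: (lev_meas _ (L2_meas hu)).
by move=> x /ltW.
Qed.

Lemma quarter_le (k a b : R) : 4 * a <= b -> k ^+ 2 * a <= b * (k / 2) ^+ 2.
Proof. by move=> h; rewrite (_ : b * _ = k ^+ 2 * (b / 4)); [rewrite ler_wpM2l ?sqr_ge0//; lra|field]. Qed.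

Lemma half_dist (k a : R) : a <= k / 2 -> k / 2 <= `|k - a|.
Proof. by move=> h; rewrite (le_trans _ (ler_norm _))//; lra. Qed.

Lemma quarter_mul (k a b : R) : (k / 2) ^+ 2 * a <= b -> k ^+ 2 * a <= 4 * b.
Proof. by move=> h; rewrite (_ : k ^+ 2 * a = 4 * ((k / 2) ^+ 2 * a)); [rewrite ler_wpM2l|field]. Qed.

Lemma twice_sub (k t : R) : 0 < k -> 2 * k < t -> 0 <= t - k. Proof. lra. Qed.

(* [v] is [|u|] truncated between [k] and [2 * k].  Its average over a cube of volume at least
   [4 * la u k] is at most [k / 2], hence far from [v] where [2 * k < |u|]. *)
Lemma level_step u (k h : R) : H1 u -> 0 < k -> 0 < h -> 4 * la u k <= (2 * h) ^+ N ->
  k ^+ 2 * la u (2 * k) <= 4 * ((N%:R * h) ^+ 2 * dirichlet u).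
Proof.
move=> hu k0 h0 hh; have Lu := H1_L2 hu; have mu := L2_meas Lu.
pose v x := Num.min (Num.max (`|u x| - k) 0) k.
have mv : measurable_fun setT v.
  by apply: measurable_minr => //; apply: measurable_maxr => //; apply: measurable_funB => //; exact: measurableT_comp.
have v0 x : 0 <= v x by rewrite /v le_min le_max lexx orbT ltW.
have vk x : v x <= k by rewrite /v ge_min lexx orbT.
have vu x : `|v x| <= `|u x|.
  rewrite ger0_norm// /v ge_min ge_max normr_ge0 andbT; apply/orP; left; rewrite lerBlDr lerDl ltW//.
have Lv : L2 v by exact: L2_le mv vu Lu.
have minL (a b c : R) : `|Num.min a c - Num.min b c| <= `|a - b|.
  have A := ler_norm (a - b); have B := ler_norm (b - a); rewrite (distrC b) in B.
  rewrite ler_norml /Num.min; case: ltrP => h1; case: ltrP => h2; apply/andP; split; lra.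
have maxL (a b c : R) : `|Num.max a c - Num.max b c| <= `|a - b|.
  have A := ler_norm (a - b); have B := ler_norm (b - a); rewrite (distrC b) in B.
  rewrite ler_norml /Num.max; case: ltrP => h1; case: ltrP => h2; apply/andP; split; lra.
have [hv Dv] : H1 v /\ dirichlet v <= 1 ^+ 2 * dirichlet u.
  apply: H1_increment_le => // x y; rewrite mul1r (le_trans (minL _ _ _))// (le_trans (maxL _ _ _))//.
  by rewrite opprB addrA subrK ler_dist_dist.
rewrite expr1n mul1r in Dv.
have [fin1 _] := lev_fin k0 Lu; have ml := lev_meas k mu.
have [L1 n1] := L2_indic ml fin1.
have nv : nsq v <= k ^+ 2 * la u k.
  rewrite /la -n1 -nsqZ//; apply: nsq_le => //; first exact: L2Z.
  move=> x; rewrite !fE indicE; case: (boolP (x \in lev u k)) => hx.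
    by rewrite mulr1 !ger0_norm// ltW.
  rewrite mulr0 normr0 ger0_norm// /v ge_min ge_max lexx andbT.
  by move: hx; rewrite notin_setE /lev /= => /negP; rewrite -leNgt => hx; rewrite subr_le0 hx.
have [La nA] := avg_cube_le hv h0.
have H : (2 * h) ^+ N > 0 by rewrite exprn_gt0// mulr_gt0.
have ab x : `|avg (cube h) v x| <= k / 2.
  have k2 : 0 <= k / 2 by rewrite divr_ge0// ltW.
  rewrite -ler_sqr ?nnegrE// real_normK ?num_real//.
  apply: le_trans (avg_le _ _ _ _ Lv) _.
  - exact: cube_measurable.
  - by rewrite leb_cube ?ltry// ltW.
  - by rewrite lm_cube// ltW.
  rewrite lm_cube ?(ltW h0)// ler_pdivrMl//.
  exact: le_trans nv (quarter_le _ hh).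
have mA := L2_meas La.
have k2 : 0 < k / 2 by rewrite divr_gt0.
have [] := @chebyshev_nsq _ _ (avg (cube h) v - v) (lev u (2 * k)) (k / 2) k2.
- exact: L2B.
- exact: lev_meas.
- move=> x; rewrite /lev /= !fE => hx.
  have -> : v x = k.
    rewrite /v max_l ?min_r//; first by rewrite lerBrDr -mulr2n -mulr_natl ltW.
    exact: twice_sub k0 hx.
  have := ab x; rewrite distrC ler_norml => /andP[_ h1].
  exact: half_dist h1.
move=> _; rewrite -/(la _ _) => h1.
have h2 : (N%:R * h) ^+ 2 * dirichlet v <= (N%:R * h) ^+ 2 * dirichlet u by rewrite ler_wpM2l ?sqr_ge0.
have : (k / 2) ^+ 2 * la u (2 * k) <= (N%:R * h) ^+ 2 * dirichlet u.
  exact: le_trans h1 (le_trans nA h2).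
exact: quarter_mul.
Qed.

Lemma level_stepE (m : nat) u (k h : R) : N = m -> H1 u -> 0 < k -> 0 < h -> 4 * la u k <= (2 * h) ^+ m ->
  k ^+ 2 * la u (2 * k) <= 4 * ((m%:R * h) ^+ 2 * dirichlet u).
Proof. by move=> <-; exact: level_step. Qed.

Lemma la_ge0 u k : 0 <= la u k. Proof. exact: lm_ge0. Qed.

Lemma la_le u k k' : 0 < k -> k <= k' -> L2 u -> la u k' <= la u k.
Proof.
move=> k0 kk hu; apply: le_lm; [exact: (lev_meas _ (L2_meas hu))|exact: (lev_meas _ (L2_meas hu))|by have [] := lev_fin k0 hu|].
by move=> x; rewrite /lev /=; exact: le_lt_trans.
Qed.

(** [level_step] is iterated along the levels [2 ^+ j], with [h] of the order of the [N]-th root of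
    the measure [la]. The next measure is then at most a constant times [4^-1 ^+ j * la ^ (2 / N)].
    For [N = 3] the decay [2^(-6 j)] reproduces itself, which is the Sobolev exponent 6; for
    [N = 1, 2] the power of [la] is at least 1, so the decay beats every geometric rate and [s] may
    be any integer above [q]. *)
Lemma level_decay (q T : R) : (1 <= N <= 3)%N -> (N = 3%N -> q < 6) -> exists s : nat, exists K : R,
  [/\ q < s%:R, 0 <= K & forall u, H1 u -> nsq u <= T -> dirichlet u <= T ->
  forall j : nat, la u (2 ^+ j) <= K * (2^-1 ^+ s) ^+ j].
Proof.
move=> hN hq.
have [T' [T1 TT]] : exists T' : R, 1 <= T' /\ T <= T'.
  by exists (Num.max 1 T); rewrite !le_max !lexx orbT.
have two0 (j : nat) : 0 < 2 ^+ j :> R by rewrite exprn_gt0.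
have base u (j : nat) : H1 u -> nsq u <= T -> la u (2 ^+ j) <= T'.
  move=> hu uT; have Lu := H1_L2 hu; have [_] := @lev_fin u 1 ltr01 Lu; rewrite expr1n mul1r => h.
  rewrite (le_trans _ (le_trans uT TT))// (le_trans _ h)//; apply: la_le => //.
  by rewrite exprn_ege1// ler1n.
have [N3|N3] := eqVneq N 3%N.
  (* The constant is [36 * 64]: the first factor is [4 * 3 ^+ 2] from the level step with [N = 3],
     the second is the gain [2 ^+ 6] required at each doubling. *)
  have [c [c1 cT c36]] : exists c : R, [/\ 1 <= c, T' <= c & 2304 * T' <= c] by exists (2304 * T'); split; lra.
  have c0 : 0 < c by exact: lt_le_trans ltr01 c1.
  exists 6%N, (c ^+ 3); split; [exact: hq|by rewrite exprn_ge0// ltW|].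
  move=> u hu uT DT; elim=> [|j IH].
    rewrite expr0 mulr1 (le_trans (base u 0%N hu uT))// (le_trans cT)// exprS ler_peMr ?(ltW c0)//.
    exact: exprn_ege1.
  pose X : R := 4^-1 ^+ j; have X0 : 0 < X by rewrite exprn_gt0// invr_gt0.
  have e6 : (2^-1 ^+ 6) ^+ j = X ^+ 3.
    by rewrite /X [RHS]exprAC; congr (_ ^+ _); rewrite !exprVn; congr (_^-1); ring.
  have e4 : 2 ^+ j ^+ 2 = X^-1.
    by rewrite exprAC /X -exprVn invrK; congr (_ ^+ _); ring.
  rewrite e6 in IH.
  have h0 : 0 < c * X by rewrite mulr_gt0.
  have := level_stepE N3 hu (two0 j) h0; rewrite -exprS e4 => /(_ _)/wrap[].
    rewrite !exprMn; move: IH (mulr_gt0 (exprn_gt0 3 c0) (exprn_gt0 3 X0)); move: (c ^+ 3 * _) => Y; lra.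
  rewrite ler_pdivrMl// => h; apply: (le_trans h).
  have -> : (2^-1 ^+ 6) ^+ j.+1 = X ^+ 3 / 64 by rewrite exprSr e6; congr (_ * _); lra.
  have D0 := dirichlet_ge0 u.
  have h2 : 4 * ((3 * (c * X)) ^+ 2 * dirichlet u) <= 4 * ((3 * (c * X)) ^+ 2 * T').
    by rewrite ler_wpM2l// ler_wpM2l ?sqr_ge0// (le_trans DT).
  rewrite (le_trans (ler_wpM2l (ltW X0) h2))// (_ : X * _ = X ^+ 3 * c ^+ 2 * (36 * T')); last by ring.
  rewrite (_ : c ^+ 3 * _ = X ^+ 3 * c ^+ 2 * (c / 64)); last by field.
  rewrite ler_wpM2l ?mulr_ge0 ?exprn_ge0 ?(ltW c0) ?(ltW X0)//; lra.
have [s qs] : exists s : nat, q < s%:R.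
  by exists (Num.truncn q).+1; exact: truncnS_gt.
have r0 : 0 < 2^-1 ^+ s :> R by rewrite exprn_gt0// invr_gt0.
set r := 2^-1 ^+ s in r0 *.
have r1 : r <= 1 by rewrite exprn_ile1// ?invr_ge0// invf_le1// ler1n.
have T0 : 0 < T' by exact: lt_le_trans ltr01 T1.
(* From [j0] on, each step gains the factor [r]; the earlier levels obey the trivial bound [T'], and
   the division by [r ^+ j0] in the constant pays for them. *)
have [j0 hj0] : exists j0 : nat, 16 * T' ^+ 2 * 4^-1 ^+ j0 <= r.
  have : (4^-1 ^+ n : R) @[n --> \oo] --> 0.
    by apply: cvg_expr; rewrite ger0_norm ?invr_ge0// invf_lt1// ltr1n.
  have d0 : 0 < r / (16 * T' ^+ 2) by rewrite divr_gt0// mulr_gt0// exprn_gt0.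
  move/cvgr0Pnorm_le => /(_ _ d0)[n _ /(_ n (leqnn n))] h; exists n.
  rewrite mulrC -ler_pdivlMr ?mulr_gt0 ?exprn_gt0//.
  by move: h; rewrite ger0_norm// exprn_ge0// invr_ge0.
exists s, (T' / r ^+ j0); split => //; first by rewrite divr_ge0 ?exprn_ge0// ltW.
move=> u hu uT DT; have Lu := H1_L2 hu; elim=> [|j IH].
  rewrite expr0 mulr1 (le_trans (base u 0%N hu uT))// ler_pdivlMr ?exprn_gt0//.
  by rewrite ler_piMr ?(ltW T0)// exprn_ile1 ?(ltW r0).
have [jj|jj] := ltnP j j0.
  rewrite (le_trans (base u _ hu uT))// -mulrA ler_peMr ?(ltW T0)// mulrC.
  by rewrite ler_pdivlMr ?exprn_gt0// mul1r ler_wiXn2l// ltW.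
have step : la u (2 ^+ j.+1) <= 16 * T' ^+ 2 * 4^-1 ^+ j * la u (2 ^+ j).
  pose X : R := 4^-1 ^+ j; have X0 : 0 < X by rewrite exprn_gt0// invr_gt0.
  have e4 : 2 ^+ j ^+ 2 = X^-1.
    by rewrite exprAC /X -exprVn invrK; congr (_ ^+ _); ring.
  rewrite -/X; have := la_ge0 u (2 ^+ j); rewrite le_eqVlt => /predU1P[a0|a0].
    rewrite -a0 mulr0 [leRHS]a0; apply: la_le => //.
    by rewrite exprS ler_peMl ?ler1n ?(ltW (two0 j)).
  have D0 := dirichlet_ge0 u; have aT := base u j hu uT; have DT' := le_trans DT TT.
  have [N1|N1] := eqVneq N 1%N.
    have h0 : 0 < 2 * la u (2 ^+ j) by rewrite mulr_gt0.
    have := level_stepE N1 hu (two0 j) h0; rewrite -exprS e4 => /(_ _)/wrap[].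
      by rewrite expr1; lra.
    rewrite ler_pdivrMl// => h; apply: (le_trans h).
    move: a0 D0 aT DT' T1 X0 {h h0 IH e4}; move: (la u _) (dirichlet u) => a D a0 D0 aT DT' T1 X0.
    have h1 : D * a <= T' ^+ 2 by rewrite expr2 ler_pM// ltW.
    have : 0 <= X * a by rewrite mulr_ge0// ltW.
    nra.
  have N2 : N = 2%N by case/andP: hN N3 N1; case: N => [|[|[|[|n]]]].
  have h0 : 0 < Num.sqrt (la u (2 ^+ j)) by rewrite sqrtr_gt0.
  have := level_stepE N2 hu (two0 j) h0; rewrite -exprS e4 => /(_ _)/wrap[].
    by rewrite exprMn sqr_sqrtr ?(ltW a0)//; lra.
  rewrite ler_pdivrMl// exprMn sqr_sqrtr ?(ltW a0)// => h; apply: (le_trans h).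
  move: a0 D0 aT DT' T1 X0 {h h0 IH e4}; move: (la u _) (dirichlet u) => a D a0 D0 aT DT' T1 X0.
  have h1 : D <= T' ^+ 2 by rewrite (le_trans DT')// expr2 ler_peMl// ltW.
  have : 0 <= X * a by rewrite mulr_ge0// ltW.
  nra.
rewrite (le_trans step)// [in leRHS]exprSr [leRHS]mulrA [leRHS]mulrC ler_pM ?la_ge0//.
  by rewrite !mulr_ge0 ?exprn_ge0 ?invr_ge0// ltW.
rewrite (le_trans _ hj0)// ler_wpM2l ?mulr_ge0 ?exprn_ge0 ?(ltW T0)//.
by rewrite ler_wiXn2l// ?invr_ge0// invf_le1// ler1n.
Qed.

End level_sets.

(** * Inequalities for real powers *)

Section powers.
Variable R : realType.
Implicit Types (a b s t x y r : R).

(** Young's inequality for the product of [t] and 1, with the conjugate exponents [r] and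
    [r / (r - 1)]. *)
Lemma bernoulli r t : 1 <= r -> 0 <= t -> 1 + r * (t - 1) <= t `^ r.
Proof.
rewrite le_eqVlt => /predU1P[<- t0|r1 t0]; first by rewrite powRr1// mul1r addrC subrK.
have r0 : 0 < r by exact: lt_trans r1.
have h := @conjugate_powR R t 1 r (r / (r - 1)) t0 ler01 r0.
have r10 : 0 < r - 1 by rewrite subr_gt0.
have := h (divr_gt0 r0 r10); rewrite powR1 mulr1 => {}h.
have : t <= t `^ r / r + 1 / (r / (r - 1)).
  by apply: h; field; rewrite !gt_eqF.
have -> : 1 / (r / (r - 1)) = (r - 1) / r by field; rewrite !gt_eqF.
by rewrite -mulrDl ler_pdivlMr// mulrBr mulr1 (mulrC t); lra.
Qed.

Lemma powR_tangent r x y : 1 <= r -> 0 <= x -> 0 <= y ->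
  y `^ r + r * y `^ (r - 1) * (x - y) <= x `^ r.
Proof.
move=> r1 x0; rewrite le_eqVlt => /predU1P[<-|y0].
  have rn0 : r != 0 by rewrite gt_eqF// (lt_le_trans ltr01).
  rewrite powR0// add0r subr0; have [->|rn] := eqVneq r 1.
    by rewrite subrr powRr0 mul1r mul1r powRr1.
  by rewrite powR0 ?subr_eq0// mulr0 mul0r powR_ge0.
have h := bernoulli r1 (divr_ge0 x0 (ltW y0)).
have yr : 0 < y `^ r by rewrite powR_gt0.
have e1 : y `^ r = y * y `^ (r - 1).
  by rewrite -[X in X * _](powRr1 (ltW y0)) -powRD ?(gt_eqF y0) ?implybT// addrC subrK.
have e2 : (x / y) `^ r * y `^ r = x `^ r.
  by rewrite -powRM ?divr_ge0// ?(ltW y0)// divfK// gt_eqF.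
rewrite -e2 (le_trans _ (ler_wpM2r (ltW yr) h))// mulrDl mul1r lerD2l e1.
by rewrite le_eqVlt; apply/orP; left; apply/eqP; field; rewrite gt_eqF.
Qed.

Lemma powR_homo r x y : 0 <= r -> 0 <= x -> x <= y -> x `^ r <= y `^ r.
Proof. by move=> r0 x0 xy; apply: ge0_ler_powR => //; rewrite nnegrE//; exact: le_trans xy. Qed.

Lemma powR_addexp x r s : 0 <= r -> 0 <= s -> 0 <= x -> 0 < r + s -> x `^ (r + s) = x `^ r * x `^ s.
Proof.
move=> r0 s0 _ rs; rewrite powRD//; apply/implyP => /eqP e; by rewrite e ltxx in rs.
Qed.

Section exponent.
Variable p : R.
Hypothesis p0 : 0 < p.

Definition pw s := `|s| `^ (p + 2).
(** [(p + 2) * dpowp p s] is the derivative of [pw p] at [s]. *)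
Definition dpowp s := `|s| `^ p * s.
Local Notation dpw := dpowp.

Lemma pw_ge0 s : 0 <= pw s. Proof. exact: powR_ge0. Qed.
Lemma pw_abs s : pw `|s| = pw s. Proof. by rewrite /pw normr_id. Qed.
Lemma pwN s : pw (- s) = pw s. Proof. by rewrite /pw normrN. Qed.
Lemma dpwN s : dpw (- s) = - dpw s. Proof. by rewrite /dpw normrN mulrN. Qed.
Lemma pw0 : pw 0 = 0. Proof. by rewrite /pw normr0 powR0// gt_eqF// addr_gt0. Qed.
Lemma pwE s : pw s = `|s| `^ p * s ^+ 2.
Proof.
rewrite /pw powR_addexp ?(ltW p0) ?ler0n ?normr_ge0 ?addr_gt0//; congr (_ * _).
by rewrite -[RHS]real_normK ?num_real// -powR_mulrn.
Qed.
Lemma dpwM s : dpw s * s = pw s. Proof. by rewrite pwE /dpw -mulrA -expr2. Qed.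
Lemma pwM a s : pw (a * s) = `|a| `^ (p + 2) * pw s.
Proof. by rewrite /pw normrM powRM. Qed.
Lemma dpw_pos s : 0 <= s -> dpw s = s `^ (p + 1).
Proof.
move=> s0; rewrite /dpw ger0_norm// powR_addexp ?(ltW p0) ?ler01 ?addr_gt0//.
by rewrite powRr1.
Qed.
Lemma dpw_ge0 s : 0 <= s -> 0 <= dpw s. Proof. by move=> s0; rewrite mulr_ge0 ?powR_ge0. Qed.
Lemma pw_pos s : 0 <= s -> pw s = s `^ (p + 2). Proof. by move=> s0; rewrite /pw ger0_norm. Qed.
Lemma abs_dpw s : `|dpw s| = dpw `|s|.
Proof. by rewrite /dpw normrM normr_id ger0_norm// powR_ge0. Qed.
Lemma dpw_homo s t : 0 <= s -> s <= t -> dpw s <= dpw t.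
Proof.
move=> s0 st; have t0 := le_trans s0 st.
by rewrite !dpw_pos//; apply: powR_homo => //; rewrite addr_ge0// ltW.
Qed.

(** Tangent inequality of a convex function, reduced to nonnegative arguments by parity. Integrated
    over space, it stands in for the differentiability of the power integral. *)
Lemma pw_convex a b : pw a + (p + 2) * dpw a * b <= pw (a + b).
Proof.
have H x y : 0 <= x -> 0 <= y -> pw x + (p + 2) * dpw x * (y - x) <= pw y.
  move=> x0 y0; rewrite !pw_pos// dpw_pos//.
  have := @powR_tangent (p + 2) y x; rewrite (_ : p + 2 - 1 = p + 1); last by ring.
  by apply => //; move: p0; lra.
have K x y : 0 <= x -> pw x + (p + 2) * dpw x * (y - x) <= pw y.
  move=> x0; have [y0|y0] := leP 0 y; first exact: H.
  rewrite -(pwN y); apply: le_trans (H x (- y) x0 _); last by rewrite oppr_ge0 ltW.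
  by rewrite lerD2l ler_wpM2l ?mulr_ge0 ?dpw_ge0//; move: p0; lra.
suff T y : pw a + (p + 2) * dpw a * (y - a) <= pw y by have := T (a + b); rewrite [a + b - a]addrC addKr.
have [a0|a0] := leP 0 a; first exact: K.
rewrite -(pwN a) -(pwN y) -[a]opprK (dpwN (- a)).
have := K (- a) (- y); rewrite oppr_ge0 => /(_ (ltW a0)); rewrite !opprK.
by have -> : (p + 2) * - dpw (- a) * (y - a) = (p + 2) * dpw (- a) * (- y + a) by ring.
Qed.

Lemma dpw_lip a b (M : R) : `|a| <= M -> `|b| <= M -> `|dpw a - dpw b| <= (p + 1) * M `^ p * `|a - b|.
Proof.
have H x y : 0 <= y -> y <= x -> x <= M -> dpw x - dpw y <= (p + 1) * M `^ p * (x - y).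
  move=> y0 yx xM; have x0 := le_trans y0 yx.
  have := @powR_tangent (p + 1) y x; rewrite addrK -!dpw_pos// => /(_ _ y0 x0) h.
  have {h} : dpw x - dpw y <= (p + 1) * x `^ p * (x - y).
    by have := h (ltac:(by rewrite lerDr ltW)); move: (dpw x) (dpw y) (_ `^ _) => A B C; lra.
  move/le_trans; apply; rewrite ler_wpM2r ?subr_ge0// ler_wpM2l ?addr_ge0 ?(ltW p0)//.
  by apply: powR_homo => //; exact: ltW.
have K x y : 0 <= y -> 0 <= x -> x <= M -> y <= M -> `|dpw x - dpw y| <= (p + 1) * M `^ p * `|x - y|.
  move=> y0 x0 xM yM; have [yx|/ltW xy] := leP y x.
    by rewrite !ger0_norm ?subr_ge0//; [exact: H|exact: dpw_homo].
  by rewrite distrC (distrC x) !ger0_norm ?subr_ge0//; [exact: H|exact: dpw_homo].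
have K2 x y : 0 <= y -> 0 <= x -> x <= M -> y <= M -> `|dpw x + dpw y| <= (p + 1) * M `^ p * `|x + y|.
  move=> y0 x0 xM yM; rewrite !ger0_norm ?addr_ge0 ?dpw_ge0// mulrDr.
  have L z : 0 <= z -> z <= M -> dpw z <= (p + 1) * M `^ p * z.
    move=> z0 zM; rewrite /dpw ger0_norm// ler_wpM2r//.
    rewrite -[leLHS]mul1r ler_pM ?powR_ge0 ?ler01//; first by rewrite lerDr ltW.
    by apply: powR_homo => //; exact: ltW.
  by rewrite lerD// L.
move=> aM bM; have [a0|/ltW a0] := leP 0 a; have [b0|/ltW b0] := leP 0 b.
- by rewrite ger0_norm// in aM; rewrite ger0_norm// in bM; exact: K.
- rewrite ger0_norm// in aM; rewrite ler0_norm// in bM.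
  by rewrite -[b]opprK (dpwN (- b)) !opprK; apply: K2; rewrite ?oppr_ge0.
- rewrite ler0_norm// in aM; rewrite ger0_norm// in bM.
  rewrite -[a]opprK (dpwN (- a)) -!opprD !normrN; apply: K2; rewrite ?oppr_ge0//.
- rewrite ler0_norm// in aM; rewrite ler0_norm// in bM.
  have -> : `|a - b| = `|- a - - b| by rewrite -normrN; congr `|_|; ring.
  have -> : `|dpw a - dpw b| = `|dpw (- a) - dpw (- b)| by rewrite !dpwN -normrN; congr `|_|; ring.
  by apply: K; rewrite ?oppr_ge0.
Qed.

Lemma max_powR r a b : 0 <= r -> 0 <= a -> 0 <= b -> (a + b) `^ r <= 2 `^ r * (a `^ r + b `^ r).
Proof.
move=> r0 a0 b0; wlog ab : a b a0 b0 / a <= b.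
  move=> h; have [/h|/ltW/h] := leP a b; first exact.
  by rewrite addrC (addrC (a `^ r)); apply.
have : (a + b) `^ r <= (2 * b) `^ r by apply: powR_homo; rewrite ?addr_ge0// mulr_natl mulr2n lerD2r.
by move/le_trans; apply; rewrite powRM// ler_wpM2l ?powR_ge0// lerDr powR_ge0.
Qed.

(** Upper counterpart of [pw_convex]: the tangent at [a + b] bounds the increment, and replacing it
    by the tangent at [a] costs a second-order term through the Lipschitz bound [dpw_lip]. *)
Lemma pw_remainder a b : pw (a + b) <= pw a + (p + 2) * dpw a * b
  + (p + 2) * (p + 1) * 2 `^ p * (`|a| `^ p * b ^+ 2 + pw b).
Proof.
have h := pw_convex (a + b) (- b); rewrite addrK in h.
have := dpw_lip (ler_normD a b) (ler_wpDr (normr_ge0 b) (lexx `|a|)).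
rewrite [a + b - a]addrC addKr => L.
have q0 : 0 < (p + 2) by move: p0; lra.
have M := max_powR (ltW p0) (normr_ge0 a) (normr_ge0 b).
have e1 : (dpw (a + b) - dpw a) * b <= (p + 1) * (2 `^ p * (`|a| `^ p + `|b| `^ p)) * b ^+ 2.
  rewrite (le_trans (ler_norm _))// normrM (le_trans (ler_wpM2r (normr_ge0 b) L))//.
  have -> (X : R) : X * `|b| * `|b| = X * b ^+ 2 by rewrite -mulrA -[X in _ * X]expr2 real_normK ?num_real.
  rewrite ler_wpM2r ?sqr_ge0// ler_wpM2l//.
  by rewrite addr_ge0// ltW.
have := ler_wpM2l (ltW q0) e1; rewrite (pwE b).
move: h; move: (pw _) (pw _) (dpw _) (dpw _) (_ `^ _) (_ `^ _) (_ `^ _) => A B C D X Y Z h; lra.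
Qed.

(** The increment is at most of the order of [(|a| + |b|)^(p + 1) |b|]. Where [|b|] is small
    relative to [|a|] it is absorbed by [e * pw a], elsewhere by a multiple of [pw b]. *)
Lemma pw_brezis_lieb e : 0 < e -> exists C, 0 <= C /\
  forall a b, `|pw (a + b) - pw a| <= e * pw a + C * pw b.
Proof.
move=> e0; have q0 : 0 < (p + 2) by move: p0; lra.
have p10 : 0 <= p + 1 by rewrite addr_ge0// ltW.
pose A := (p + 2) * 2 `^ (p + 1).
have A0 : 0 < A by rewrite mulr_gt0// powR_gt0.
have first a b : `|pw (a + b) - pw a| <= (p + 2) * dpw (`|a| + `|b|) * `|b|.
  have h1 := pw_convex a b; have h2 := pw_convex (a + b) (- b); rewrite addrK in h2.
  have d (x : R) : `|x| <= `|a| + `|b| -> `|(p + 2) * dpw x * b| <= (p + 2) * dpw (`|a| + `|b|) * `|b|.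
    by move=> hx; rewrite normrM (normrM (p + 2)) (gtr0_norm q0) abs_dpw ler_wpM2r// ler_wpM2l ?(ltW q0)// dpw_homo.
  have d1 := d a (ler_wpDr (normr_ge0 b) (lexx _)); have d2 := d (a + b) (ler_normD a b).
  rewrite ler_norml; move: d1 d2; rewrite !ler_norml => /andP[d1 _] /andP[_ d2].
  move: h1 h2 d1 d2; rewrite mulrN; move: (pw _) (pw _) ((p + 2) * _ * _) ((p + 2) * _ * _) ((p + 2) * _ * _) => X Y Z T V; lra.
(* Threshold for [|b| / |a|]: below 1, the sum [|a| + |b|] is at most [2 |a|], and below [e / A] the
   increment is at most [e * pw a]. *)
pose d := Num.min 1 (e / A); have d0 : 0 < d by rewrite lt_min ltr01 divr_gt0.
exists ((p + 2) * (d^-1 + 1) `^ (p + 1)); split; first by rewrite mulr_ge0 ?powR_ge0// ltW.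
move=> a b; apply: (le_trans (first a b)); rewrite dpw_pos ?addr_ge0//.
have S x y : 0 <= x -> 0 <= y -> x `^ (p + 1) * y `^ (p + 1) = (x * y) `^ (p + 1).
  by move=> *; rewrite powRM.
have P x : pw x = `|x| `^ (p + 1) * `|x|.
  by rewrite -[in LHS]pw_abs -dpwM dpw_pos.
have [bd|bd] := leP `|b| (d * `|a|).
  rewrite ler_wpDr ?mulr_ge0 ?pw_ge0 ?powR_ge0 ?(ltW q0)// (P a) mulrA.
  have h1 : (`|a| + `|b|) `^ (p + 1) <= 2 `^ (p + 1) * `|a| `^ (p + 1).
    rewrite S//; apply: powR_homo; [exact: p10|by rewrite addr_ge0|]; rewrite mulr_natl mulr2n lerD2l (le_trans bd)//.
    by rewrite ler_piMl// /d ge_min lexx.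
  apply: (@le_trans _ _ (A * `|a| `^ (p + 1) * (d * `|a|))).
    apply: ler_pM; rewrite ?mulr_ge0 ?powR_ge0 ?(ltW q0)//.
    by rewrite /A -mulrA ler_wpM2l ?(ltW q0).
  rewrite mulrA ler_wpM2r// mulrAC ler_wpM2r ?powR_ge0// mulrC -ler_pdivlMr//.
  by rewrite /d ge_min lexx orbT.
rewrite ler_wpDl ?mulr_ge0 ?pw_ge0 ?(ltW e0)// (P b) mulrA ler_wpM2r// -mulrA ler_wpM2l ?(ltW q0)//.
rewrite S ?addr_ge0 ?invr_ge0 ?(ltW d0)//; apply: powR_homo; [exact: p10|by rewrite addr_ge0|]; rewrite mulrDl mul1r lerD2r.
by rewrite ler_pdivlMl// ltW.
Qed.

Lemma dpw_mul_le a b : `|dpw a * b| <= pw a + pw b.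
Proof.
have H x y : 0 <= x -> 0 <= y -> dpw x * y <= pw x + pw y.
  move=> x0 y0; have [xy|/ltW yx] := leP x y.
    rewrite ler_wpDl ?pw_ge0// -(dpwM y) ler_wpM2r// dpw_homo//.
  by rewrite ler_wpDr ?pw_ge0// -(dpwM x) ler_wpM2l// dpw_ge0.
by rewrite normrM abs_dpw -(pw_abs a) -(pw_abs b); exact: H.
Qed.

End exponent.
End powers.

(** * Weak limits *)

Section weak_sequences.
Context d (T : measurableType d) (R : realType) (mu : {measure set T -> \bar R}).
Implicit Types (f g h u v w : T -> R).
Local Notation itg := (itg mu).
Local Notation L2 := (L2 mu).
Local Notation dot := (l2dot mu).
Local Notation nsq := (l2sq mu).

Lemma dominated_int_ae (f : nat -> T -> R) (g h : T -> R) :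
  (forall n, measurable_fun setT (f n)) -> measurable_fun setT g ->
  {ae mu, forall x, f n x @[n --> \oo] --> g x} ->
  itg h -> (forall n x, `|f n x| <= h x) ->
  \int[mu]_x f n x @[n --> \oo] --> \int[mu]_x g x.
Proof.
move=> mf mg [A [mA A0 hA]] ih fh; pose c : T -> R := \1_(~` A).
have mc : measurable_fun setT c by apply: measurable_indic; exact: measurableC.
have cae : {ae mu, forall x, c x = 1}.
  exists A; split => // x /=; rewrite /c indicE; case: (boolP (x \in ~` A)) => //=.
  by rewrite notin_setE /= => /contrapT.
have [|||n x|_ H] := @dominated_int _ _ _ mu (fun n x => f n x * c x) (fun x => g x * c x) h.
- by move=> n; exact: measurable_funM.
- move=> x; rewrite /c indicE; case: (boolP (x \in ~` A)) => /=.
    rewrite inE /= => xA; rewrite mulr1; under eq_fun do rewrite mulr1.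
    by apply: contrapT => hx; apply: xA; exact: hA.
  by move=> _; rewrite mulr0; under eq_fun do rewrite mulr0; exact: cvg_cst.
- exact: ih.
- rewrite normrM (le_trans _ (fh n x))// ler_piMr// /c indicE; case: (_ \in _); rewrite ?normr1 ?normr0//.
rewrite (int_ae mg (measurable_funM mg mc)); last by apply: filterS cae => x e; rewrite /= e mulr1.
move: H; apply: cvg_eqr => n; apply/esym/int_ae => //; first exact: measurable_funM.
by apply: filterS cae => x e; rewrite /= e mulr1.
Qed.

(** A filter is the intersection of the ultrafilters finer than it. Limits obtained by compactness
    along every finer ultrafilter thus become limits along the filter itself. *)
Lemma ultra_near (I : Type) (F : set_system I) (FF : ProperFilter F) (P : set I) :
  (forall V, UltraFilter V -> F `<=` V -> V P) -> F P.
Proof.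
move=> H; apply: contrapT => nP.
have PF : ProperFilter (within (~` P) F).
  apply: Build_ProperFilter_ex => [Q /= hQ].
  apply: contrapT => nQ; apply: nP; move: hQ; rewrite /within /=; apply: filterS => x hx.
  by apply: contrapT => nPx; apply: nQ; exists x; exact: hx.
have [V [UV sV]] := ultraFilterLemma PF.
have VP : V P by apply: H => // Q FQ; apply: sV; rewrite /within /=; exact: filterS FQ.
have VnP : V (~` P) by apply: sV; rewrite /within /=; exact: nearW.
have : V (P `&` ~` P) by exact: filterI.
by rewrite setICr => /filter_ex[].
Qed.

(** Let [g] be the weak limit along an ultrafilter, and choose [phi k] so that the pairings with
    [f 0, ..., f k] are within [k.+1%:R^-1] of those of [g]. Any other limit point [g'] of the
    chosen sequence has the same pairings with all [f m], so [g' - g] is orthogonal to every [f m],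
    hence to their weak limits [g] and [g'], hence to itself. For limits it suffices that
    [k <= phi k]. *)
Lemma weak_subseq (f : nat -> T -> R) (C : R) :
  (forall n, L2 (f n)) -> (forall n, nsq (f n) <= C) ->
  exists phi : nat -> nat, (forall k, (k <= phi k)%N) /\
  exists2 g, L2 g & forall w, L2 w -> dot (f (phi k)) w @[k --> \oo] --> dot g w.
Proof.
move=> Lf fC; have [U [UU sU]] := @ultraFilterLemma _ (\oo : set_system nat) _.
have [g [Lg hg]] := L2_weak_limit UU Lf fC.
have /choice[phi hphi] : forall k : nat, exists n, (k <= n)%N /\
    forall m, (m <= k)%N -> `|dot (f n) (f m) - dot g (f m)| < k.+1%:R^-1.
  move=> k; apply: (@filter_ex _ U); apply: filterI; first by apply: sU; exists k.
  have : \forall n \near U, forall m : 'I_k.+1, `|dot (f n) (f m) - dot g (f m)| < k.+1%:R^-1.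
    apply: filter_forall => m; move/cvgrPdist_lt : (hg (f m) (Lf m)).
    by move=> /(_ k.+1%:R^-1 _)/wrap[|]; [rewrite invr_gt0|apply: filterS => n; rewrite distrC].
  by apply: filterS => n hn m mk; exact: (hn (Ordinal (mk : (m < k.+1)%N))).
exists phi; split; first by move=> k; exact: (hphi k).1.
exists g => // w Lw.
have cm m : dot (f (phi k)) (f m) @[k --> \oo] --> dot g (f m).
  apply/(subr_cvg0 (fun k => dot (f (phi k)) (f m))).
  apply: (@squeeze0 _ _ _ _ _ (fun n => n.+1%:R^-1)); last exact: inv_succ_cvg0.
  by exists m => // k /= mk; apply/ltW; exact: (hphi k).2.
apply/cvgrPdist_lt => e e0; apply: ultra_near => V UV sV.
have [g' [Lg' hg']] := L2_weak_limit UV (fun k => Lf (phi k)) (fun k => fC (phi k)).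
have Lr := L2B Lg' Lg.
have fr m : dot (f m) (g' - g) = 0.
  rewrite dotC dotBl//; apply/eqP; rewrite subr_eq0; apply/eqP.
  rewrite -(cvg_lim _ (hg' (f m) (Lf m)))// -(cvg_lim _ (cm m))//.
  apply: cvg_lim => //; rewrite (cvg_lim _ (cm m))//.
  by apply: cvg_trans (cm m); apply: cvg_app.
have z1 : dot g' (g' - g) = 0.
  rewrite -(cvg_lim _ (hg' _ Lr))//; under eq_fun do rewrite fr.
  by apply: cvg_lim => //; exact: cvg_cst.
have z2 : dot g (g' - g) = 0.
  rewrite -(cvg_lim _ (hg _ Lr))//; under eq_fun do rewrite fr.
  by apply: cvg_lim => //; exact: cvg_cst.
have r0 : nsq (g' - g) = 0 by rewrite -dotff dotBl// z1 z2 subrr.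
have <- : dot g' w = dot g w.
  apply/eqP; rewrite -subr_eq0 -dotBl// -sqrf_eq0 eq_le sqr_ge0 andbT.
  by rewrite (le_trans (dot_CS Lr Lw))// r0 mul0r.
by move/cvgrPdist_lt : (hg' w Lw); apply.
Qed.

End weak_sequences.

(** * The Gagliardo-Nirenberg inequality *)

Section mountain_pass_level.
Context {R : realType} {N : nat}.
Local Notation E := 'rV[R]_N.
Local Notation leb := (@lebesgue_rV R N).
Local Notation itg := (itg leb).
Local Notation L2 := (L2 leb).
Local Notation dot := (l2dot leb).
Local Notation nsq := (l2sq leb).
Local Notation hs := (@hs R).
Opaque dotD dirichlet gr grad H1.

Variable p : R.
Hypothesis p0 : 0 < p.
Hypothesis hN : (1 <= N <= 3)%N.
Hypothesis hq : N = 3%N -> p + 2 < 6.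
Local Notation q := (p + 2).
Local Notation pw := (pw p).
Local Notation dpw := (dpowp p).
Local Notation k := (N%:R * p / 4).
Local Notation beta := (q / 2 - N%:R * p / 4).
(** In terms of [p], [hb] is the subcriticality condition and [hk] says that [p] is at least
    [8 / N]; see [exponent_conditions]. *)
Hypothesis hb : 0 < beta.
Hypothesis hk : 2 <= k.

(** * The integral of |u|^(p+2) and non-vanishing *)

Section power_integrals.
Implicit Types (f g u v w : E -> R) (x y z : E) (i : 'I_N) (A : set E).

Definition Bp u : R := \int[leb]_x pw (u x).

Lemma q_gt0 : 0 < q. Proof. by move: p0; lra. Qed.

Lemma meas_pw u : measurable_fun setT u -> measurable_fun setT (fun x => pw (u x)).
Proof.
move=> mu; apply: (measurableT_comp (f := fun t : R => t `^ (p + 2))); first exact: measurable_powR.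
exact: measurableT_comp.
Qed.

Lemma meas_dpw u : measurable_fun setT u -> measurable_fun setT (fun x => dpw (u x)).
Proof.
move=> mu; apply: measurable_funM => //.
apply: (measurableT_comp (f := fun t : R => t `^ p)); first exact: measurable_powR.
exact: measurableT_comp.
Qed.

Lemma dyadic_level (J : nat) (t : R) : 2 ^+ J < t -> exists j : nat, 2 ^+ (J + j) < t <= 2 ^+ (J + j).+1.
Proof.
move=> Jt; have H : exists n : nat, t <= 2 ^+ n.
  have [n hn] : exists n : nat, t <= n%:R.
    by exists (Num.truncn t).+1; rewrite ltW// truncnS_gt.
  exists n; rewrite (le_trans hn)// -natrX ler_nat; exact/ltnW/ltn_expl.
case: (ex_minnP H) => -[|m] hm hmin.
  by move: (le_lt_trans hm (le_lt_trans (exprn_ege1 J (ler1n R 2)) Jt)); rewrite ltxx.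
have hm' : 2 ^+ m < t by rewrite ltNge; apply/negP => /hmin; rewrite ltnn.
have Jm : (J <= m)%N.
  rewrite leqNgt; apply/negP => mJ; have := lt_le_trans Jt hm; rewrite ltr_eXn2l ?ltr1n//.
  by rewrite ltnS leqNgt mJ.
by exists (m - J)%N; rewrite subnKC// hm' hm.
Qed.

Lemma pow2_powR (n : nat) : (2 ^+ n) `^ q = (2 `^ q) ^+ n :> R.
Proof. by rewrite -powR_mulrn// -powRrM mulrC powRrM powR_mulrn// powR_ge0. Qed.

(** Three ranges of [|u|]: below [e] the power is at most [e ^ p * u ^+ 2]; between [e] and [2 ^+ J]
    it is at most [(2 ^ q) ^+ J] on a set of measure [la u e]; above, the dyadic layers sum to a
    geometric series of ratio [rho], which is less than 1 because [q < s]. *)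
Lemma pw_split u (K : R) (s J : nat) (e : R) : L2 u -> 0 <= K ->
  (forall j : nat, la u (2 ^+ j) <= K * (2^-1 ^+ s) ^+ j) -> 0 < e <= 1 -> q < s%:R ->
  let rho := 2 `^ q * 2^-1 ^+ s in
  rho < 1 /\ itg (fun x => pw (u x)) /\
  Bp u <= e `^ p * nsq u + (2 `^ q) ^+ J * la u e + K * 2 `^ q * (rho ^+ J / (1 - rho)).
Proof.
move=> hu K0 dec /andP[e0 e1] qs rho; have mu := L2_meas hu.
set b := 2 `^ q in rho *; have b0 : 0 < b by rewrite powR_gt0.
have rho0 : 0 <= rho by rewrite mulr_ge0 ?exprn_ge0 ?invr_ge0// ltW.
have rho1 : rho < 1.
  rewrite /rho exprVn ltr_pdivrMr ?exprn_gt0// mul1r -powR_mulrn//.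
  by rewrite /b /powR !gt_eqF// ltr_expR ltr_pM2r// ln_gt0// ltr1n.
split => //.
pose A j := lev u (2 ^+ (J + j)).
have two0 (j : nat) : 0 < 2 ^+ j :> R by rewrite exprn_gt0.
have mA j : measurable (A j) by exact: lev_meas.
have fA j : (leb (A j) < +oo)%E by have [] := lev_fin (two0 (J + j)%N) hu.
have mE := lev_meas e mu; have [fE' _] := lev_fin e0 hu.
pose g x : R := e `^ p * u x ^+ 2 + b ^+ J * \1_(lev u e) x.
pose G j x : \bar R := (b ^+ (J + j).+1 * \1_(A j) x)%:E.
have [I1 n1] := itg_indic mE fE'.
have Ig : itg g by apply: (itgD (f := e `^ p *: (fun x => u x ^+ 2))); [apply: itgZ; exact: hu.2|exact: (itgZ (b ^+ J) I1)].
have g0 x : 0 <= g x by rewrite addr_ge0// mulr_ge0 ?powR_ge0 ?sqr_ge0 ?exprn_ge0 ?(ltW b0)// indicE.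
have G0 j x : (0 <= G j x)%E by rewrite lee_fin mulr_ge0 ?exprn_ge0 ?(ltW b0)// indicE.
have mG j : measurable_fun setT (G j).
  by apply/measurable_EFinP; apply: measurable_funM => //; exact: measurable_indic.
have pt x : ((pw (u x))%:E <= (g x)%:E + \sum_(0 <= j <oo) G j x)%E.
  have S0 : (0 <= \sum_(0 <= j <oo) G j x)%E by apply: nneseries_ge0.
  have [ue|ue] := leP `|u x| e.
    apply: (@le_trans _ _ (g x)%:E); last by rewrite leeDl.
    rewrite lee_fin /g (pwE p0); apply: ler_wpDr; first by rewrite mulr_ge0 ?exprn_ge0 ?(ltW b0)// indicE.
    rewrite ler_wpM2r ?sqr_ge0//; apply: powR_homo => //; exact: ltW.
  have [uJ|uJ] := leP `|u x| (2 ^+ J).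
    apply: (@le_trans _ _ (g x)%:E); last by rewrite leeDl.
    rewrite lee_fin /g; apply: ler_wpDl; first by rewrite mulr_ge0 ?powR_ge0 ?sqr_ge0.
    rewrite indicE mem_set// mulr1 -pow2_powR; apply: powR_homo => //; exact: (ltW q_gt0).
  have [j /andP[uj1 uj2]] := dyadic_level uJ.
  apply: (@le_trans _ _ (\sum_(0 <= j <oo) G j x)%E); last by rewrite leeDr// lee_fin.
  apply: (@le_trans _ _ (G j x)).
    rewrite /G lee_fin indicE mem_set// mulr1 -pow2_powR; apply: powR_homo => //; exact: (ltW q_gt0).
  apply: (@le_trans _ _ (\sum_(0 <= i < j.+1) G i x)%E).
    by rewrite big_nat_recr//= leeDr// sume_ge0.
  exact: nneseries_lim_ge.
have geo n : \sum_(0 <= j < n) rho ^+ j <= (1 - rho)^-1.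
  rewrite big_mkord -[leRHS]mul1r ler_pdivlMr ?subr_gt0// mulrC -opprB mulNr -subrX1 opprB.
  by rewrite lerBlDr lerDl exprn_ge0.
have GI n : (\sum_(0 <= j < n) \int[leb]_x G j x <= (K * b * (rho ^+ J / (1 - rho)))%:E)%E.
  have -> : (\sum_(0 <= j < n) \int[leb]_x G j x)%E = (\sum_(0 <= j < n) b ^+ (J + j).+1 * la u (2 ^+ (J + j)))%:E.
    rewrite -sumEFin; apply: eq_bigr => j _; have [I2 n2] := itg_indic (mA j) (fA j).
    by rewrite /G (int_fin (itgZ (b ^+ (J + j).+1) I2)) intZ// n2.
  rewrite lee_fin.
  apply: (@le_trans _ _ (\sum_(0 <= j < n) K * b * rho ^+ J * rho ^+ j)).
    apply: ler_sum => j _; rewrite exprS.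
    apply: (le_trans (ler_wpM2l _ (dec _))); first by rewrite mulr_ge0 ?exprn_ge0 ?(ltW b0).
    rewrite -!mulrA -exprD /rho exprMn.
    by rewrite le_eqVlt; apply/orP; left; apply/eqP; ring.
  rewrite -mulr_sumr [leRHS]mulrA; apply: ler_wpM2l; last exact: geo.
  by rewrite !mulr_ge0 ?exprn_ge0 ?(ltW b0).
apply: itg_fin; first exact: meas_pw.
  by move=> x; exact: pw_ge0.
apply: (@le_trans _ _ (\int[leb]_x ((g x)%:E + \sum_(0 <= j <oo) G j x))%E).
  have mg : measurable_fun setT (fun x => (g x)%:E) by apply/measurable_EFinP; exact: (itg_meas Ig).
  have ms : measurable_fun setT (fun x => (\sum_(0 <= j <oo) G j x)%E) by apply: ge0_emeasurable_sum.
  apply: ge0_le_integral => //.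
  - by move=> x _; rewrite lee_fin pw_ge0.
  - by apply/measurable_EFinP; exact: meas_pw.
  - exact: emeasurable_funD.
rewrite ge0_integralD//; last 3 first.
- by apply/measurable_EFinP; exact: (itg_meas Ig).
- by move=> x _; apply: nneseries_ge0.
- by apply: ge0_emeasurable_sum.
  rewrite EFinD; apply: leeD.
  rewrite (int_fin Ig) lee_fin /g.
  rewrite (intD (f := e `^ p *: (fun x => u x ^+ 2)) (g := b ^+ J *: (\1_(lev u e) : E -> R))).
  - by rewrite !intZ ?n1//; exact: hu.2.
  - by apply: itgZ; exact: hu.2.
  - exact: itgZ.
rewrite integral_nneseries//; apply: lime_le; first by apply: is_cvg_nneseries => n _ _; exact: integral_ge0.
  by apply: nearW => n; exact: GI.
by move=> x _; rewrite lee_fin.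
Qed.

Lemma Bp_bound (T : R) : exists C : R, forall u, H1 u -> nsq u <= T -> dirichlet u <= T ->
  itg (fun x => pw (u x)) /\ Bp u <= C.
Proof.
have [s [K [qs K0 dec]]] := level_decay T hN hq.
exists (T + (2 `^ q) ^+ 0 * T + K * 2 `^ q * ((2 `^ q * 2^-1 ^+ s) ^+ 0 / (1 - 2 `^ q * 2^-1 ^+ s))).
move=> u hu uT DT; have Lu := H1_L2 hu.
have [|_ [h1 h2]] := @pw_split u K s 0 1 Lu K0 (dec u hu uT DT) _ qs; first by rewrite ltr01 lexx.
split => //; apply: (le_trans h2); rewrite lerD2r powR1 mul1r lerD// !expr0 !mul1r (le_trans _ uT)//.
by have [_] := lev_fin (u := u) ltr01 Lu; rewrite expr1n mul1r.
Qed.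

Lemma itg_pw u : H1 u -> itg (fun x => pw (u x)).
Proof.
move=> hu; have [C] := Bp_bound (Num.max (nsq u) (dirichlet u)).
by move=> /(_ u hu)[||//]; rewrite le_max lexx ?orbT.
Qed.

Lemma itg_dpw u v : H1 u -> H1 v -> itg (fun x => dpw (u x) * v x).
Proof.
move=> hu hv; have [mu mv] := (L2_meas (H1_L2 hu), L2_meas (H1_L2 hv)).
apply: (itg_le (g := (fun x => pw (u x)) + (fun x => pw (v x)))).
- by apply: measurable_funM => //; exact: meas_dpw.
- by move=> x; exact: dpw_mul_le.
- by apply: itgD; exact: itg_pw.
Qed.

(** A power integral of size [c0] cannot come from very small or very large values alone, so the
    level set above some [e] has measure at least [d]. Were all averages over small cubes below
    [e / 2], they would differ from [u] by [e / 2] on that set, contradicting [avg_cube_le]. *)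
Lemma nonvanishing (T c0 : R) : 0 < c0 -> exists h eta : R, [/\ 0 < h, 0 < eta &
  forall u, H1 u -> nsq u <= T -> dirichlet u <= T -> c0 <= Bp u ->
  exists y, eta <= `|avg (cube h) u y|].
Proof.
move=> c00; have [s [K [qs K0 dec]]] := level_decay T hN hq.
pose T' := Num.max T 1; have T1 : 1 <= T' by rewrite le_max lexx orbT.
have T0 : 0 < T' by exact: lt_le_trans T1.
have TT : T <= T' by rewrite le_max lexx.
set rho := 2 `^ q * 2^-1 ^+ s.
have rho0 : 0 <= rho by rewrite mulr_ge0 ?powR_ge0 ?exprn_ge0 ?invr_ge0.
have rho1 : rho < 1.
  rewrite /rho exprVn ltr_pdivrMr ?exprn_gt0// mul1r -powR_mulrn//.
  by rewrite /powR !gt_eqF// ltr_expR ltr_pM2r// ln_gt0// ltr1n.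
pose A := K * 2 `^ q / (1 - rho).
have A0 : 0 <= A by rewrite divr_ge0 ?mulr_ge0 ?powR_ge0// subr_ge0 ltW.
have [J hJ] : exists J : nat, A * rho ^+ J <= c0 / 4.
  have cr : (rho ^+ n) @[n --> \oo] --> (0 : R) by apply: cvg_expr; rewrite ger0_norm.
  have d0 : 0 < c0 / 4 / (A + 1) by rewrite !divr_gt0// ltr_wpDl.
  move/cvgr0Pnorm_le : cr => /(_ _ d0)[n _ /(_ n (leqnn n))]; rewrite ger0_norm ?exprn_ge0// => h; exists n.
  rewrite (le_trans (ler_wpM2l A0 h))// mulrCA ler_piMr ?divr_ge0 ?(ltW c00)//.
  by rewrite ler_pdivrMr ?ltr_wpDl// mul1r lerDl.
(* [J] and [e] make the contributions of large and of small values at most [c0 / 4] each; the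
   remaining half gives the lower bound [d]. *)
pose e := Num.min 1 ((c0 / 4 / T') `^ p^-1).
have e0 : 0 < e by rewrite lt_min ltr01 powR_gt0// !divr_gt0.
have e1 : e <= 1 by rewrite ge_min lexx.
have ep : e `^ p * T' <= c0 / 4.
  rewrite -ler_pdivlMr//; apply: (@le_trans _ _ (((c0 / 4 / T') `^ p^-1) `^ p)).
    by apply: powR_homo; rewrite ?(ltW p0) ?(ltW e0)// ge_min lexx orbT.
  by rewrite -powRrM mulVf ?gt_eqF// powRr1// !divr_ge0// ltW.
pose b := (2 `^ q) ^+ J; have b0 : 0 < b by rewrite exprn_gt0// powR_gt0.
pose d := c0 / 2 / b; have d0 : 0 < d by rewrite !divr_gt0.
have key u : H1 u -> nsq u <= T -> dirichlet u <= T -> c0 <= Bp u -> d <= la u e.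
  move=> hu uT DT cB; have Lu := H1_L2 hu.
  have [|_ [_ h2]] := @pw_split u K s J e Lu K0 (dec u hu uT DT) _ qs; first by rewrite e0.
  rewrite /d ler_pdivrMr// (mulrC (la u e)).
  have h3 : e `^ p * nsq u <= c0 / 4.
    by rewrite (le_trans _ ep)// ler_wpM2l ?powR_ge0// (le_trans uT).
  have h4 : K * 2 `^ q * (rho ^+ J / (1 - rho)) <= c0 / 4.
    by rewrite (le_trans _ hJ)// /A le_eqVlt; apply/orP; left; apply/eqP; rewrite -!mulrA; congr (_ * (_ * _)); rewrite mulrC.
  move: (le_trans cB h2) h3 h4; rewrite -/b -/rho.
  move: (_ * nsq u) (b * _) (_ * (_ / _)) => X Y Z; lra.
(* Chosen so that the averaging error [(N h)^2 T'] equals [e^2 d / 16], below the value [e^2 d / 4]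
   that Chebyshev's inequality would require. *)
pose h := e / 4 * Num.sqrt d / Num.sqrt T' / N%:R.
have N0 : 0 < N%:R :> R by rewrite ltr0n; case/andP: hN.
have h0 : 0 < h by rewrite !divr_gt0// ?mulr_gt0 ?divr_gt0 ?sqrtr_gt0.
have hT : (N%:R * h) ^+ 2 * T' = e ^+ 2 / 16 * d.
  have -> : N%:R * h = e / 4 * Num.sqrt d / Num.sqrt T' by rewrite /h mulrC divfK// gt_eqF.
  rewrite expr_div_n exprMn !sqr_sqrtr ?(ltW d0) ?(ltW T0)// divfK ?gt_eqF// expr_div_n.
  by congr (_ / _ * _); ring.
have e20 : 0 < e / 2 by rewrite divr_gt0.
exists h, (e / 2); split => // u hu uT DT cB; have dl := key u hu uT DT cB.
apply: contrapT => H; have {}H y : `|avg (cube h) u y| <= e / 2.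
  by rewrite leNgt; apply/negP => /ltW hy; apply: H; exists y.
have Lu := H1_L2 hu; have [La na] := avg_cube_le hu h0.
have [|||_] := @chebyshev_nsq _ _ (avg (cube h) u - u) (lev u e) (e / 2) e20.
- exact: L2B.
- exact: lev_meas (L2_meas Lu).
- move=> x; rewrite /lev /= !fE => hx; have := H x; rewrite -[e in e < _]mulr1 in hx.
  rewrite distrC => hy; rewrite (le_trans _ (lerB_dist _ _))//.
  by move: hx hy; move: `|u x| `|avg _ _ _| => X Y; lra.
apply/negP; rewrite -ltNge -/(la u e).
apply: (le_lt_trans na).
apply: (@le_lt_trans _ _ ((N%:R * h) ^+ 2 * T')).
  by rewrite ler_wpM2l ?sqr_ge0// (le_trans DT).
rewrite hT expr_div_n; apply: (@lt_le_trans _ _ (e ^+ 2 / 2 ^+ 2 * d)).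
  by rewrite ltr_pM2r// ltr_pM2l ?exprn_gt0// expr2; lra.
by rewrite ler_wpM2l// divr_ge0 ?sqr_ge0.
Qed.

(** With zero gradient [u] equals its averages over arbitrarily large cubes, and these tend to 0
    because the mass is finite. *)
Lemma dirichlet_eq0 u : H1 u -> dirichlet u = 0 -> nsq u = 0.
Proof.
move=> hu D0; have Lu := H1_L2 hu.
have N0 : (0 < N)%N by case/andP: hN.
have ae : {ae leb, forall x, forall n : nat, u x ^+ 2 <= nsq u * n.+1%:R^-1}.
  apply: ae_foralln => n; pose h : R := n.+1%:R; have h0 : 0 < h by rewrite /h.
  have [La na] := avg_cube_le hu h0.
  have e : nsq (avg (cube h) u - u) = 0.
    by apply/eqP; rewrite eq_le nsq_ge0 andbT (le_trans na)// D0 mulr0.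
  apply: filterS (nsqB_eq0 La Lu e) => x <-.
  have lc : lm (cube h : set E) = (2 * h) ^+ N by rewrite lm_cube// ltW.
  apply: (le_trans (avg_le _ _ _ _ Lu)); rewrite ?lc ?exprn_gt0 ?mulr_gt0//.
  - exact: cube_measurable.
  - by rewrite leb_cube ?ltry// ltW.
  rewrite mulrC ler_wpM2l ?nsq_ge0// lef_pV2 ?posrE ?exprn_gt0 ?mulr_gt0//.
  have h1 : 1 <= 2 * h by rewrite /h -natrM ler1n.
  by rewrite (le_trans (_ : h <= 2 * h))//; [rewrite ler_peMl// ?ler1n// ltW|exact: ler_eXnr].
apply: nsq0_ae => //; apply: filterS ae => x hx.
have c : (nsq u * n.+1%:R^-1) @[n --> \oo] --> nsq u * 0 by apply: cvgMl_tmp; exact: inv_succ_cvg0.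
rewrite mulr0 in c; apply/eqP; rewrite -sqrf_eq0 eq_le sqr_ge0 andbT.
by rewrite -(cvg_lim _ c)//; apply: limr_ge; [apply/cvg_ex; eexists; exact: c|exact: nearW].
Qed.

End power_integrals.

(** * Weak limits in H^1 and the Brezis-Lieb lemma *)

Section weak_sobolev.
Implicit Types (f g u v w : E -> R) (x y z : E) (i : 'I_N) (A : set E).

Lemma nsq_gr_le i u : H1 u -> nsq (gr i u) <= dirichlet u.
Proof.
move=> hu; rewrite (dirichletE hu) (bigD1 i)//= lerDl; apply: sumr_ge0 => j _; exact: nsq_ge0.
Qed.

(** The bounded gradients have a weak limit along an ultrafilter, which serves as weak gradient of
    [g]; convergence along the whole sequence then follows from convergence against test
    functions. *)
Lemma H1_weak_limit (u : nat -> E -> R) g (C : R) : (forall n, H1 (u n)) ->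
  (forall n, dirichlet (u n) <= C) -> L2 g ->
  (forall w, L2 w -> dot (u n) w @[n --> \oo] --> dot g w) ->
  H1 g /\ forall i w, L2 w -> dot (gr i (u n)) w @[n --> \oo] --> dot (gr i g) w.
Proof.
move=> hu DC Lg hw.
have tc i phi : test_function phi -> dot (gr i (u n)) phi @[n --> \oo] --> - dot g (partial i phi).
  move=> tp; apply: (@cvg_eqr _ _ _ _ (fun n => - dot (u n) (partial i phi))).
    by move=> n; rewrite (gr_test i (hu n) tp) opprK.
  by apply: cvgN; apply: hw; exact/test_L2/test_partial.
have gC i n : nsq (gr i (u n)) <= C by exact: le_trans (nsq_gr_le i (hu n)) (DC n).
have hg : H1 g.
  apply: H1_intro => // i; have [U [UU sU]] := @ultraFilterLemma _ (\oo : set_system nat) _.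
  have [G [LG hG]] := L2_weak_limit UU (fun n => gr_L2 i (hu n)) (gC i).
  exists G; split => // phi tp; have c1 := hG phi (test_L2 tp).
  have c2 : dot (gr i (u n)) phi @[n --> U] --> - dot g (partial i phi).
    by apply: cvg_trans (tc i phi tp); apply: cvg_app.
  by rewrite -(cvg_lim _ c1)// (cvg_lim _ c2)// opprK.
split => // i w Lw; apply: (weak_cvg_dense _ (C := C)) => //; try by [exact: gr_L2|move=> n; exact: gr_L2].
move=> phi tp; rewrite -[dot (gr i g) phi]opprK -(gr_test i hg tp); exact: tc.
Qed.

(** Rellich's theorem for weakly null sequences: the averages at a fixed scale tend to 0 pointwise
    and boundedly, and [avg_cube_le] makes them close to [w n] uniformly in [n]. *)
Lemma weak_local (w : nat -> E -> R) (C r : R) : (forall n, H1 (w n)) ->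
  (forall n, nsq (w n) <= C) -> (forall n, dirichlet (w n) <= C) ->
  (forall f, L2 f -> dot (w n) f @[n --> \oo] --> (0 : R)) ->
  nsq (w n * \1_(cube r)) @[n --> \oo] --> (0 : R).
Proof.
move=> hw MC DC w0; have mC := @cube_measurable R N r.
have C0 : 0 <= C by exact: le_trans (nsq_ge0 _ _) (MC 0%N).
have avg0 (h : R) : 0 < h -> nsq (avg (cube h) (w n) * \1_(cube r)) @[n --> \oo] --> (0 : R).
  move=> h0; have mh := @cube_measurable R N h.
  have fh : (leb (cube h) < +oo)%E by rewrite leb_cube ?ltry// ltW.
  have lh : 0 < lm (cube h : set E) by rewrite lm_cube ?(ltW h0)// exprn_gt0// mulr_gt0.
  have [L1 _] := L2_indic mh fh.
  have [|||n x|_] := @dominated_int _ _ _ leb (fun n x => (avg (cube h) (w n) * \1_(cube r)) x ^+ 2) (fun=> 0)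
      (((lm (cube h : set E))^-1 * C) *: (\1_(cube r) : E -> R)).
  - move=> n; apply: measurable_funX; apply: measurable_funM; last exact: measurable_indic.
    exact: (meas_avg mh fh (H1_L2 (hw n))).
  - move=> x; have c1 : avg (cube h) (w n) x @[n --> \oo] --> (lm (cube h : set E))^-1 * 0.
      apply: cvgMl_tmp; apply: (@cvg_eqr _ _ _ _ (fun n => dot (w n) (sh (- x) \1_(cube h)))).
        by move=> n; rewrite (dot_shl x (H1_L2 (hw n)) L1).
      by apply: w0; exact: L2_sh.
    rewrite mulr0 in c1.
    have c2 : ((avg (cube h) (w n) x * \1_(cube r) x) * (avg (cube h) (w n) x * \1_(cube r) x)) @[n --> \oo]
       --> ((0 : R) * \1_(cube r) x) * (0 * \1_(cube r) x) by apply: cvgM; apply: cvgMr_tmp.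
    by move: c2; rewrite !mul0r; apply: cvg_eqr => n; rewrite expr2.
  - by apply: itgZ; exact: itg_indic_cube.
  - rewrite ger0_norm ?sqr_ge0// !fE indicE; case: (_ \in _); rewrite ?mulr1 ?mulr0 ?expr0n//=.
    rewrite (le_trans (avg_le _ mh fh lh (H1_L2 (hw n))))// ler_wpM2l ?invr_ge0 ?lm_ge0//.
  - by rewrite int0.
apply/cvgr0Pnorm_lt => e e0.
(* The scale makes the averaging error at most [e / 4] for all [n]; the added ones keep the divisors
   positive. *)
pose h := Num.sqrt (e / 4) / (Num.sqrt (C + 1) * (N%:R + 1)).
have C1 : 0 < C + 1 by rewrite ltr_wpDl.
have N1 : 0 < N%:R + 1 :> R by rewrite ltr_wpDl.
have h0 : 0 < h by rewrite divr_gt0 ?mulr_gt0 ?sqrtr_gt0 ?divr_gt0.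
have hC : (N%:R * h) ^+ 2 * C <= e / 4.
  apply: (@le_trans _ _ (((N%:R + 1) * h) ^+ 2 * (C + 1))).
    apply: ler_pM; rewrite ?sqr_ge0 ?lerDl// lerXn2r ?nnegrE ?mulr_ge0 ?(ltW h0) ?(ltW N1)//.
    by rewrite ler_wpM2r ?(ltW h0)// lerDl.
  have -> : (N%:R + 1) * h = Num.sqrt (e / 4) / Num.sqrt (C + 1).
    by rewrite /h invfM mulrCA mulrCA (mulrC _ (_^-1 : R)) ?mulrA; field; rewrite !gt_eqF ?sqrtr_gt0.
  rewrite expr_div_n !sqr_sqrtr ?(ltW C1) ?divr_ge0 ?(ltW e0)// divfK// gt_eqF//.
have e8 : 0 < e / 8 by rewrite divr_gt0.
move/cvgr0Pnorm_lt : (avg0 h h0) => /(_ _ e8); apply: filterS => n; rewrite !ger0_norm ?nsq_ge0// => hn.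
have Lw := H1_L2 (hw n); have [La na] := avg_cube_le (hw n) h0.
have [L1 n1] := L2_mul_indic mC (L2B Lw La); have [L2' _] := L2_mul_indic mC La.
have -> : w n * \1_(cube r) = (w n - avg (cube h) (w n)) * \1_(cube r) + avg (cube h) (w n) * \1_(cube r).
  by rewrite -mulrDl subrK.
apply: (le_lt_trans (nsqD_le L1 L2')).
rewrite nsqBC in n1.
have b1 : nsq (avg (cube h) (w n) - w n) <= e / 4.
  by rewrite (le_trans na)// (le_trans _ hC)// ler_wpM2l ?sqr_ge0.
move: (le_trans n1 b1) hn; gen_atoms; lra.
Qed.

(** Diagonal choice: the [k]-th term is small at a rapid rate on the cube of half-side [k], and
    every point lies in all cubes but finitely many. *)
Lemma weak_ae (w : nat -> E -> R) (C : R) : (forall n, H1 (w n)) ->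
  (forall n, nsq (w n) <= C) -> (forall n, dirichlet (w n) <= C) ->
  (forall f, L2 f -> dot (w n) f @[n --> \oo] --> (0 : R)) ->
  exists psi : nat -> nat, (forall k, (k <= psi k)%N) /\
    {ae leb, forall x, w (psi k) x @[k --> \oo] --> (0 : R)}.
Proof.
move=> hw MC DC w0.
have /choice[psi hpsi] : forall k : nat, exists n, (k <= n)%N /\ nsq (w n * \1_(cube k%:R)) <= 8^-1 ^+ k.
  move=> k; have e0 : 0 < 8^-1 ^+ k :> R by rewrite exprn_gt0// invr_gt0.
  move/cvgr0Pnorm_le : (weak_local k%:R hw MC DC w0) => /(_ _ e0)[m _ hm].
  exists (maxn k m); rewrite leq_maxl; split => //.
  by have := hm (maxn k m); rewrite /= leq_maxr => /(_ isT); rewrite ger0_norm// nsq_ge0.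
exists psi; split; first by move=> k; exact: (hpsi k).1.
have Lk k : L2 (w (psi k) * \1_(cube k%:R)) by exact: (L2_mul_indic (cube_measurable _) (H1_L2 (hw (psi k)))).1.
have := @L2_rapid_ae _ _ _ leb (fun k => w (psi k) * \1_(cube k%:R)) 0 Lk (L20 _).
move=> /(_ _)/wrap[|]; first by move=> k; rewrite subr0; exact: (hpsi k).2.
apply: filterS => x hx.
have [m _ hm] : (\bigcup_(n : nat) cube n%:R) x by rewrite cube_cover.
apply: cvg_trans hx; apply: near_eq_cvg; exists m => // k /= mk.
by rewrite !fE indicE mem_set ?mulr1//; apply: cubeS hm; rewrite ler_nat.
Qed.

Lemma Bp_ge0 u : 0 <= Bp u. Proof. by apply: int_ge0 => x; exact: pw_ge0. Qed.

Lemma pw_cvg0 (w : nat -> R) : w n @[n --> \oo] --> 0 -> pw (w n) @[n --> \oo] --> 0.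
Proof.
move=> hx; apply/cvgr0Pnorm_lt => a a0; have b0 : 0 < a `^ (p + 2)^-1 by rewrite powR_gt0.
move/cvgr0Pnorm_lt : hx => /(_ _ b0); apply: filterS => n hn.
rewrite ger0_norm ?pw_ge0// /pw (lt_le_trans (gt0_ltr_powR (q_gt0) _ _ hn))// ?nnegrE ?powR_ge0//.
by rewrite -powRrM mulVf ?powRr1 ?(ltW a0)// gt_eqF// q_gt0.
Qed.

Lemma pw_cvg (t : R) (w : nat -> R) : w n @[n --> \oo] --> 0 ->
  pw (t + w n) @[n --> \oo] --> pw t.
Proof.
move=> /pw_cvg0 hx; apply/(subr_cvg0 (fun n => pw (t + w n))); apply/cvgr0Pnorm_lt => a a0.
have t0 := pw_ge0 p t; have t1 : 0 < pw t + 1 by rewrite ltr_wpDl.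
have [K [K0 hK]] := pw_brezis_lieb p0 (divr_gt0 a0 (mulr_gt0 (ltr0Sn R 1) t1)).
have K1 : 0 < K + 1 by rewrite ltr_wpDl.
move/cvgr0Pnorm_lt : hx => /(_ _ (divr_gt0 a0 (mulr_gt0 (ltr0Sn R 1) K1))); apply: filterS => n.
rewrite ger0_norm ?pw_ge0// ltr_pdivlMr ?mulr_gt0// => hn; apply: (le_lt_trans (hK _ _)).
have h1 : a / (2 * (pw t + 1)) * pw t <= a / 2.
  rewrite invfM mulrA -mulrA ler_piMr ?divr_ge0 ?(ltW a0)// mulrC ler_pdivrMr// mul1r lerDl//.
have h2 : K * pw (w n) < a / 2.
  rewrite ltr_pdivlMr//; apply: le_lt_trans hn; rewrite mulrAC mulrC.
  have := pw_ge0 p (w n); move: (pw _) => X; nra.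
by rewrite [ltRHS](splitr a); apply: ler_ltD.
Qed.

(** By [pw_brezis_lieb] the defect [g n] exceeds [e' * pw (w n)] by at most a multiple of the fixed
    integrable function [pw u]. Dominated convergence handles the excess, and the bound on
    [Bp (w n)] handles the rest. *)
Lemma brezis_lieb (w : nat -> E -> R) u (C : R) : H1 u -> (forall n, H1 (w n)) ->
  (forall n, Bp (w n) <= C) -> {ae leb, forall x, w n x @[n --> \oo] --> (0 : R)} ->
  (Bp (u + w n) - Bp (w n)) @[n --> \oo] --> Bp u.
Proof.
move=> hu hw BC wae; have C0 : 0 <= C by exact: le_trans (Bp_ge0 _) (BC 0%N).
apply/(subr_cvg0 (fun n => Bp (u + w n) - Bp (w n))); apply/cvgr0Pnorm_lt => e e0.
pose e' := e / (2 * (C + 1)); have e'0 : 0 < e' by rewrite divr_gt0// mulr_gt0// ltr_wpDl.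
have [K [K0 hK]] := pw_brezis_lieb p0 e'0.
have iw n := itg_pw (hw n); have iu := itg_pw hu.
have iuw n := itg_pw (H1D hu (hw n)).
have mu := L2_meas (H1_L2 hu); have mw n := L2_meas (H1_L2 (hw n)).
pose g n x := pw (u x + w n x) - pw (w n x) - pw (u x).
have mpu := meas_pw mu; have mpw n := meas_pw (mw n).
have mg n : measurable_fun setT (g n).
  by apply: measurable_funB => //; apply: measurable_funB => //; apply: meas_pw; exact: measurable_funD.
have ig n : itg (g n) by apply: (itgB (f := fun x => pw (u x + w n x) - pw (w n x))) => //; apply: itgB => //; exact: iuw.
(* The positive part of the excess: dominated by an integrable function and pointwise convergent to
   0. *)
pose W n x := Num.max (`|g n x| - e' * pw (w n x)) 0.
have mW n : measurable_fun setT (W n).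
  apply: measurable_maxr => //; apply: measurable_funB; first exact: measurableT_comp.
  exact: measurable_funM.
have W0 n x : 0 <= W n x by rewrite le_max lexx orbT.
have Wle n x : `|W n x| <= ((K + 1) *: (fun x => pw (u x))) x.
  rewrite ger0_norm// ge_max !fE mulr_ge0 ?addr_ge0 ?pw_ge0// andbT /g.
  have := hK (w n x) (u x); rewrite (addrC (w n x)) => h.
  rewrite lerBlDr (le_trans (ler_normB _ _))// (ger0_norm (pw_ge0 p (u x))).
  move: h; move: (pw _) (pw _) `|_| => X Y Z; lra.
have cW : \int[leb]_x W n x @[n --> \oo] --> (0 : R).
  rewrite -(int0 leb); apply: (dominated_int_ae mW _ _ _ Wle) => //; last by apply: itgZ.
  apply: filterS wae => x hx.
  have c1 := pw_cvg0 hx; have c2 := @pw_cvg (u x) _ hx.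
  apply: (@squeeze0 _ _ _ _ _ (fun n => `|pw (u x + w n x) - pw (u x)| + pw (w n x))).
    apply: nearW => n; rewrite ger0_norm// ge_max addr_ge0 ?pw_ge0// andbT.
    rewrite lerBlDr (le_trans _ (_ : `|pw (u x + w n x) - pw (u x)| + pw (w n x) <= _))//.
      rewrite /g -addrA addrCA addrC -[X in _ <= _ + X]ger0_norm ?pw_ge0// -[X in _ <= _ + X]normrN.
      by rewrite (le_trans _ (ler_normD _ _))// lexx.
    by rewrite lerDl mulr_ge0 ?pw_ge0// ltW.
  have c3 : (`|pw (u x + w n x) - pw (u x)| + pw (w n x)) @[n --> \oo] --> `|pw (u x) - pw (u x)| + 0.
    by apply: cvgD => //; apply: cvg_norm; apply: cvgB => //; exact: cvg_cst.
  by rewrite subrr normr0 addr0 in c3.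
have e20 : 0 < e / 2 by rewrite divr_gt0.
move/cvgr0Pnorm_lt : cW => /(_ _ e20); apply: filterS => n; rewrite ger0_norm; last exact: int_ge0.
move=> hn; have iW : itg (W n) by exact: itg_le (mW n) (Wle n) (itgZ (K + 1) iu).
have -> : Bp (u + w n) - Bp (w n) - Bp u = \int[leb]_x g n x.
  have i1 : itg (fun x => pw (u x + w n x) - pw (w n x)) by exact: itgB (iuw n) (iw n).
  by rewrite /g (intB i1 iu) (intB (iuw n) (iw n)).
have le1 : `|\int[leb]_x g n x| <= \int[leb]_x (W n x + e' * pw (w n x)).
  have iWe : itg (fun x => W n x + e' * pw (w n x)) by apply: (itgD iW); exact: (itgZ e' (iw n)).
  have gle x : `|g n x| <= W n x + e' * pw (w n x).
    by rewrite -lerBlDr /W le_max lexx.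
  rewrite ler_norml; apply/andP; split; last by apply: int_le => // x; exact: le_trans (ler_norm _) (gle x).
  rewrite lerNl -mulN1r -intZ//; apply: int_le => //; first exact: (itgZ (-1) (ig n)).
  by move=> x; rewrite mulN1r (le_trans (ler_norm _))// normrN.
apply: (le_lt_trans le1); rewrite (intD iW (itgZ e' (iw n))) intZ//.
rewrite [ltRHS](splitr e); apply: ltr_leD => //.
have C1 : 0 < C + 1 by rewrite ltr_wpDl.
apply: (le_trans (ler_wpM2l (ltW e'0) (BC n))).
have -> : e' * C = e / 2 * (C / (C + 1)) by rewrite /e'; field; rewrite gt_eqF.
by rewrite ler_piMr ?(ltW e20)// ler_pdivrMr// mul1r lerDl.
Qed.

End weak_sobolev.

(** * The optimal constant and its attainment *)

Section gagliardo_nirenberg.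
Implicit Types (f g u v w : E -> R) (x y z : E) (i : 'I_N) (A : set E).

Lemma powR_exp (a r : R) : expR a `^ r = expR (r * a).
Proof. by rewrite /powR gt_eqF ?expR_gt0// expRK. Qed.

Lemma Bp_ae u v : measurable_fun setT u -> measurable_fun setT v ->
  {ae leb, forall x, u x = v x} -> Bp u = Bp v.
Proof.
by move=> mu mv uv; apply: int_ae; [exact: meas_pw|exact: meas_pw|apply: filterS uv => x ->].
Qed.

Lemma BpZ (a : R) u : H1 u -> Bp (a *: u) = `|a| `^ q * Bp u.
Proof.
move=> hu; rewrite /Bp -intZ; last exact: (itg_pw hu).
by apply: eq_Rintegral => x _; rewrite !fE pwM.
Qed.

Lemma Bp_mpres c T u : H1 u -> mpres c T -> Bp (u \o T) = c * Bp u.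
Proof. by move=> hu mp; exact: (mpres_int mp (itg_pw hu)). Qed.

(** The factor [l ^ (N / 2)] makes the dilation preserve the L^2 norm, so it moves along the
    constraint set. *)
Definition dil (l : R) u : E -> R := (l `^ (N%:R / 2)) *: (u \o ( *:%R l)).

Lemma dilP (l : R) u : 0 < l -> H1 u -> [/\ H1 (dil l u), nsq (dil l u) = nsq u,
  dirichlet (dil l u) = l ^+ 2 * dirichlet u & Bp (dil l u) = l `^ (N%:R * p / 2) * Bp u].
Proof.
move=> l0 hu; have [hv _] := H1_dil l0 hu; have mp := mpres_scale (N := N) l0.
have hs := H1Z (l `^ (N%:R / 2)) hv; have Lv := H1_L2 hv.
have lN : (l `^ (N%:R / 2)) ^+ 2 * l^-1 ^+ N = 1.
  rewrite -powR_mulrn ?powR_ge0// -powRrM divfK// powR_mulrn ?(ltW l0)//.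
  by rewrite exprVn divff// expf_neq0// gt_eqF.
split => //.
- by rewrite (nsqZ _ Lv) (mpres_nsq mp (H1_L2 hu)) mulrA lN mul1r.
- rewrite (dirichletZ _ hv) (dirichlet_dil l0 hu) mulrCA; congr (_ * _).
  by rewrite mulrA lN mul1r.
rewrite (BpZ _ hv) (Bp_mpres hu mp) mulrA; congr (_ * _).
have := lnK (l0 : l \in Num.pos); move: (ln l) => a <-.
rewrite ger0_norm ?powR_ge0// !powR_exp -expRN -expRM_natl -expRD; congr expR.
by field.
Qed.

Definition unit_pair u := [/\ H1 u, nsq u = 1 & dirichlet u = 1].

Lemma dirichlet_gt0 u : H1 u -> 0 < nsq u -> 0 < dirichlet u.
Proof.
move=> hu M0; rewrite lt0r dirichlet_ge0 andbT; apply/eqP => D0.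
by have := dirichlet_eq0 hu D0 => e; rewrite e ltxx in M0.
Qed.

Lemma normalize u : H1 u -> 0 < nsq u -> exists2 v, unit_pair v &
  Bp u = Bp v * dirichlet u `^ k * nsq u `^ beta.
Proof.
move=> hu M0; have D0 := dirichlet_gt0 hu M0.
pose m := ln (nsq u); pose d := ln (dirichlet u).
have eM : nsq u = expR m by rewrite lnK.
have eD : dirichlet u = expR d by rewrite lnK.
(* [s] normalizes the mass; the dilation by [l] preserves it and then normalizes the Dirichlet
   energy. Writing the quantities as exponentials makes the exponent identities linear. *)
pose s := expR (- m / 2); pose l := expR ((m - d) / 2).
have l0 : 0 < l by exact: expR_gt0.
have hsu := H1Z s hu; have [hv M D B] := dilP l0 hsu.
exists (dil l (s *: u)).
  split => //.
    by rewrite M (nsqZ _ (H1_L2 hu)) eM /s -expRM_natl -expRD -[RHS]expR0; congr expR; field.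
  by rewrite D (dirichletZ _ hu) eD /s /l -!expRM_natl -!expRD -[RHS]expR0; congr expR; field.
rewrite B (BpZ _ hu) ger0_norm ?expR_ge0// eM eD /s /l !powR_exp.
rewrite (_ : _ * _ * _ * _ = (expR (N%:R * p / 2 * ((m - d) / 2)) * expR (q * (- m / 2)) * expR (k * d) * expR (beta * m)) * Bp u); last by ring.
by rewrite -!expRD (_ : _ + _ = 0) ?expR0 ?mul1r//; field.
Qed.

Lemma unit_bound : exists C, forall v, unit_pair v -> Bp v <= C.
Proof.
have [C hC] := Bp_bound 1; exists C => v [hv M1 D1].
by apply: (hC v hv _ _).2; rewrite ?M1 ?D1.
Qed.

Definition Cst : R := sup [set Bp v | v in unit_pair].

Lemma Cst_ub v : unit_pair v -> Bp v <= Cst.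
Proof.
move=> hv; apply: ub_le_sup; last by exists v.
by have [C hC] := unit_bound; exists C => _ [w hw <-]; exact: hC.
Qed.

Lemma gn u : H1 u -> Bp u <= Cst * dirichlet u `^ k * nsq u `^ beta.
Proof.
move=> hu; have := nsq_ge0 leb u; rewrite le_eqVlt => /predU1P[M0|M0].
  rewrite -M0 powR0 ?(gt_eqF hb)// mulr0.
  have u0 := nsq_eq0 (H1_L2 hu) (esym M0).
  rewrite (@Bp_ae u 0 (L2_meas (H1_L2 hu)) (L2_meas (L20 leb)))//.
  by rewrite /Bp; under eq_Rintegral => x _ do rewrite (pw0 p0); rewrite int0.
have [v uv ->] := normalize hu M0.
by rewrite ler_wpM2r ?powR_ge0// ler_wpM2r ?powR_ge0// Cst_ub.
Qed.

Lemma Bp_gt0 u : H1 u -> 0 < nsq u -> 0 < Bp u.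
Proof.
move=> hu M0; rewrite lt0r Bp_ge0 andbT; apply/eqP => B0.
have h := int_eq0 (itg_pw hu) (fun x => pw_ge0 p (u x)) B0.
suff e : nsq u = 0 by rewrite e ltxx in M0.
apply: nsq0_ae; first exact: H1_L2.
by apply: filterS h => x /eqP; rewrite powR_eq0 normr_eq0 => /andP[/eqP].
Qed.

Lemma unit_sh y u : unit_pair u -> unit_pair (sh y u) /\ Bp (sh y u) = Bp u.
Proof.
move=> [hu M1 D1]; have [hs _] := dirichlet_sh y hu; split; last first.
  by have := Bp_mpres hu (mpres_shift y); rewrite mul1r.
split; [exact: hs|rewrite (nsq_sh y (H1_L2 hu)); exact: M1|rewrite (dirichlet_shE y hu); exact: D1].
Qed.

Variable u0 : E -> R.
Hypothesis hu0 : H1 u0.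
Hypothesis Mu0 : 0 < nsq u0.

Lemma Cst_gt0 : 0 < Cst.
Proof.
have [v uv _] := normalize hu0 Mu0; apply: lt_le_trans (Cst_ub uv).
by case: uv => hv M1 D1; apply: Bp_gt0 => //; rewrite M1.
Qed.

(** By [nonvanishing] each nearly maximal function has a definite average around some point;
    translating that point to the origin keeps a definite pairing with one fixed cube, so the weak
    limit cannot be 0. *)
Lemma maximizing_seq : exists u : nat -> E -> R, [/\ forall n, unit_pair (u n),
  forall n, Cst - n.+1%:R^-1 < Bp (u n) &
  exists h eta : R, [/\ 0 < h, 0 < eta & forall n, eta <= `|dot (u n) (\1_(cube h))|]].
Proof.
have C0 := Cst_gt0.
have [h [eta [h0 eta0 H]]] := nonvanishing 1 (divr_gt0 C0 (ltr0Sn R 1)).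
have hs : has_sup [set Bp v | v in unit_pair].
  split; first by have [v uv _] := normalize hu0 Mu0; exists (Bp v), v.
  by have [C hC] := unit_bound; exists C => _ [w hw <-]; exact: hC.
have lc : 0 < lm (cube h : set E) by rewrite lm_cube ?(ltW h0)// exprn_gt0// mulr_gt0.
have /choice[u hu] : forall n : nat, exists v, [/\ unit_pair v, Cst - n.+1%:R^-1 < Bp v &
    eta * lm (cube h : set E) <= `|dot v (\1_(cube h))|].
  (* The minimum with [Cst / 2] keeps the power integral above [Cst / 2], the threshold for which
     [nonvanishing] was invoked. *)
  move=> n; pose e := Num.min (n.+1%:R^-1) (Cst / 2).
  have e0 : 0 < e by rewrite lt_min invr_gt0 ltr0Sn divr_gt0.
  have [_ [v uv <-] hv] := sup_adherent e0 hs; rewrite -/Cst in hv.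
  have [hv1 M1 D1] := uv.
  have [|||y hy] := H v hv1.
  - by rewrite M1.
  - by rewrite D1.
  - rewrite (le_trans _ (ltW hv))// lerBrDl -lerBrDr (le_trans (_ : e <= Cst / 2))//; last by lra.
    by rewrite /e ge_min lexx orbT.
  have [us Bs] := unit_sh y uv; exists (sh y v); split; [exact: us| |].
    by rewrite Bs (le_lt_trans _ hv)// lerD2l lerN2 /e ge_min lexx.
  rewrite -ler_pdivlMr// mulrC -[_^-1]gtr0_norm ?invr_gt0// -normrM; exact: hy.
exists u; split => [n|n|]; [by have [] := hu n|by have [] := hu n|].
by exists h, (eta * lm (cube h : set E)); split => //; [rewrite mulr_gt0|move=> n; have [] := hu n].
Qed.

Lemma powR_le1 (t r : R) : 0 <= r -> 0 <= t <= 1 -> t `^ r <= 1.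
Proof. 
move=> r0 /andP[t0 t1]; have e : 1 `^ r = 1 :> R by rewrite powR1.
by rewrite -[leRHS]e; exact: powR_homo. Qed.

Lemma powR_le_sqr (t : R) : 0 <= t <= 1 -> t `^ k <= t ^+ 2.
Proof.
move=> t01; have /andP[t0 t1] := t01.
have -> : k = 2 + (k - 2) by rewrite addrC subrK.
rewrite powR_addexp// ?subr_ge0//; last by rewrite addrC subrK (lt_le_trans _ hk).
by rewrite powR_mulrn// ler_piMr ?exprn_ge0// powR_le1// subr_ge0.
Qed.

Lemma subseq_cvg (s : nat -> nat) : (forall n, (n <= s n)%N) -> s n @[n --> \oo] --> \oo.
Proof. by move=> hs A [m _ hm]; exists m => // n /= mn; apply: hm => /=; exact: leq_trans (hs n). Qed.

(** Let [x] and [y] be the Dirichlet energy and the mass of the weak limit [g], both in []0, 1]].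
    The remainder carries [1 - x] and [1 - y] in the limit, so the Brezis-Lieb lemma and [gn] give
    [Cst - Cst (1 - x)^2 <= Bp g <= Cst x^2 y^beta], powers of order [k] being bounded by squares.
    This leaves only [x = y = 1]. *)
Lemma maximizer_exists : exists2 v, unit_pair v & Bp v = Cst.
Proof.
have C0 := Cst_gt0.
have [u [uu uB [h [eta [h0 eta0 hd]]]]] := maximizing_seq.
have hu n : H1 (u n) by have [] := uu n.
have Mu n : nsq (u n) = 1 by have [] := uu n.
have Du n : dirichlet (u n) = 1 by have [] := uu n.
have Lu n := H1_L2 (hu n).
have Mu1 n : nsq (u n) <= 1 by rewrite Mu.
have Du1 n : dirichlet (u n) <= 1 by rewrite Du.
have [phi [phik [g Lg wg]]] := weak_subseq (C := 1) Lu Mu1.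
have [hg gg] := H1_weak_limit (fun n => hu (phi n)) (fun n => Du1 (phi n)) Lg wg.
pose w n := u (phi n) - g.
have hw n : H1 (w n) by exact: H1B (hu _) hg.
have Lw n := H1_L2 (hw n).
have Mc : nsq (w n) @[n --> \oo] --> 1 - nsq g.
  have c : (1 - 2 * dot (u (phi n)) g + nsq g) @[n --> \oo] --> 1 - 2 * dot g g + nsq g.
    apply: cvgD; last exact: cvg_cst.
    by apply: cvgB; [exact: cvg_cst|apply: cvgMl_tmp; exact: wg].
  have -> : 1 - nsq g = 1 - 2 * dot g g + nsq g by rewrite dotff; ring.
  by apply: cvg_eqr c => n; rewrite /w nsqB// Mu.
have Dc : dirichlet (w n) @[n --> \oo] --> 1 - dirichlet g.
  have c1 : dotD (u (phi n)) g @[n --> \oo] --> dotD g g.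
    apply: (@cvg_big R 'I_N +%R 0 xpredT addR_continuous) => i _; apply: gg; exact: gr_L2.
  have c : (1 - 2 * dotD (u (phi n)) g + dirichlet g) @[n --> \oo] --> 1 - 2 * dotD g g + dirichlet g.
    apply: cvgD; last exact: cvg_cst.
    by apply: cvgB; [exact: cvg_cst|apply: cvgMl_tmp].
  have -> : 1 - dirichlet g = 1 - 2 * dotD g g + dirichlet g by rewrite (dotDff hg); ring.
  by apply: cvg_eqr c => n; rewrite /w (dirichletB (hu _) hg) Du.
have Lc : L2 (\1_(cube h) : E -> R) by exact: L2_indic_cube.
have M0 : 0 < nsq g.
  have c : dot (u (phi n)) (\1_(cube h)) ^+ 2 @[n --> \oo] --> dot g (\1_(cube h)) ^+ 2.
    by rewrite expr2; under eq_fun do rewrite expr2; apply: cvgM; exact: wg.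
  have : eta ^+ 2 <= dot g (\1_(cube h)) ^+ 2.
    rewrite -(cvg_lim _ c)//; apply: limr_ge; first by apply/cvg_ex; eexists; exact: c.
    by apply: nearW => n; rewrite -[leRHS]real_normK ?num_real// lerXn2r ?nnegrE ?(ltW eta0).
  move=> h1; have := le_trans h1 (dot_CS Lg Lc); rewrite lt0r nsq_ge0 andbT => h2.
  by apply/eqP => e; move: h2; rewrite e mul0r leNgt exprn_gt0.
have D0 := dirichlet_gt0 hg M0.
have ge0_lim (a : nat -> R) l : (forall n, 0 <= a n) -> a n @[n --> \oo] --> l -> 0 <= l.
  move=> a0 c; rewrite -(cvg_lim _ c)//; apply: limr_ge; first by apply/cvg_ex; eexists; exact: c.
  exact: nearW.
have y1 : nsq g <= 1 by rewrite -subr_ge0; exact: ge0_lim (fun n => nsq_ge0 _ _) Mc.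
have x1 : dirichlet g <= 1 by rewrite -subr_ge0; exact: ge0_lim (fun n => dirichlet_ge0 _) Dc.
have Mw n : nsq (w n) <= 4.
  have := nsqD_le (Lu (phi n)) (L2N Lg); rewrite nsqN Mu => h1; apply: (le_trans h1); move: y1; gen_atoms; lra.
have Dw n : dirichlet (w n) <= 4.
  rewrite (dirichletB (hu _) hg) Du; have := dirichlet_ge0 (u (phi n) + g).
  by rewrite (dirichletD (hu _) hg) Du; move: x1; gen_dotD; lra.
have w0 f : L2 f -> dot (w n) f @[n --> \oo] --> (0 : R).
  move=> Lf; have c : (dot (u (phi n)) f - dot g f) @[n --> \oo] --> (0 : R).
    by apply/(subr_cvg0 (fun n => dot (u (phi n)) f)); exact: wg.
  by apply: cvg_eqr c => n; rewrite /w dotBl.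
have [psi [psik wae]] := weak_ae hw Mw Dw w0.
have hwp k := hw (psi k).
have [CB hCB] := Bp_bound 4.
have BC k : Bp (w (psi k)) <= CB by have [] := hCB _ (hwp k) (Mw _) (Dw _).
have bl := brezis_lieb hg hwp BC wae.
have sc := subseq_cvg psik.
have Dc' : dirichlet (w (psi k)) @[k --> \oo] --> 1 - dirichlet g by exact: cvg_comp sc Dc.
have Mc' : nsq (w (psi k)) @[k --> \oo] --> 1 - nsq g by exact: cvg_comp sc Mc.
(* The limits [1 - x] and [1 - y] are strictly below 1 because [g] is nonzero; so the remainder
   eventually has energies at most 1, where [powR_le_sqr] applies. *)
have ev1 (a : nat -> R) (t : R) : 0 < t -> a k @[k --> \oo] --> 1 - t -> \forall k \near \oo, a k <= 1.
  move=> t0 /cvgrPdist_lt/(_ t t0); apply: filterS => n; rewrite ltr_distlC subrK => /andP[_ h1].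
  by rewrite ltW// (lt_le_trans h1)// subrK.
have key : Cst - Cst * (1 - dirichlet g) ^+ 2 <= Bp g.
  have c1 : (Cst - k.+1%:R^-1 - Cst * (dirichlet (w (psi k)) * dirichlet (w (psi k)))) @[k --> \oo] -->
      Cst - 0 - Cst * ((1 - dirichlet g) * (1 - dirichlet g)).
    apply: cvgB; first by apply: cvgB; [exact: cvg_cst|exact: inv_succ_cvg0].
    by apply: cvgMl_tmp; apply: cvgM.
  rewrite subr0 -expr2 in c1; rewrite -(cvg_lim _ c1)// -(cvg_lim _ bl)//; apply: ler_lim.
  - by apply/cvg_ex; eexists; exact: c1.
  - by apply/cvg_ex; eexists; exact: bl.
  apply: filterS2 (ev1 _ _ D0 Dc') (ev1 _ _ M0 Mc') => n d1 m1.
  have -> : g + w (psi n) = u (phi (psi n)) by rewrite /w addrC subrK.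
  apply: lerB.
    rewrite (le_trans _ (ltW (uB _)))// lerD2l lerN2 lef_pV2 ?posrE ?ltr0Sn// ler_nat ltnS.
    exact: leq_trans (psik n) (phik _).
  apply: (le_trans (gn (hwp n))); rewrite -mulrA ler_wpM2l ?(ltW C0)// -[leRHS]mulr1 -expr2.
  by rewrite ler_pM ?powR_ge0 ?powR_le_sqr ?powR_le1 ?dirichlet_ge0 ?nsq_ge0 ?(ltW hb).
have key2 : 1 - (1 - dirichlet g) ^+ 2 <= dirichlet g ^+ 2 * nsq g `^ beta.
  rewrite -(ler_pM2l C0) mulrBr mulr1 (le_trans key)// (le_trans (gn hg))// -mulrA ler_wpM2l ?(ltW C0)//.
  by rewrite ler_wpM2r ?powR_ge0// powR_le_sqr// dirichlet_ge0.
have yb : nsq g `^ beta <= 1 by rewrite powR_le1 ?(ltW hb)// nsq_ge0.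
(* The key inequality reads [2 x - x^2 <= x^2 y^beta <= x^2], so [x >= 1] after division by
   [x > 0]. *)
have xE : dirichlet g = 1.
  apply/eqP; rewrite eq_le x1 /=; move: D0 x1 key2 yb (powR_ge0 (nsq g) beta); gen_atoms.
  move: (_ `^ _) => Y; nra.
have yE : nsq g = 1.
  apply/eqP; rewrite eq_le y1 /= leNgt; apply/negP => ylt.
  have := gt0_ltr_powR hb (_ : nsq g \in Num.nneg) (_ : 1 \in Num.nneg) ylt.
  rewrite !nnegrE nsq_ge0 ler01 powR1 => /(_ isT isT).
  by move: key2; rewrite xE subrr expr0n/= subr0 expr1n mul1r => /le_lt_trans h1 /h1; rewrite ltxx.
exists g; first by split.
apply/eqP; rewrite eq_le Cst_ub//=; move: key; rewrite xE subrr expr0n/= mulr0 subr0//.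
Qed.

End gagliardo_nirenberg.

(** * Euler-Lagrange equation and transformations of optimizers *)

Section optimizers.
Implicit Types (f g u v w : E -> R) (x y z : E) (i : 'I_N) (A : set E).

Lemma min_derive (f : R -> R) (l : R) : is_derive (0 : R) 1 f l -> (forall s, f 0 <= f s) -> l = 0.
Proof.
move=> /cvg_is_derive/cvgr_dnbhsP H f0.
have c1 := H _ (conj (@hs_neq0 R) hs_cvg0); have c2 := H _ (conj (@hsN_neq0 R) hsN_cvg0).
apply/eqP; rewrite eq_le; apply/andP; split.
  rewrite -(cvg_lim _ c2)//; apply: limr_le; first by apply/cvg_ex; eexists; exact: c2.
  apply: nearW => n; rewrite nmulr_rle0 ?subr_ge0 ?addr0 ?f0// invr_lt0 oppr_lt0; exact: hs_gt0.
rewrite -(cvg_lim _ c1)//; apply: limr_ge; first by apply/cvg_ex; eexists; exact: c1.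
by apply: nearW => n; rewrite mulr_ge0 ?subr_ge0 ?addr0 ?f0// invr_ge0 ltW// hs_gt0.
Qed.

Lemma quad_derive (a b c : R) : is_derive (0 : R) 1 (fun s => a + 2 * b * s + c * s ^+ 2) (2 * b).
Proof.
apply: is_derive_cvg; apply/cvgr_dnbhsP => h [hn h0].
have c1 : (2 * b + c * h n) @[n --> \oo] --> 2 * b + c * 0.
  by apply: cvgD; [exact: cvg_cst|exact: cvgMl_tmp].
rewrite mulr0 addr0 in c1; apply: cvg_eqr c1 => n; rewrite !addr0.
by have := hn n; move: (h n) => t t0; field.
Qed.

Lemma EL_ge0 (C X Y B r I s : R) : B + r * s * I <= C * X * Y ->
  0 <= C * (X * Y) - (B + 2 * (r / 2 * I) * s + 0 * s ^+ 2).
Proof.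
move=> h; have -> : 2 * (r / 2 * I) * s = r * s * I by field.
by rewrite mul0r addr0 mulrA subr_ge0.
Qed.

Lemma powR_quad_derive (a b c r : R) : 0 < a ->
  is_derive (0 : R) 1 (fun s => (a + 2 * b * s + c * s ^+ 2) `^ r) (r * a `^ (r - 1) * (2 * b)).
Proof.
move=> a0; pose g s := a + 2 * b * s + c * s ^+ 2.
have g0 : g 0 = a by rewrite /g mulr0 expr0n mulr0 !addr0.
have := @is_derive1_comp _ (@powR R ^~ r) g 0 (r * a `^ (r - 1)) (2 * b).
apply; last exact: quad_derive.
by rewrite g0; exact: is_derive1_powR.
Qed.

Definition opt v := [/\ H1 v, 0 < nsq v & Bp v = Cst * dirichlet v `^ k * nsq v `^ beta].

Lemma Bp_tangent v phi (s : R) : H1 v -> H1 phi ->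
  Bp v + q * s * \int[leb]_x (dpw (v x) * phi x) <= Bp (v + s *: phi).
Proof.
move=> hv hp; have hvs := H1D hv (H1Z s hp).
have i1 := itg_pw hv; have i2 := itg_dpw hv hp; have i3 := itg_pw hvs.
rewrite /Bp -(intZ (q * s) i2) -(intD i1 (itgZ (q * s) i2)).
apply: int_le => //; first exact: (itgD i1 (itgZ (q * s) i2)).
move=> x; rewrite !fE; have := pw_convex p0 (v x) (s * phi x).
by rewrite (_ : q * dpw (v x) * (s * phi x) = q * s * (dpw (v x) * phi x))//; ring.
Qed.

(** Along [v + s *: phi] the right-hand side of [gn] is differentiable in [s] and dominates [Bp],
    hence also the tangent line of [Bp]. The difference vanishes at [s = 0], so its derivative there
    is 0. *)
Lemma opt_EL v phi : opt v -> H1 phi -> q * \int[leb]_x (dpw (v x) * phi x) =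
  Cst * (2 * k * dirichlet v `^ (k - 1) * nsq v `^ beta * dotD v phi
       + 2 * beta * dirichlet v `^ k * nsq v `^ (beta - 1) * dot v phi).
Proof.
move=> [hv M0 Bv] hp; have D0 := dirichlet_gt0 hv M0.
set I := \int[leb]_x _; have Lv := H1_L2 hv; have Lp := H1_L2 hp.
pose d s := dirichlet v + 2 * dotD v phi * s + dirichlet phi * s ^+ 2.
pose m s := nsq v + 2 * dot v phi * s + nsq phi * s ^+ 2.
have dE s : dirichlet (v + s *: phi) = d s.
  rewrite (dirichletD hv (H1Z s hp)) (dirichletZ s hp) (dotDZr s hp hv) /d.
  by gen_dotD; ring.
have mE s : nsq (v + s *: phi) = m s.
  rewrite (nsqD Lv (L2Z s Lp)) (nsqZ s Lp) (dotZr s Lv Lp) /m.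
  by gen_atoms; ring.
pose f s := Cst * (d s `^ k * m s `^ beta) - (Bp v + 2 * (q / 2 * I) * s + 0 * s ^+ 2).
have fd := is_deriveB (is_deriveZ Cst (is_deriveM (powR_quad_derive (dotD v phi) (dirichlet phi) k D0)
   (powR_quad_derive (dot v phi) (nsq phi) beta M0))) (quad_derive (Bp v) (q / 2 * I) 0).
have d0 : d 0 = dirichlet v by rewrite /d mulr0 expr0n mulr0 !addr0.
have m0 : m 0 = nsq v by rewrite /m mulr0 expr0n mulr0 !addr0.
have e := @min_derive f _ fd.
have {}e := e _; have /e {}e : forall s, f 0 <= f s.
  move=> s; have h1 := gn (H1D hv (H1Z s hp)); have h2 := Bp_tangent s hv hp.
  have := le_trans h2 h1; rewrite dE mE -/I => h3.
  have -> : f 0 = 0 by rewrite /f d0 m0 Bv; ring.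
  exact: (EL_ge0 h3).
move: e; rewrite -/(d _) -/(m _) d0 m0.
rewrite /GRing.scale /= => e; apply/eqP; rewrite -subr_eq0 -oppr_eq0; apply/eqP; rewrite -[RHS]e.
clear f fd e; clearbody I.
move: (dirichlet v `^ k) (dirichlet v `^ (k - 1)) (nsq v `^ beta) (nsq v `^ (beta - 1)) (dot v phi) (dotD v phi) Cst I.
by move=> a1 a2 a3 a4 a5 a6 a7 a8; field.
Qed.

Lemma powR_strict (C M x y r : R) : 0 < C -> 0 < M -> 0 <= x -> x < y -> 0 < r ->
  C * x `^ r * M < C * y `^ r * M.
Proof.
move=> C0 M0 x0 xy r0; rewrite ltr_pM2r// ltr_pM2l// gt0_ltr_powR// nnegrE// (le_trans x0)// ltW//.
Qed.

(** A strict drop of the Dirichlet energy at fixed mass and power integral would violate [gn]. Hence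
    every rearrangement that does not raise the energy, such as absolute value or polarization,
    preserves it exactly. *)
Lemma opt_le v w : opt v -> H1 w -> nsq w = nsq v -> Bp w = Bp v -> dirichlet w <= dirichlet v ->
  opt w /\ dirichlet w = dirichlet v.
Proof.
move=> [hv M0 Bv] hw Mw Bw Dw; have D0 := dirichlet_gt0 hv M0.
have C0 := Cst_gt0 hv M0.
suff e : dirichlet w = dirichlet v.
  by split; [split; [exact: hw|rewrite Mw; exact: M0|rewrite Bw Bv e Mw]|exact: e].
apply: le_anti; apply/andP; split; first exact: Dw.
rewrite leNgt; apply/negP => lt.
have k0 : 0 < k by exact: lt_le_trans hk.
have := gn hw; rewrite Bw Bv Mw; apply/negP; rewrite -ltNge.
exact: (powR_strict C0 (powR_gt0 beta M0) (dirichlet_ge0 w) lt k0).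
Qed.

Lemma opt_abs v : opt v -> opt (fun x => `|v x|) /\ dirichlet (fun x => `|v x|) = dirichlet v.
Proof.
move=> ov; have [hv M0 Bv] := ov; have [ha Da] := H1_abs hv; apply: (opt_le ov ha _ _ Da).
  by apply: eq_Rintegral => x _; rewrite real_normK ?num_real.
by apply: eq_Rintegral => x _; rewrite pw_abs.
Qed.

Lemma opt_sh y v : opt v -> opt (sh y v).
Proof.
move=> ov; have [hv M0 Bv] := ov; have [hs _] := dirichlet_sh y hv.
apply: (@opt_le v (sh y v) ov hs _ _ _).1.
- exact: (nsq_sh y (H1_L2 hv)).
- by have := Bp_mpres hv (mpres_shift y); rewrite mul1r.
- by rewrite (dirichlet_shE y hv).
Qed.

Lemma dirichlet_refl e v : dotv e e = 1 -> H1 v -> dirichlet (v \o refl e) = dirichlet v.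
Proof.
move=> e1 hv; have [hs _] := H1_refl e1 hv.
by rewrite -(dotDff hs) -(dotDff hv) (dotD_refl e1 hv hv).
Qed.

Lemma opt_refl e v : dotv e e = 1 -> opt v -> opt (v \o refl e).
Proof.
move=> e1 ov; have [hv M0 Bv] := ov; have [hs _] := H1_refl e1 hv.
have mp := mpres_refl e1.
apply: (@opt_le v (v \o refl e) ov hs _ _ _).1.
- by rewrite (mpres_nsq mp (H1_L2 hv)) mul1r.
- by rewrite (Bp_mpres hv mp) mul1r.
- by rewrite (dirichlet_refl e1 hv).
Qed.

Lemma optZ (a : R) v : a != 0 -> opt v -> opt (a *: v).
Proof.
move=> a0 [hv M0 Bv]; have hav := H1Z a hv; have Lv := H1_L2 hv.
split; [exact: hav|by rewrite (nsqZ a Lv) mulr_gt0// exprn_even_gt0|].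
rewrite (BpZ a hv) Bv (dirichletZ a hv) (nsqZ a Lv).
have D0 := dirichlet_ge0 v; have n0 := normr_ge0 a.
have e2 : a ^+ 2 = `|a| `^ 2 by rewrite powR_mulrn// real_normK ?num_real.
rewrite e2; have M0' := nsq_ge0 leb v.
move: D0 M0' (powR_ge0 `|a| 2) => {Bv hv hav M0 Lv}; move: (dirichlet v) (nsq v) => D M D0 M0 h2.
rewrite !powRM// -!powRrM.
have na : `|a| != 0 by rewrite normr_eq0.
have qe : q = 2 * k + 2 * beta by field.
rewrite [in LHS](_ : `|a| `^ q = `|a| `^ (2 * k + 2 * beta)); last by rewrite -qe.
rewrite powRD ?(negPf na) ?implybT//; ring.
Qed.

Lemma opt_ae u v : measurable_fun setT v -> {ae leb, forall x, u x = v x} -> opt u -> opt v.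
Proof.
move=> mv uv [hu M0 Bu]; have hv := H1_ae mv uv hu; have [Lu Lv] := (H1_L2 hu, H1_L2 hv).
have eM := nsq_ae Lu Lv uv; have eD := dirichlet_ae hu hv uv.
split; [exact: hv|rewrite -eM; exact: M0|rewrite -eM -eD -Bu; apply/esym].
exact: (Bp_ae (L2_meas Lu) mv uv).
Qed.

End optimizers.

(** * The strong maximum principle *)

Section strong_maximum.
Implicit Types (f g u v w : E -> R) (x y z : E) (i : 'I_N) (A : set E).

Lemma sinh_lower (u : R) : 0 <= u -> u <= expR u - expR (- u).
Proof.
move=> u0; have h1 := expR_ge1Dx u; have h2 := expR_gt0 u.
have h3 : expR (- u) <= 1 by rewrite -expR0 ler_expR oppr_le0.
have h : expR (- u) <= 1 / (1 + u).
  rewrite expRN div1r lef_pV2 ?posrE//; lra.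
have h4 : u - u * expR (-u) <= u by rewrite gerBl mulr_ge0// expR_ge0.
lra.
Qed.

(* the discrete counterpart of |grad ln w|^2 eta^2 <= 4 |grad eta|^2 - 2 grad w . grad (eta^2/w) *)
Lemma log_increment (a b e e' : R) : 0 < a -> 0 < b -> 0 <= e -> 0 <= e' ->
  (b - a) * (e' ^+ 2 / b - e ^+ 2 / a) <=
  2 * (e' - e) ^+ 2 - 8^-1 * Num.min e e' ^+ 2 * (ln b - ln a) ^+ 2.
Proof.
(* [X] is the square root of [b / a]. The left-hand side becomes [(e' - e)^2 - (e' / X - e X)^2],
   and [|T| / 2] is at most [|X - 1 / X|]. *)
move=> a0 b0 e0 e'0; pose T := ln b - ln a; pose X := expR (T / 2).
have X0 : 0 < X by exact: expR_gt0.
have bE : b = a * X ^+ 2.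
  rewrite /X -expRM_natl -[a in RHS](lnK a0) -expRD -[LHS](lnK b0); congr expR.
  by rewrite /T mulrC divfK// addrC subrK.
have e1 : (b - a) * (e' ^+ 2 / b - e ^+ 2 / a) = (e' - e) ^+ 2 - (e' / X - e * X) ^+ 2.
  by rewrite bE; field; rewrite !gt_eqF.
have XT : T ^+ 2 <= 4 * (X - X^-1) ^+ 2.
  have [T0|/ltW T0] := leP 0 T.
    have := @sinh_lower (T / 2) (divr_ge0 T0 (ler0n R 2)); rewrite expRN -/X => h.
    have h2 : 0 <= T / 2 by rewrite divr_ge0.
    move: h; move: (X - _) => Y; nra.
  have := @sinh_lower (- T / 2) (divr_ge0 _ (ler0n R 2)); rewrite oppr_ge0 => /(_ T0).
  rewrite mulNr opprK expRN -/X => h.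
  have h2 : 0 <= - (T / 2) by rewrite oppr_ge0 ler_pdivrMr// mul0r.
  move: h; have -> : X - X^-1 = - (X^-1 - X) by rewrite opprB.
  move: (X^-1 - X) => Y; nra.
rewrite e1 -/T; pose m := Num.min e e'; rewrite -/m.
have m0 : 0 <= m by rewrite le_min e0.
suff : 2^-1 * m ^+ 2 * (X - X^-1) ^+ 2 - (e' - e) ^+ 2 <= (e' / X - e * X) ^+ 2.
  have := ler_wpM2l (sqr_ge0 m) XT; move: (T ^+ 2) ((X - X^-1) ^+ 2) (m ^+ 2) (_ ^+ 2) (_ ^+ 2) => A B C D F; lra.
have XV0 : 0 < X^-1 by rewrite invr_gt0.
have XX : X * X^-1 = 1 by rewrite mulfV// gt_eqF.
(* In each case [e' / X - e X] is [m (1 / X - X)] plus a multiple of [e' - e]. If the multiplier is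
   at most 1, [half] absorbs the second term; otherwise both terms have the same sign. *)
have half (A Y : R) : 2^-1 * A ^+ 2 - Y ^+ 2 <= (A + Y) ^+ 2 by have := sqr_ge0 (A + 2 * Y); nra.
have [ee|ee] := leP e e'.
  have mE : m = e by rewrite /m min_l.
  have -> : e' / X - e * X = m * (X^-1 - X) + (e' - e) * X^-1 by rewrite mE; ring.
  have [X1|X1] := leP 1 X.
    have V1 : X^-1 <= 1 by rewrite invf_le1.
    have h1 : ((e' - e) * X^-1) ^+ 2 <= (e' - e) ^+ 2.
      by rewrite exprMn ler_piMr ?sqr_ge0// exprn_ile1// ltW.
    have := half (m * (X^-1 - X)) ((e' - e) * X^-1); rewrite exprMn.
    have -> : (X - X^-1) ^+ 2 = (X^-1 - X) ^+ 2 by ring.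
    move: h1; move: (_ ^+ 2) (_ ^+ 2) (_ ^+ 2) (_ ^+ 2) => A B C D; lra.
  have V1 : X <= X^-1 by rewrite (le_trans (ltW X1))// invf_ge1// ltW.
  have h1 : 0 <= m * (X^-1 - X) by rewrite mulr_ge0// subr_ge0.
  have h2 : 0 <= (e' - e) * X^-1 by rewrite mulr_ge0 ?subr_ge0// ltW.
  have -> : 2^-1 * m ^+ 2 * (X - X^-1) ^+ 2 = 2^-1 * (m * (X^-1 - X)) ^+ 2 by ring.
  move: h1 h2 (sqr_ge0 (e' - e)); move: (m * _) (_ * X^-1) (_ ^+ 2) => A B C; nra.
have mE : m = e' by rewrite /m min_r// ltW.
have -> : e' / X - e * X = m * (X^-1 - X) + (e' - e) * X by rewrite mE; ring.
have [X1|X1] := leP X 1.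
  have h1 : ((e' - e) * X) ^+ 2 <= (e' - e) ^+ 2.
    by rewrite exprMn ler_piMr ?sqr_ge0// exprn_ile1// ltW.
  have := half (m * (X^-1 - X)) ((e' - e) * X); rewrite exprMn.
  have -> : (X - X^-1) ^+ 2 = (X^-1 - X) ^+ 2 by ring.
  move: h1; move: (_ ^+ 2) (_ ^+ 2) (_ ^+ 2) (_ ^+ 2) => A B C D; lra.
have V1 : X^-1 <= X by rewrite (le_trans _ (ltW X1))// invf_le1// ltW.
have h1 : 0 <= m * (X - X^-1) by rewrite mulr_ge0// subr_ge0.
have h2 : 0 <= (e - e') * X by rewrite mulr_ge0 ?subr_ge0 ?(ltW ee)// ltW.
have -> : 2^-1 * m ^+ 2 * (X - X^-1) ^+ 2 = 2^-1 * (m * (X - X^-1)) ^+ 2 by ring.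
have -> : (m * (X^-1 - X) + (e' - e) * X) ^+ 2 = (m * (X - X^-1) + (e - e') * X) ^+ 2 by ring.
move: h1 h2 (sqr_ge0 (e' - e)); move: (m * _) (_ * X) (_ ^+ 2) => A B C; nra.
Qed.

Lemma H1_lip (eta : E -> R) (L r : R) : measurable_fun setT eta -> 0 <= L -> 0 <= r ->
  (forall x, 0 <= eta x <= 1) -> (forall x, ~ cube r x -> eta x = 0) ->
  (forall i x (s : R), `|eta (x + s *: ei i) - eta x| <= L * `|s|) -> H1 eta.
Proof.
move=> me L0 r0 e01 er eL.
have Le : L2 eta.
  by apply: (@bounded_supp_L2 _ _ eta 1 r) => // x; have /andP[h1 h2] := e01 x; rewrite ger0_norm.
apply: H1_of_bound => // i; have Lc := @L2_indic_cube R N (r + 1).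
exists (L ^+ 2 * nsq (\1_(cube (r + 1)) : E -> R) + 4 * nsq eta) => s.
have m := L2_meas (L2B (L2_sh (s *: ei i) Le) Le).
have [s1|s1] := leP `|s| 1.
  apply: (@le_trans _ _ (L ^+ 2 * nsq (\1_(cube (r + 1)) : E -> R) * s ^+ 2)); last first.
    by rewrite ler_wpM2r ?sqr_ge0// lerDl mulr_ge0// nsq_ge0.
  rewrite mulrAC -exprMn -nsqZ//; apply: nsq_le => //; first exact: L2Z.
  move=> x; rewrite !fE /sh indicE normrM normrM (ger0_norm L0).
  have [xr|xr] := pselect (cube (r + 1) x); first by rewrite mem_set// normr1 mulr1; exact: eL.
  rewrite memNset// normr0 mulr0 !er ?subrr ?normr0//.
    by move=> h; apply: xr; apply: cubeS h; rewrite lerDl.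
  move=> /cubeP h; apply: xr; apply/cubeP => j; have := h j; rewrite !mxE => {}h.
  rewrite -[x ord0 j](@addrK _ (s * ((@ord0 0 == ord0) && (j == i))%:R)) (le_trans (ler_normB _ _))// lerD//.
  by rewrite normrM (le_trans _ s1)// ler_piMr//; case: (_ && _); rewrite ?normr1 ?normr0.
apply: (@le_trans _ _ (4 * nsq eta)).
  have := nsqD_le (L2_sh (s *: ei i) Le) (L2N Le); rewrite nsqN nsq_sh// => h; apply: (le_trans h).
  by move: (nsq eta) => X; lra.
have s2 : 1 <= s ^+ 2 by rewrite -[s ^+ 2]real_normK ?num_real// exprn_ege1// ltW.
rewrite (le_trans (_ : _ <= (4 * nsq eta) * s ^+ 2))//; first by rewrite ler_peMr// mulr_ge0// nsq_ge0.
by rewrite ler_wpM2r ?sqr_ge0// lerDr mulr_ge0 ?sqr_ge0 ?nsq_ge0.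
Qed.

Variables (w eta : E -> R) (om : R).
Hypothesis hw : H1 w.
Hypothesis w0 : forall x, 0 <= w x.
Hypothesis om0 : 0 <= om.
Hypothesis he : H1 eta.
Hypothesis he2 : H1 (fun x => eta x ^+ 2).
Hypothesis e01 : forall x, 0 <= eta x <= 1.

Section epsilon.
Variable eps : R.
Hypothesis eps0 : 0 < eps.

(** Moser's test function: inserted in the supersolution inequality it controls the increments of
    [ell] where [eta = 1], uniformly in [eps]. *)
Let phi x := eta x ^+ 2 / (w x + eps).
Let ell x := ln (w x + eps).

Lemma we_gt0 x : 0 < w x + eps. Proof. by rewrite ltr_wpDl. Qed.

Lemma phi_meas : measurable_fun setT phi.
Proof.
apply: measurable_funM; first by apply: measurable_funX; exact: L2_meas (H1_L2 he).
have -> : (fun x => (w x + eps)^-1) = (fun x => (w x + eps) `^ (-1)).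
  by apply/funext => x; rewrite powR_inv1// ltW// we_gt0.
apply: (measurableT_comp (f := fun t : R => t `^ (-1))); first exact: measurable_powR.
by apply: measurable_funD => //; exact: L2_meas (H1_L2 hw).
Qed.

Lemma H1_phi : H1 phi.
Proof.
have L2e := H1_L2 he2.
have Lp : L2 phi.
  apply: (L2_le phi_meas _ (L2Z eps^-1 L2e)) => x.
  have e : `|phi x| = `|eta x ^+ 2| * `|(w x + eps)^-1| by rewrite /phi normrM.
  rewrite e !fE [leRHS]normrM [leLHS]mulrC ler_wpM2r//.
  by rewrite !gtr0_norm ?invr_gt0 ?we_gt0// lef_pV2 ?posrE ?we_gt0// lerDr.
apply: H1_of_bound => // i.
exists (2 * (eps^-1 ^+ 2 * nsq (gr i (fun x => eta x ^+ 2))) + 2 * (eps^-1 ^+ 4 * nsq (gr i w))) => s.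
have b1 := H1_dq_le i s he2; have b2 := H1_dq_le i s hw.
have La := L2B (L2_sh (s *: ei i) L2e) L2e.
have Lb := L2B (L2_sh (s *: ei i) (H1_L2 hw)) (H1_L2 hw).
pose g x := eps^-1 * `|(sh (s *: ei i) (fun x => eta x ^+ 2) - (fun x => eta x ^+ 2)) x| + eps^-1 ^+ 2 * `|(sh (s *: ei i) w - w) x|.
have Lg : L2 g.
  by apply: (L2D (L2Z eps^-1 (L2_abs La)) (L2Z (eps^-1 ^+ 2) (L2_abs Lb))).
apply: (@le_trans _ _ (nsq g)).
  apply: nsq_le => //; first exact: L2_meas (L2B (L2_sh _ Lp) Lp).
  move=> x; rewrite !fE /sh /phi; have W := we_gt0 x; have W' := we_gt0 (x + s *: ei i).
  have -> : eta (x + s *: ei i) ^+ 2 / (w (x + s *: ei i) + eps) - eta x ^+ 2 / (w x + eps) =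
    (eta (x + s *: ei i) ^+ 2 - eta x ^+ 2) / (w (x + s *: ei i) + eps) - eta x ^+ 2 / (w (x + s *: ei i) + eps) / (w x + eps) * (w (x + s *: ei i) - w x).
    by field; rewrite !gt_eqF.
  have V (z : E) : (w z + eps)^-1 <= eps^-1 by rewrite lef_pV2 ?posrE ?we_gt0// lerDr.
  have V0 (z : E) : 0 <= (w z + eps)^-1 by rewrite invr_ge0 ltW ?we_gt0.
  have eV : 0 <= eps^-1 by rewrite invr_ge0 ltW.
  rewrite [leRHS]ger0_norm ?addr_ge0 ?mulr_ge0 ?exprn_ge0//.
  rewrite (le_trans (ler_normB _ _))// /g !fE /sh; apply: lerD.
    by rewrite normrM mulrC ler_wpM2r// ger0_norm.
  have h0 : 0 <= eta x ^+ 2 / (w (x + s *: ei i) + eps) / (w x + eps) by exact: (mulr_ge0 (mulr_ge0 (sqr_ge0 _) (V0 _)) (V0 _)).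
  rewrite normrM (ger0_norm h0); apply: ler_wpM2r => //; rewrite -mulrA (expr2 eps^-1).
  have /andP[h1 h2] := e01 x.
  rewrite -[leRHS]mul1r ler_pM ?sqr_ge0 ?mulr_ge0 ?exprn_ile1// ler_pM//.
have := nsqD_le (L2Z eps^-1 (L2_abs La)) (L2Z (eps^-1 ^+ 2) (L2_abs Lb)).
rewrite nsqZ ?nsqZ; [|exact: L2_abs|exact: L2_abs].
have nabs f : nsq (fun x => `|f x|) = nsq f.
  by apply: eq_Rintegral => x _; rewrite real_normK ?num_real.
rewrite !nabs -exprM => h; apply: (le_trans h).
have c1 := ler_wpM2l (exprn_ge0 2 (ltW (eps0 : 0 < eps))) b1.
have v2 : 0 <= eps^-1 ^+ 2 by exact: sqr_ge0.
have v4 : 0 <= eps^-1 ^+ 4 by rewrite exprn_ge0// invr_ge0 ltW.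
have := ler_wpM2l v2 b1; have := ler_wpM2l v4 b2; rewrite -[(2 * 2)%N]/4%N.
move=> _ _; rewrite [leRHS]mulrDl; apply: lerD; rewrite -[leRHS]mulrA ler_wpM2l// -[leRHS]mulrA ler_wpM2l// [leRHS]mulrC.
  exact: b1.
exact: b2.
Qed.

Lemma ell_lip x y : `|ell x - ell y| <= eps^-1 * `|w x - w y|.
Proof.
have H (a b : R) : eps <= a -> a <= b -> ln b - ln a <= eps^-1 * (b - a).
  move=> ea ab; have a0 : 0 < a by exact: lt_le_trans ea.
  have b0 : 0 < b by exact: lt_le_trans ab.
  rewrite -ln_div//; apply: (@le_trans _ _ (b / a - 1)).
    have := expR_ge1Dx (ln (b / a)); rewrite lnK ?posrE ?divr_gt0//; lra.
  have -> : b / a - 1 = a^-1 * (b - a) by field; rewrite gt_eqF.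
  by rewrite ler_wpM2r ?subr_ge0// lef_pV2 ?posrE.
have e x' : eps <= w x' + eps by rewrite lerDr.
have m (a b : R) : 0 < a -> a <= b -> ln a <= ln b by move=> a0 ab; rewrite ler_ln ?posrE// (lt_le_trans a0).
rewrite /ell; have -> : w x - w y = (w x + eps) - (w y + eps) by ring.
have [h|/ltW h] := leP (w x + eps) (w y + eps).
  by rewrite distrC (distrC (w x + eps)) !ger0_norm ?subr_ge0 ?m ?we_gt0//; exact: H.
by rewrite !ger0_norm ?subr_ge0 ?m ?we_gt0//; exact: H.
Qed.

Lemma ell_meas : measurable_fun setT ell.
Proof.
apply: (measurableT_comp (f := @ln R)); first exact: measurable_ln.
by apply: measurable_funD => //; exact: L2_meas (H1_L2 hw).
Qed.

(** The logarithmic increment with the weight that [log_increment] provides, the smaller of the two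
    cutoff values. *)
Let kap i (h : R) x := Num.min (eta x) (eta (x + h *: ei i)) * (ell (x + h *: ei i) - ell x).

Lemma L2_kap i (h : R) : L2 (kap i h).
Proof.
have me := L2_meas (H1_L2 he); have Lw := H1_L2 hw.
apply: (L2_le _ _ (L2Z eps^-1 (L2B (L2_sh (h *: ei i) Lw) Lw))).
  apply: measurable_funM; first by apply: measurable_minr => //; exact: (mpres_meas (mpres_shift (h *: ei i)) me).
  by apply: measurable_funB; [exact: (mpres_meas (mpres_shift (h *: ei i)) ell_meas)|exact: ell_meas].
move=> x; rewrite /kap !fE /sh normrM -[leRHS]mul1r ler_pM//.
  have /andP[h1 h2] := e01 x; have /andP[h3 h4] := e01 (x + h *: ei i).
  by rewrite ger0_norm ?le_min ?h1// ge_min h2.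
by rewrite normrM [X in _ <= X * _]gtr0_norm ?invr_gt0//; exact: ell_lip.
Qed.

Lemma kap_sum_le (h : R) : 8^-1 * \sum_i nsq (kap i h) <=
  2 * \sum_i nsq (sh (h *: ei i) eta - eta) - \sum_i dot (sh (h *: ei i) w - w) (sh (h *: ei i) phi - phi).
Proof.
rewrite !mulr_sumr -sumrB; apply: ler_sum => i _.
have Le := H1_L2 he; have Lw := H1_L2 hw; have Lp := H1_L2 H1_phi.
have LK := L2_kap i h; have LE := L2B (L2_sh (h *: ei i) Le) Le.
have LW := L2B (L2_sh (h *: ei i) Lw) Lw; have LP := L2B (L2_sh (h *: ei i) Lp) Lp.
rewrite /l2sq /l2dot -(intZ 8^-1 LK.2) -(intZ 2 LE.2).
have i1 := itgZ 2 LE.2; have i2 := itg_mul LW LP.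
rewrite -(intB i1 i2); apply: int_le; [exact: (itgZ 8^-1 LK.2)|exact: (itgB i1 i2)|].
move=> x; rewrite !fE /sh /kap /phi /ell.
have /andP[h1 _] := e01 x; have /andP[h3 _] := e01 (x + h *: ei i).
have := log_increment (we_gt0 x) (we_gt0 (x + h *: ei i)) h1 h3.
have -> : w (x + h *: ei i) + eps - (w x + eps) = w (x + h *: ei i) - w x by ring.
rewrite exprMn; move: (ln _ - ln _) (Num.min _ _) => A B.
move: (eta _) (eta _) (_ * (_ - _)) => C D F; lra.
Qed.

Hypothesis super : 0 <= dotD w phi + om * dot w phi.

(** Independent of [eps], since [dot w phi] is at most [nsq eta]. *)
Let C0 := 8 * (2 * dirichlet eta + om * nsq eta).

Lemma dot_w_phi_le : dot w phi <= nsq eta.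
Proof.
have Le := H1_L2 he; have Lw := H1_L2 hw; have Lp := H1_L2 H1_phi.
apply: int_le; [exact: itg_mul|exact: Le.2|move=> x].
rewrite /phi mulrCA ler_piMr ?sqr_ge0// ler_pdivrMr ?we_gt0// mul1r lerDl ltW//.
Qed.

(** [log_increment] is sharp only for small steps, so the shift by [s] is cut into [n.+1] equal
    pieces. Telescoping and Cauchy-Schwarz bound the squared increment by [n.+1] times the sum of
    squares; after integration the factors [n.+1] turn the pieces into difference quotients, which
    converge to [dirichlet eta] and [dotD w phi] as [n] grows. *)
Lemma log_shift_bound i (s : R) (K : set E) : 0 < s -> measurable K ->
  (forall x (t : R), K x -> 0 <= t <= s -> eta (x + t *: ei i) = 1) ->
  forall A, measurable A -> A `<=` K -> (forall d : R, 0 <= d ->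
   (forall x, A x -> d <= `|ell (x + s *: ei i) - ell x|) -> (leb A < +oo)%E -> d ^+ 2 * lm A <= s ^+ 2 * C0).
Proof.
move=> s0 mK eK A mA AK d d0 Ad Afin.
pose h n := s / n.+1%:R.
have hn n : h n != 0 by rewrite mulf_neq0 ?gt_eqF// invr_gt0.
have h0 : h n @[n --> \oo] --> (0 : R) by rewrite -(mulr0 s); apply: cvgMl_tmp; exact: inv_succ_cvg0.
have hP := H1_phi.
have c1 := dirichlet_cvg he hn h0; have c2 := dotD_cvg hw hP hn h0.
have c3 : (s ^+ 2 * (8 * (2 * (\sum_i nsq (dq (h n) i eta)) - \sum_i dot (dq (h n) i w) (dq (h n) i phi)))) @[n --> \oo]
    --> s ^+ 2 * (8 * (2 * dirichlet eta - dotD w phi)).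
  by apply: cvgMl_tmp; apply: cvgMl_tmp; apply: cvgB => //; apply: cvgMl_tmp.
apply: (@le_trans _ _ (s ^+ 2 * (8 * (2 * dirichlet eta - dotD w phi)))); last first.
  rewrite ler_wpM2l ?sqr_ge0// /C0 ler_wpM2l//.
  have := ler_wpM2l om0 dot_w_phi_le; move: super; gen_dotD; move: (om * _) (om * _) => X Y; lra.
rewrite -(cvg_lim _ c3)//; apply: limr_ge; first by apply/cvg_ex; eexists; exact: c3.
apply: nearW => n; set m := n.+1.
have hm : h n * m%:R = s by rewrite /h divfK// gt_eqF// ltr0n.
pose Kj (j : nat) := sh ((j%:R * h n) *: ei i) (kap i (h n)).
have LKj j : L2 (Kj j) by apply: L2_sh; exact: L2_kap.
have tel x : A x -> ell (x + s *: ei i) - ell x = \sum_(j < m) Kj j x.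
  move=> Ax; have S : forall M : nat, (M <= m)%N -> ell (x + (M%:R * h n) *: ei i) - ell x = \sum_(j < M) Kj j x.
    elim=> [|M IH] Mm; first by rewrite big_ord0 mul0r scale0r addr0 subrr.
    rewrite big_ord_recr /= -IH ?(ltnW Mm)// /Kj /sh /kap.
    have eq1 (M' : nat) : (M' <= m)%N -> eta (x + (M'%:R * h n) *: ei i) = 1.
      move=> Mm'; apply: eK; first exact: AK.
      have hp : 0 < h n by rewrite divr_gt0.
      rewrite mulr_ge0 ?(ltW hp)//= -hm mulrC ler_wpM2l ?(ltW hp)// ler_nat//.
    have -> : x + (M%:R * h n) *: ei i + h n *: ei i = x + (M.+1%:R * h n) *: ei i.
      by rewrite -addrA -scalerDl -[M.+1]addn1 natrD mulrDl mul1r.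
    by rewrite !eq1 ?(ltnW Mm)// minxx mul1r; ring.
  by rewrite -S// -hm mulrC.
have sumsq (F : nat -> R) M : (\sum_(j < M) F j) ^+ 2 <= M%:R * \sum_(j < M) F j ^+ 2.
  elim: M => [|M IH]; first by rewrite !big_ord0 expr0n mulr0.
  rewrite !big_ord_recr /= sqrrD -[M.+1]addn1 natrD.
  have S2 : 2 * ((\sum_(j < M) F j) * F M) <= \sum_(j < M) F j ^+ 2 + M%:R * F M ^+ 2.
    rewrite mulr_suml mulr_sumr; have -> : M%:R * F M ^+ 2 = \sum_(j < M) F M ^+ 2 by rewrite sumr_const card_ord mulr_natl.
    rewrite -big_split; apply: ler_sum => j _ /=; have := sqr_ge0 (F j - F M); lra.
  move: IH S2; rewrite -mulr_natl; move: (\sum_(_ < _) _) (\sum_(_ < _) _) (M%:R) (F M) => a b c e; lra.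
have [I1 n1] := itg_indic mA Afin.
have LS : itg (fun x => m%:R * \sum_(j < m) Kj j x ^+ 2).
  by apply: (itgZ m%:R (itg_sum (fun j : 'I_m => (LKj j).2))).
apply: (@le_trans _ _ (\int[leb]_x (m%:R * \sum_(j < m) Kj j x ^+ 2))).
  rewrite -n1 -intZ//; apply: int_le => //; first exact: (itgZ (d ^+ 2) I1).
  move=> x; rewrite indicE; case: (boolP (x \in A)) => [|_]; last by rewrite mulr0 mulr_ge0// sumr_ge0// => j _; exact: sqr_ge0.
  rewrite inE mulr1 => Ax; apply: le_trans (sumsq (fun j => Kj j x) m); rewrite -tel//.
  by rewrite -[leRHS]real_normK ?num_real// lerXn2r ?nnegrE// Ad.
rewrite intZ; last exact: (itg_sum (fun j : 'I_m => (LKj j).2)).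
rewrite int_sum; last by move=> j; exact: (LKj j).2.
have -> : \sum_(j < m) \int[leb]_x Kj j x ^+ 2 = m%:R * nsq (kap i (h n)).
  rewrite (eq_bigr (fun=> nsq (kap i (h n)))); first by rewrite sumr_const card_ord mulr_natl.
  by move=> j _; exact: nsq_sh (L2_kap i (h n)).
have hp : 0 < h n by rewrite divr_gt0.
have mE : m%:R = s / h n by rewrite -hm mulrAC divff ?mul1r.
rewrite mulrA -expr2 mE expr_div_n -mulrA ler_wpM2l ?sqr_ge0//.
have k1 : nsq (kap i (h n)) <= \sum_i nsq (kap i (h n)).
  by rewrite (bigD1 i)//= lerDl; apply: sumr_ge0 => j _; exact: nsq_ge0.
rewrite (le_trans (ler_wpM2l _ k1)) ?invr_ge0 ?sqr_ge0//.
have k2 := kap_sum_le (h n).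
rewrite ler_pdivrMl ?exprn_gt0//.
have Le := H1_L2 he; have Lw := H1_L2 hw; have Lp := H1_L2 hP.
have -> : \sum_i nsq (dq (h n) i eta) = (h n) ^- 2 * \sum_i nsq (sh (h n *: ei i) eta - eta).
  by rewrite mulr_sumr; apply: eq_bigr => j _; rewrite nsqZ ?exprVn//; exact: L2B (L2_sh _ Le) Le.
have -> : \sum_i dot (dq (h n) i w) (dq (h n) i phi) = (h n) ^- 2 * \sum_i dot (sh (h n *: ei i) w - w) (sh (h n *: ei i) phi - phi).
  rewrite mulr_sumr; apply: eq_bigr => j _.
  have L1 := L2B (L2_sh (h n *: ei j) Lw) Lw; have L2' := L2B (L2_sh (h n *: ei j) Lp) Lp.
  by rewrite (dotZl _ L1 (L2Z _ L2')) (dotZr _ L1 L2') mulrA -expr2 exprVn.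
move: k2; move: (\sum_i _) (\sum_i _) (\sum_i _) => a b c k2.
have -> : (h n) ^+ 2 * (8 * (2 * ((h n) ^- 2 * b) - (h n) ^- 2 * a)) = 8 * (2 * b - a) by field.
lra.
Qed.

End epsilon.

(** Between a zero of [w] and a point where [w] is at least [d], the logarithm of [w + eps] jumps by
    an amount that is unbounded as [eps] tends to 0, whereas the bound of [log_shift_bound] does not
    depend on [eps]. *)
Lemma zero_set_shift_null i (s : R) (K : set E) (d : R) : 0 < s -> 0 < d ->
  measurable K -> (leb K < +oo)%E ->
  (forall x (t : R), K x -> 0 <= t <= s -> eta (x + t *: ei i) = 1) ->
  (forall eps : R, 0 < eps -> 0 <= dotD w (fun x => eta x ^+ 2 / (w x + eps)) + om * dot w (fun x => eta x ^+ 2 / (w x + eps))) ->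
  let A := [set x | K x /\ (w x = 0 /\ d <= w (x + s *: ei i) \/ d <= w x /\ w (x + s *: ei i) = 0)] in
  measurable A -> leb A = 0.
Proof.
move=> s0 d0 mK fK eK sup A mA.
have AK : A `<=` K by move=> x [].
have fA : (leb A < +oo)%E by apply: le_lt_trans fK; apply: le_measure; rewrite ?inE.
pose C := s ^+ 2 * (8 * (2 * dirichlet eta + om * nsq eta)).
have C0 : 0 <= C.
  by rewrite mulr_ge0 ?sqr_ge0// mulr_ge0// addr_ge0// mulr_ge0// ?dirichlet_ge0// nsq_ge0.
have key (D : R) : 0 <= D -> D ^+ 2 * lm A <= C.
  (* With this [eps] the jump is at least [D]. *)
  move=> D0; pose eps := d * expR (- D); have eps0 : 0 < eps by rewrite mulr_gt0// expR_gt0.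
  apply: (@log_shift_bound eps eps0 (sup eps eps0) i s K s0 mK eK A mA AK D D0 _ fA).
  have H (t : R) : d <= t -> D <= `|ln (t + eps) - ln (0 + eps)|.
    move=> dt; rewrite add0r (le_trans _ (ler_norm _))//.
    have t0 : 0 < t + eps by rewrite addr_gt0// (lt_le_trans d0).
    rewrite -ln_div// -[D]expRK ler_ln ?posrE ?expR_gt0 ?divr_gt0// ler_pdivlMr//.
    by rewrite /eps mulrCA -expRD subrr expR0 mulr1 (le_trans dt)// lerDl ltW.
  by move=> x [_ [[-> /H h]|[/H h ->]]]; [exact: h|rewrite distrC].
have l0 : lm A = 0.
  apply/eqP; rewrite eq_le lm_ge0 andbT leNgt; apply/negP => A0.
  (* For [x = C / lm A] the square of [x + 1] exceeds [x], contrary to [key]. *)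
  have := key (C / lm A + 1); have h : 0 <= C / lm A by rewrite divr_ge0// ltW.
  move=> /(_ (addr_ge0 h ler01)); apply/negP; rewrite -ltNge.
  have -> : C = (C / lm A) * lm A by rewrite divfK// gt_eqF.
  rewrite mulfK ?gt_eqF// ltr_pM2r//; move: h; move: (C / _) => X; nra.
by rewrite -[leb A]fineK ?ge0_fin_numE// -/(lm A) l0.
Qed.

End strong_maximum.

(** * Translation of the zero set inside a half-space *)

Section strong_max_principle.
Implicit Types (f g u v : E -> R) (x y z : E) (i : 'I_N) (A : set E).
Variables (w : E -> R) (om s0 : R) (i0 : 'I_N).
Hypothesis hw : H1 w.
Hypothesis w0 : forall x, 0 <= w x.
Hypothesis om0 : 0 <= om.
Hypothesis super : forall phi, H1 phi -> (forall x, 0 <= phi x) ->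
  (exists2 d, 0 < d & forall x, x ord0 i0 <= s0 + d -> phi x = 0) -> 0 <= dotD w phi + om * dot w phi.

(** Piecewise linear with Lipschitz constant [2 * m]: it is 1 on the forward segments of length [s]
    parallel to the axes that start in the cube [m] at distance at least [m^-1] inside the
    half-space, and 0 outside the cube [m + s + 1] and within [(2 * m)^-1] of the boundary. So test
    functions built from it are admissible in [super]. *)
Definition cutoff (m s : R) : E -> R := fun x =>
  Num.max 0 (Num.min 1 (Num.min (m + s + 1 - `|x|) ((x ord0 i0 - s0) * (2 * m) - 1))).

Lemma cutoff01 m s x : 0 <= cutoff m s x <= 1.
Proof. by rewrite /cutoff le_max lexx /= ge_max ler01 /= ge_min lexx. Qed.

Lemma min_lip (a b c d K : R) : `|a - b| <= K -> `|c - d| <= K -> `|Num.min a c - Num.min b d| <= K.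
Proof.
rewrite !ler_norml => /andP[h1 h2] /andP[h3 h4].
by rewrite /Num.min; case: ltrP => h5; case: ltrP => h6; apply/andP; split; lra.
Qed.
Lemma max_lip (a b c d K : R) : `|a - b| <= K -> `|c - d| <= K -> `|Num.max a c - Num.max b d| <= K.
Proof.
rewrite !ler_norml => /andP[h1 h2] /andP[h3 h4].
by rewrite /Num.max; case: ltrP => h5; case: ltrP => h6; apply/andP; split; lra.
Qed.

Lemma norm_shift_le i (s : R) : `|s *: ei i : E| <= `|s|.
Proof. 
rewrite normrZ ler_piMr//.
have h (c : R) : 0 <= c -> c = 1 -> `|ei i : E| <= c.
  move=> c0 c1; rewrite /Num.norm/= mx_normrE; apply: bigmax_le => // -[a b] _; rewrite !mxE/= c1.
  by case: (_ && _); rewrite ?normr1 ?normr0.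
exact: h.
Qed.

Lemma cutoff_lip m s i x (t : R) : 1 <= m -> `|cutoff m s (x + t *: ei i) - cutoff m s x| <= (2 * m) * `|t|.
Proof.
move=> m1; have K0 : 0 <= 2 * m * `|t| by rewrite mulr_ge0// mulr_ge0// (le_trans ler01).
rewrite /cutoff; apply: max_lip; first by rewrite subrr normr0.
apply: min_lip; first by rewrite subrr normr0.
apply: min_lip.
  have -> : m + s + 1 - `|x + t *: ei i| - (m + s + 1 - `|x|) = `|x| - `|x + t *: ei i| by ring.
  rewrite distrC (le_trans (ler_dist_dist _ _))// (addrC x) addrK (le_trans (norm_shift_le i t))// ler_peMl//; lra.
rewrite !mxE; set b : R := _%:R.
have -> : (x ord0 i0 + t * b - s0) * (2 * m) - 1 - ((x ord0 i0 - s0) * (2 * m) - 1) = (2 * m) * (t * b) by ring.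
rewrite normrM ger0_norm; last by lra.
rewrite ler_wpM2l//; first by lra.
by rewrite normrM ler_piMr// /b; case: (_ && _); rewrite ?normr1 ?normr0.
Qed.

Lemma cutoff_supp m s x : 0 <= m + s + 1 -> ~ cube (m + s + 1) x -> cutoff m s x = 0.
Proof.
move=> ms0 xc; rewrite /cutoff max_l// !ge_min; apply/orP; right; apply/orP; left.
rewrite subr_le0 leNgt; apply/negP => h; apply: xc; apply/cubeP => i.
by rewrite (le_trans (coord_le_norm x i))// ltW.
Qed.

Lemma cutoff_supp2 m s x : 1 <= m -> x ord0 i0 <= s0 + (2 * m)^-1 -> cutoff m s x = 0.
Proof.
move=> m1 h; rewrite /cutoff max_l// !ge_min; apply/orP; right; apply/orP; right.
have m2 : 0 < 2 * m by lra.
by rewrite subr_le0 -ler_pdivlMr// div1r lerBlDl.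
Qed.

Lemma cutoff_meas m s : measurable_fun setT (cutoff m s).
Proof.
apply: measurable_maxr => //; apply: measurable_minr => //; apply: measurable_minr.
  apply: measurable_funB => //; apply: continuous_measurable; exact: norm_continuous.
apply: measurable_funB => //; apply: measurable_funM => //; apply: measurable_funB => //.
exact: measurable_coord.
Qed.

Lemma cutoff_one m s i x (t : R) : 1 <= m -> 0 <= s -> `|x| <= m -> s0 + m^-1 <= x ord0 i0 -> 0 <= t <= s ->
  cutoff m s (x + t *: ei i) = 1.
Proof.
move=> m1 s_0 xm xi /andP[t0 ts]; rewrite /cutoff min_l ?max_r//.
rewrite le_min; apply/andP; split.
  rewrite lerBrDr addrC -lerBrDr addrK (le_trans (ler_normD _ _))// lerD//.
  by rewrite (le_trans (norm_shift_le i t))// ger0_norm.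
rewrite !mxE lerBrDr; have m0 : 0 < m by exact: lt_le_trans ltr01 m1.
apply: (@le_trans _ _ (m^-1 * (2 * m))); first by rewrite mulrCA mulVf ?gt_eqF//; lra.
rewrite ler_wpM2r//; first by lra.
by rewrite lerBrDl (le_trans xi)// lerDl mulr_ge0.
Qed.

(** The exceptional set is a countable union of the null sets of [zero_set_shift_null], with bounded
    pieces [K] of the half-space and thresholds [n.+1%:R^-1] for the nonzero value. *)
Lemma zero_set_shift i (s : R) : 0 < s -> {ae leb, forall x, s0 < x ord0 i0 ->
   (w x = 0 <-> w (x + s *: ei i) = 0)}.
Proof.
move=> sp; have s_0 := ltW sp; have mw := L2_meas (H1_L2 hw).
pose K (m : R) := [set x : E | cube m x /\ s0 + m^-1 <= x ord0 i0].
have mle (f : E -> R) (a : R) : measurable_fun setT f -> measurable [set x | a <= f x].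
  move=> mf; have -> : [set x : E | a <= f x] = f @^-1` `[a, +oo[.
    by apply/seteqP; split => x; rewrite /= in_itv/= andbT.
  by rewrite -[X in measurable X]setTI; exact: mf.
have mK m : measurable (K m).
  apply: measurableI; first exact: cube_measurable.
  exact: (mle (fun x : E => x ord0 i0) _ (measurable_coord i0)).
have fK m : 0 <= m -> (leb (K m) < +oo)%E.
  move=> m0; apply: (@le_lt_trans _ _ (leb (cube m))); last by rewrite leb_cube// ltry.
  by apply: le_measure; rewrite ?inE//; [exact: cube_measurable|move=> x []].
have mws : measurable_fun setT (fun x => w (x + s *: ei i)) by exact: (mpres_meas (mpres_shift (s *: ei i)) mw).
have meq (f : E -> R) (a : R) : measurable_fun setT f -> measurable [set x | f x = a].
  move=> mf; have -> : [set x : E | f x = a] = f @^-1` [set a] by [].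
  by rewrite -[X in measurable X]setTI; exact: mf.
have H (n : nat) : {ae leb, forall x, K n.+1%:R x ->
    ~ (w x = 0 /\ n.+1%:R^-1 <= w (x + s *: ei i) \/ n.+1%:R^-1 <= w x /\ w (x + s *: ei i) = 0)}.
  set m : R := n.+1%:R; have m1 : 1 <= m by rewrite /m ler1n.
  have mV : 0 < m^-1 by rewrite invr_gt0 (lt_le_trans ltr01).
  set A := [set x | K m x /\ (w x = 0 /\ m^-1 <= w (x + s *: ei i) \/ m^-1 <= w x /\ w (x + s *: ei i) = 0)].
  have mA : measurable A.
    apply: measurableI => //; apply: measurableU; apply: measurableI; [exact: meq|exact: mle|exact: mle|exact: meq].
  have ms0 : 0 <= m + s + 1 by lra.
  have he : H1 (cutoff m s).
    apply: (@H1_lip _ (2 * m) (m + s + 1)) => //; [exact: cutoff_meas|lra|exact: cutoff01| |].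
      by move=> x; exact: cutoff_supp.
    by move=> j x t; exact: cutoff_lip.
  have he2 : H1 (fun x => cutoff m s x ^+ 2).
    apply: (@H1_lip _ (2 * (2 * m)) (m + s + 1)) => //; [by apply: measurable_funX; exact: cutoff_meas|lra| | |].
    - by move=> x; have /andP[h1 h2] := cutoff01 m s x; rewrite sqr_ge0 exprn_ile1.
    - by move=> x xc; rewrite cutoff_supp// expr0n.
    move=> j x t; rewrite subr_sqr normrM mulrC -mulrA ler_pM//; last exact: cutoff_lip.
    have /andP[h1 h2] := cutoff01 m s x; have /andP[h3 h4] := cutoff01 m s (x + t *: ei j).
    by rewrite ger0_norm ?addr_ge0//; lra.
  have A0 : leb A = 0.
    apply: (zero_set_shift_null hw w0 om0 he he2 (cutoff01 m s) sp mV (mK m)) => //.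
    - by apply: fK; rewrite (le_trans ler01).
    - move=> x t [xm xi]; apply: cutoff_one => //.
      by rewrite /Num.norm/= mx_normrE; apply: bigmax_le => [|[a b] _]; [rewrite (le_trans ler01)|rewrite (ord1 a); move/cubeP : xm].
    move=> eps eps0; apply: super; first by apply: (H1_phi (w := w) (eta := cutoff m s)) => //; exact: cutoff01.
      by move=> x; rewrite divr_ge0 ?sqr_ge0// addr_ge0// ltW.
    exists (2 * m)^-1; first by rewrite invr_gt0; lra.
    by move=> x hx; rewrite cutoff_supp2// expr0n mul0r.
  exists A; split => // x /= hx; apply: contrapT => xA; apply: hx => xK h; exact: xA.
apply: filterS (ae_foralln H) => x hx xs.
have big (t : R) : 0 < t -> exists n : nat, K n.+1%:R x /\ n.+1%:R^-1 <= t.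
  move=> t0.
  have [n hn] : exists n : nat, Num.max `|x| (Num.max t^-1 (x ord0 i0 - s0)^-1) < n%:R.
    by exists (Num.truncn (Num.max `|x| (Num.max t^-1 (x ord0 i0 - s0)^-1))).+1; exact: truncnS_gt.
  move: hn; rewrite !gt_max => /and3P[h1 h2 h3]; exists n.
  have n1 : n%:R <= n.+1%:R :> R by rewrite ler_nat.
  have inv (a : R) : 0 < a -> a^-1 < n%:R -> n.+1%:R^-1 <= a.
    move=> a0 ha; rewrite -[leRHS]invrK lef_pV2 ?posrE ?invr_gt0//.
    by rewrite (le_trans (ltW ha)).
  split; last exact: inv.
  split; last by rewrite -lerBrDl inv// subr_gt0.
  by apply/cubeP => j; rewrite (le_trans (coord_le_norm x j))// (le_trans (ltW h1)).
split=> hz.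
  apply: contrapT => /eqP nz; have wp : 0 < w (x + s *: ei i) by rewrite lt0r nz w0.
  by have [n [xK hn]] := big _ wp; apply: (hx n xK); left.
apply: contrapT => /eqP nz; have wp : 0 < w x by rewrite lt0r nz w0.
by have [n [xK hn]] := big _ wp; apply: (hx n xK); right.
Qed.

Lemma zero_set_translate y : 0 <= y ord0 i0 -> {ae leb, forall x, s0 < x ord0 i0 ->
   (w x = 0 <-> w (x + y) = 0)}.
Proof.
move=> y0.
have one i (s : R) : (i = i0 -> 0 <= s) -> {ae leb, forall x, s0 < x ord0 i0 ->
   (w x = 0 <-> w (x + s *: ei i) = 0)}.
  move=> hs; have [s_0|s_0|e] := ltgtP 0 s; first exact: zero_set_shift; last first.
    by apply: aeW => x _; rewrite -e scale0r addr0.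
  (* A backward move occurs only along an axis parallel to the boundary; it is the forward case read
     from the translated point, which is still in the half-space. *)
  have sp : 0 < - s by rewrite oppr_gt0.
  apply: filterS (mpres_ae (mpres_shift (s *: ei i)) (zero_set_shift i sp)) => x /= h xs.
  have ii0 : i != i0 by apply/eqP => /hs; rewrite leNgt s_0.
  rewrite scaleNr addrK in h; split=> hz; apply/h => //; rewrite !mxE eqxx eq_sym (negPf ii0) /= mulr0 addr0//.
have S (s : seq 'I_N) : {ae leb, forall x, s0 < x ord0 i0 ->
   (w x = 0 <-> w (x + \sum_(j <- s) y ord0 j *: ei j) = 0)}.
  elim: s => [|j s IH]; first by apply: aeW => x _; rewrite big_nil addr0.
  have H1' := mpres_ae (mpres_shift (\sum_(j <- s) y ord0 j *: ei j)) (one j (y ord0 j) (fun e => eq_ind_r (fun j => 0 <= y ord0 j) y0 e)).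
  apply: filterS2 IH H1' => x h1 h2 xs; rewrite big_cons (addrC (_ *: _)) addrA.
  rewrite h1//; apply: h2; rewrite mxE summxE (lt_le_trans xs)// lerDl.
  by apply: sumr_ge0 => k _; rewrite !mxE eqxx /=; have [<-|_] := eqVneq i0 k; rewrite ?mulr1 ?mulr0.
by have := S (index_enum _); rewrite -[\sum_(j <- index_enum _) _]row_sum_delta.
Qed.

(* The estimate of [ln (w + eps)] makes the zero set of [w] invariant under translations, up to
   null sets; by Fubini, the zero set or its complement is then null. *)
Theorem strong_max : {ae leb, forall x, s0 < x ord0 i0 -> w x = 0} \/
  {ae leb, forall x, s0 < x ord0 i0 -> 0 < w x}.
Proof.
have mw := L2_meas (H1_L2 hw).
pose Z := [set x : E | s0 < x ord0 i0 /\ w x = 0]; pose P := [set x : E | s0 < x ord0 i0 /\ 0 < w x].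
have mlt (f : E -> R) (a : R) : measurable_fun setT f -> measurable [set x | a < f x].
  move=> mf; have -> : [set x : E | a < f x] = f @^-1` `]a, +oo[.
    by apply/seteqP; split => x; rewrite /= in_itv/= andbT.
  by rewrite -[X in measurable X]setTI; exact: mf.
have mP : measurable P by apply: measurableI; apply: mlt => //; exact: measurable_coord.
have mZ : measurable Z.
  apply: measurableI; first by apply: mlt; exact: measurable_coord.
  suff : measurable (w @^-1` [set 0]) by [].
  by rewrite -[X in measurable X]setTI; exact: mw.
have mind (C : set E) d (X : measurableType d) (f : X -> 'rV[R]_N) : measurable C -> measurable_fun setT f ->
    measurable_fun setT (fun t : X => (\1_C (f t) : R)%:E).
  move=> mC mf; apply/measurable_EFinP.
  by apply: (measurableT_comp (f := \1_C : E -> R)) => //; exact: measurable_indic.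
(* [F] detects pairs of a zero and a displacement leading to a point of positivity. Integrated over
   displacements first it yields the product of the two measures, and over zeros first it vanishes
   by [zero_set_translate]. *)
pose F (q : E * E) : \bar R := (\1_Z q.1 * \1_P (q.1 + q.2))%:E.
have mF : measurable_fun setT F.
  rewrite /F; under eq_fun do rewrite EFinM; apply: emeasurable_funM; apply: mind => //.
  by apply: measurable_addv.
have F0 q : (0 <= F q)%E by rewrite lee_fin mulr_ge0.
have E1 : (\int[leb]_x \int[leb]_y F (x, y) = leb P * leb Z)%E.
  transitivity (\int[leb]_x (leb P * (\1_Z x : R)%:E))%E; last first.
    rewrite ge0_integralZl//; last by apply: (mind Z _ _ id).
    by rewrite integral_indic// setIT.
  apply: eq_integral => x _; rewrite /F /=; under eq_integral do rewrite EFinM.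
  rewrite ge0_integralZl//; last by apply: mind => //; exact: measurable_addv.
  rewrite muleC; congr (_ * _)%E; rewrite -(leb_translation x mP).
  rewrite (_ : (fun y => _) = fun y => (\1_((fun y => y + x) @^-1` P) y : R)%:E).
    by rewrite integral_indic ?setIT//; rewrite -[X in measurable X]setTI; exact: measurable_addl.
  apply/funext => y; rewrite !indicE.
  by have -> : (y \in (fun y => y + x) @^-1` P) = (x + y \in P) by rewrite addrC; apply/idP/idP; rewrite !inE.
have E2 : (\int[leb]_y \int[leb]_x F (x, y) = 0)%E.
  rewrite integral0_eq// => y _.
  have mFy : measurable_fun setT (fun x => F (x, y)).
    by apply: (measurableT_comp mF); apply: measurable_fun_pair.
  rewrite (ae_eq_integral (cst 0%E)) ?integral0//.
  have Z0 x z : \1_Z x * \1_P z = 0 :> R \/ (Z x /\ P z).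
    rewrite !indicE; case: (boolP (x \in Z)); rewrite ?inE ?mul0r; last by left.
    by case: (boolP (z \in P)); rewrite ?inE ?mulr0; [right|left].
  have [y0|/ltW y0] := leP 0 (y ord0 i0).
    apply: filterS (zero_set_translate y0) => x h _; rewrite /F /=; congr EFin.
    have [//|[[xs xz] [_ xp]]] := Z0 x (x + y); have := (h xs).1 xz => e.
    by rewrite e ltxx in xp.
  have ny0 : 0 <= (- y) ord0 i0 by rewrite mxE oppr_ge0.
  apply: filterS (mpres_ae (mpres_shift y) (zero_set_translate ny0)) => x h _; rewrite /F /=; congr EFin.
  have [//|[[xs xz] [ps xp]]] := Z0 x (x + y); have := (h ps).2; rewrite addrK => /(_ xz) e.
  by rewrite e ltxx in xp.
move: E2; rewrite -fubini_tonelli// E1 => /eqP; rewrite mule_eq0 => /orP[/eqP h|/eqP h]; [left|right].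
  exists P; split => // x /= hx; split; first by apply: contrapT => ns; apply: hx => /ns.
  by rewrite lt0r w0 andbT; apply/eqP => e; apply: hx => _.
exists Z; split => // x /= hx; split; first by apply: contrapT => ns; apply: hx => /ns.
by apply: contrapT => /eqP e; apply: hx => _; rewrite lt0r e w0.
Qed.

End strong_max_principle.

(** * Cutting an odd function along a hyperplane *)

Section cut.
Implicit Types (f g u v w phi : E -> R) (x y z : E) (i j : 'I_N) (A : set E).

Lemma gr_zero_on f j A (h : nat -> R) : H1 f -> measurable A -> (forall n, h n != 0) ->
  h n @[n --> \oo] --> 0 -> (forall n x, A x -> f (x + h n *: ei j) = f x) ->
  {ae leb, forall x, A x -> gr j f x = 0}.
Proof.
move=> hf mA hn h0 fA; have Lf := H1_L2 hf; have Lg := gr_L2 j hf.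
have [LA _] := L2_mul_indic mA Lg.
have e : nsq (gr j f * \1_A) = 0.
  have c := H1_dq_cvg j hf hn h0.
  have le n : nsq (gr j f * \1_A) <= nsq (dq (h n) j f - gr j f).
    have Ld := L2B (L2_dq (h n) j Lf) Lg; have [LdA le] := L2_mul_indic mA Ld.
    apply: le_trans le; rewrite le_eqVlt; apply/orP; left; apply/eqP.
    apply: eq_Rintegral => x _; rewrite !fE indicE; case: (boolP (x \in A)); rewrite ?mulr0// inE => Ax.
    by rewrite /dq !fE /sh fA// subrr mulr0 sub0r !mulr1 sqrrN.
  apply/eqP; rewrite eq_le nsq_ge0 andbT -(cvg_lim _ c)//; apply: limr_ge; first by apply/cvg_ex; eexists; exact: c.
  exact: nearW.
apply: filterS (nsq_eq0 LA e) => x; rewrite !fE indicE => h1 Ax.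
by move: h1; rewrite mem_set// mulr1.
Qed.

Lemma dot_ae0 f g : L2 f -> L2 g -> {ae leb, forall x, f x = 0 \/ g x = 0} -> dot f g = 0.
Proof.
move=> hf hg h; rewrite -[RHS](int0 leb); apply: int_ae.
- by apply: measurable_funM; [exact: L2_meas hf|exact: L2_meas hg].
- exact: measurable_cst.
by apply: filterS h => x [->|->]; rewrite ?mul0r ?mulr0.
Qed.

Variable i0 : 'I_N.
Local Notation e0 := (ei i0 : E).
Local Notation sg := (refl e0).
Local Notation H := [set x : E | 0 < x ord0 i0].

Lemma unit_e0 : dotv e0 e0 = 1 :> R.
Proof.
rewrite /dotv (bigD1 i0)//= big1 ?addr0; first by rewrite mxE !eqxx mulr1.
by move=> j ji; rewrite mxE (negPf ji) andbF mul0r.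
Qed.

Lemma sg_coord x : sg x ord0 i0 = - x ord0 i0.
Proof.
have d : dotv x e0 = x ord0 i0.
  rewrite /dotv (bigD1 i0)//= big1 ?addr0; first by rewrite mxE !eqxx mulr1.
  by move=> j ji; rewrite mxE (negPf ji) andbF mulr0.
by rewrite /refl !mxE d !eqxx mulr1; ring.
Qed.

Lemma sgK : involutive sg. Proof. exact: reflK unit_e0. Qed.

Lemma sg_fix x : x ord0 i0 = 0 -> sg x = x.
Proof.
move=> h; have d : dotv x e0 = x ord0 i0.
  rewrite /dotv (bigD1 i0)//= big1 ?addr0; first by rewrite mxE !eqxx mulr1.
  by move=> j ji; rewrite mxE (negPf ji) andbF mulr0.
by rewrite /refl d h mulr0 scale0r subr0.
Qed.

Lemma measH (r : R) : measurable [set x : E | r < x ord0 i0].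
Proof.
have -> : [set x : E | r < x ord0 i0] = (fun x : E => x ord0 i0) @^-1` `]r, +oo[.
  by apply/seteqP; split => x; rewrite /= in_itv/= andbT.
by rewrite -[X in measurable X]setTI; exact: (measurable_coord i0).
Qed.
Lemma measH' (r : R) : measurable [set x : E | x ord0 i0 < r].
Proof.
have -> : [set x : E | x ord0 i0 < r] = (fun x : E => x ord0 i0) @^-1` `]-oo, r[.
  by apply/seteqP; split => x; rewrite /= in_itv/=.
by rewrite -[X in measurable X]setTI; exact: (measurable_coord i0).
Qed.
Lemma measHc (r : R) : measurable [set x : E | x ord0 i0 <= r].
Proof.
have -> : [set x : E | x ord0 i0 <= r] = (fun x : E => x ord0 i0) @^-1` `]-oo, r].
  by apply/seteqP; split => x; rewrite /= in_itv/=.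
by rewrite -[X in measurable X]setTI; exact: (measurable_coord i0).
Qed.

Lemma gr_zero_right f j (r : R) : H1 f -> (forall x, r < x ord0 i0 -> f x = 0) ->
  {ae leb, forall x, r < x ord0 i0 -> gr j f x = 0}.
Proof.
move=> hf f0; apply: (gr_zero_on hf (measH r) (@hs_neq0 R) hs_cvg0) => n x /= rx.
rewrite !f0// !mxE (lt_le_trans rx)// lerDl mulr_ge0// ltW//; exact: hs_gt0.
Qed.

Lemma gr_zero_left f j (r : R) : H1 f -> (forall x, x ord0 i0 <= r -> f x = 0) ->
  {ae leb, forall x, x ord0 i0 <= r -> gr j f x = 0}.
Proof.
move=> hf f0; apply: (gr_zero_on hf (measHc r) (@hsN_neq0 R) hsN_cvg0) => n x /= rx.
by rewrite !f0// !mxE (le_trans _ rx)// gerDl mulNr oppr_le0 mulr_ge0// ltW// hs_gt0.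
Qed.

Lemma dotD_disjoint f g (r : R) : H1 f -> H1 g -> (forall x, x ord0 i0 <= r -> f x = 0) ->
  (forall x, r < x ord0 i0 -> g x = 0) -> dotD f g = 0.
Proof.
move=> hf hg f0 g0; have -> : dotD f g = \sum_i dot (gr i f) (gr i g) by [].
apply: big1 => j _; apply: dot_ae0; [exact: gr_L2|exact: gr_L2|].
apply: filterS2 (gr_zero_left j hf f0) (gr_zero_right j hg g0) => x h1 h2.
by have [h|h] := leP (x ord0 i0) r; [left; exact: h1|right; exact: h2].
Qed.

(** The folding of the space onto the half-space: the coordinate [i0] is replaced by its absolute
    value. *)
Let ab x : E := x + (`|x ord0 i0| - x ord0 i0) *: e0.

Lemma ab_pos x : 0 <= x ord0 i0 -> ab x = x.
Proof. by move=> h; rewrite /ab ger0_norm// subrr scale0r addr0. Qed.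

Lemma ab_neg x : x ord0 i0 < 0 -> ab x = sg x.
Proof.
move=> h; have d : dotv x e0 = x ord0 i0.
  rewrite /dotv (bigD1 i0)//= big1 ?addr0; first by rewrite mxE !eqxx mulr1.
  by move=> j ji; rewrite mxE (negPf ji) andbF mulr0.
by rewrite /ab ltr0_norm// /refl d -scaleNr; congr (_ + _ *: _); ring.
Qed.

Lemma ab_shift x (t : R) : ab (x + t *: e0) = ab x + (`|x ord0 i0 + t| - `|x ord0 i0|) *: e0.
Proof.
have e : (x + t *: e0) ord0 i0 = x ord0 i0 + t by rewrite !mxE !eqxx mulr1.
rewrite /ab e.
rewrite -!addrA -!scalerDl; congr (_ + _ *: _); ring.
Qed.

Lemma ab_cube x (r : R) : cube r (ab x) <-> cube r x.
Proof.
have c j : `|ab x ord0 j| = `|x ord0 j|.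
  have [x0|x0] := leP 0 (x ord0 i0); first by rewrite ab_pos.
  rewrite ab_neg//; have [->|ji] := eqVneq j i0; first by rewrite sg_coord normrN.
  by rewrite /refl !mxE (negPf ji) andbF mulr0 subr0.
by split=> /cubeP h; apply/cubeP => j; have := h j; rewrite c.
Qed.

Lemma ab_meas f : measurable_fun setT f -> measurable_fun setT (f \o ab).
Proof.
move=> mf; apply: (measurableT_comp mf); apply: measurable_addv => //; apply: measurable_fun_rV => j.
have -> : (fun x : E => ((`|x ord0 i0| - x ord0 i0) *: e0) ord0 j) = (fun x : E => (`|x ord0 i0| - x ord0 i0) * e0 ord0 j).
  by apply/funext => x; rewrite mxE.
apply: measurable_funM => //; apply: measurable_funB; last exact: measurable_coord.
apply: measurableT_comp => //; exact: measurable_coord.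
Qed.

Lemma ind_bool (b : E -> bool) x : \1_[set x | b x] x = (b x)%:R :> R.
Proof. by rewrite indicE; case: (boolP (b x)) => h; [rewrite mem_set|rewrite memNset//; exact/negP]. Qed.

(** An odd function has zero trace on the hyperplane, so the cut creates no singular part. Along the
    other axes the indicator commutes with difference quotients. Along [i0], oddness turns twice the
    pairing of the cut function with the derivative of [phi] into the pairing of [z] with the
    derivative of the Lipschitz function [phi \o ab], where integration by parts is allowed. *)
Lemma H1_cut (z : E -> R) : H1 z -> (forall x, z (sg x) = - z x) -> H1 (z * \1_H).
Proof.
move=> hz odd; have Lz := H1_L2 hz; have mp := mpres_refl unit_e0.
have mH := measH 0; have [Lc _] := L2_mul_indic mH Lz.
apply: H1_intro => // i; have Lg := gr_L2 i hz.
have dotA (a b : E -> R) A : dot (a * \1_A) b = dot a (b * \1_A).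
  by apply: eq_Rintegral => x _; rewrite !fE mulrAC mulrA.
have [ii|ii] := eqVneq i i0; last first.
  have [LgH _] := L2_mul_indic mH Lg.
  exists (gr i z * \1_H); split => // phi tp; have Lp := test_L2 tp; have Ldp := test_L2 (test_partial i tp).
  have [LpH _] := L2_mul_indic mH Lp; have [LdH _] := L2_mul_indic mH Ldp.
  rewrite !dotA.
  have dqH n : dq (hs n) i (phi * \1_H) = dq (hs n) i phi * \1_H.
    apply/funext => x; rewrite /dq !fE /sh -mulrA; congr (_ * _); rewrite mulrBl; congr (_ * _ - _).
    rewrite !indicE; suff -> : (x + hs n *: ei i \in H) = (x \in H) by [].
    have e : (x + hs n *: ei i) ord0 i0 = x ord0 i0 by rewrite !mxE eqxx eq_sym (negPf ii) /= mulr0 addr0.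
    by apply/idP/idP; rewrite !inE /= e.
  have c1 : dot (dq (hs n) i (phi * \1_H)) z @[n --> \oo] --> dot (partial i phi * \1_H) z.
    apply: dot_cvgl => //; first by move=> n; exact: L2_dq.
    apply: (@squeeze0 _ _ _ _ _ (fun n => nsq (dq (hs n) i phi - partial i phi))); last first.
      by apply: test_dq_cvg' => //; [exact: hs_neq0|exact: hs_cvg0].
    apply: nearW => n; rewrite ger0_norm ?nsq_ge0// dqH -mulrBl.
    by have [] := L2_mul_indic mH (L2B (L2_dq (hs n) i Lp) Ldp).
  have c2 : dot (dq (hs n) i (phi * \1_H)) z @[n --> \oo] --> - dot (gr i z) (phi * \1_H).
    apply: (@cvg_eqr _ _ _ _ (fun n => - dot (dq (- hs n) i z) (phi * \1_H))).
      by move=> n; rewrite (dot_dq _ _ LpH Lz) dotC.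
    by apply: cvgN; apply: dot_cvgl => //; [move=> n; exact: L2_dq|apply: H1_dq_cvg => //; [exact: hsN_neq0|exact: hsN_cvg0]].
  by rewrite (dotC _ z) -(cvg_lim _ c1)// (cvg_lim _ c2).
pose Hc : set E := [set x | x ord0 i0 < 0].
have mHc : measurable Hc by exact: measH'.
pose G : set E := [set x | 0 <= x ord0 i0].
have mG : measurable G.
  have -> : G = ~` Hc by apply/seteqP; split => x; rewrite /G /Hc /= leNgt => /negP.
  exact: measurableC.
have [L1 _] := L2_mul_indic mG Lg; have [L2' _] := L2_mul_indic mHc Lg.
have L2s := mpres_L2 mp L2'.
(* The [i0]-derivative of an odd function is even, so this symmetrized form represents the
   derivative of [z] on the half-space. *)
exists (2^-1 *: (gr i z * \1_G + ((gr i z * \1_Hc) \o sg))); split; first by apply: L2Z; exact: L2D.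
move=> phi tp; have Lp := test_L2 tp; have Ldp := test_L2 (test_partial i tp).
pose psi := phi \o ab.
have [M hM] := test_bounded tp; have [C hC] := test_lipschitz i tp.
have [_ [r hr]] := (test_functionP phi).1 tp.
have Lpsi : L2 psi.
  apply: (@bounded_supp_L2 _ _ psi M r); [exact: ab_meas (test_meas tp)|by move=> x; exact: hM|].
  by move=> x xr; apply: hr => /ab_cube.
(* The derivative of the folded function [psi]; the value on the hyperplane is that of the forward
   quotient, as the steps [hs n] are positive. *)
pose T := (partial i phi * \1_G) - ((partial i phi * \1_H) \o sg).
have [LT1 _] := L2_mul_indic mG Ldp; have [LT2 _] := L2_mul_indic mH Ldp.
have LT2s := mpres_L2 mp LT2.
have LT : L2 T by exact: L2B.
have C0 : 0 <= C by have := hC 0 1; rewrite normr1 mulr1; exact: le_trans.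
have TE x : T x = if 0 <= x ord0 i0 then partial i phi x else - partial i phi (sg x).
  rewrite /T !fE /= !fE !ind_bool sg_coord oppr_gt0.
  by have [x0|x0] := leP 0 (x ord0 i0); rewrite ?mulr1 ?mulr0 ?subr0 ?sub0r.
have dpsi n x : `|dq (hs n) i psi x| <= C * \1_(cube (r + 1)) x.
  have hn : 0 < hs n by exact: hs_gt0.
   rewrite /dq !fE /sh /psi /= ii ab_shift indicE.
  have [xr|xr] := pselect (cube (r + 1) x).
    rewrite mem_set// mulr1 normrM gtr0_norm ?invr_gt0// ler_pdivrMl// mulrC.
    rewrite -ii (le_trans (hC _ _))// ler_wpM2l// (le_trans (ler_dist_dist _ _))//.
    by rewrite addrAC subrr add0r gtr0_norm.
  rewrite memNset// mulr0 hr; last first.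
    rewrite -ab_shift => /ab_cube/cubeP h; apply: xr; apply/cubeP => j; have := h j; rewrite !mxE => {}h.
    rewrite -[x ord0 j](@addrK _ (hs n * ((@ord0 0 == ord0) && (j == i0))%:R)) (le_trans (ler_normB _ _))// lerD//.
    rewrite normrM (le_trans _ (@hs_le1 R n))// ler_piMr//; case: (_ && _); rewrite ?normr1 ?normr0//.
  rewrite hr ?subrr ?mulr0 ?normr0// => /ab_cube h; apply: xr; apply: cubeS h; rewrite lerDl//.
have cT : nsq (dq (hs n) i psi - T) @[n --> \oo] --> (0 : R).
  have cpt x : dq (hs n) i psi x @[n --> \oo] --> T x.
    rewrite TE; have [x0|x0] := leP 0 (x ord0 i0).
      apply: (@cvg_eqr _ _ _ _ (fun n => (hs n)^-1 * (phi (x + hs n *: ei i) - phi x))); last first.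
        by apply: test_dq_pt => //; [exact: hs_neq0|exact: hs_cvg0].
      move=> n; rewrite /dq !fE /sh /psi /= ii ab_shift ab_pos//; congr (_ * (phi (_ + _ *: _) - _)).
      by rewrite !ger0_norm ?addr_ge0// ?(ltW (@hs_gt0 R n))//; ring.
    have c : (- ((- hs n)^-1 * (phi (sg x + (- hs n) *: ei i) - phi (sg x)))) @[n --> \oo] --> - partial i phi (sg x).
      by apply: cvgN; apply: test_dq_pt => //; [exact: hsN_neq0|exact: hsN_cvg0].
    apply: cvg_trans c; apply: near_eq_cvg.
    have nx : 0 < - x ord0 i0 by rewrite oppr_gt0.
    move/cvgr0Pnorm_lt : (@hs_cvg0 R) => /(_ _ nx); apply: filterS => n; rewrite gtr0_norm ?hs_gt0// => hn.
    rewrite /dq !fE /sh /psi /= ii ab_shift (ab_neg x0) invrN mulNr opprK; congr (_ * (phi (_ + _ *: _) - _)).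
    rewrite ltr0_norm; last by rewrite addrC -ltrBrDr sub0r.
    by rewrite ltr0_norm//; ring.
  have Td x : `|T x| <= C * \1_(cube (r + 1)) x.
    have c : `|dq (hs n) i psi x| @[n --> \oo] --> `|T x| by apply: cvg_norm.
    rewrite -(cvg_lim _ c)//; apply: limr_le; first by apply/cvg_ex; eexists; exact: c.
    exact: nearW.
  have [|||n x|_] := @dominated_int _ _ _ leb (fun n x => (dq (hs n) i psi - T) x ^+ 2) (fun=> 0)
     ((2 * C) ^+ 2 *: \1_(cube (r + 1))).
  - by move=> n; apply: measurable_funX; exact: L2_meas (L2B (L2_dq (hs n) i Lpsi) LT).
  - move=> x; have c : (dq (hs n) i psi x - T x) @[n --> \oo] --> (0 : R).
      by apply/(subr_cvg0 (fun n => dq (hs n) i psi x)).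
    have cc : ((dq (hs n) i psi x - T x) * (dq (hs n) i psi x - T x)) @[n --> \oo] --> (0 * 0 : R) by apply: cvgM.
    by move: cc; rewrite mulr0; apply: cvg_eqr => n; rewrite expr2 !fE.
  - by apply: itgZ; exact: itg_indic_cube.
  - have h1 := dpsi n x; have h2 := Td x; rewrite ger0_norm ?sqr_ge0// -real_normK ?num_real//.
    have h3 : `|(dq (hs n) i psi - T) x| <= 2 * C * \1_(cube (r + 1)) x.
      by rewrite !fE (le_trans (ler_normB _ _))// -mulrA mulr_natl mulr2n lerD.
    rewrite !fE; move: h3; rewrite indicE; case: (_ \in _); rewrite ?mulr1 ?mulr0 => h3.
      by rewrite lerXn2r ?nnegrE ?mulr_ge0.
    by have -> : `|(dq (hs n) i psi - T) x| = 0; [apply/eqP; rewrite eq_le h3 normr_ge0|rewrite expr0n].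
  - by rewrite int0.
have c1 : dot (dq (hs n) i psi) z @[n --> \oo] --> dot T z.
  by apply: dot_cvgl => //; move=> n; exact: L2_dq.
have c2 : dot (dq (hs n) i psi) z @[n --> \oo] --> - dot (gr i z) psi.
  apply: (@cvg_eqr _ _ _ _ (fun n => - dot (dq (- hs n) i z) psi)).
    by move=> n; rewrite (dot_dq _ _ Lpsi Lz) dotC.
  by apply: cvgN; apply: dot_cvgl => //; [move=> n; exact: L2_dq|apply: H1_dq_cvg => //; [exact: hsN_neq0|exact: hsN_cvg0]].
have eT : dot T z = - dot (gr i z) psi by rewrite -(cvg_lim _ c1)// (cvg_lim _ c2).
have e1 : dot T z = 2 * dot (z * \1_H) (partial i phi).
  rewrite /T (dotBl LT1 LT2s Lz).
  have -> : dot (partial i phi * \1_G) z = dot (z * \1_H) (partial i phi).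
    apply: eq_Rintegral => x _; rewrite !fE !ind_bool; have [x0|x0|x0] := ltgtP 0 (x ord0 i0).
    - by rewrite !mulr1 mulrC.
    - by rewrite !mulr0 !mul0r.
    have := odd x; rewrite (sg_fix (esym x0)) => zz; have -> : z x = 0 by move: zz; lra.
    by rewrite mulr0 !mul0r.
  have -> : dot ((partial i phi * \1_H) \o sg) z = - dot (z * \1_H) (partial i phi).
    have eo : z = (- z) \o sg by apply/funext => x; have := odd x; rewrite /= ?fE => ->; rewrite opprK.
    rewrite [X in dot _ X = _]eo.
    rewrite (mpres_dot mp LT2 (L2N Lz)) mul1r (dotNr LT2 Lz); congr (- _).
    by apply: eq_Rintegral => x _; rewrite !fE; ring.
  by rewrite opprK mulr_natl mulr2n.
have e2 : dot (gr i z) psi = dot (gr i z * \1_G + ((gr i z * \1_Hc) \o sg)) phi.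
  rewrite (dotDl L1 L2s Lp).
  have -> : dot ((gr i z * \1_Hc) \o sg) phi = dot (gr i z * \1_Hc) (phi \o sg).
    have -> : phi = (phi \o sg) \o sg by apply/funext => x; rewrite /= sgK.
    rewrite (mpres_dot mp L2' (mpres_L2 mp Lp)) mul1r; congr dot; apply/funext => x; rewrite /= sgK//.
  have Ls := mpres_L2 mp Lp.
  rewrite -(intD (itg_mul L1 Lp) (itg_mul L2' Ls)); apply: eq_Rintegral => x _; rewrite !fE /psi /= !ind_bool.
  have [x0|x0] := leP 0 (x ord0 i0); rewrite ?mulr1 ?mulr0 ?mul0r ?addr0 ?add0r.
    by rewrite ab_pos.
  by rewrite ab_neg.
rewrite (dotZl 2^-1 (L2D L1 L2s) Lp) -e2; move: eT; rewrite e1; move: (dot _ _) (dot _ _) => X Y; lra.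
Qed.

End cut.

(** * Sign, polarization and symmetry of optimizers *)

Section polarization.
Implicit Types (f g u v w phi : E -> R) (x y z : E) (i j : 'I_N) (A : set E).

(** The multipliers depend only on mass and Dirichlet energy, so [v], its absolute value and its
    polarization satisfy one and the same equation, and these equations can be added or
    subtracted. *)
Lemma opt_EL_pos v : opt v -> exists c1 c2 : R, [/\ 0 < c1, 0 < c2 &
  forall w, opt w -> nsq w = nsq v -> dirichlet w = dirichlet v -> forall phi, H1 phi ->
  q * \int[leb]_x (dpw (w x) * phi x) = c1 * dotD w phi + c2 * dot w phi].
Proof.
move=> [hv M0 Bv]; have D0 := dirichlet_gt0 hv M0.
have C0 := Cst_gt0 hv M0; have k0 : 0 < k by exact: lt_le_trans hk.
exists (Cst * (2 * k * dirichlet v `^ (k - 1) * nsq v `^ beta)).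
exists (Cst * (2 * beta * dirichlet v `^ k * nsq v `^ (beta - 1))); split.
- have a1 := powR_gt0 (k - 1) D0; have a2 := powR_gt0 beta M0.
  exact: mulr_gt0 C0 (mulr_gt0 (mulr_gt0 (mulr_gt0 (ltr0Sn R 1) k0) a1) a2).
- have a1 := powR_gt0 k D0; have a2 := powR_gt0 (beta - 1) M0.
  exact: mulr_gt0 C0 (mulr_gt0 (mulr_gt0 (mulr_gt0 (ltr0Sn R 1) hb) a1) a2).
move=> w ow Mw Dw phi hp; rewrite (opt_EL ow hp) Mw Dw.
move: (dirichlet v `^ k) (dirichlet v `^ (k - 1)) (nsq v `^ beta) (nsq v `^ (beta - 1)) (dot w phi) (dotD w phi) Cst.
by move=> a1 a2 a3 a4 a5 a6 a7; ring.
Qed.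

Lemma ae_coord_union (i : 'I_N) (P : E -> Prop) :
  (forall n : nat, {ae leb, forall x, - n%:R < x ord0 i -> P x}) -> {ae leb, forall x, P x}.
Proof.
move=> h; apply: filterS (ae_foralln h) => x hx.
have hn := truncnS_gt `|x ord0 i|; apply: (hx (Num.truncn `|x ord0 i|).+1).
by rewrite ltrNl (le_lt_trans _ hn)// -normrN ler_norm.
Qed.

Lemma norm_add_pos (s : R) : 0 < `|s| + s -> s = `|s|.
Proof.
move=> h; rewrite ger0_norm//; have [//|un] := leP 0 s.
by move: h; rewrite ltr0_norm// addNr ltxx.
Qed.

Lemma add_div_arith (c1 c2 s I1 I2 A B C D : R) : c1 != 0 ->
  s * I1 = c1 * A + c2 * C -> s * I2 = c1 * B + c2 * D ->
  A + B + c2 / c1 * (C + D) = s / c1 * (I1 + I2).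
Proof.
move=> c10 e1 e2.
have -> : s / c1 * (I1 + I2) = (s * I1 + s * I2) / c1 by field.
by rewrite e1 e2; field.
Qed.

(** The half-spaces [- n%:R < x ord0 i0] exhaust the space. If both alternatives occurred for
    different [n], they would contradict each other on a common half-space, which would be null, and
    so would be its translates. *)
Lemma strong_max_global (i0 : 'I_N) w (om : R) : H1 w -> (forall x, 0 <= w x) -> 0 <= om ->
  (forall phi, H1 phi -> (forall x, 0 <= phi x) -> 0 <= dotD w phi + om * dot w phi) ->
  {ae leb, forall x, w x = 0} \/ {ae leb, forall x, 0 < w x}.
Proof.
move=> hw w0 om0 super.
have S (n : nat) : {ae leb, forall x, - n%:R < x ord0 i0 -> w x = 0} \/ {ae leb, forall x, - n%:R < x ord0 i0 -> 0 < w x}.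
  by apply: (strong_max hw w0 om0) => phi hp phi0 _; exact: super.
have [[m hm]|none] := pselect (exists n : nat, {ae leb, forall x, - n%:R < x ord0 i0 -> 0 < w x}); last first.
  by left; apply: (@ae_coord_union i0) => n; case: (S n) => // h; exfalso; apply: none; exists n.
have [[n0 hn]|] := pselect (exists n : nat, {ae leb, forall x, - n%:R < x ord0 i0 -> w x = 0}); last first.
  move=> none; right; apply: (@ae_coord_union i0) => n; case: (S n) => // h.
  by exfalso; apply: none; exists n.
pose l := minn n0 m; left.
have hZ : {ae leb, forall x, - l%:R < x ord0 i0 -> False}.
  apply: filterS2 hm hn => x h1 h2 xm.
  have l1 : - m%:R < x ord0 i0 by rewrite (le_lt_trans _ xm)// lerN2 ler_nat geq_minr.
  have l2 : - n0%:R < x ord0 i0 by rewrite (le_lt_trans _ xm)// lerN2 ler_nat geq_minl.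
  by have := h1 l1; rewrite (h2 l2) ltxx.
apply: (@ae_coord_union i0) => n'; apply: filterS (mpres_ae (mpres_shift (n'%:R *: ei i0)) hZ) => x hx xn.
exfalso; apply: hx; rewrite !mxE !eqxx mulr1 (@le_lt_trans _ _ 0) ?oppr_le0//.
by rewrite -ltrBlDr sub0r.
Qed.

Lemma nsq_gt0_ae v : H1 v -> 0 < nsq v -> {ae leb, forall x, v x = 0} -> False.
Proof. by move=> hv M0 z; have := nsq0_ae (H1_L2 hv) z => e; rewrite e ltxx in M0. Qed.

Lemma opt_pos (i0 : 'I_N) v : opt v -> (forall x, 0 <= v x) -> {ae leb, forall x, 0 < v x}.
Proof.
move=> ov v0; have [hv M0 _] := ov; have [c1 [c2 [c10 c20 EL]]] := opt_EL_pos ov.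
have om0 : 0 <= c2 / c1 by rewrite divr_ge0// ltW.
case: (strong_max_global i0 hv v0 om0) => [phi hp phi0|z|//]; last first.
  by case: (nsq_gt0_ae hv M0 z).
have e := EL v ov erefl erefl phi hp.
have -> : dotD v phi + c2 / c1 * dot v phi = q / c1 * \int[leb]_x (dpw (v x) * phi x).
  rewrite [in RHS]mulrAC e; move: (dotD _ _) (dot _ _) => a b; field; exact: lt0r_neq0.
rewrite mulr_ge0 ?divr_ge0 ?(ltW c10) ?(ltW (q_gt0))//; apply: int_ge0 => x.
by rewrite mulr_ge0// dpw_ge0.
Qed.

(* [|u| + u] is a nonnegative supersolution: it vanishes or is positive almost everywhere. *)
Lemma opt_sign (i0 : 'I_N) u : opt u ->
  {ae leb, forall x, u x = `|u x|} \/ {ae leb, forall x, - u x = `|u x|}.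
Proof.
move=> ou; have [hu M0 _] := ou; have [c1 [c2 [c10 c20 EL]]] := opt_EL_pos ou.
have [oa Da] := opt_abs ou; set a : E -> R := fun x => `|u x| in oa Da.
have [ha _ _] := oa.
have Ma : nsq a = nsq u by apply: eq_Rintegral => x _; rewrite /a real_normK ?num_real.
have om0 : 0 <= c2 / c1 by apply: divr_ge0; exact: ltW.
have hw := H1D ha hu; have w0 x : 0 <= (a + u) x.
  by rewrite fE /a -lerBlDr sub0r -normrN ler_norm.
have sm := strong_max_global i0 hw w0 om0; case: sm => [phi hp phi0|z|z].
- have E1 := EL a oa Ma Da phi hp; have E2 := EL u ou erefl erefl phi hp.
  have i1 := itg_dpw ha hp; have i2 := itg_dpw hu hp.
  rewrite (dotDDl ha hu hp) (dotDl (H1_L2 ha) (H1_L2 hu) (H1_L2 hp)).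
  rewrite (add_div_arith (lt0r_neq0 c10) E1 E2) -(intD i1 i2).
  apply: mulr_ge0; first by apply: divr_ge0; [exact: ltW (q_gt0)|exact: ltW].
  apply: int_ge0 => x; rewrite -mulrDl; apply: mulr_ge0; last exact: phi0.
  by rewrite /a -abs_dpw -lerBlDr sub0r -normrN ler_norm.
- right; apply: filterS z => x; rewrite fE => /eqP; rewrite addr_eq0 => /eqP h.
  by rewrite -/(a x) h.
- left; apply: filterS z => x; exact: norm_add_pos.
Qed.

Lemma sub_div_arith (c1 c2 s I1 I2 A B C D : R) : c1 != 0 ->
  s * I1 = c1 * A + c2 * C -> s * I2 = c1 * B + c2 * D ->
  A - B + c2 / c1 * (C - D) = s / c1 * (I1 - I2).
Proof.
move=> c10 e1 e2.
have -> : s / c1 * (I1 - I2) = (s * I1 - s * I2) / c1 by field.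
by rewrite e1 e2; field.
Qed.

Lemma quarter_arith (d2 d d1 : R) : d <= d1 ->
  2^-1 ^+ 2 * (d2 + 2 * 0 + 2 * d) <= 2^-1 ^+ 2 * (d2 + 2 * 0 + 2 * d1).
Proof. by move=> h; rewrite ler_wpM2l ?sqr_ge0//; lra. Qed.

Lemma max_neq_lt (s t : R) : Num.max s t != s -> s < t.
Proof. by move=> h; rewrite ltNge; apply/negP => h2; move: h; rewrite max_l// eqxx. Qed.

Lemma dbl_inj (s t : R) : s + s = t + t -> s = t. Proof. lra. Qed.

Lemma pair_sub_arith (s t s' t' : R) : s + t = s' + t' -> t - t' = - (s - s').
Proof. lra. Qed.

Lemma eqN_0 (t : R) : t = - t -> t = 0. Proof. lra. Qed.

Section coordinate.
Variable i0 : 'I_N.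
Local Notation e0 := (ei i0 : E).
Local Notation sg := (refl e0).
Local Notation H := [set x : E | 0 < x ord0 i0].

(* [vH] is the polarization of [v], equal to the minimum of [v x] and [v (sg x)] on the other side.
   It does not increase the Dirichlet energy, hence is again an optimizer. *)
Lemma polarize v : opt v -> (forall x, 0 <= v x) ->
  exists vH, [/\ opt vH, nsq vH = nsq v, dirichlet vH = dirichlet v,
    forall x, 0 < x ord0 i0 -> vH x = Num.max (v x) (v (sg x)) &
    forall x, vH (sg x) - v (sg x) = - (vH x - v x)].
Proof.
move=> ov v0; have [hv M0 Bv] := ov; have Lv := H1_L2 hv.
have u1 := unit_e0 i0; have mp := mpres_refl u1.
have [hvs _] := H1_refl u1 hv.
(* [s] and [z] are twice the even and the odd part of [v], and they are orthogonal for the Dirichlet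
   product. Polarization keeps [s] and replaces [z] by [y], the odd function equal to the absolute
   value of [z] on the half-space. *)
pose s := v + (v \o sg); pose z := v - (v \o sg).
have hS : H1 s := H1D hv hvs.
have hz : H1 z := H1B hv hvs.
have odd x : z (sg x) = - z x by rewrite /z !fE /= sgK opprB.
pose f := z * \1_H; have hf : H1 f by exact: H1_cut.
have [ha Da] := H1_abs hf; set a : E -> R := fun x => `|f x| in ha Da.
have [has _] := H1_refl u1 ha; have [hfs _] := H1_refl u1 hf.
pose y := a - (a \o sg); have hy : H1 y := H1B ha has.
have f0 x : x ord0 i0 <= 0 -> f x = 0.
  by move=> h; rewrite /f !fE (ind_bool (fun x => 0 < x ord0 i0)) ltNge h mulr0.
have a0 x : x ord0 i0 <= 0 -> a x = 0 by move=> h; rewrite /a f0// normr0.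
have dis g : (forall x, x ord0 i0 <= 0 -> g x = 0) -> forall x, 0 < x ord0 i0 -> (g \o sg) x = 0.
  by move=> g0 x h; rewrite /= g0// sg_coord oppr_le0 ltW.
have Dy : dirichlet y = 2 * dirichlet a.
  rewrite /y (dirichletB ha has) (dotD_disjoint ha has a0 (dis a a0)) (dirichlet_refl u1 ha).
  by gen_atoms; ring.
have zE : z = f - (f \o sg).
  apply/funext => x; rewrite !fE /= /f !fE !(ind_bool (fun x => 0 < x ord0 i0)) odd sg_coord oppr_gt0.
  have [x0|x0|x0] := ltgtP 0 (x ord0 i0); rewrite ?mulr1 ?mulr0 ?subr0 ?sub0r ?opprK//.
  by have := odd x; rewrite (sg_fix (esym x0)); exact: eqN_0.
have Dz : dirichlet z = 2 * dirichlet f.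
  rewrite zE (dirichletB hf hfs) (dotD_disjoint hf hfs f0 (dis f f0)) (dirichlet_refl u1 hf).
  by gen_atoms; ring.
have par g : H1 g -> g \o sg = - g -> dotD s g = 0.
  move=> hg og; have := dotD_refl u1 hS hg; rewrite og.
  have -> : s \o sg = s by apply/funext => x; rewrite /s /= !fE /= sgK addrC.
  rewrite (dotDC s (- g)) (dotDNl hg hS) (dotDC g s).
  by move/esym; exact: eqN_0.
have ys : y \o sg = - y by apply/funext => x; rewrite /y /= !fE /= sgK opprB.
have zs : z \o sg = - z by apply/funext => x; rewrite /= odd.
pose vH := 2^-1 *: (s + y); have hsy := H1D hS hy; have hsz := H1D hS hz.
have hvH : H1 vH by exact: H1Z.
have vE : v = 2^-1 *: (s + z) by apply/funext => x; rewrite /s /z !fE; field.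
have DvH : dirichlet vH <= dirichlet v.
  rewrite [in leRHS]vE /vH (dirichletZ _ hsy) (dirichletZ _ hsz) (dirichletD hS hy) (dirichletD hS hz).
  rewrite (par y hy ys) (par z hz zs) Dy Dz; exact: (quarter_arith _ Da).
have vHx x : 0 < x ord0 i0 -> vH x = Num.max (v x) (v (sg x)) /\ vH (sg x) = Num.min (v x) (v (sg x)).
  move=> x0; rewrite /vH /y /s /a /f !fE /= !fE !(ind_bool (fun x => 0 < x ord0 i0)) sgK sg_coord oppr_gt0 x0.
  rewrite ltNge (ltW x0) /= /z !fE /= !mulr1 !mulr0 normr0.
  have [h|/ltW h] := leP (v x) (v (sg x)).
    by rewrite ler0_norm ?subr_le0//; split; field.
  by rewrite ger0_norm ?subr_ge0//; split; field.
have vHpair (F : R -> R) x : F (vH x) + F (vH (sg x)) = F (v x) + F (v (sg x)).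
  have P x' : 0 < x' ord0 i0 -> F (vH x') + F (vH (sg x')) = F (v x') + F (v (sg x')).
    move=> x0; have [-> ->] := vHx x' x0; have [h|/ltW h] := leP (v x') (v (sg x')).
      by rewrite addrC.
    by [].
  have [x0|x0|x0] := ltgtP 0 (x ord0 i0); first exact: P.
    by have := P (sg x); rewrite sg_coord oppr_gt0 sgK addrC [RHS]addrC; apply.
  have e : vH x = v x.
    have fx : f x = 0 by apply: f0; rewrite -x0.
    rewrite /vH /y /s /a !fE /= (sg_fix (esym x0)) fx normr0; move: (v x) => t; by field.
  by rewrite (sg_fix (esym x0)) e.
have intF (F : E -> R) (F' : E -> R) : itg F -> itg F' -> (forall x, F x + F (sg x) = F' x + F' (sg x)) ->
    \int[leb]_x F x = \int[leb]_x F' x.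
  move=> iF iF' FF; have := mpres_int mp iF; have := mpres_int mp iF'; rewrite !mul1r => e1 e2.
  have jF := mpres_itg mp iF; have jF' := mpres_itg mp iF'.
  have h := intD iF jF; have h' := intD iF' jF'.
  have e3 : \int[leb]_x (F x + (F \o sg) x) = \int[leb]_x (F' x + (F' \o sg) x).
    by apply: eq_Rintegral => x _; rewrite /= FF.
  by apply: dbl_inj; rewrite -[X in _ + X = _]e2 -h e3 h' -[X in _ = _ + X]e1.
have MvH : nsq vH = nsq v.
  by apply: intF; [exact: (H1_L2 hvH).2|exact: Lv.2|move=> x; exact: (vHpair (fun t => t ^+ 2))].
have BvH : Bp vH = Bp v.
  by apply: intF; [exact: (itg_pw hvH)|exact: (itg_pw hv)|move=> x; exact: (vHpair pw)].
have [ovH De] := opt_le ov hvH MvH BvH DvH.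
exists vH; split.
- exact: ovH.
- exact: MvH.
- exact: De.
- by move=> x x0; exact: (vHx x x0).1.
move=> x; have := vHpair id x; exact: pair_sub_arith.
Qed.

(* Subtracting the Euler-Lagrange equations of [vH] and [v] makes [|vH - v|] a supersolution
   on the half-space. *)
Lemma polarization_dichotomy v : opt v -> (forall x, 0 <= v x) ->
  {ae leb, forall x, 0 < x ord0 i0 -> v (sg x) <= v x} \/
  {ae leb, forall x, 0 < x ord0 i0 -> v x < v (sg x)}.
Proof.
move=> ov v0; have [hv M0 Bv] := ov; have [vH [ovH MH DH vHx dodd]] := polarize ov v0.
have [hvH _ _] := ovH.
have [c1 [c2 [c10 c20 EL]]] := opt_EL_pos ov.
pose d := vH - v; have hd : H1 d by exact: H1B.
have [hw _] := H1_abs hd; set w : E -> R := fun x => `|d x| in hw.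
have om0 : 0 <= c2 / c1 by apply: divr_ge0; exact: ltW.
have dE x : d x = vH x - v x by [].
have dpos x : 0 < x ord0 i0 -> 0 <= d x by move=> x0; rewrite dE (vHx x x0) subr_ge0 le_max lexx.
have SM : {ae leb, forall x, 0 < x ord0 i0 -> w x = 0} \/ {ae leb, forall x, 0 < x ord0 i0 -> 0 < w x}.
  apply: (strong_max hw _ om0) => [x|phi hp phi0 [dl dl0 hdl]]; first exact: normr_ge0.
  have ph0 x : x ord0 i0 <= 0 -> phi x = 0 by move=> x0; apply: hdl; rewrite add0r; exact: le_trans x0 (ltW dl0).
  have hwd := H1B hw hd.
  have e1 : dotD w phi = dotD d phi.
    apply/eqP; rewrite -subr_eq0 -(dotDBl hw hd hp) dotDC; apply/eqP.
    apply: (dotD_disjoint hp hwd ph0) => x x0.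
    have e : (w - d) x = `|d x| - d x by [].
    by rewrite e (ger0_norm (dpos x x0)) subrr.
  have e2 : dot w phi = dot d phi.
    apply: eq_Rintegral => x _; have [x0|x0] := leP (x ord0 i0) 0; first by rewrite (ph0 x x0) !mulr0.
    by rewrite /w (ger0_norm (dpos x x0)).
  have E1 := EL vH ovH MH DH phi hp; have E2 := EL v ov erefl erefl phi hp.
  have i1 := itg_dpw hvH hp; have i2 := itg_dpw hv hp.
  have e3 : dotD w phi + c2 / c1 * dot w phi = q / c1 * (\int[leb]_x (dpw (vH x) * phi x) - \int[leb]_x (dpw (v x) * phi x)).
    rewrite e1 e2 /d (dotDBl hvH hv hp) (dotBl (H1_L2 hvH) (H1_L2 hv) (H1_L2 hp)).
    exact: (sub_div_arith (lt0r_neq0 c10) E1 E2).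
  rewrite e3 -(intB i1 i2); apply: mulr_ge0; first by apply: divr_ge0; [exact: ltW (q_gt0)|exact: ltW].
  apply: int_ge0 => x; rewrite -mulrBl; have [x0|x0] := leP (x ord0 i0) 0; first by rewrite (ph0 x x0) mulr0.
  have := dpos x x0; rewrite dE subr_ge0 => h.
  by apply: mulr_ge0; [rewrite subr_ge0; exact: dpw_homo|exact: phi0].
case: SM => h; [left|right]; apply: filterS h => x hx x0.
  have := hx x0; rewrite /w dE (vHx x x0) => /normr0_eq0/subr0_eq <-.
  by rewrite le_max lexx orbT.
have := hx x0; rewrite /w dE (vHx x x0) normr_gt0 subr_eq0 => h.
exact: (max_neq_lt h).
Qed.

Definition Hl : set E := [set x | x ord0 i0 < 0].

(** In both cases of [polarization_dichotomy] the difference of [v] and its reflection has a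
    constant sign on the half-space; equality of the masses on the two sides makes the integral of
    the difference of squares 0, so the difference itself vanishes. *)
Lemma halving_symmetric v : opt v -> (forall x, 0 <= v x) ->
  nsq (v * \1_H) = nsq (v * \1_Hl) -> {ae leb, forall x, v (sg x) = v x}.
Proof.
move=> ov v0 half; have [hv M0 Bv] := ov; have Lv := H1_L2 hv.
have mp := mpres_refl (unit_e0 i0); have mH := measH i0 (0 : R); have mH' := measH' i0 (0 : R).
have [La _] := L2_mul_indic mH Lv; have [Lb _] := L2_mul_indic mH (mpres_L2 mp Lv).
have [Ll _] := L2_mul_indic mH' Lv.
have e : nsq ((v \o sg) * \1_H) = nsq (v * \1_H).
  rewrite half -[RHS]mul1r -(mpres_nsq mp Ll); congr nsq; apply/funext => x; rewrite !fE /= !fE.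
  by rewrite (ind_bool (fun x => 0 < x ord0 i0)) (ind_bool (fun x => x ord0 i0 < 0)) sg_coord oppr_lt0.
have sym : {ae leb, forall x, 0 < x ord0 i0 -> v (sg x) = v x} -> {ae leb, forall x, v (sg x) = v x}.
  move=> h; apply: filterS2 h (mpres_ae mp h) => x h1 h2.
  have [x0|x0|x0] := ltgtP 0 (x ord0 i0); first exact: h1.
    by have := h2; rewrite sg_coord oppr_gt0 sgK => /(_ x0) ->.
  by rewrite (sg_fix (esym x0)).
apply: sym.
have dif (s : R) : s ^+ 2 = 1 -> (forall x, itg (fun x => s * ((v * \1_H) x ^+ 2 - ((v \o sg) * \1_H) x ^+ 2))) /\
   \int[leb]_x (s * ((v * \1_H) x ^+ 2 - ((v \o sg) * \1_H) x ^+ 2)) = 0.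
  move=> _; have i1 := itgB La.2 Lb.2; split; first by move=> x; exact: (itgZ s i1).
  rewrite (intZ s i1) (intB La.2 Lb.2); move: e; rewrite /l2sq => ->; by rewrite subrr mulr0.
have key (s : R) : s ^+ 2 = 1 -> {ae leb, forall x, 0 < x ord0 i0 -> 0 <= s * (v x - v (sg x))} ->
   {ae leb, forall x, 0 < x ord0 i0 -> v (sg x) = v x}.
  move=> s1 hs; have [i1 z1] := dif s s1.
  pose F x := Num.max 0 (s * ((v * \1_H) x ^+ 2 - ((v \o sg) * \1_H) x ^+ 2)).
  have ae1 : {ae leb, forall x, s * ((v * \1_H) x ^+ 2 - ((v \o sg) * \1_H) x ^+ 2) = F x}.
    apply: filterS hs => x hx; rewrite /F max_r// !fE /= (ind_bool (fun x => 0 < x ord0 i0)).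
    have [x0|x0] := ltP 0 (x ord0 i0); last by rewrite !mulr0 subrr mulr0.
    by rewrite !mulr1 subr_sqr mulrA mulr_ge0 ?hx// addr_ge0.
  have mF : measurable_fun setT F by apply: measurable_maxr => //; exact: itg_meas (i1 0).
  have iF := itg_ae mF ae1 (i1 0).
  have F0 x : 0 <= F x by rewrite le_max lexx.
  have zF : \int[leb]_x F x = 0 by rewrite -z1; apply/esym; apply: int_ae => //; exact: itg_meas (i1 0).
  apply: filterS2 (int_eq0 iF F0 zF) ae1 => x /= h0 h x0; rewrite h0 in h; move: h.
  rewrite !fE /= (ind_bool (fun x => 0 < x ord0 i0)) x0 !mulr1 => /eqP.
  rewrite mulf_eq0 subr_eq0 => /orP[/eqP s0|].
    by exfalso; move: s1; rewrite s0 expr0n => /eqP; rewrite eq_sym oner_eq0.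
  by rewrite eqrXn2// => /eqP ->.
case: (polarization_dichotomy ov v0) => h.
  by apply: (key 1); rewrite ?expr1n//; apply: filterS h => x hx x0; rewrite mul1r subr_ge0 hx.
by apply: (key (-1)); rewrite ?sqrrN ?expr1n//; apply: filterS h => x hx x0; rewrite mulN1r opprB subr_ge0 ltW// hx.
Qed.

End coordinate.
End polarization.

(** * Radial symmetry of the optimizers *)

Section radial.
Implicit Types (f g u v w phi : E -> R) (x y z : E) (i j : 'I_N) (A : set E).

Local Notation H i := [set x : E | 0 < x ord0 i].
Local Notation Hm i := [set x : E | x ord0 i < 0].

Lemma sg_other (i j : 'I_N) x : j != i -> refl (ei i) x ord0 j = x ord0 j.
Proof. by move=> ji; rewrite /refl !mxE eqxx (negPf ji) mulr0 subr0. Qed.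

Lemma lip_cut (i : 'I_N) A v (s t : R) : measurable A -> H1 v ->
  (nsq (sh (s *: ei i) v * \1_A) - nsq (sh (t *: ei i) v * \1_A)) ^+ 2 <=
  (s - t) ^+ 2 * (nsq (gr i v) * (4 * nsq v)).
Proof.
move=> mA hv; have Lv := H1_L2 hv.
have Ls := L2_sh (s *: ei i) Lv; have Lt := L2_sh (t *: ei i) Lv.
have [Lsa _] := L2_mul_indic mA Ls; have [Lta _] := L2_mul_indic mA Lt.
have [_ b1] := L2_mul_indic mA (L2B Ls Lt); have [_ b2] := L2_mul_indic mA (L2D Ls Lt).
set f := sh (s *: ei i) v in Ls Lsa b1 b2 *; set g := sh (t *: ei i) v in Lt Lta b1 b2 *.
have -> : nsq (f * \1_A) - nsq (g * \1_A) = dot ((f - g) * \1_A) ((f + g) * \1_A).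
  rewrite -(intB Lsa.2 Lta.2); apply: eq_Rintegral => x _; rewrite !fE; ring.
have e1 : (f - g) * \1_A = f * \1_A - g * \1_A by apply/funext => x; rewrite !fE; ring.
have e2 : (f + g) * \1_A = f * \1_A + g * \1_A by apply/funext => x; rewrite !fE; ring.
have cs := dot_CS (L2B Lsa Lta) (L2D Lsa Lta); rewrite -e1 -e2 in cs.
apply: (le_trans cs).
have n1 : nsq (f - g) <= (s - t) ^+ 2 * nsq (gr i v).
  have := H1_dq_le i (s - t) hv; apply: le_trans.
  have := nsq_sh (t *: ei i) (L2B (L2_sh ((s - t) *: ei i) Lv) Lv) => <-.
  by rewrite shB sh_sh -scalerDl [t + _]addrC subrK.
have n2 : nsq (f + g) <= 4 * nsq v.
  have := nsqD_le Ls Lt; rewrite /f /g !(nsq_sh _ Lv) => h; apply: (le_trans h).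
  by rewrite -mulrDl; move: (nsq_ge0 leb v); lra.
rewrite mulrA; apply: ler_pM; [exact: nsq_ge0|exact: nsq_ge0|exact: le_trans n1|exact: le_trans n2].
Qed.

Lemma lip_continuous (F : R -> R) (C : R) : (forall s t, (F s - F t) ^+ 2 <= (s - t) ^+ 2 * C) ->
  continuous F.
Proof.
move=> h t; apply/cvgrPdist_le => /= e e0.
have C0 : 0 <= `|C| + 1 by rewrite addr_ge0.
have Cp : 0 < `|C| + 1 by rewrite ltr_wpDl.
near=> s; rewrite -(@ler_pXn2r _ 2)// ?nnegrE ?normr_ge0 ?(ltW e0)// real_normK ?num_real//.
apply: (le_trans (h t s)).
have d : `|t - s| <= e / (`|C| + 1).
  by near: s; apply: cvgr_dist_le => //; exact: divr_gt0.
have d2 : (t - s) ^+ 2 <= e ^+ 2 / (`|C| + 1) ^+ 2.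
  rewrite -(real_normK (num_real (t - s))) -expr_div_n.
  by rewrite ler_pXn2r ?nnegrE ?normr_ge0// divr_ge0// ltW.
have c2 : C <= (`|C| + 1) ^+ 2.
  have := ler_norm C; have := normr_ge0 C; move: (`|C|) => c; nra.
apply: le_trans (_ : e ^+ 2 / (`|C| + 1) ^+ 2 * (`|C| + 1) ^+ 2 <= _); last first.
  by rewrite divfK// expf_neq0// lt0r_neq0.
apply: (le_trans (ler_wpM2l (sqr_ge0 _) c2)); by rewrite ler_wpM2r// sqr_ge0.
Unshelve. all: by end_near. Qed.

Lemma cut_cvg0 (A : nat -> set E) v : (forall n, measurable (A n)) -> L2 v ->
  (forall x, exists m, forall n, (m <= n)%N -> ~ A n x) ->
  nsq (v * \1_(A n)) @[n --> \oo] --> (0 : R).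
Proof.
move=> mA Lv hA.
have L n : L2 (v * \1_(A n)) by have [] := L2_mul_indic (mA n) Lv.
suff [_] : itg (fun=> 0) /\ nsq (v * \1_(A n)) @[n --> \oo] --> \int[leb]_x (0 : R) by rewrite int0.
apply: (dominated_int (f := fun n x => (v * \1_(A n)) x ^+ 2) (h := fun x => v x ^+ 2)).
- by move=> n; exact: itg_meas (L n).2.
- move=> x; have [m hm] := hA x; apply: cvg_near_cst; exists m => // n /= /hm nA.
  by rewrite !fE indicE memNset// mulr0 expr0n.
- exact: Lv.2.
- move=> n x; rewrite !fE ger0_norm ?sqr_ge0// indicE exprMn; case: (_ \in _); rewrite ?expr1n ?mulr1//.
  by rewrite expr0n mulr0 sqr_ge0.
Qed.

(** Intermediate value theorem: the difference of the masses on the two sides is continuous in the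
    shift, and tends to [- nsq v] and [nsq v] at the two ends. *)
Lemma halving (i : 'I_N) v : H1 v -> 0 < nsq v -> exists s : R,
  nsq (sh (s *: ei i) v * \1_(H i)) = nsq (sh (s *: ei i) v * \1_(Hm i)).
Proof.
move=> hv M0; have Lv := H1_L2 hv; have mH := measH i (0 : R); have mHm := measH' i (0 : R).
pose K s := nsq (sh (s *: ei i) v * \1_(H i)) - nsq (sh (s *: ei i) v * \1_(Hm i)).
have cK : continuous K.
  by move=> s; apply: cvgB; [apply: (lip_continuous (fun s t => lip_cut i s t mH hv))|
    apply: (lip_continuous (fun s t => lip_cut i s t mHm hv))].
have FE s : nsq (sh (s *: ei i) v * \1_(H i)) = nsq (v * \1_[set x : E | s < x ord0 i]).
  rewrite -(nsq_sh (s *: ei i) (L2_mul_indic (measH i s) Lv).1); congr nsq; apply/funext => x.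
  rewrite !fE /sh !fE (ind_bool (fun x => 0 < x ord0 i)) (ind_bool (fun x => s < x ord0 i)).
  by rewrite !mxE !eqxx mulr1 ltrDr.
have GE s : nsq (sh (s *: ei i) v * \1_(Hm i)) = nsq (v * \1_[set x : E | x ord0 i < s]).
  rewrite -(nsq_sh (s *: ei i) (L2_mul_indic (measH' i s) Lv).1); congr nsq; apply/funext => x.
  rewrite !fE /sh !fE (ind_bool (fun x => x ord0 i < 0)) (ind_bool (fun x => x ord0 i < s)).
  by rewrite !mxE !eqxx mulr1 gtrDr.
have cst (A : nat -> set E) : (forall n, measurable (A n)) -> (forall x, exists m, forall n, (m <= n)%N -> ~ A n x) ->
    nsq (v * \1_(~` A n)) @[n --> \oo] --> nsq v.
  move=> mA hA; have LA n := (L2_mul_indic (mA n) Lv).1; have LAc n := (L2_mul_indic (measurableC (mA n)) Lv).1.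
  apply: (@cvg_eqr _ _ _ _ (fun n => nsq v - nsq (v * \1_(A n)))).
    move=> n; have := intD (LAc n).2 (LA n).2 => h; apply/eqP; rewrite subr_eq; apply/eqP.
    rewrite /l2sq -h; apply: eq_Rintegral => x _; rewrite !fE !indicE in_setC.
    by case: (_ \in _); rewrite /= ?mulr1 ?mulr0 ?expr0n/= ?addr0 ?add0r.
  rewrite -[X in _ --> X]subr0; apply: cvgB; [exact: cvg_cst|exact: cut_cvg0].
have big x : exists m, forall n, (m <= n)%N -> `|x ord0 i| < n%:R.
  exists (Num.truncn `|x ord0 i|).+1 => n hn; apply: lt_le_trans (truncnS_gt _) _.
  by rewrite ler_nat.
have A1 x : exists m, forall n : nat, (m <= n)%N -> ~ n%:R <= x ord0 i.
  have [m hm] := big x; exists m => n /hm h; apply/negP; rewrite -ltNge.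
  exact: le_lt_trans (ler_norm _) h.
have A2 x : exists m, forall n : nat, (m <= n)%N -> ~ x ord0 i <= - n%:R.
  have [m hm] := big x; exists m => n /hm h; apply/negP; rewrite -ltNge ltrNl.
  by apply: le_lt_trans h; rewrite -normrN ler_norm.
have mA1 n : measurable [set x : E | n%:R <= x ord0 i].
  rewrite (_ : [set _ | _] = ~` [set x : E | x ord0 i < n%:R]); first by apply: measurableC; exact: measH'.
  by apply/seteqP; split => x /=; rewrite leNgt => /negP.
have mA2 n : measurable [set x : E | x ord0 i <= - n%:R] by exact: measHc.
have small (A B : nat -> set E) : (forall n, A n `<=` B n) -> (forall n, measurable (A n)) ->
    (forall x, exists m, forall n, (m <= n)%N -> ~ B n x) -> nsq (v * \1_(A n)) @[n --> \oo] --> (0 : R).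
  move=> AB mA hB; apply: (cut_cvg0 mA Lv) => x; have [m hm] := hB x; exists m => n /hm nB /AB; exact: nB.
have Kp : K n%:R @[n --> \oo] --> - nsq v.
  apply: (@cvg_eqr _ _ _ _ (fun n => nsq (v * \1_[set x : E | n%:R < x ord0 i]) - nsq (v * \1_(~` [set x : E | n%:R <= x ord0 i])))).
    move=> n; rewrite /K FE GE; congr (_ - nsq (v * \1__)).
    by apply/seteqP; split => x /=; rewrite ltNge => /negP.
  rewrite -[X in _ --> X]sub0r; apply: cvgB; last exact: cst.
  by apply: (small _ (fun n => [set x : E | n%:R <= x ord0 i])) => [n x /= /ltW|n|]; [|exact: measH|exact: A1].
have Km : K (- n%:R) @[n --> \oo] --> nsq v.
  apply: (@cvg_eqr _ _ _ _ (fun n => nsq (v * \1_(~` [set x : E | x ord0 i <= - n%:R])) - nsq (v * \1_[set x : E | x ord0 i < - n%:R]))).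
    move=> n; rewrite /K FE GE; congr (nsq (v * \1__) - _).
    by apply/seteqP; split => x /=; rewrite ltNge => /negP.
  rewrite -[X in _ --> X]subr0; apply: cvgB; first exact: cst.
  by apply: (small _ (fun n => [set x : E | x ord0 i <= - n%:R])) => [n x /= /ltW|n|]; [|exact: measH'|exact: A2].
have M0' : - nsq v < 0 by rewrite oppr_lt0.
have [n1 _ h1'] := cvgr_lt _ Kp _ M0'; have [n2 _ h2'] := cvgr_gt _ Km _ M0.
pose n := maxn n1 n2; have h1 := h1' n (leq_maxl _ _); have h2 := h2' n (leq_maxr _ _).
have le : - n%:R <= n%:R :> R by rewrite ge0_cp.
have [||s _ Ks] := @IVT R K (- n%:R) n%:R 0 le.
- exact: continuous_subspaceT.
- by rewrite ge_min le_max (ltW h1) (ltW h2) orbT.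
by exists s; apply/subr0_eq.
Qed.

(** The coordinates are treated one by one: a translation along one axis does not disturb the
    symmetry already achieved in the others. *)
Lemma sym_translate (s : seq 'I_N) v : opt v -> (forall x, 0 <= v x) -> exists y,
  forall i, i \in s -> {ae leb, forall x, sh y v (refl (ei i) x) = sh y v x}.
Proof.
move=> ov v0; elim: s => [|i s [y IH]]; first by exists 0.
have [is_|ns] := boolP (i \in s).
  by exists y => j; rewrite inE => /orP[/eqP ->|]; exact: IH.
have ow := opt_sh y ov; set w := sh y v in ow IH.
have [hw M0 _] := ow; have [t ht] := halving i hw M0.
have ou := opt_sh (t *: ei i) ow.
exists (t *: ei i + y) => j; rewrite -sh_sh -/w inE => /orP[/eqP ->|js].
  by apply: (halving_symmetric ou) => // x; exact: v0.
have ij : i != j by apply: contraNneq ns => ->.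
have h := mpres_ae (mpres_shift (t *: ei i)) (IH j js).
apply: filterS h => x; rewrite /sh reflD reflZ => <-; congr (w (_ + _ *: _)).
apply/rowP => l; have [->|lj] := eqVneq l j; last by rewrite sg_other.
by rewrite sg_coord !mxE eqxx eq_sym (negPf ij) oppr0.
Qed.

(** The composition of the reflections in all coordinates is [- x]. *)
Lemma even_translate v : opt v -> (forall x, 0 <= v x) -> exists y,
  {ae leb, forall x, sh y v (- x) = sh y v x}.
Proof.
move=> ov v0; have [y hy] := sym_translate (index_enum 'I_N) ov v0; exists y.
set w := sh y v in hy *.
have S (s : seq 'I_N) : (forall i, i \in s -> {ae leb, forall x, w (refl (ei i) x) = w x}) ->
   {ae leb, forall x, w (foldr (fun i z => refl (ei i) z) x s) = w x}.
  elim: s => [|i s IH] h; first by apply: aeW.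
  have IH' := IH (fun j js => h j (mem_behead (s := i :: s) js)).
  have mp : mpres 1 (fun x : E => foldr (fun i z => refl (ei i) z) x s).
    elim: s {IH IH' h} => [|j s IH].
      have := @mpres_shift R N 0; congr mpres; apply/funext => x; exact: addr0.
    by have := mpres_comp IH (mpres_refl (unit_e0 j)); rewrite mul1r.
  apply: filterS2 IH' (mpres_ae mp (h i (mem_head i s))) => x h1 h2 /=; by rewrite h2 h1.
have C (s : seq 'I_N) x : uniq s -> forall j,
    foldr (fun i z => refl (ei i) z) x s ord0 j = if j \in s then - x ord0 j else x ord0 j.
  elim: s => [|i s IH]//= /andP[ns us] j; rewrite inE; have [->|ji] /= := eqVneq j i.
    by rewrite sg_coord (IH us) (negPf ns).
  by rewrite sg_other//; exact: (IH us).
have := S (index_enum 'I_N) hy; apply: filterS => x <-; congr w.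
by apply/rowP => j; rewrite C ?index_enum_uniq// mem_index_enum mxE.
Qed.

(** Evenness makes every hyperplane through the origin halve the mass. The symmetry result is
    available only for coordinate hyperplanes, so the reflection across [e] is conjugated to one of
    these by the reflection that exchanges [e] and [e0]. *)
Lemma even_opt_refl e v : opt v -> (forall x, 0 <= v x) -> {ae leb, forall x, v (- x) = v x} ->
  dotv e e = 1 -> {ae leb, forall x, v (refl e x) = v x}.
Proof.
move=> ov v0 ev u1; have N0 : (0 < N)%N by case/andP: hN.
pose i0 := Ordinal N0; pose e0 : E := ei i0; have u0 : dotv e0 e0 = 1 := unit_e0 i0.
have evS w : H1 w -> {ae leb, forall x, w (- x) = w x} -> nsq (w * \1_(H i0)) = nsq (w * \1_(Hm i0)).
  move=> hw ew; have Lw := H1_L2 hw; have mH := measH i0 (0 : R); have mHm := measH' i0 (0 : R).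
  have [L1 _] := L2_mul_indic mH Lw; have [L2' _] := L2_mul_indic mHm Lw.
  have mp := mpres_opp (R := R) (N := N).
  rewrite -[RHS]mul1r -(mpres_nsq mp L2'); apply: (nsq_ae L1 (mpres_L2 mp L2')).
  apply: filterS ew => x hx; rewrite !fE /= !fE hx (ind_bool (fun x => 0 < x ord0 i0)) (ind_bool (fun x => x ord0 i0 < 0)).
  by rewrite mxE oppr_lt0.
have [ee|ne] := eqVneq e e0.
  by rewrite ee; apply: (halving_symmetric ov v0); apply: evS ev; case: ov.
(* The unit vector along [e - e0] is normal to the hyperplane whose reflection exchanges the unit
   vectors [e] and [e0]. *)
pose d := e - e0; have dd : 0 < dotv d d.
  rewrite lt0r dotv_ge0 andbT; apply/eqP => /dotv_eq0 /subr0_eq h; by rewrite h eqxx in ne.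
pose n := (Num.sqrt (dotv d d))^-1 *: d.
have s2 : Num.sqrt (dotv d d) ^+ 2 = dotv d d by rewrite sqr_sqrtr// ltW.
have sn0 : Num.sqrt (dotv d d) != 0 by rewrite lt0r_neq0// sqrtr_gt0.
have un : dotv n n = 1.
  by rewrite /n dotvZl dotvZr -{3}s2; field.
have dE : dotv d d = 2 * (1 - dotv e e0).
  by rewrite /d dotvBl !dotvBr u1 u0 (dotvC e0 e); ring.
have de : 2 * dotv d e = dotv d d.
  by rewrite dE /d dotvBl u1 (dotvC e0 e).
have nE y : refl n y = y - (2 * dotv y d / dotv d d) *: d.
  rewrite /refl /n dotvZr scalerA; congr (_ - _ *: _).
  by move: (Num.sqrt (dotv d d)) s2 sn0 => S <- S0; field.
have re : refl n e = e0.
  by rewrite nE (dotvC e d) de divff ?lt0r_neq0// scale1r /d opprB addrC subrK.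
have re0 : refl n e0 = e by rewrite -re reflK.
have key x : refl n (refl e0 (refl n x)) = refl e x.
  have h (c : R) : refl n (refl n x - c *: e0) = x - c *: e.
    by rewrite -scaleNr reflD reflZ reflK// re0 scaleNr.
  rewrite [refl e0 _](_ : _ = refl n x - (2 * dotv (refl n x) e0) *: e0)// h.
  by have := dotv_refl x e un; rewrite re => ->.
have ow := opt_refl un ov; set w := v \o refl n in ow.
have w0 x : 0 <= w x by exact: v0.
have ew : {ae leb, forall x, w (- x) = w x}.
  apply: filterS (mpres_ae (mpres_refl un) ev) => x /= h.
  by rewrite /w /= -h -[- x]scaleN1r reflZ scaleN1r.
have hw : {ae leb, forall x, w (refl e0 x) = w x}.
  by apply: (halving_symmetric ow w0); apply: evS ew; case: ow.
apply: filterS (mpres_ae (mpres_refl un) hw) => x; rewrite /w /= reflK// => <-.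
by rewrite key.
Qed.

Lemma avg_refl e v x (r : R) : L2 v -> dotv e e = 1 -> {ae leb, forall x, v (refl e x) = v x} ->
  avg (eball r) v (refl e x) = avg (eball r) v x.
Proof.
move=> Lv u1 hv; rewrite /avg; congr (_ * _).
have mp := mpres_refl u1; have mA : measurable (eball r : set E) by exact: eball_measurable.
have [LA _] := L2_indic mA (eball_finite r).
have L1 := L2_sh (refl e x) Lv; have L1' := L2_sh x Lv.
rewrite -[LHS]mul1r -(mpres_dot mp L1 LA).
apply: dot_ae (mpres_L2 mp L1) (mpres_L2 mp LA) L1' LA _ _.
  apply: filterS (mpres_ae (mpres_shift x) hv) => z h.
  by rewrite /sh /= -reflD; exact: h.
apply: aeW => z /=; rewrite !indicE; congr ((_ : bool)%:R).
by apply/idP/idP; rewrite !inE /eball /= enorm_refl.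
Qed.

Lemma refl_between x y : enorm x = enorm y -> x != y -> exists2 e, dotv e e = 1 & refl e x = y.
Proof.
move=> exy nxy; pose d := x - y.
have dd : 0 < dotv d d.
  rewrite lt0r dotv_ge0 andbT; apply/eqP => /dotv_eq0 /subr0_eq h; by rewrite h eqxx in nxy.
have s2 : Num.sqrt (dotv d d) ^+ 2 = dotv d d by rewrite sqr_sqrtr// ltW.
have sn0 : Num.sqrt (dotv d d) != 0 by rewrite lt0r_neq0// sqrtr_gt0.
exists ((Num.sqrt (dotv d d))^-1 *: d); first by rewrite dotvZl dotvZr -{3}s2; field.
have hx : dotv x x = dotv y y by rewrite -!enorm_sqr exy.
have dx : 2 * dotv x d = dotv d d.
  by rewrite /d dotvBl !dotvBr hx (dotvC y x); ring.
rewrite /refl dotvZr scalerA (_ : _ * _ / _ = 1); last first.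
  move: dx; move: (Num.sqrt (dotv d d)) s2 sn0 (dotv x d) => S <- S0 t dx.
  by have -> : 2 * (S^-1 * t) / S = (2 * t) / S ^+ 2 by [field]; rewrite dx divff// expf_neq0.
by rewrite scale1r /d opprB addrC subrK.
Qed.

(* The averages of the optimizer over balls are exactly invariant under reflections and converge
   to it almost everywhere. *)
Lemma opt_radial v : opt v -> (forall x, 0 <= v x) -> exists y (qf : R -> R),
  {ae leb, forall x, sh y v x = qf (enorm x)}.
Proof.
move=> ov v0; have [y ev] := even_translate ov v0; exists y.
have ow := opt_sh y ov; set w := sh y v in ow ev *.
have w0 x : 0 <= w x by exact: v0.
have [hw M0 _] := ow; have Lw := H1_L2 hw; have D0 := dirichlet_ge0 w.
have N0 : (0 < N)%N by case/andP: hN.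
pose i0 := Ordinal N0; have u0 : dotv (ei i0 : E) (ei i0) = 1 := unit_e0 i0.
have NR : 0 < N%:R :> R by rewrite ltr0n.
(* The averaging errors are then at most [9^-1 ^+ n], within the rate [8^-1 ^+ n] required by
   [L2_rapid_ae]; the added one covers a small Dirichlet energy. *)
pose r n : R := 3^-1 ^+ n / (N%:R * (dirichlet w + 1)).
have d1 : 0 < dirichlet w + 1 by rewrite ltr_wpDl.
have r0 n : 0 < r n by rewrite divr_gt0 ?exprn_gt0 ?invr_gt0 ?mulr_gt0.
have lm0 n : 0 < lm (eball (r n) : set E).
  by rewrite /lm fine_gt0// eball_gt0//= eball_finite.
have sub n (z : E) : eball (r n) z -> cube (r n) z.
  by move=> /= hz; apply/cubeP => i; apply: le_trans (coord_le_enorm _ _) (ltW hz).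
have b n : (N%:R * r n) ^+ 2 * dirichlet w <= 8^-1 ^+ n.
  have -> : N%:R * r n = 3^-1 ^+ n / (dirichlet w + 1).
    by rewrite /r; field; rewrite !lt0r_neq0.
  rewrite expr_div_n -exprM mulnC exprM -mulrA.
  apply: le_trans (_ : (3^-1 ^+ 2) ^+ n * 1 <= _).
    rewrite ler_wpM2l ?exprn_ge0// ?sqr_ge0// ler_pdivrMl ?exprn_gt0// mulr1.
    by move: (dirichlet w) D0 => D; nra.
  by rewrite mulr1 lerXn2r ?nnegrE ?sqr_ge0//; lra.
have mA n : measurable (eball (r n) : set E) by exact: eball_measurable.
have avgP n := nsq_avg_le (mA n) (eball_finite (r n)) (lm0 n) Lw
   (fun z hz => nsq_sh_cube hw (ltW (r0 n)) (sub n z hz)).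
have cv := L2_rapid_ae (fun n => (avgP n).1) Lw (fun n => le_trans (avgP n).2 (b n)).
(* The profile at radius [s] is read off on the axis [i0]. *)
exists (fun s => lim ((fun n => avg (eball (r n)) w (s *: ei i0)) @ \oo)).
apply: filterS cv => x hx; apply/esym/cvg_lim => //.
suff -> : (fun n => avg (eball (r n)) w (enorm x *: ei i0)) = (fun n => avg (eball (r n)) w x) by [].
apply/funext => n; have [e|ne] := eqVneq (enorm x *: ei i0) x; first by rewrite [in LHS]e.
have ex : enorm (enorm x *: (ei i0 : E)) = enorm x.
  by rewrite {1}/enorm dotvZl dotvZr u0 mulr1 -expr2 sqrtr_sqr ger0_norm// enorm_ge0.
have [e ue re] := refl_between ex ne.
by rewrite -[in RHS]re (avg_refl _ _ Lw ue (even_opt_refl ow w0 ev ue)).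
Qed.

End radial.

(** * The ground state *)

Section ground_state.
Implicit Types (f g u v w phi : E -> R) (x y z : E) (i j : 'I_N) (A : set E).

Lemma test_H1 phi : test_function phi -> H1 phi /\ forall i, {ae leb, forall x, gr i phi x = partial i phi x}.
Proof.
move=> tp; apply: (H1_of_dq (test_L2 tp)) => i; first exact: test_L2 (test_partial i tp).
by apply: test_dq_cvg' => // [n|]; [exact: hs_neq0|exact: hs_cvg0].
Qed.

Lemma int_grad_test u phi : H1 u -> test_function phi ->
  \int[leb]_x (\sum_(i < N) grad u x ord0 i * partial i phi x) = dotD u phi.
Proof.
move=> hu tp; have [hp gp] := test_H1 tp.
rewrite (int_sum (f := fun i x => gr i u x * partial i phi x)); last first.
  by move=> i; exact: itg_mul (gr_L2 i hu) (test_L2 (test_partial i tp)).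
apply: eq_bigr => i _; have Lp := test_L2 (test_partial i tp).
apply: (dot_ae (gr_L2 i hu) Lp (gr_L2 i hu) (gr_L2 i hp)); first exact: aeW.
by apply: filterS (gp i) => x ->.
Qed.

Lemma weak_solution_intro (A : R) (F : R -> R) u : H1 u ->
  (forall phi, H1 phi -> A * dotD u phi + \int[leb]_x (F (u x) * phi x) = 0) -> weak_solution A F u.
Proof.
move=> hu h phi tp; have [hp _] := test_H1 tp.
by rewrite (int_grad_test hu tp); exact: h.
Qed.

Lemma opt_dil (l : R) v : 0 < l -> opt v -> opt (dil l v).
Proof.
move=> l0 [hv M0 Bv]; have [h M D B] := dilP l0 hv; split; [exact: h|by rewrite M|].
have D0 := dirichlet_gt0 hv M0.
rewrite B M D Bv powRM ?exprn_ge0 ?(ltW l0) ?(ltW D0)//.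
have -> : (l ^+ 2) `^ k = l `^ (N%:R * p / 2).
  by rewrite -powR_mulrn ?(ltW l0)// -powRrM; congr (_ `^ _); field.
by move: (_ `^ _) (_ `^ _) (_ `^ _) => A1 A2 A3; ring.
Qed.

Lemma ae_False : {ae leb, forall x : E, False} -> False.
Proof.
move=> [A [mA A0 sA]]; have : (leb (cube 1 : set E) <= leb A)%E.
  by apply: le_measure; rewrite ?inE//; [exact: cube_measurable|move=> x _; exact: sA].
by rewrite A0 leb_cube// mulr1 lee_fin leNgt exprn_gt0.
Qed.

Lemma nsq_gt0 u : H1 u -> {ae leb, forall x, 0 < u x} -> 0 < nsq u.
Proof.
move=> hu pu; rewrite lt0r nsq_ge0 andbT; apply/eqP => /(nsq_eq0 (H1_L2 hu)) z.
by apply: ae_False; apply: filterS2 pu z => x h e; rewrite e ltxx in h.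
Qed.

Lemma powR_root (s r : R) : 0 < s -> 0 < r -> exists2 m : R, 0 < m & m `^ s = r.
Proof.
move=> s0 r0; exists (r `^ s^-1); first exact: powR_gt0.
by rewrite -powRrM mulVf ?lt0r_neq0// powRr1// ltW.
Qed.

Lemma EL_arith (C r s A B A' B' a1 a2 T : R) : A * B = T -> A' * B' = T ->
  C * (2 * r * A * B * a1 + 2 * s * A' * B' * a2) = 2 * C * T * (r * a1 + s * a2).
Proof. by move=> e1 e2; rewrite -[2 * r * A * B]mulrA e1 -[2 * s * A' * B']mulrA e2; ring. Qed.

(** When mass and Dirichlet energy equal the same [m ^+ 2], the powers in [opt_EL] combine into
    [m ^ p], and the chosen value of [m] reduces the multipliers to [k] and [beta]. Divided by [k],
    this is the equation of [Q], whose coefficients are [beta / k] and [k^-1]. *)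
Lemma scaled_EL (w : E -> R) (m : R) : 0 < m -> m `^ p = q / (2 * Cst) -> 0 < Cst -> opt w -> nsq w = m ^+ 2 ->
  dirichlet w = m ^+ 2 -> forall phi, H1 phi ->
  \int[leb]_x (dpw (w x) * phi x) = k * dotD w phi + beta * dot w phi.
Proof.
move=> m0 mp C0 ow Mw Dw phi hp; have := opt_EL ow hp; rewrite Mw Dw.
have P r s : r + s = q / 2 - 1 -> (m ^+ 2) `^ r * (m ^+ 2) `^ s = m `^ p.
  move=> e; rewrite -powRD; last by rewrite (lt0r_neq0 (exprn_gt0 _ m0)) implybT.
  by rewrite e -powR_mulrn ?(ltW m0)// -powRrM; congr (_ `^ _); field.
have P1 := P (k - 1) beta ltac:(ring); have P2 := P k (beta - 1) ltac:(ring).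
have q0 := q_gt0; rewrite (EL_arith _ _ _ _ _ P1 P2) mp => e.
by apply: (mulfI (lt0r_neq0 q0)); rewrite e; congr (_ * _); field; exact: lt0r_neq0.
Qed.

Lemma opt_positive_radial (m : R) w : 0 < m -> m `^ p = q / (2 * Cst) -> 0 < Cst -> opt w ->
  (forall x, 0 <= w x) -> nsq w = m ^+ 2 -> dirichlet w = m ^+ 2 ->
  exists y, positive_radial_solution p (sh y w).
Proof.
move=> m0 mp C0 ow w0 Mw Dw; have [y [qf rad]] := opt_radial ow w0; exists y.
have N0 : (0 < N)%N by case/andP: hN.
have ou := opt_sh y ow; set u := sh y w in rad ou *.
have [hw _ _] := ow; have [hu _ _] := ou.
have Mu : nsq u = m ^+ 2 by rewrite (nsq_sh y (H1_L2 hw)).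
have Du : dirichlet u = m ^+ 2 by rewrite (dirichlet_shE y hw).
split=> //; last by exists qf.
- apply: weak_solution_intro => // phi hp; have e := scaled_EL m0 mp C0 ou Mu Du hp.
  have i1 := itg_mul (H1_L2 hu) (H1_L2 hp); have i2 := itg_dpw hu hp.
  have NR : N%:R != 0 :> R by rewrite pnatr_eq0 -lt0n.
  have -> : \int[leb]_x (((4 + 2 * p - N%:R * p) / (N%:R * p) * u x - 4 / (N%:R * p) * `|u x| `^ p * u x) * phi x)
     = beta / k * dot u phi - k^-1 * \int[leb]_x (dpw (u x) * phi x).
    rewrite -(intZ _ i1) -(intZ _ i2) -(intB (itgZ _ i1) (itgZ _ i2)); apply: eq_Rintegral => x _.
    rewrite !fE /dpowp; move: (`|u x| `^ p) (u x) (phi x) => t s r; field; by rewrite NR lt0r_neq0.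
  rewrite e; move: (dotD u phi) (dot u phi) => s t; field; by rewrite NR lt0r_neq0.
- exact: (opt_pos (Ordinal N0) ou (fun x => w0 _)).
Qed.

Lemma Q_opt Q : is_Q p Q -> exists m : R, [/\ 0 < m, m `^ p = q / (2 * Cst), opt Q, nsq Q = m ^+ 2 & dirichlet Q = m ^+ 2].
Proof.
move=> [[hQ _ Qp _] uQ]; have MQ := nsq_gt0 hQ Qp.
have C0 := Cst_gt0 hQ MQ; have q0 := q_gt0.
have [v [hv Mv Dv] Bv] := maximizer_exists hQ MQ.
have ov : opt v by split=> //; rewrite ?Bv ?Dv Mv ?powR1 ?mulr1.
have [oa Da] := opt_abs ov; set a : E -> R := fun x => `|v x| in oa Da.
have [ha _ _] := oa.
have Ma : nsq a = 1 by rewrite -Mv; apply: eq_Rintegral => x _; rewrite /a real_normK ?num_real.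
have [m m0 mp] := powR_root p0 (divr_gt0 q0 (mulr_gt0 (ltr0Sn R 1) C0)).
exists m; have ow := optZ (lt0r_neq0 m0) oa.
have Mw : nsq (m *: a) = m ^+ 2 by rewrite (nsqZ _ (H1_L2 ha)) Ma mulr1.
have Dw : dirichlet (m *: a) = m ^+ 2 by rewrite (dirichletZ _ ha) Da Dv mulr1.
have w0 x : 0 <= (m *: a) x by rewrite fE; apply: mulr_ge0; [exact: ltW|exact: normr_ge0].
have [hw _ _] := ow.
have [y /uQ [z hz]] := opt_positive_radial m0 mp C0 ow w0 Mw Dw.
have ae : {ae leb, forall x, sh (y - z) (m *: a) x = Q x}.
  apply: filterS (mpres_ae (mpres_shift (- z)) hz) => x.
  by rewrite subrK => <-; rewrite /sh -addrA [- z + y]addrC.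
have oQ : opt Q by apply: (opt_ae (L2_meas (H1_L2 hQ)) ae); exact: opt_sh.
have [hs1 _] := dirichlet_sh (y - z) hw.
split; [exact: m0|exact: mp|exact: oQ| |].
  by rewrite -(nsq_ae (H1_L2 hs1) (H1_L2 hQ) ae) (nsq_sh _ (H1_L2 hw)).
by rewrite -(dirichlet_ae hs1 hQ ae) (dirichlet_shE _ hw).
Qed.

(** The dilation by [l^-1] followed by the factor [m / c] brings mass and Dirichlet energy to
    [m ^+ 2]; there the optimizer is a translate of [Q] after a translation, and undoing the scaling
    multiplies the displacement by [l^-1]. *)
Lemma opt_unique Q (m c l : R) w : is_Q p Q -> 0 < m -> m `^ p = q / (2 * Cst) -> 0 < Cst -> 0 < c -> 0 < l ->
  opt w -> (forall x, 0 <= w x) -> nsq w = c ^+ 2 -> dirichlet w = (l * c) ^+ 2 ->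
  is_translate w (fun x => c * l `^ (N%:R / 2) / m * Q (l *: x)).
Proof.
move=> [_ uQ] m0 mp C0 c0 l0 ow w0 Mw Dw; have [hw _ _] := ow.
have li : 0 < l^-1 by rewrite invr_gt0.
have mc : 0 < m / c by rewrite divr_gt0.
have [hd Md Dd _] := dilP li hw; have od := opt_dil li ow.
have oz := optZ (lt0r_neq0 mc) od.
have z0 x : 0 <= ((m / c) *: dil l^-1 w) x.
  by rewrite !fE mulr_ge0 ?(ltW mc)// mulr_ge0 ?powR_ge0//; exact: w0.
have Mz : nsq ((m / c) *: dil l^-1 w) = m ^+ 2.
  by rewrite (nsqZ _ (H1_L2 hd)) Md Mw; field; exact: lt0r_neq0.
have Dz : dirichlet ((m / c) *: dil l^-1 w) = m ^+ 2.
  by rewrite (dirichletZ _ hd) Dd Dw; field; rewrite !lt0r_neq0.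
have [y /uQ [z hz]] := opt_positive_radial m0 mp C0 oz z0 Mz Dz.
exists (l^-1 *: (z - y)).
apply: filterS (mpres_ae (mpres_shift (- (l^-1 *: y))) (mpres_ae (mpres_scale l0) hz)) => x /=.
have -> : l *: (x + l^-1 *: (z - y)) = l *: (x - l^-1 *: y) + z.
  by apply/rowP => j; rewrite !mxE; field; exact: lt0r_neq0.
move=> <-; rewrite /sh /dil !fE /=.
have -> : l^-1 *: (l *: (x - l^-1 *: y) + y) = x.
  by apply/rowP => j; rewrite !mxE; field; exact: lt0r_neq0.
rewrite !mulrA -{1}[w x]mul1r; congr (_ * _).
have -> : l^-1 `^ (N%:R / 2) = (l `^ (N%:R / 2))^-1.
  by rewrite -powR_inv1 ?(ltW l0)// -powRrM mulrC powRrM powR_inv1 ?powR_ge0.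
have s0 : l `^ (N%:R / 2) != 0 by rewrite lt0r_neq0// powR_gt0.
by field; rewrite s0 !lt0r_neq0.
Qed.

End ground_state.

(** * The Pohozaev identity of constrained critical points *)

Section critical_points.
Implicit Types (f g u v w phi : E -> R) (x y z : E) (i j : 'I_N) (A : set E).

(** A lower bound valid for both signs of [s] is enough: [s] of the sign opposite to [X], and so
    small that the quadratic term stays below a quarter of the linear one, contradicts [X != 0]. *)
Lemma slope_eq0 (X C : R) : (forall e, 0 < e -> exists2 d, 0 < d & forall s, `|s| < d -> - (e * `|s|) <= s * X + C * s ^+ 2) ->
  X = 0.
Proof.
move=> h; have [//|X0] := eqVneq X 0; exfalso.
have x0 : 0 < `|X| by rewrite normr_gt0.
have [d d0 hd] := h (`|X| / 2) (divr_gt0 x0 (ltr0Sn R 1)).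
have C1 : 0 < `|C| + 1 by rewrite ltr_wpDl.
pose r := Num.min (d / 2) (`|X| / (4 * (`|C| + 1))).
have r0 : 0 < r by rewrite lt_min !divr_gt0// mulr_gt0.
have rd : r < d by rewrite gt_min; apply/orP; left; lra.
have rX : r * (4 * (`|C| + 1)) <= `|X| by rewrite -ler_pdivlMr ?mulr_gt0// ge_min lexx orbT.
have sX : - Num.sg X * r * X = - (r * `|X|) by rewrite normrEsg; ring.
have := hd (- Num.sg X * r); rewrite sX normrM normrN normr_sg X0 mul1r (gtr0_norm r0) => /(_ rd).
have -> : (- Num.sg X * r) ^+ 2 = r ^+ 2 by rewrite exprMn sqrrN sqr_sg X0 mul1r.
have cC : C * r <= `|X| / 4.
  have := ler_norm C; move: (`|X|) (`|C|) rX C1 => x c rX C1 cC; nra.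
have cr := ler_wpM2l (ltW r0) cC; move: (`|X|) x0 cr => x x0 cr; nra.
Qed.

Lemma energy_quad (a b D d F s I B B' : R) : 0 <= a -> 0 <= b -> 0 <= D -> 0 <= F -> `|s| <= 1 -> B + q * s * I <= B' ->
  a / 2 * (D + 2 * (s * d) + s ^+ 2 * F) + b / 4 * (D + 2 * (s * d) + s ^+ 2 * F) ^+ 2 - 1 / q * B'
   - (a / 2 * D + b / 4 * D ^+ 2 - 1 / q * B) <=
  s * ((a + b * D) * d - I) + (a / 2 * F + b / 4 * (4 * d ^+ 2 + 2 * D * F + 4 * `|d| * F + F ^+ 2)) * s ^+ 2.
Proof.
move=> a0 b0 D0 F0 s1 hB; have q0 := q_gt0.
have h1 : 1 / q * B + s * I <= 1 / q * B'.
  have -> : 1 / q * B + s * I = 1 / q * (B + q * s * I) by field; exact: lt0r_neq0.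
  by rewrite ler_pM2l// divr_gt0.
have h2 : s * d <= `|d|.
  by rewrite (le_trans (ler_norm _))// normrM ler_piMl.
have h3 : s ^+ 2 <= 1 by rewrite -(real_normK (num_real s)) expr_le1.
have h4 : b * (s ^+ 2 * F * (s * d)) <= b * (s ^+ 2 * F * `|d|).
  by rewrite ler_wpM2l// ler_wpM2l// mulr_ge0// sqr_ge0.
have h5 : b * (s ^+ 2 * F ^+ 2 * s ^+ 2) <= b * (s ^+ 2 * F ^+ 2 * 1).
  by rewrite ler_wpM2l// ler_wpM2l// mulr_ge0// sqr_ge0.
rewrite -subr_ge0.
have -> : forall G, G = (1 / q * B' - (1 / q * B + s * I)) + (b * (s ^+ 2 * F * `|d|) - b * (s ^+ 2 * F * (s * d)))
   + 4^-1 * (b * (s ^+ 2 * F ^+ 2 * 1) - b * (s ^+ 2 * F ^+ 2 * s ^+ 2)) -> 0 <= G.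
  by move=> G ->; apply: addr_ge0; [apply: addr_ge0|apply: mulr_ge0]; rewrite ?subr_ge0 ?invr_ge0.
  by [].
field; exact: lt0r_neq0.
Qed.

Lemma critical_arith (A B mu s t1 t2 t3 X I Z : R) : - t1 <= B - A - mu * (s * t3) ->
  B - A <= s * (X - I) + Z -> t1 <= t2 -> - t2 <= s * (X - I - mu * t3) + Z.
Proof. by move=> h1 h2 h3; rewrite (mulrBr s (X - I)) [s * (mu * t3)]mulrCA; lra. Qed.

Lemma frac_le (e S n : R) : 0 <= e -> 0 <= S -> 0 <= n -> e / (n + 1) * (S * n) <= e * S.
Proof.
move=> e0 S0 n0; have n1 : 0 < n + 1 by rewrite ltr_wpDl.
have -> : e / (n + 1) * (S * n) = e * S * (n / (n + 1)) by field; exact: lt0r_neq0.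
by rewrite ler_piMr ?mulr_ge0// ler_pdivrMr// mul1r lerDl.
Qed.

(* Convexity of [Bp] replaces its differentiability. *)
Lemma critical_EL (a b mu : R) u : 0 < a -> 0 < b -> H1 u ->
  (forall e, 0 < e -> exists2 d, 0 < d & forall phi, H1 phi -> normH1 phi < d ->
      `|energy a b p (u \+ phi) - energy a b p u - mu * \int[leb]_x (u x * phi x)| <= e * normH1 phi) ->
  forall phi, H1 phi -> (a + b * dirichlet u) * dotD u phi - \int[leb]_x (dpw (u x) * phi x) = mu * dot u phi.
Proof.
move=> a0 b0 hu hE phi hp; apply/eqP; rewrite -subr_eq0; apply/eqP.
pose F := dirichlet phi; pose d0 := dotD u phi; pose D := dirichlet u.
apply: (slope_eq0 (C := a / 2 * F + b / 4 * (4 * d0 ^+ 2 + 2 * D * F + 4 * `|d0| * F + F ^+ 2))) => e e0.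
have n0 : 0 <= normH1 phi by exact: sqrtr_ge0.
have n1 : 0 < normH1 phi + 1 by rewrite ltr_wpDl.
have [d dp hd] := hE (e / (normH1 phi + 1)) (divr_gt0 e0 n1).
exists (Num.min 1 (d / (normH1 phi + 1))); first by rewrite lt_min ltr01 divr_gt0.
move=> s; rewrite lt_min => /andP[s1 s2].
have hs1 := H1Z s hp.
have nE : normH1 (s *: phi) = `|s| * normH1 phi.
  rewrite /normH1 (dirichletZ _ hp) (_ : normL2_sq (s *: phi) = s ^+ 2 * normL2_sq phi); last exact: (nsqZ s (H1_L2 hp)).
  rewrite -mulrDr.
  by rewrite sqrtrM ?sqr_ge0// sqrtr_sqr.
have nd : normH1 (s *: phi) < d.
  rewrite nE; move: s2; rewrite ltr_pdivlMr// => h; apply: le_lt_trans h.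
  by rewrite ler_wpM2l// lerDl.
have := hd _ hs1 nd.
have -> : u \+ (s *: phi) = u + s *: phi by [].
have -> : \int[leb]_x (u x * (s *: phi) x) = s * dot u phi by exact: dotZr (H1_L2 hu) (H1_L2 hp).
rewrite nE ler_norml => /andP[lo _].
have BT := Bp_tangent s hu hp.
have EQ := energy_quad d0 (ltW a0) (ltW b0) (dirichlet_ge0 u) (dirichlet_ge0 phi) (ltW s1) BT.
have Es : energy a b p (u + s *: phi) - energy a b p u <=
   s * ((a + b * D) * d0 - \int[leb]_x (dpw (u x) * phi x)) +
   (a / 2 * F + b / 4 * (4 * d0 ^+ 2 + 2 * D * F + 4 * `|d0| * F + F ^+ 2)) * s ^+ 2.
  apply: le_trans EQ; rewrite /energy (dirichletD hu hs1) (dirichletZ _ hp) (dotDZr _ hp hu).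
  exact: lexx.
have f1 : e / (normH1 phi + 1) * (`|s| * normH1 phi) <= e * `|s|.
  exact: frac_le (ltW e0) (normr_ge0 s) n0.
exact: (critical_arith lo Es f1).
Qed.

Section remainder.
Variable u : E -> R.
Hypothesis hu : H1 u.

(** The integral of the second-order term of [pw_remainder], without its constant. *)
Definition rem w : R := \int[leb]_x (`|u x| `^ p * w x ^+ 2 + pw (w x)).

Lemma meas_absp v : measurable_fun setT v -> measurable_fun setT (fun x : E => `|v x| `^ p).
Proof.
move=> mv; apply: (measurableT_comp (f := fun t : R => t `^ p)); first exact: measurable_powR.
exact: measurableT_comp.
Qed.

Lemma prod_le (a b : R) : `|a| `^ p * b ^+ 2 <= pw a + pw b.
Proof.
have [h|/ltW h] := leP `|a| `|b|.
  apply: le_trans (_ : pw b <= _); last by rewrite lerDr pw_ge0.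
  by rewrite pwE// ler_wpM2r ?sqr_ge0// powR_homo// ltW.
apply: le_trans (_ : pw a <= _); last by rewrite lerDl pw_ge0.
rewrite pwE// ler_wpM2l ?powR_ge0// -(real_normK (num_real b)) -(real_normK (num_real a)).
by rewrite lerXn2r ?nnegrE.
Qed.

Lemma itg_rem w : H1 w -> itg (fun x => `|u x| `^ p * w x ^+ 2 + pw (w x)).
Proof.
move=> hw; have [mu mw] := (L2_meas (H1_L2 hu), L2_meas (H1_L2 hw)).
have i1 := itg_pw hu; have i2 := itg_pw hw.
apply: (itg_le (g := (fun x => pw (u x)) + (fun x => pw (w x)) + (fun x => pw (w x)))).
- by apply: measurable_funD; [apply: measurable_funM; [exact: meas_absp|exact: measurable_funX]|exact: meas_pw].
- move=> x; rewrite ger0_norm; first exact: lerD (prod_le _ _) (lexx _).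
  by apply: addr_ge0; [apply: mulr_ge0; [exact: powR_ge0|exact: sqr_ge0]|exact: pw_ge0].
- by apply: itgD => //; exact: itgD.
Qed.

(** The first term covers [|a| <= K]. Beyond, [|b| <= s |a|] gives the truncated power of [a], whose
    integral is small for large [K], and [|b| > s |a|] gives the power of [b]. *)
Lemma split_le (K s a b : R) : 0 <= K -> 0 < s ->
  `|a| `^ p * b ^+ 2 <= K `^ p * b ^+ 2 + s ^+ 2 * (if K < `|a| then pw a else 0) + s `^ (- p) * pw b.
Proof.
move=> K0 s0; have x0 : 0 <= s `^ (- p) * pw b by rewrite mulr_ge0 ?powR_ge0 ?pw_ge0.
have y0 : 0 <= K `^ p * b ^+ 2 by rewrite mulr_ge0 ?powR_ge0 ?sqr_ge0.
case: ifPn => [_|]; last first.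
  rewrite -leNgt mulr0 addr0 => aK; apply: le_trans (_ : K `^ p * b ^+ 2 <= _); last by rewrite lerDl.
  by rewrite ler_wpM2r ?sqr_ge0// powR_homo// ltW.
have [h|/ltW h] := leP `|b| (s * `|a|).
  apply: le_trans (_ : s ^+ 2 * pw a <= _); last by rewrite -addrA [leRHS]addrCA lerDl addr_ge0.
  rewrite pwE// [leRHS]mulrCA ler_wpM2l ?powR_ge0// -(real_normK (num_real b)) -(real_normK (num_real a)) -exprMn.
  by rewrite lerXn2r ?nnegrE// mulr_ge0// ltW.
apply: le_trans (_ : s `^ (- p) * pw b <= _).
  rewrite pwE// mulrA ler_wpM2r ?sqr_ge0// powRN -(ler_pM2l (powR_gt0 p s0)) mulrA mulfV ?mul1r ?lt0r_neq0 ?powR_gt0//.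
  by rewrite -powRM ?(ltW s0)// powR_homo ?(ltW p0)// mulr_ge0// ltW.
by rewrite lerDr addr_ge0// mulr_ge0 ?sqr_ge0 ?pw_ge0.
Qed.

Lemma tail_small (e : R) : 0 < e -> exists2 K : R, 0 <= K &
  itg (fun x => if K < `|u x| then pw (u x) else 0) /\ \int[leb]_x (if K < `|u x| then pw (u x) else 0) <= e.
Proof.
move=> e0; have mu := L2_meas (H1_L2 hu); have iu := itg_pw hu.
pose f (n : nat) x := if n%:R < `|u x| then pw (u x) else 0.
have mf n : measurable_fun setT (f n).
  apply: measurable_fun_ifT; [|exact: meas_pw|exact: measurable_cst].
  by apply: measurable_fun_ltr; [exact: measurable_cst|exact: measurableT_comp].
have fle n x : `|f n x| <= pw (u x).
  by rewrite /f; case: ifP => _; rewrite ?normr0 ?ger0_norm ?pw_ge0.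
have f0 x : f n x @[n --> \oo] --> (0 : R).
  apply: cvg_near_cst; exists (Num.truncn `|u x|).+1 => // n /= hn; rewrite /f ltNge.
  by rewrite (ltW (lt_le_trans (truncnS_gt _) _))// ler_nat.
have [_ cv] := dominated_int mf f0 iu fle; rewrite int0 in cv.
have [n _ hn] := cvgr_lt _ cv _ e0; have := hn n (leqnn n) => /= h.
exists n%:R; first exact: ler0n.
split; last exact: ltW h.
exact: (itg_le (mf n) (fle n) iu).
Qed.

Lemma pow_split (x d : R) : 0 <= x <= 1 -> 0 < d -> x `^ beta <= d `^ beta + x / d.
Proof.
move=> /andP[x0 x1] d0; have [h|/ltW h] := leP x d.
  by rewrite (le_trans (powR_homo (ltW hb) x0 h))// lerDl divr_ge0// ltW.
rewrite (le_trans (powR_le1 (ltW hb) _)) ?x0//.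
rewrite (@le_trans _ _ (x / d))//; last by rewrite lerDr powR_ge0.
by rewrite ler_pdivlMr// mul1r.
Qed.

(* With [s^2 = dirichlet w + nsq w] and [x = nsq w / s^2], Gagliardo-Nirenberg bounds [Bp w] by
   [Cst * s^q * x^beta], and [x^beta <= d^beta + x / d] absorbs it. *)
Lemma rem_small (T0 e : R) : 0 < Cst -> 0 <= T0 -> 0 < e -> exists2 C : R, 0 <= C & forall w, H1 w ->
  dirichlet w + nsq w <= T0 ^+ 2 -> rem w <= e * (dirichlet w + nsq w) + C * nsq w.
Proof.
move=> C0 T00 e0; pose c1 := Cst * (1 + T0 `^ p).
have c1p : 0 < c1 by rewrite mulr_gt0// ltr_pwDl// powR_ge0.
have [K K0 [iK tK]] := tail_small (divr_gt0 e0 (ltr0Sn R 1)).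
have e2 : 0 < e / 2 / c1 by rewrite !divr_gt0.
have [d d0 db] := powR_root hb e2.
exists (K `^ p + c1 / d); first by rewrite addr_ge0 ?powR_ge0// divr_ge0// ltW.
move=> w hw; have Lw := H1_L2 hw; have M0 := nsq_ge0 leb w; have D0 := dirichlet_ge0 w => TT.
have [T0'|Tn] := eqVneq (dirichlet w + nsq w) 0.
  have Mw : nsq w = 0 by apply/eqP; rewrite eq_le M0 andbT -T0' lerDr.
  rewrite T0' Mw !mulr0 addr0 le_eqVlt; apply/orP; left; apply/eqP.
  rewrite /rem -(int0 leb); apply: int_ae; [exact: itg_meas (itg_rem hw)|exact: measurable_cst|].
  by apply: filterS (nsq_eq0 Lw Mw) => x ->; rewrite expr0n mulr0 pw0// addr0.
have Tp : 0 < dirichlet w + nsq w by rewrite lt0r Tn addr_ge0.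
pose s := Num.sqrt (dirichlet w + nsq w).
have s0 : 0 < s by rewrite sqrtr_gt0.
have s2 : s ^+ 2 = dirichlet w + nsq w by rewrite sqr_sqrtr// ltW.
have sT : s <= T0 by rewrite -(ger0_norm T00) -sqrtr_sqr ler_sqrt ?sqr_ge0.
have i1 := itg_pw hw.
have r1 : rem w <= K `^ p * nsq w + s ^+ 2 * \int[leb]_x (if K < `|u x| then pw (u x) else 0) + (s `^ (- p) + 1) * Bp w.
  have j1 := itgZ (K `^ p) Lw.2; have j2 := itgZ (s ^+ 2) iK; have j3 := itgZ (s `^ (- p) + 1) i1.
  have j12 := itgD j1 j2; have j := itgD j12 j3.
  have := int_le (itg_rem hw) j; rewrite (intD j12 j3) (intD j1 j2) (intZ _ Lw.2) (intZ _ iK) (intZ _ i1); apply.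
  by move=> x; rewrite !fE mulrDl mul1r addrA lerD2r; exact: split_le.
have DT : dirichlet w <= s ^+ 2 by rewrite s2 lerDl.
pose x := nsq w / s ^+ 2.
have s20 : 0 < s ^+ 2 by rewrite exprn_gt0.
have x01 : 0 <= x <= 1 by rewrite divr_ge0 ?sqr_ge0//= ler_pdivrMr// mul1r s2 lerDr.
have Mx : nsq w = s ^+ 2 * x by rewrite /x mulrC divfK// lt0r_neq0.
have B1 : Bp w <= Cst * (s `^ q * x `^ beta).
  apply: (le_trans (gn hw)); rewrite -mulrA ler_wpM2l ?(ltW C0)//.
  have -> : s `^ q * x `^ beta = (s ^+ 2) `^ k * nsq w `^ beta.
    rewrite Mx [(_ * x) `^ _]powRM ?sqr_ge0 ?(andP x01).1// mulrA -powRD; last by rewrite (lt0r_neq0 s20) implybT.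
    by rewrite -powR_mulrn ?(ltW s0)// -powRrM; congr (_ `^ _ * _); field.
  by rewrite ler_wpM2r ?powR_ge0// powR_homo// (le_trans _ hk).
have B2 : (s `^ (- p) + 1) * Bp w <= c1 * (s ^+ 2 * x `^ beta).
  have sp : 0 <= s `^ (- p) + 1 by rewrite addr_ge0 ?powR_ge0.
  apply: (le_trans (ler_wpM2l sp B1)).
  have -> : s `^ q = s `^ p * s ^+ 2 by rewrite powRD ?(lt0r_neq0 s0) ?implybT// powR_mulrn ?(ltW s0).
  have -> : (s `^ (- p) + 1) * (Cst * (s `^ p * s ^+ 2 * x `^ beta)) = Cst * (1 + s `^ p) * (s ^+ 2 * x `^ beta).
    by rewrite powRN; have := lt0r_neq0 (powR_gt0 p s0); move: (s `^ p) (x `^ beta) => A B A0; field.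
  apply: ler_wpM2r; first by apply: mulr_ge0; [exact: sqr_ge0|exact: powR_ge0].
  apply: ler_wpM2l; first exact: ltW.
  by rewrite lerD2l; apply: powR_homo; [exact: ltW|exact: ltW|exact: sT].
have B3 : c1 * (s ^+ 2 * x `^ beta) <= c1 * (s ^+ 2 * (e / 2 / c1 + x / d)).
  by rewrite ler_wpM2l ?(ltW c1p)// ler_wpM2l ?sqr_ge0// -db; exact: pow_split.
have t1 : s ^+ 2 * \int[leb]_x (if K < `|u x| then pw (u x) else 0) <= s ^+ 2 * (e / 2).
  by rewrite ler_wpM2l ?sqr_ge0.
apply: (le_trans r1); apply: le_trans (lerD (lerD (lexx _) t1) (le_trans B2 B3)) _.
rewrite -s2 le_eqVlt; apply/orP; left; apply/eqP.
rewrite Mx; move: (K `^ p) (s ^+ 2) => A S; field; by rewrite !lt0r_neq0.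
Qed.

End remainder.
End critical_points.

(** * The Pohozaev identity with a weight depending on one coordinate *)

Section pohozaev.
Implicit Types (f g u v w phi : E -> R) (x y z : E) (i j : 'I_N) (A : set E).

Lemma sq_div (C h X : R) : 0 < h -> - (C * h ^+ 2) <= h * X -> - (C * h) <= X.
Proof. by move=> h0; rewrite expr2 mulrA mulrC -mulrN ler_pM2l. Qed.

Lemma sq_divN (C h X : R) : 0 < h -> - (C * (- h) ^+ 2) <= - h * X -> X <= C * h.
Proof. by move=> h0; rewrite sqrrN mulNr lerN2 expr2 (mulrCA C) ler_pM2l. Qed.

Lemma par_le (m d : R) : 0 <= m + 2 * d + m -> m - 2 * d + m <= 4 * m.
Proof. lra. Qed.

Lemma ler_lim_seq (u v : nat -> R) (l m : R) : u n @[n --> \oo] --> l -> v n @[n --> \oo] --> m ->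
  (forall n, u n <= v n) -> l <= m.
Proof.
move=> cu cv h; rewrite -(cvg_lim _ cu)// -(cvg_lim _ cv)//.
by apply: ler_lim; [apply/cvg_ex; exists l|apply/cvg_ex; exists m|exact: nearW].
Qed.

Lemma wt_dpw_arith (t T c r dw w pu ps : R) : 0 < q -> 0 <= r -> 0 <= c -> t <= T -> 1 <= t ->
  ps <= pu + q * dw * w + q * c * r ->
  q^-1 * (t * (ps - pu)) - c * T * r <= dw * (t * w).
Proof.
move=> q0 r0 c0 tT t1 h; have t0 : 0 <= t by rewrite (le_trans _ t1).
have h1 : q^-1 * (ps - pu) <= dw * w + c * r.
  by rewrite mulrC ler_pdivrMr//; move: h; move: (q) => s; lra.
have h2 := ler_wpM2l t0 h1.
have h3 : c * r * t <= c * r * T by rewrite ler_wpM2l// !mulr_ge0// ltW.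
move: h2 h3; move: (q^-1) => s; lra.
Qed.

Lemma pohozaev_arith (A mu c C1 T h W : R) (d I r Dw Mw G s S P1 P2 : R) : 0 < A -> 0 < c -> 0 <= C1 -> 0 < T ->
  d <= h * (2^-1 * S) - 2^-1 * Dw + h * s -> h * (P1 / q) - c * r <= I ->
  A * d - I = mu * (2^-1 * (h * P2) - 2^-1 * W) ->
  r <= A / (2 * c) * (Dw + Mw) + C1 * Mw -> Mw <= h ^+ 2 * G -> W <= T * Mw -> 0 <= W ->
  - ((A / 2 + c * C1 + 2^-1 * (`|mu| * T)) * G * h ^+ 2) <=
    h * (A * (2^-1 * S + s) - P1 / q - mu / 2 * P2).
Proof.
move=> A0 c0 C10 T0 hd hI e hr hM hW W0.
have h1 : A * d <= A * (h * (2^-1 * S) - 2^-1 * Dw + h * s) by rewrite ler_pM2l.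
have h2 : c * r <= A / 2 * (Dw + Mw) + c * C1 * Mw.
  have := ler_wpM2l (ltW c0) hr; congr (_ <= _); field; exact: lt0r_neq0.
have h3 : mu * W <= `|mu| * T * Mw.
  apply: le_trans (_ : `|mu| * W <= _); first by rewrite ler_wpM2r// ler_norm.
  by rewrite -mulrA ler_wpM2l.
have K0 : 0 <= A / 2 + c * C1 + 2^-1 * (`|mu| * T).
  by rewrite !addr_ge0// ?divr_ge0 ?mulr_ge0// ?ltW.
have h4 := ler_wpM2l K0 hM; move: (P1 / q) hI => P1' hI.
move: (`|mu| * T) h3 h4 {K0} => mT h3 h4.
move: (c * r) hI h2 => cr hI h2; move: (c * C1) h2 h4 => cC h2 h4.
have e2 : I = A * d - mu * (2^-1 * (h * P2)) + 2^-1 * (mu * W) by rewrite -[I](subKr (A * d)) e; field.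
rewrite e2 in hI; move: (mu * W) h3 hI => mW h3 hI.
have e3 : (A / 2 + cC + 2^-1 * mT) * (h ^+ 2 * G) = (A / 2 + cC + 2^-1 * mT) * G * h ^+ 2 by ring.
rewrite e3 in h4; move: (_ * G * h ^+ 2) h4 => Z h4.
lra.
Qed.

Section weight.
Variables (i : 'I_N) (th dth : R -> R) (Th : R).
Hypothesis thD : forall s : R, is_derive s (1 : R) th (dth s).
Hypothesis dth1 : forall s, `|dth s| <= 1.
Hypothesis mdth : measurable_fun setT dth.
Hypothesis th1 : forall s, 1 <= th s.
Hypothesis thT : forall s, th s <= Th.

(** A bounded substitute for the coordinate in the classical multiplier [x_i] times the [i]-th
    derivative of [u]; the derivative is replaced by an increment of [u], which stays in H^1. *)
Definition wt (x : E) : R := th (x ord0 i).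
Definition dwt (x : E) : R := dth (x ord0 i).
Local Notation f := wt.
Local Notation f' := dwt.

Lemma Th0 : 0 < Th.
Proof. exact: lt_le_trans ltr01 (le_trans (th1 0) (thT 0)). Qed.

Lemma meas_wt : measurable_fun setT f.
Proof.
apply: (measurableT_comp (f := th)); last exact: measurable_coord.
by apply: continuous_measurable_fun => s; exact: is_derive_continuous (thD s).
Qed.

Lemma meas_dwt : measurable_fun setT f'.
Proof. by apply: (measurableT_comp (f := dth)) => //; exact: measurable_coord. Qed.

Lemma wt_abs x : `|f x| <= Th.
Proof. by rewrite ger0_norm /wt//; exact: le_trans ler01 (th1 _). Qed.

Lemma dlt_abs (j : 'I_N) x : `|(j == i)%:R * f' x| <= 1.
Proof.
rewrite normrM; apply: mulr_ile1; [exact: normr_ge0|exact: normr_ge0| |exact: dth1].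
by case: (j == i); rewrite ?normr1 ?normr0.
Qed.

Lemma wt_shift j x (s : R) : f (x + s *: ei j) = th (x ord0 i + s * (j == i)%:R).
Proof. by rewrite /wt !mxE eqxx eq_sym. Qed.

Lemma wt_lip j x (s : R) : `|f (x + s *: ei j) - f x| <= `|s|.
Proof.
rewrite wt_shift [f x]/wt; apply: le_trans (lipschitz_derive thD dth1 _ _) _.
by rewrite mul1r addrC addKr normrM ler_piMr//; case: eqP; rewrite ?normr1 ?normr0.
Qed.

Lemma wt_dq x (h : nat -> R) : (forall n, h n != 0) -> h n @[n --> \oo] --> (0 : R) ->
  (h n)^-1 * (f (x + h n *: ei i) - f x) @[n --> \oo] --> f' x.
Proof.
move=> h0 hc; have := cvg_is_derive (thD (x ord0 i)).
move/cvgr_dnbhsP => /(_ h (conj h0 hc)) H.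
apply: (cvg_eqr _ _ H) => n; by rewrite wt_shift eqxx mulr1 (addrC (h n)).
Qed.

Lemma wt_mul w : H1 w -> H1 (f * w) /\ forall j, {ae leb, forall x,
  gr j (f * w) x = (f * gr j w + (fun x => (j == i)%:R * f' x) * w) x}.
Proof.
move=> hw; have C0 := Th0; have C1 : 1 <= Th := le_trans (th1 0) (thT 0).
apply: (H1_mul hw (ltW C0) meas_wt _ wt_abs).
- move=> j; apply: measurable_funM; [exact: measurable_cst|exact: meas_dwt].
- move=> j x; apply: le_trans C1; exact: dlt_abs.
- by move=> j x s; apply: le_trans (wt_lip j x s) _; rewrite ler_peMl.
- move=> j x; have [->|ji] := eqVneq j i.
    by rewrite mul1r; apply: wt_dq => [n|]; [exact: hs_neq0|exact: hs_cvg0].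
  rewrite mul0r; apply: cvg_near_cst; near=> n.
  by rewrite wt_shift (negPf ji) mulr0 addr0 subrr mulr0.
Unshelve. all: by end_near. Qed.

Lemma itg_bdd (g F : E -> R) (C : R) : measurable_fun setT g -> (forall x, `|g x| <= C) -> itg F -> itg (g * F).
Proof.
move=> mg gC iF; have iA := itgZ C (itg_abs iF).
apply: (itg_le (g := C *: (fun x => `|F x|))) => //.
  exact: measurable_funM mg (itg_meas iF).
by move=> x; rewrite !fE normrM; apply: ler_wpM2r.
Qed.

(** Discrete integration by parts: the increment of [F] is carried over to the weight. As [h] tends
    to 0 this tends to minus the integral of [dwt * F]. *)
Definition Phi (h : R) (F : E -> R) : R :=
  \int[leb]_x (h^-1 * (f (x - h *: ei i) - f x) * F x).

Lemma Phi_quot (h : R) x : h != 0 -> `|h^-1 * (f (x - h *: ei i) - f x)| <= 1.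
Proof.
move=> h0; rewrite normrM -scaleNr normfV ler_pdivrMl ?normr_gt0// mulr1.
by apply: le_trans (wt_lip _ _ _) _; rewrite normrN.
Qed.

Lemma meas_quot (h : R) : measurable_fun setT (fun x : E => h^-1 * (f (x - h *: ei i) - f x)).
Proof.
apply: measurable_funM; first exact: measurable_cst.
apply: measurable_funB; last exact: meas_wt.
exact: (measurableT_comp meas_wt (measurable_addl (- (h *: ei i)))).
Qed.

Lemma wt_int (h : R) F : h != 0 -> itg F ->
  \int[leb]_x (f x * (sh (h *: ei i) F x - F x)) = h * Phi h F.
Proof.
move=> h0 iF; have iQ := itg_bdd (meas_quot h) (fun x => Phi_quot x h0) iF.
have i1 := itg_bdd meas_wt wt_abs iF.
have ms : measurable_fun setT (fun x : E => f (x - h *: ei i)).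
  exact: (measurableT_comp meas_wt (measurable_addl (- (h *: ei i)))).
have i2 := itg_bdd ms (fun x => wt_abs (x - h *: ei i)) iF.
have i3 := mpres_itg (mpres_shift (h *: ei i)) i2.
have e := mpres_int (mpres_shift (h *: ei i)) i2; rewrite mul1r in e.
rewrite /Phi -(intZ h iQ).
transitivity (\int[leb]_x (((fun x : E => f (x - h *: ei i)) * F) (x + h *: ei i)) - \int[leb]_x ((f : E -> R) * F) x).
  rewrite -(intB i3 i1); apply: eq_Rintegral => x _; rewrite /= !fE addrK /sh; ring.
rewrite e -(intB i2 i1); apply: eq_Rintegral => x _; rewrite !fE.
move: (f _) (f _) (F x) => A B C; field; exact: h0.
Qed.

Lemma Phi_cvg (h : nat -> R) F : (forall n, h n != 0) -> h n @[n --> \oo] --> (0 : R) -> itg F ->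
  Phi (h n) F @[n --> \oo] --> - \int[leb]_x (f' x * F x).
Proof.
move=> h0 hc iF.
have i0 := itg_bdd meas_dwt (fun x => dth1 _) iF.
have -> : - (\int[leb]_x (f' x * F x)) = \int[leb]_x (- f' x * F x).
  by rewrite -mulN1r -(intZ _ i0); apply: eq_Rintegral => x _; rewrite fE mulN1r mulNr.
suff [_] : itg (fun x => - f' x * F x) /\ Phi (h n) F @[n --> \oo] --> \int[leb]_x (- f' x * F x) by [].
apply: (dominated_int (f := fun n x => (h n)^-1 * (f (x - h n *: ei i) - f x) * F x) (h := fun x => `|F x|)).
- by move=> n; apply: measurable_funM; [exact: meas_quot|exact: itg_meas iF].
- move=> x; apply: cvgMl; have hN0 n : - h n != 0 by rewrite oppr_eq0.
  have hNc : - h n @[n --> \oo] --> (0 : R) by rewrite -oppr0; exact: cvgN.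
  have c := @wt_dq x _ hN0 hNc.
  apply: (@cvg_eqr _ _ _ _ (fun n => - ((- h n)^-1 * (f (x + - h n *: ei i) - f x)))).
    by move=> n; rewrite invrN mulNr opprK scaleNr.
  exact: cvgN.
- exact: itg_abs.
- by move=> n x; rewrite normrM ler_piMl// Phi_quot.
Qed.

(** With [G] the translate of [g], one has [g (G - g) = (G^2 - g^2) / 2 - (G - g)^2 / 2]. The first
    part is a difference to which [Phi] applies; the second, [W] after weighting, has a sign and is
    comparable to the squared increment. *)
Lemma wt_sq (h : R) g : h != 0 -> L2 g ->
  exists W : R, [/\ dot g (f * (sh (h *: ei i) g - g)) = 2^-1 * (h * Phi h (fun x => g x ^+ 2)) - 2^-1 * W,
    nsq (sh (h *: ei i) g - g) <= W & W <= Th * nsq (sh (h *: ei i) g - g)].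
Proof.
move=> h0 Lg; have Ls := L2_sh (h *: ei i) Lg; have Lw := L2B Ls Lg.
have iW := itg_bdd meas_wt wt_abs Lw.2.
exists (\int[leb]_x (f x * (sh (h *: ei i) g - g) x ^+ 2)); split.
- rewrite -(wt_int h0 Lg.2).
  have i1 := itg_bdd meas_wt wt_abs (itgB (mpres_itg (mpres_shift (h *: ei i)) Lg.2) Lg.2).
  rewrite -(intZ _ i1) -(intZ _ iW) -(intB (itgZ _ i1) (itgZ _ iW)); apply: eq_Rintegral => x _.
  rewrite !fE /sh /=; move: (f x) (g x) (g _) => A B C; by field.
- apply: int_le; [exact: Lw.2|exact: iW|].
  by move=> x; rewrite ler_peMl ?sqr_ge0//; exact: th1.
- rewrite -(intZ _ Lw.2); apply: (int_le iW (itgZ _ Lw.2)) => x; apply: ler_wpM2r; [exact: sqr_ge0|exact: thT].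
Qed.

(** The product rule gives the weighted increment of each derivative, treated by [wt_sq], and a term
    with the derivative of the weight, present only in direction [i]. The bound [1 <= th] lets the
    weight be dropped from the negative square terms. *)
Lemma wt_dotD (h : R) u : h != 0 -> H1 u -> dotD u (f * (sh (h *: ei i) u - u)) <=
  h * (2^-1 * \sum_j Phi h (fun x => gr j u x ^+ 2)) - 2^-1 * dirichlet (sh (h *: ei i) u - u)
  + h * dot (f' * gr i u) (dq h i u).
Proof.
move=> h0 hu; have [hs1 gs] := dirichlet_sh (h *: ei i) hu; have Lu := H1_L2 hu.
pose w := sh (h *: ei i) u - u; have hw : H1 w := H1B hs1 hu; have Lw := H1_L2 hw.
have gw j : {ae leb, forall x, gr j w x = (sh (h *: ei i) (gr j u) - gr j u) x}.
  have [_ l] := H1_lin (-1) hu hs1.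
  have e : w = -1 *: u + sh (h *: ei i) u by apply/funext => x; rewrite !fE mulN1r addrC.
  apply: filterS2 (l j) (gs j) => x; rewrite -e !fE => -> ->; by rewrite mulN1r addrC.
have Lg j := gr_L2 j hu; have Ld j : L2 (sh (h *: ei i) (gr j u) - gr j u) := L2B (L2_sh _ (Lg j)) (Lg j).
have [hf gf] := wt_mul hw.
have Lfd j : L2 (f * (sh (h *: ei i) (gr j u) - gr j u)).
  apply: (L2_le (g := Th *: (sh (h *: ei i) (gr j u) - gr j u))).
  - exact: measurable_funM meas_wt (L2_meas (Ld j)).
  - by move=> x; rewrite !fE !normrM ler_wpM2r// (le_trans (wt_abs x))// ler_norm.
  - exact: L2Z.
have LT j : L2 ((fun x => (j == i)%:R * f' x) * w).
  apply: (L2_le (g := w)); [|move=> x|exact: Lw].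
    apply: measurable_funM (L2_meas Lw); apply: measurable_funM; [exact: measurable_cst|exact: meas_dwt].
  rewrite fE normrM ler_piMl//; exact: dlt_abs.
have E1 j : dot (gr j u) (gr j (f * w)) = dot (gr j u) (f * (sh (h *: ei i) (gr j u) - gr j u))
    + dot (gr j u) ((fun x => (j == i)%:R * f' x) * w).
  rewrite -(dotDr (Lg j) (Lfd j) (LT j)).
  apply: (dot_ae (Lg j) (gr_L2 j hf) (Lg j) (L2D (Lfd j) (LT j))); first exact: aeW.
  by apply: filterS2 (gf j) (gw j) => x; rewrite !fE => -> ->.
have E2 : \sum_j dot (gr j u) ((fun x => (j == i)%:R * f' x) * w) = h * dot (f' * gr i u) (dq h i u).
  rewrite (bigD1 i)//= big1 ?addr0; last first.
    move=> j ji; rewrite /l2dot -[RHS](int0 leb); apply: eq_Rintegral => x _.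
    by rewrite !fE (negPf ji) !mul0r mulr0.
  have Lq := L2_dq h i Lu; have Lfg : L2 (f' * gr i u).
    apply: (L2_le (g := gr i u)) => //; first exact: measurable_funM meas_dwt (L2_meas (Lg i)).
    by move=> x; rewrite fE normrM ler_piMl//; exact: dth1.
  rewrite -(dotZr _ Lfg Lq); apply: eq_Rintegral => x _.
  rewrite eqxx !fE mul1r /dq !fE /w !fE; move: (f' x) (gr i u x) (sh _ _ x) (u x) => A B C D; by field.
have E3 : dotD u (f * w) <= \sum_j (2^-1 * (h * Phi h (fun x => gr j u x ^+ 2)) - 2^-1 * nsq (gr j w))
    + h * dot (f' * gr i u) (dq h i u).
  have -> : dotD u (f * w) = \sum_j dot (gr j u) (gr j (f * w)) by exact: erefl.
  rewrite (eq_bigr _ (fun j _ => E1 j)) big_split /= E2 lerD2r; apply: ler_sum => j _.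
  have [W [-> n1 _]] := wt_sq h0 (Lg j); rewrite (nsq_ae (gr_L2 j hw) (Ld j) (gw j)).
  by rewrite lerD2l lerN2 ler_wpM2l.
apply: (le_trans E3); rewrite lerD2r (dirichletE hw) sumrB -!mulr_sumr.
by rewrite mulrCA.
Qed.

(** [pw_remainder] compares [dpw u] times the increment of [u] with the increment of [pw u], up to
    [rem]; the weighted increment of [pw u] is a value of [Phi]. *)
Lemma wt_dpw (h : R) u : h != 0 -> H1 u -> h * (Phi h (fun x => pw (u x)) / q) - (p + 1) * 2 `^ p * Th * rem u (sh (h *: ei i) u - u)
   <= \int[leb]_x (dpw (u x) * (f * (sh (h *: ei i) u - u)) x).
Proof.
move=> h0 hu; have [hs1 _] := dirichlet_sh (h *: ei i) hu; have q0 := q_gt0.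
set w := sh (h *: ei i) u - u; have hw : H1 w by exact: H1B.
have [hf _] := wt_mul hw.
have i1 := itg_pw hu; have iF := itg_dpw hu hf.
have iR := itg_rem hu hw.
have iD := itg_bdd meas_wt wt_abs (itgB (mpres_itg (mpres_shift (h *: ei i)) i1) i1).
rewrite mulrA -(wt_int h0 i1) mulrC -(intZ q^-1 iD) -(intZ _ iR) -(intB (itgZ _ iD) (itgZ _ iR)).
apply: int_le; [exact: itgB (itgZ _ iD) (itgZ _ iR)|exact: iF|].
move=> x; rewrite !fE /sh /=.
have := pw_remainder p0 (u x) (w x).
have -> : u x + w x = u (x + h *: ei i) by rewrite /w !fE /sh addrC subrK.
have r0 : 0 <= `|u x| `^ p * w x ^+ 2 + pw (w x).
  by apply: addr_ge0; [apply: mulr_ge0; [exact: powR_ge0|exact: sqr_ge0]|exact: pw_ge0].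
have k0 : 0 <= (p + 1) * 2 `^ p by rewrite mulr_ge0 ?powR_ge0// addr_ge0// ltW.
rewrite -[q * (p + 1) * _]mulrA => hr.
exact: (wt_dpw_arith q0 r0 k0 (thT _) (th1 _) hr).
Qed.

(* The equation of [u] is tested with [theta * (sh (h *: ei i) u - u)].  Since [1 <= theta], the
   terms of second order in the increment have a sign, up to the remainder [rem]. *)
Lemma pohozaev_bound (A mu : R) u : 0 < A -> 0 < Cst -> H1 u ->
  (forall phi, H1 phi -> A * dotD u phi - \int[leb]_x (dpw (u x) * phi x) = mu * dot u phi) ->
  exists C : R, forall h, h != 0 -> `|h| <= 1 -> - (C * h ^+ 2) <= h *
    (A * (2^-1 * \sum_j Phi h (fun x => gr j u x ^+ 2) + dot (f' * gr i u) (dq h i u))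
      - Phi h (fun x => pw (u x)) / q - mu / 2 * Phi h (fun x => u x ^+ 2)).
Proof.
move=> A0 C0 hu EL; have Lu := H1_L2 hu; have T0 := Th0; have q0 := q_gt0.
pose c := (p + 1) * 2 `^ p * Th.
have cp : 0 < c by rewrite !mulr_gt0 ?powR_gt0// addr_gt0.
have e0 : 0 < A / (2 * c) by rewrite divr_gt0// mulr_gt0.
pose S := Num.sqrt (4 * dirichlet u + 4 * nsq u).
have S2 : S ^+ 2 = 4 * dirichlet u + 4 * nsq u.
  by rewrite sqr_sqrtr// addr_ge0// mulr_ge0 ?dirichlet_ge0 ?nsq_ge0.
have [C1 C10 hC] := rem_small hu C0 (sqrtr_ge0 _ : 0 <= S) e0.
exists ((A / 2 + c * C1 + 2^-1 * (`|mu| * Th)) * nsq (gr i u)) => h h0 h1.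
have [hs1 _] := dirichlet_sh (h *: ei i) hu.
set w := sh (h *: ei i) u - u; have hw : H1 w by exact: H1B.
have [hf _] := wt_mul hw.
have Mw : nsq w <= h ^+ 2 * nsq (gr i u) := H1_dq_le i h hu.
have Dw : dirichlet w <= 4 * dirichlet u.
  have := dirichlet_ge0 (sh (h *: ei i) u + u).
  rewrite (dirichletD hs1 hu) /w (dirichletB hs1 hu) (dirichlet_shE _ hu).
  exact: par_le.
have Mw4 : nsq w <= 4 * nsq u.
  have := nsq_ge0 leb (sh (h *: ei i) u + u).
  rewrite (nsqD (L2_sh _ Lu) Lu) /w (nsqB (L2_sh _ Lu) Lu) (nsq_sh _ Lu).
  exact: par_le.
have rw := hC w hw; rewrite S2 in rw; have {}rw := rw (lerD Dw Mw4).
have [W [eW n1 WT]] := wt_sq h0 Lu; have W0 := le_trans (nsq_ge0 leb _) n1.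
have d1 := wt_dotD h0 hu; have d2 := wt_dpw h0 hu; have e := EL _ hf.
rewrite -/w in eW WT d1 d2; rewrite eW in e.
move: d1 d2 e rw Mw WT W0; rewrite -/c.
move: (dotD _ _) (\int[leb]_x _) (rem _ _) (dirichlet w) (nsq w) (nsq (gr i u)) (dot _ _) (\sum_j _) (Phi h _) (Phi h _).
move=> d I r D M G s S' P1 P2 d1 d2 e rw Mw WT W0.
exact: (pohozaev_arith A0 cp C10 T0 d1 d2 e rw Mw WT W0).
Qed.

(** The inequality of [pohozaev_bound] has the form [h X(h) >= - C h^2] for steps of both signs.
    Divided by [h], it gives [X0 >= 0] from positive steps and [X0 <= 0] from negative ones. *)
Lemma pohozaev_weight (A mu : R) u : 0 < A -> 0 < Cst -> H1 u ->
  (forall phi, H1 phi -> A * dotD u phi - \int[leb]_x (dpw (u x) * phi x) = mu * dot u phi) ->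
  A * (2^-1 * \sum_j \int[leb]_x (f' x * gr j u x ^+ 2) - \int[leb]_x (f' x * gr i u x ^+ 2))
    = (\int[leb]_x (f' x * pw (u x))) / q + mu / 2 * \int[leb]_x (f' x * u x ^+ 2).
Proof.
move=> A0 C0 hu EL; have Lu := H1_L2 hu; have Lg j := gr_L2 j hu.
have [C hC] := pohozaev_bound A0 C0 hu EL.
pose X h := A * (2^-1 * \sum_j Phi h (fun x => gr j u x ^+ 2) + dot (f' * gr i u) (dq h i u))
      - Phi h (fun x => pw (u x)) / q - mu / 2 * Phi h (fun x => u x ^+ 2).
pose X0 := A * (2^-1 * \sum_j (- \int[leb]_x (f' x * gr j u x ^+ 2)) + \int[leb]_x (f' x * gr i u x ^+ 2))
   - (- \int[leb]_x (f' x * pw (u x))) / q - mu / 2 * (- \int[leb]_x (f' x * u x ^+ 2)).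
have Lfg : L2 (f' * gr i u).
  apply: (L2_le (g := gr i u)) => //; first exact: measurable_funM meas_dwt (L2_meas (Lg i)).
  by move=> x; rewrite fE normrM ler_piMl//; exact: dth1.
have cX (h : nat -> R) : (forall n, h n != 0) -> h n @[n --> \oo] --> (0 : R) -> X (h n) @[n --> \oo] --> X0.
  move=> h0 hc; have P F iF := @Phi_cvg h F h0 hc iF.
  have c1 : \sum_j Phi (h n) (fun x => gr j u x ^+ 2) @[n --> \oo] --> \sum_j (- \int[leb]_x (f' x * gr j u x ^+ 2)).
    apply: (@cvg_big R 'I_N +%R 0 xpredT addR_continuous) => j _; exact: P (Lg j).2.
  have c2 : dot (f' * gr i u) (dq (h n) i u) @[n --> \oo] --> \int[leb]_x (f' x * gr i u x ^+ 2).
    have -> : \int[leb]_x (f' x * gr i u x ^+ 2) = dot (f' * gr i u) (gr i u).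
      by apply: eq_Rintegral => x _; rewrite fE expr2 mulrA.
    rewrite dotC; apply: (@cvg_eqr _ _ _ _ (fun n => dot (dq (h n) i u) (f' * gr i u))).
      by move=> n; rewrite dotC.
    by apply: dot_cvgl => [n|||]; [exact: L2_dq|exact: Lg|exact: Lfg|exact: H1_dq_cvg].
  apply: cvgB; last exact: cvgMr (P _ Lu.2).
  apply: cvgB; last exact: cvgMl (P _ (itg_pw hu)).
  by apply: cvgMr; apply: cvgD c2; exact: cvgMr.
have cp := cX _ (@hs_neq0 R) hs_cvg0; have cm := cX _ (@hsN_neq0 R) hsN_cvg0.
have cC : C * hs n @[n --> \oo] --> (0 : R).
  have c : C * hs n @[n --> \oo] --> C * 0 by apply: cvgMr; exact: hs_cvg0.
  by rewrite mulr0 in c.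
have cCN : - (C * hs n) @[n --> \oo] --> (0 : R) by rewrite -oppr0; exact: cvgN.
have X00 : X0 = 0.
  apply/eqP; rewrite eq_le; apply/andP; split.
    apply: (ler_lim_seq cm cC) => n; have h0 := @hs_gt0 R n; have := hC (- hs n) (hsN_neq0 _); rewrite normrN => /(_ (hs_le1 _)).
    exact: sq_divN h0.
  apply: (ler_lim_seq cCN cp) => n; have h0 := @hs_gt0 R n; have := hC (hs n) (hs_neq0 _) (hs_le1 _).
  exact: sq_div h0.
move: X00; rewrite /X0 sumrN; move: (\sum_j _) (\int[leb]_x _) (\int[leb]_x _) (\int[leb]_x _) => s1 s2 s3 s4 e.
by apply/eqP; rewrite -subr_eq0; apply/eqP; rewrite -[RHS]oppr0 -e; ring.
Qed.

End weight.
End pohozaev.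

(** * Removal of the weight and the full identity *)

Section pohozaev_identity.
Implicit Types (f g u v w phi : E -> R) (x y z : E) (i j : 'I_N) (A : set E).

Lemma sum_coord_arith (A D X : R) (g : 'I_N -> R) : D = \sum_i g i ->
  \sum_(i < N) (A * (2^-1 * D - g i)) = \sum_(i < N) X -> A * (N%:R * (2^-1 * D) - D) = N%:R * X.
Proof. by move=> e; rewrite -mulr_sumr sumrB -e !sumr_const card_ord !(mulr_natl _ N). Qed.

Lemma pohozaev_algebra (A mu D B M : R) : 0 < q ->
  A * (N%:R * (2^-1 * D) - D) = N%:R * (B / q + mu / 2 * M) -> A * D - B = mu * M ->
  q * (A * D) = 2 * k * B.
Proof.
move=> q0 e1 e2; have {}e2 : mu / 2 * M = (A * D - B) / 2 by rewrite e2; field.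
rewrite e2 in e1.
have -> : A * D = - (A * (N%:R * (2^-1 * D) - D) - N%:R * (2^-1 * (A * D))) by field.
by rewrite e1; field; exact: lt0r_neq0.
Qed.

(** An arctangent stretched by [n.+1]: bounded for each [n], at least 1 since [pi + atan] is
    positive, with slope at most 1 tending to 1 everywhere, so that the weight disappears in the
    limit of [pohozaev_weight]. *)
Definition ramp (n : nat) (s : R) : R := 1 + n.+1%:R * (pi + atan (n.+1%:R^-1 * s)).
Definition dramp (n : nat) (s : R) : R := (1 + (n.+1%:R^-1 * s) ^+ 2)^-1.

Lemma ramp_derive n (s : R) : is_derive s (1 : R) (ramp n) (dramp n s).
Proof.
have n0 : n.+1%:R != 0 :> R by rewrite pnatr_eq0.
have d1 : is_derive s (1 : R) (fun t : R => n.+1%:R^-1 * t) n.+1%:R^-1.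
  have d0 : is_derive s (1 : R) (n.+1%:R^-1 \*: (id : R -> R)) (n.+1%:R^-1 *: (1 : R)) by exact: is_deriveZ.
  by apply: is_derive_eq d0 _; rewrite [_ *: _]mulr1.
have d2 := is_derive1_atan (n.+1%:R^-1 * s).
have d3 := is_derive1_comp (f := atan) (g := fun t : R => n.+1%:R^-1 * t) d2 d1.
have d4 : is_derive s (1 : R) (ramp n) (0 + n.+1%:R *: (0 + ((1 + (n.+1%:R^-1 * s) ^+ 2)^-1 * n.+1%:R^-1))).
  by apply: is_deriveD; apply: is_deriveZ; apply: is_deriveD.
apply: is_derive_eq d4 _; rewrite !add0r /dramp [_ *: _]mulrCA mulfV// mulr1//.
Qed.

Lemma dramp_pos n (s : R) : 0 < 1 + (n.+1%:R^-1 * s) ^+ 2.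
Proof. by rewrite ltr_pwDl// sqr_ge0. Qed.

Lemma dramp_le1 n (s : R) : `|dramp n s| <= 1.
Proof.
by rewrite /dramp normfV ger0_norm ?invf_le1 ?(ltW (dramp_pos _ _)) ?dramp_pos// lerDl sqr_ge0.
Qed.

Lemma meas_dramp n : measurable_fun setT (dramp n).
Proof.
apply: continuous_measurable_fun => s; apply: cvgV; first by rewrite lt0r_neq0// dramp_pos.
apply: cvgD; first exact: cvg_cst.
by apply: cvgM; apply: cvgM; [exact: cvg_cst|exact: cvg_id|exact: cvg_cst|exact: cvg_id].
Qed.

Lemma ramp_ge1 n (s : R) : 1 <= ramp n s.
Proof.
rewrite /ramp lerDl mulr_ge0//; have := atan_gtNpi2 (n.+1%:R^-1 * s); have := pi_ge0 R.
move: (atan _) (pi : R) => u v; lra.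
Qed.

Lemma ramp_le n (s : R) : ramp n s <= 1 + n.+1%:R * (2 * pi).
Proof.
rewrite /ramp lerD2l ler_wpM2l//; have := atan_ltpi2 (n.+1%:R^-1 * s); have := pi_ge0 R.
move: (atan _) (pi : R) => u v; lra.
Qed.

Lemma dramp_cvg (s : R) : dramp n s @[n --> \oo] --> (1 : R).
Proof.
rewrite -[X in _ --> X]invr1; apply: cvgV; first exact: oner_neq0.
rewrite -[X in _ --> X]addr0; apply: cvgD; first exact: cvg_cst.
have c : n.+1%:R^-1 * s @[n --> \oo] --> (0 : R).
  by rewrite -(mul0r s); apply: cvgMl; exact: inv_succ_cvg0.
have c2 : (n.+1%:R^-1 * s) * (n.+1%:R^-1 * s) @[n --> \oo] --> (0 * 0 : R) by exact: cvgM.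
by rewrite mul0r in c2.
Qed.

Lemma dramp_int_cvg (i : 'I_N) F : itg F ->
  \int[leb]_x (dwt i (dramp n) x * F x) @[n --> \oo] --> \int[leb]_x F x.
Proof.
move=> iF.
suff [_] : itg F /\ \int[leb]_x (dwt i (dramp n) x * F x) @[n --> \oo] --> \int[leb]_x F x by [].
apply: (dominated_int (f := fun n x => dwt i (dramp n) x * F x) (h := fun x => `|F x|)).
- by move=> n; apply: measurable_funM; [exact: meas_dwt (meas_dramp n)|exact: itg_meas iF].
- move=> x; rewrite -[X in _ --> X]mul1r; apply: cvgMl; exact: dramp_cvg.
- exact: itg_abs.
- by move=> n x; rewrite normrM ler_piMl//; exact: dramp_le1.
Qed.

Lemma pohozaev_coord (i : 'I_N) (A mu : R) u : 0 < A -> 0 < Cst -> H1 u ->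
  (forall phi, H1 phi -> A * dotD u phi - \int[leb]_x (dpw (u x) * phi x) = mu * dot u phi) ->
  A * (2^-1 * dirichlet u - nsq (gr i u)) = Bp u / q + mu / 2 * nsq u.
Proof.
move=> A0 C0 hu EL; have Lu := H1_L2 hu; have Lg j := gr_L2 j hu.
have E n := pohozaev_weight i (ramp_derive n) (dramp_le1 n) (meas_dramp n) (ramp_ge1 n) (ramp_le n)
  A0 C0 hu EL.
rewrite (dirichletE hu).
have cg j := dramp_int_cvg i (Lg j).2; have cu := dramp_int_cvg i Lu.2.
have cB := dramp_int_cvg i (itg_pw hu).
have cs : \sum_j \int[leb]_x (dwt i (dramp n) x * gr j u x ^+ 2) @[n --> \oo] --> \sum_j nsq (gr j u).
  apply: (@cvg_big R 'I_N +%R 0 xpredT addR_continuous) => j _; exact: cg.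
have cl : A * (2^-1 * \sum_j \int[leb]_x (dwt i (dramp n) x * gr j u x ^+ 2) - \int[leb]_x (dwt i (dramp n) x * gr i u x ^+ 2))
   @[n --> \oo] --> A * (2^-1 * \sum_j nsq (gr j u) - nsq (gr i u)).
  by apply: cvgMr; apply: cvgB; [exact: cvgMr|exact: cg].
have cr : (\int[leb]_x (dwt i (dramp n) x * pw (u x))) / q + mu / 2 * \int[leb]_x (dwt i (dramp n) x * u x ^+ 2)
   @[n --> \oo] --> Bp u / q + mu / 2 * nsq u.
  by apply: cvgD; [exact: cvgMl|exact: cvgMr].
have cl' := cvg_eqr _ (fun n => E n) cl.
by apply: (cvg_unique _ (cl' _) cr).
Qed.

(** The identities of the [N] directions are summed; testing the equation with [u] itself then
    eliminates [mu]. *)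
Lemma pohozaev (A mu : R) u : 0 < A -> 0 < Cst -> H1 u ->
  (forall phi, H1 phi -> A * dotD u phi - \int[leb]_x (dpw (u x) * phi x) = mu * dot u phi) ->
  q * (A * dirichlet u) = 2 * k * Bp u.
Proof.
move=> A0 C0 hu EL.
have S : \sum_(i < N) (A * (2^-1 * dirichlet u - nsq (gr i u))) = \sum_(i < N) (Bp u / q + mu / 2 * nsq u).
  by apply: eq_bigr => i _; exact: (pohozaev_coord i A0 C0 hu EL).
have {}S := sum_coord_arith (dirichletE hu) S.
have := EL u hu; rewrite (dotDff hu) (dotff leb u).
have -> : \int[leb]_x (dpw (u x) * u x) = Bp u by apply: eq_Rintegral => x _; rewrite dpwM.
exact: (pohozaev_algebra (q_gt0) S).
Qed.

End pohozaev_identity.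

(** * The mountain pass level *)

Section fibers.
Implicit Types (f g u v w phi : E -> R) (x y z : E) (i j : 'I_N) (A : set E).

Section fiber.
Variables (a b G t : R).
Hypotheses (a0 : 0 < a) (b0 : 0 < b) (t0 : 0 < t).
(** The variable is the Dirichlet energy; for the value of [G] fixed in the final section this is
    the function [f_p], by [f_pE]. *)
Definition fiber (s : R) : R := a / 2 * s + b / 4 * s ^+ 2 - G * s `^ k.
Hypothesis tmax : forall s, 0 < s -> s != t -> fiber s < fiber t.

Lemma fiber_le s : 0 < s -> fiber s <= fiber t.
Proof. by move=> s0; have [->//|st] := eqVneq s t; exact/ltW/tmax. Qed.

Lemma expR_derive (C r : R) : is_derive (0 : R) (1 : R) (fun s => C * expR (r * s)) (C * r).
Proof.
have d0 : is_derive (0 : R) (1 : R) (r \*: (id : R -> R)) (r *: (1 : R)) by exact: is_deriveZ.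
have d1 := is_derive1_comp (f := expR) (g := r \*: (id : R -> R)) (is_derive_expR _) d0.
have d2 : is_derive (0 : R) (1 : R) (C \*: (expR \o (r \*: (id : R -> R)))) (C *: (expR (r *: (0 : R)) * (r *: (1 : R)))).
  exact: is_deriveZ.
by apply: is_derive_eq d2 _; rewrite ![_ *: _]mulrC mul0r expR0 !mul1r mulrC.
Qed.

(* Along [s |-> t * expR s] the maximum is global, so the derivative at [0] vanishes. *)
Lemma fiber_crit : a / 2 * t + b / 2 * t ^+ 2 = k * (G * t `^ k).
Proof.
pose f s := - (fiber (t * expR s)).
have fexp s : f s = (- (a / 2 * t)) * expR (1 * s) + (- (b / 4 * t ^+ 2)) * expR (2 * s) + (G * t `^ k) * expR (k * s).
  rewrite /f /fiber powRM ?expR_ge0 ?(ltW t0)// powR_exp exprMn -expRM_natl mul1r.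
  by move: (expR _) (expR _) (expR _) (t `^ k) => x y z w; ring.
have d : is_derive (0 : R) (1 : R) f (- (a / 2 * t) * 1 + - (b / 4 * t ^+ 2) * 2 + (G * t `^ k) * k).
  have -> : f = (fun s => (- (a / 2 * t)) * expR (1 * s)) \+ (fun s => (- (b / 4 * t ^+ 2)) * expR (2 * s)) \+ (fun s => (G * t `^ k) * expR (k * s)).
    by apply/funext => s; rewrite fexp.
  by apply: is_deriveD; [apply: is_deriveD|]; exact: expR_derive.
have := min_derive d; rewrite /f expR0 mulr1 => /(_ (fun s => _)) h.
have : - (a / 2 * t) * 1 + - (b / 4 * t ^+ 2) * 2 + (G * t `^ k) * k = 0.
  by apply: h => s; rewrite lerN2; apply: fiber_le; rewrite mulr_gt0 ?expR_gt0.
by move: (G * _) => z e; apply/eqP; rewrite -subr_eq0 -oppr_eq0 -e; apply/eqP; field.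
Qed.

(** Criticality at [t] eliminates [G], and the sign of the fiber becomes a comparison of [x],
    [x ^+ 2] and the power of order [k]. *)
Lemma fiber_scale (x : R) : 0 <= x -> fiber (t * x) = a / 2 * t * x + b / 4 * t ^+ 2 * x ^+ 2 - (a / 2 * t + b / 2 * t ^+ 2) / k * x `^ k.
Proof.
move=> x0; have k0 : 0 < k by exact: lt_le_trans hk.
rewrite fiber_crit /fiber powRM// ?(ltW t0)//; move: (t `^ k) (x `^ k) (k) (lt0r_neq0 k0) => A B r r0.
by field.
Qed.

(** Since the energy lies above the fiber, a point of the sphere with negative energy must have
    Dirichlet energy beyond [t]. The bound comes from powers of order [k] being below squares on
    []0, 1]]. *)
Lemma fiber_pos s : 0 < s <= t -> 0 < fiber s.
Proof.
move=> /andP[s0 st]; pose x := s / t.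
have -> : s = t * x by rewrite /x mulrC divfK// lt0r_neq0.
have x0 : 0 < x by rewrite divr_gt0.
have x1 : x <= 1 by rewrite ler_pdivrMr// mul1r.
have k0 : 0 < k by exact: lt_le_trans hk.
rewrite fiber_scale ?(ltW x0)//; have := powR_le_sqr (_ : 0 <= x <= 1); rewrite (ltW x0) x1 => /(_ isT) xk.
have at0 : 0 < a / 2 * t by rewrite !mulr_gt0// invr_gt0.
have bt0 : 0 < b / 4 * t ^+ 2 by rewrite mulr_gt0 ?exprn_gt0// divr_gt0.
have bE : b / 2 * t ^+ 2 = 2 * (b / 4 * t ^+ 2) by field.
rewrite bE; move: (a / 2 * t) (b / 4 * t ^+ 2) at0 bt0 => A B A0 B0.
have c1 : (A + 2 * B) / k <= A / 2 + B.
  rewrite ler_pdivrMr// (le_trans (_ : _ <= (A / 2 + B) * 2))//; first by lra.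
  by rewrite ler_wpM2l// addr_ge0// ?ltW// divr_gt0.
have c2 : (A + 2 * B) / k * x `^ k <= (A / 2 + B) * x ^+ 2.
  by apply: ler_pM => //; [rewrite divr_ge0// ?ltW// addr_gt0// mulr_gt0|exact: powR_ge0].
have x2 : A * x ^+ 2 <= A * x by rewrite ler_pM2l// expr2 ger_pMl.
move: ((A + 2 * B) / k * x `^ k) (x ^+ 2) c2 x2 => u v c2 x2.
have : 0 < A * x by rewrite mulr_gt0.
have : 0 <= B * v - B * v by rewrite subrr.
lra.
Qed.

Lemma fiber_neg : fiber (t * expR 2) < 0.
Proof.
have k0 : 0 < k by exact: lt_le_trans hk.
rewrite fiber_scale ?expR_ge0//; pose x : R := expR 2; rewrite -/x.
have x3 : 3 <= x by rewrite (le_trans _ (expR_ge1Dx 2))//; lra.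
(* The factor [expR (2 * (k - 2))] is at least [2 * k - 3], hence at least [k / 2] because [2 <= k];
   for [k = 2] negativity still follows from [x >= 3]. *)
have xk : k / 2 * x ^+ 2 <= x `^ k.
  have -> : x `^ k = expR (2 * (k - 2)) * x ^+ 2.
    by rewrite /x powR_exp -expRM_natl -expRD; congr expR; ring.
  by rewrite ler_wpM2r ?sqr_ge0// (le_trans _ (expR_ge1Dx _))//; move: hk; move: (k) => r; lra.
have at0 : 0 < a / 2 * t by rewrite !mulr_gt0// invr_gt0.
have bt0 : 0 < b / 4 * t ^+ 2 by rewrite mulr_gt0 ?exprn_gt0// divr_gt0.
have bE : b / 2 * t ^+ 2 = 2 * (b / 4 * t ^+ 2) by field.
rewrite bE; move: (a / 2 * t) (b / 4 * t ^+ 2) at0 bt0 => A B A0 B0.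
have AB : 0 < (A + 2 * B) / k by rewrite divr_gt0// addr_gt0// mulr_gt0.
have h := ler_wpM2l (ltW AB) xk.
have e : (A + 2 * B) / k * (k / 2 * x ^+ 2) = A / 2 * x ^+ 2 + B * x ^+ 2 by move: (k) (lt0r_neq0 k0) => r r0; field.
rewrite e in h; have x2 : 3 * (A * x) <= A * x ^+ 2 by rewrite mulrCA ler_pM2l// expr2 ler_wpM2r// (le_trans _ x3).
have Ax : 0 < A * x by rewrite mulr_gt0// (lt_le_trans _ x3).
move: ((A + 2 * B) / k * x `^ k) h => u h; move: (A * x) Ax x2 => y y0 x2.
move: (x ^+ 2) h x2 => z h x2; lra.
Qed.

End fiber.

(** [s] is the square of the dilation factor, and the hypothesis says that the derivative vanishes
    at [s = 1]. Bernoulli's inequality for [s] with exponent [k], and for [s ^+ 2] with exponent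
    [k / 2], bounds the power term by combinations matching the linear and the quadratic term
    separately. *)
Lemma fiber_max (a b D X s : R) : 0 < a -> 0 < b -> 0 < D -> 0 <= s -> (a + b * D) * D = 2 * k * X ->
  a / 2 * (s * D) + b / 4 * (s * D) ^+ 2 - s `^ k * X <= a / 2 * D + b / 4 * D ^+ 2 - X.
Proof.
move=> a0 b0 D0 s0 e; have k0 : 0 < k by exact: lt_le_trans hk.
have XE : X = (a / 2 * D + 2 * (b / 4 * D ^+ 2)) / k.
  move: (k) (lt0r_neq0 k0) e => r r0 e; have -> : X = (a + b * D) * D / (2 * r) by rewrite e; field.
  by field.
have k1 : 1 <= k by apply: le_trans hk; lra.
have B1 := bernoulli k1 s0.
have B2 : 1 + k / 2 * (s ^+ 2 - 1) <= s `^ k.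
  have k2 : 1 <= k / 2 by rewrite ler_pdivlMr// mul1r.
  have := bernoulli k2 (sqr_ge0 s); rewrite -powR_mulrn// -powRrM (_ : 2%:R * (k / 2) = k); last by field.
  by rewrite powR_mulrn.
rewrite exprMn XE.
have at0 : 0 < a / 2 * D by rewrite !mulr_gt0// invr_gt0.
have bt0 : 0 < b / 4 * D ^+ 2 by rewrite mulr_gt0 ?exprn_gt0// divr_gt0.
have -> : a / 2 * (s * D) = a / 2 * D * s by ring.
have -> : b / 4 * (s ^+ 2 * D ^+ 2) = b / 4 * D ^+ 2 * s ^+ 2 by ring.
move: (a / 2 * D) (b / 4 * D ^+ 2) at0 bt0 => A B A0 B0.
move: (s `^ k) B1 B2 => S B1 B2.
have h1 : A / k * (1 + k * (s - 1)) <= A / k * S by rewrite ler_wpM2l// divr_ge0// ltW.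
have h2 : 2 * B / k * (1 + k / 2 * (s ^+ 2 - 1)) <= 2 * B / k * S.
  by rewrite ler_wpM2l// divr_ge0// ?mulr_ge0// ltW.
have e1 : A / k * (1 + k * (s - 1)) = A / k + A * (s - 1) by move: (k) (lt0r_neq0 k0) => r r0; field.
have e2 : 2 * B / k * (1 + k / 2 * (s ^+ 2 - 1)) = 2 * B / k + B * (s ^+ 2 - 1) by move: (k) (lt0r_neq0 k0) => r r0; field.
rewrite e1 in h1; rewrite e2 in h2.
have e3 : S * ((A + 2 * B) / k) = A / k * S + 2 * B / k * S by move: (k) (lt0r_neq0 k0) => r r0; field.
have e4 : (A + 2 * B) / k = A / k + 2 * B / k by move: (k) (lt0r_neq0 k0) => r r0; field.
rewrite e3 e4; move: (A / k) (2 * B / k) (A / k * S) (2 * B / k * S) h1 h2 => x1 x2 x3 x4 h1 h2.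
lra.
Qed.

End fibers.

(** * Continuity along dilations and along paths *)

Section paths.
Implicit Types (f g u v w phi : E -> R) (x y z : E) (i j : 'I_N) (A : set E).

Lemma abs_le_sqrt (x D n : R) : 0 <= D -> 0 <= n -> x ^+ 2 <= D * n ^+ 2 -> `|x| <= Num.sqrt D * n.
Proof.
move=> D0 n0 h; rewrite -(@ler_pXn2r _ 2)// ?nnegrE ?mulr_ge0 ?sqrtr_ge0//.
by rewrite exprMn sqr_sqrtr// real_normK ?num_real.
Qed.

Lemma diff_arith (D d w n r : R) : `|d| <= r * n -> 0 <= w -> w <= n ^+ 2 ->
  `|D + 2 * d + w - D| <= 2 * r * n + n ^+ 2.
Proof. by rewrite !ler_norml => /andP[h1 h2] w0 wn; apply/andP; split; lra. Qed.

Lemma seq_bounded (y : nat -> R) (l : R) : y n @[n --> \oo] --> l -> exists2 Y : R, 0 <= Y & forall n, `|y n| <= Y.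
Proof.
move=> c; have : cvgn y by apply/cvg_ex; exists l.
move=> /cvg_seq_bounded [M [_ hM]]; exists (`|M| + 1); first by rewrite addr_ge0.
by move=> n; apply: (hM (`|M| + 1)) => //; rewrite ltr_pwDr// ler_norm.
Qed.

(** Convergent exponents are bounded, so the dilations have uniformly bounded measure factors and
    preimages of a cube lie in a common cube, as [L2_comp_cvg] requires; the varying amplitude is
    treated apart. *)
Lemma dilation_cvg f (c y : nat -> R) (c0 y0 : R) : L2 f -> y n @[n --> \oo] --> y0 -> c n @[n --> \oo] --> c0 ->
  nsq (c n *: (f \o ( *:%R (expR (y n)))) - c0 *: (f \o ( *:%R (expR y0)))) @[n --> \oo] --> (0 : R).
Proof.
move=> Lf cy cc; have [Y1 Y10 hY1] := seq_bounded cy; have [Cc Cc0 hC] := seq_bounded cc.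
pose Y := Y1 + `|y0|.
have hY n : `|y n| <= Y by rewrite (le_trans (hY1 n))// lerDl.
have hY0 : `|y0| <= Y by rewrite lerDr.
have mp (s : R) : `|s| <= Y -> exists2 k, k <= expR Y ^+ N & mpres k (fun x : E => expR s *: x).
  move=> sY; exists ((expR s)^-1 ^+ N); last exact: mpres_scale (expR_gt0 s).
  rewrite -expRN lerXn2r ?nnegrE ?expR_ge0// ler_expR (le_trans _ sY)// -normrN ler_norm//.
have LS n : L2 (f \o ( *:%R (expR (y n)))) by have [k' _ m] := mp _ (hY n); exact: mpres_L2 m Lf.
have L0 : L2 (f \o ( *:%R (expR y0))) by have [k' _ m] := mp _ hY0; exact: mpres_L2 m Lf.
have cubeS' (r s : R) x : `|s| <= Y -> cube r (expR s *: x) -> cube (r * expR Y) x.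
  move=> sY /cubeP hx; apply/cubeP => j; have := hx j; rewrite mxE normrM (gtr0_norm (expR_gt0 s)) => h.
  have r0 : 0 <= r by apply: le_trans h; rewrite mulr_ge0// expR_ge0.
  rewrite -(ler_pM2l (expR_gt0 s)) (le_trans h)// mulrCA ler_peMr// -expRD -[leLHS]expR0 ler_expR.
  by have := sY; rewrite ler_norml => /andP[+ _]; lra.
have cf : nsq ((f \o ( *:%R (expR (y n)))) - (f \o ( *:%R (expR y0)))) @[n --> \oo] --> (0 : R).
  apply: (L2_comp_cvg (C := expR Y ^+ N)) => //.
  - by move=> n; exact: mp (hY n).
  - exact: mp hY0.
  - move=> x; apply: rV_cvg => j; rewrite mxE.
    apply: (@cvg_eqr _ _ _ _ (fun n => expR (y n) * x ord0 j)); first by move=> n; rewrite mxE.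
    by apply: cvgMl; apply: cvg_comp cy _; exact: continuous_expR.
  - move=> r; exists (r * expR Y) => x [[n]|]; exact: cubeS'.
pose M0 := nsq (f \o ( *:%R (expR y0))).
apply: (@squeeze0 _ _ _ _ _ (fun n => 2 * (Cc ^+ 2 * nsq ((f \o ( *:%R (expR (y n)))) - (f \o ( *:%R (expR y0))))) + 2 * ((c n - c0) ^+ 2 * M0))).
  apply: nearW => n; rewrite ger0_norm ?nsq_ge0//.
  have -> : c n *: (f \o ( *:%R (expR (y n)))) - c0 *: (f \o ( *:%R (expR y0)))
     = c n *: ((f \o ( *:%R (expR (y n)))) - (f \o ( *:%R (expR y0)))) + (c n - c0) *: (f \o ( *:%R (expR y0))).
    by apply/funext => x; rewrite !fE; ring.
  have Ld := L2B (LS n) L0.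
  apply: (le_trans (nsqD_le (L2Z (c n) Ld) (L2Z (c n - c0) L0))); rewrite (nsqZ _ Ld) (nsqZ _ L0) lerD2r.
  rewrite ler_wpM2l// ler_wpM2r ?nsq_ge0// -(real_normK (num_real (c n))).
  by rewrite lerXn2r ?nnegrE.
rewrite (_ : 0 = 2 * (Cc ^+ 2 * 0) + 2 * ((0 * 0) * M0)); last by rewrite !(mulr0, mul0r) addr0.
have cd : c n - c0 @[n --> \oo] --> (0 : R) by rewrite -(subrr c0); apply: cvgB => //; exact: cvg_cst.
apply: cvgD; first by apply: cvgMr; exact: cvgMr.
by apply: cvgMr; apply: cvgMl; exact: cvgM.
Qed.

Lemma grZ i (A : R) u : H1 u -> {ae leb, forall x, gr i (A *: u) x = (A *: gr i u) x}.
Proof.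
move=> hu; have [_ h] := H1_lin (A - 1) hu hu; apply: filterS (h i) => x.
have -> : (A - 1) *: u + u = A *: u by apply/funext => z; rewrite !fE; ring.
by move=> ->; rewrite !fE; ring.
Qed.

Lemma grB i u v : H1 u -> H1 v -> {ae leb, forall x, gr i (u - v) x = (gr i u - gr i v) x}.
Proof.
move=> hu hv; have [_ h] := H1_lin (-1) hv hu; apply: filterS (h i) => x.
have -> : -1 *: v + u = u - v by apply/funext => z; rewrite !fE; ring.
by move=> ->; rewrite !fE; ring.
Qed.

Lemma dil_cvg u (y : nat -> R) (y0 : R) : H1 u -> y n @[n --> \oo] --> y0 ->
  normH1 (dil (expR (y n)) u - dil (expR y0) u) @[n --> \oo] --> (0 : R).
Proof.
move=> hu cy; have Lu := H1_L2 hu.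
have hd s := let: And4 h _ _ _ := dilP (expR_gt0 s) hu in h.
have powE (s : R) : expR s `^ (N%:R / 2) = expR (N%:R / 2 * s) by rewrite powR_exp.
have cexp (r : R) : expR (r * y n) @[n --> \oo] --> expR (r * y0).
  by apply: (cvg_comp (fun n => r * y n) expR); [apply: cvgMr; exact: cy|exact: continuous_expR].
have cM : nsq (dil (expR (y n)) u - dil (expR y0) u) @[n --> \oo] --> (0 : R).
  apply: (@cvg_eqr _ _ _ _ (fun n => nsq (expR (N%:R / 2 * y n) *: (u \o ( *:%R (expR (y n)))) - expR (N%:R / 2 * y0) *: (u \o ( *:%R (expR y0)))))).
    by move=> n; rewrite /dil !powE.
  by apply: (dilation_cvg Lu cy); exact: cexp.
have gd i s : {ae leb, forall x, gr i (dil (expR s) u) x = ((expR (N%:R / 2 * s) * expR s) *: (gr i u \o ( *:%R (expR s)))) x}.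
  have [h g] := H1_dil (expR_gt0 s) hu.
  apply: filterS2 (grZ i (expR s `^ (N%:R / 2)) h) (g i) => x; rewrite /dil !fE => -> ->.
  by rewrite powE mulrA.
have cG i : nsq (gr i (dil (expR (y n)) u - dil (expR y0) u)) @[n --> \oo] --> (0 : R).
  have Lg := gr_L2 i hu.
  have LL s : L2 ((expR (N%:R / 2 * s) * expR s) *: (gr i u \o ( *:%R (expR s)))).
    by apply: L2Z; apply: mpres_L2 (mpres_scale (expR_gt0 s)) Lg.
  apply: (@cvg_eqr _ _ _ _ (fun n => nsq ((expR (N%:R / 2 * y n) * expR (y n)) *: (gr i u \o ( *:%R (expR (y n))))
      - (expR (N%:R / 2 * y0) * expR y0) *: (gr i u \o ( *:%R (expR y0)))))).
    move=> n; apply/esym/(nsq_ae (gr_L2 i (H1B (hd _) (hd _))) (L2B (LL _) (LL _))).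
    have gx := gd i (y n); have g0 := gd i y0.
    apply: filterS (filterI (grB i (hd (y n)) (hd y0)) (filterI gx g0)) => x [e1 [e2 e3]].
    by rewrite e1 !fE e2 e3 !fE.
  apply: (dilation_cvg Lg cy); apply: cvgM; first exact: cexp.
  by apply: (cvg_comp y expR cy); exact: continuous_expR.
have cD : dirichlet (dil (expR (y n)) u - dil (expR y0) u) @[n --> \oo] --> (0 : R).
  apply: (@cvg_eqr _ _ _ _ (fun n => \sum_i nsq (gr i (dil (expR (y n)) u - dil (expR y0) u)))).
    by move=> n; rewrite (dirichletE (H1B (hd _) (hd _))).
  have cs : \sum_i nsq (gr i (dil (expR (y n)) u - dil (expR y0) u)) @[n --> \oo] --> \sum_(i < N) (0 : R).
    by apply: (@cvg_big R 'I_N +%R 0 xpredT addR_continuous) => i _; exact: cG.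
  by rewrite [X in _ --> X]big1 in cs.
rewrite -(sqrtr0 R) /normH1.
apply: (cvg_comp (fun n => dirichlet (dil (expR (y n)) u - dil (expR y0) u) + nsq (dil (expR (y n)) u - dil (expR y0) u)) Num.sqrt); last exact: sqrt_continuous.
by rewrite -(addr0 (0 : R)); exact: cvgD.
Qed.

(** The dilation factor runs from [expR y0] to [expR 1]; the final Dirichlet energy is multiplied by
    [expR 2], where [fiber_neg] gives negative energy. *)
Definition dil_path (y0 : R) u : R -> E -> R := fun s => dil (expR (y0 + s * (1 - y0))) u.

Lemma dil_path_sphere (c y0 : R) u : sphere c u -> path_in_sphere c (dil_path y0 u).
Proof.
move=> [hu Mu]; split.
  by move=> s _; have [h M _ _] := dilP (expR_gt0 (y0 + s * (1 - y0))) hu; split => //; rewrite -Mu.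
move=> s0 _; pose g s := normH1 (dil_path y0 u s \- dil_path y0 u s0).
have seqc (z : nat -> R) : z n @[n --> \oo] --> s0 -> g (z n) @[n --> \oo] --> (0 : R).
  move=> cz; apply: (dil_cvg hu); apply: cvgD; [exact: cvg_cst|exact: cvgMl].
have g0 : g s0 = 0.
  have c1 : g s0 @[_ --> \oo] --> (0 : R) by exact: (seqc (fun=> s0) (cvg_cst _)).
  have c2 : g s0 @[_ --> \oo] --> g s0 by exact: cvg_cst.
  by apply: cvg_unique c2 c1.
have cg : g s @[s --> s0] --> g s0.
  apply/continuous_withinNx/cvgr_dnbhsP => z [_ cz]; rewrite g0; exact: seqc.
rewrite -g0; apply: cvg_trans cg; apply: cvg_app; exact: cvg_within.
Qed.

Lemma dirichlet_diff_le u v : H1 u -> H1 v ->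
  `|dirichlet u - dirichlet v| <= 2 * Num.sqrt (dirichlet v) * normH1 (u - v) + normH1 (u - v) ^+ 2.
Proof.
move=> hu hv; set w := u - v; have hw : H1 w by exact: H1B.
have D0 := dirichlet_ge0 v; have Dw0 := dirichlet_ge0 w; have M0 : 0 <= normL2_sq w := nsq_ge0 leb w.
have -> : u = v + w by apply/funext => x; rewrite /w !fE addrC subrK.
have n2 : normH1 w ^+ 2 = dirichlet w + normL2_sq w by rewrite sqr_sqrtr// addr_ge0.
have Dn : dirichlet w <= normH1 w ^+ 2 by rewrite n2 lerDl.
have cs : `|dotD v w| <= Num.sqrt (dirichlet v) * normH1 w.
  apply: (abs_le_sqrt D0 (sqrtr_ge0 _)).
  exact: (le_trans (dotD_CS hv hw) (ler_wpM2l D0 Dn)).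
rewrite (dirichletD hv hw); exact: diff_arith cs Dw0 Dn.
Qed.

Lemma dirichlet_path_continuous (c : R) (h : R -> E -> R) : path_in_sphere c h ->
  {within `[0, 1]%classic, continuous (fun s : R => dirichlet (h s))}.
Proof.
move=> [hs hc]; apply/subspace_continuousP => s0 s01.
have s01' : s0 \in `[(0 : R), 1] by [].
have cn := hc s0 s01'; have [h0 _] := hs s0 s01'.
have c0 : dirichlet (h s) - dirichlet (h s0) @[s --> within `[0, 1]%classic (nbhs s0)] --> (0 : R).
  apply: (@squeeze0 _ _ _ _ _ (fun s => 2 * Num.sqrt (dirichlet (h s0)) * normH1 (h s \- h s0) + normH1 (h s \- h s0) * normH1 (h s \- h s0))).
    rewrite near_withinE; apply: nearW => s s1; have [h1 _] := hs s s1.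
    exact: dirichlet_diff_le.
  have cc : 2 * Num.sqrt (dirichlet (h s0)) * normH1 (h s \- h s0) + normH1 (h s \- h s0) * normH1 (h s \- h s0)
      @[s --> within `[0, 1]%classic (nbhs s0)] --> 2 * Num.sqrt (dirichlet (h s0)) * 0 + 0 * 0.
    by apply: cvgD; [apply: cvgMr; exact: cn|apply: cvgM; exact: cn].
  by rewrite !mulr0 addr0 in cc.
have c1 : (dirichlet (h s) - dirichlet (h s0)) + dirichlet (h s0) @[s --> within `[0, 1]%classic (nbhs s0)] --> 0 + dirichlet (h s0).
  by apply: cvgD; [exact: c0|exact: cvg_cst].
rewrite [X in _ --> X]add0r in c1.
by apply: (cvg_eqr _ _ c1) => s; rewrite subrK.
Qed.

End paths.

(** * The mountain pass level and its critical points *)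

Section mountain_pass.
Implicit Types (f g u v w phi : E -> R) (x y z : E) (i j : 'I_N) (A : set E).

Lemma fiber_equality (a b g t D X : R) : 0 < a -> 0 < b -> 0 < t -> 0 < D -> (a + b * D) * D = 2 * k * X ->
  a / 2 * D + b / 4 * D ^+ 2 - X = fiber a b g t -> X <= g * D `^ k -> X = g * D `^ k.
Proof.
move=> a0 b0 t0 D0 e E1 B1; apply/eqP; rewrite eq_le B1 /=.
have s0 : 0 <= t / D by rewrite divr_ge0// ltW.
(* The ratio [t / D] is the squared factor of the dilation whose Dirichlet energy is [t]; cancelling
   the terms in [a] and [b] leaves the missing inequality between the power terms. *)
have := fiber_max a0 b0 D0 s0 e; rewrite divfK ?lt0r_neq0// E1 /fiber lerD2l lerN2 => le1.
have tD : t `^ k = (t / D) `^ k * D `^ k by rewrite -powRM ?(ltW D0)// divfK// lt0r_neq0.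
have sk : 0 < (t / D) `^ k by rewrite powR_gt0// divr_gt0.
by rewrite -(ler_pM2l sk) mulrCA -tD.
Qed.

Lemma min_max_between (x y s : R) : x <= s -> s <= y -> Num.min x y <= s <= Num.max x y.
Proof. by move=> xs sy; rewrite ge_min le_max xs sy orbT. Qed.

Lemma kirchhoff_arith (a b t q' r s C X Y Z G d e I nu : R) : 0 < q' -> 0 < t ->
  a / 2 * t + b / 2 * t ^+ 2 = r * (C / q' * G * X) -> X = t * Y ->
  q' * I = C * (2 * r * Y * G * d + 2 * s * X * Z * e) ->
  nu = 2 * s * C / q' * (X * Z) -> (a + b * t) * d + (nu * e - I) = 0.
Proof.
move=> q0 t0 e1 e2 e3 ->; have q1 := lt0r_neq0 q0.
have -> : I = C * (2 * r * Y * G * d + 2 * s * X * Z * e) / q' by rewrite -e3; field.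
have e4 : a + b * t = 2 * (r * (C / q' * G * Y)).
  by apply: (mulfI (lt0r_neq0 t0)); rewrite e2 in e1; have -> : t * (a + b * t) = 2 * (a / 2 * t + b / 2 * t ^+ 2) by [field]; rewrite e1; ring.
by rewrite e4; field.
Qed.

Variables (a b c t K m : R).
Hypotheses (a0 : 0 < a) (b0 : 0 < b) (c0 : 0 < c) (t0 : 0 < t) (C0 : 0 < Cst).
Hypothesis mp : m `^ p = q / (2 * Cst).
Local Notation G := (Cst / q * (c ^+ 2) `^ beta).
Local Notation F := (fiber a b G).
Hypothesis tmax : forall s, 0 < s -> s != t -> F s < F t.

Lemma f_pE s : f_p N a b p c m s = F s.
Proof.
rewrite /f_p /fiber mp; congr (_ - _ * _).
have -> : c `^ ((2 * (p + 2) - N%:R * p) / 2) = (c ^+ 2) `^ beta.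
  by rewrite -powR_mulrn ?(ltW c0)// -powRrM; congr (_ `^ _); field.
by move: (_ `^ _) => A; field; rewrite !lt0r_neq0// q_gt0.
Qed.

Lemma energy_ge u : sphere c u -> F (dirichlet u) <= energy a b p u.
Proof.
move=> [hu Mu]; rewrite /fiber /energy lerD2l lerN2 mul1r ler_pdivrMl ?q_gt0//.
apply: le_trans (gn hu) _; rewrite [nsq u]Mu le_eqVlt; apply/orP; left; apply/eqP.
move: (_ `^ _) (_ `^ _) => A B; field; exact: lt0r_neq0 (q_gt0).
Qed.

Lemma energy_opt u : opt u -> nsq u = c ^+ 2 -> energy a b p u = F (dirichlet u).
Proof.
move=> [hu _ Bu] Mu; rewrite /energy /fiber; congr (_ - _).
transitivity (1 / q * Bp u); first exact: erefl.
rewrite Bu Mu.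
move: (_ `^ _) (_ `^ _) => A B; field; exact: lt0r_neq0 (q_gt0).
Qed.

Lemma opt_of_energy u : sphere c u -> energy a b p u = F (dirichlet u) -> opt u.
Proof.
move=> [hu Mu] e; have Mu' : nsq u = c ^+ 2 := Mu.
split=> //; first by rewrite Mu' exprn_gt0.
rewrite Mu'; move: e; rewrite /energy /fiber => /addrI/oppr_inj.
rewrite [\int[leb]_x _](_ : _ = Bp u)//; move: (_ `^ _) (_ `^ _) (Bp u) => A B X e.
have q0 := lt0r_neq0 (q_gt0).
by have -> : X = q * (1 / q * X) by [field]; rewrite e; field.
Qed.

Section level.
Variable uc : E -> R.
Hypotheses (ouc : opt uc) (Muc : nsq uc = c ^+ 2) (Duc : dirichlet uc = t).

Lemma energy_dil l : 0 < l -> energy a b p (dil l uc) = F (l ^+ 2 * t).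
Proof.
move=> l0; have [hu _ _] := ouc; have [h M D _] := dilP l0 hu.
by rewrite (energy_opt (opt_dil l0 ouc)) ?D ?Duc// M.
Qed.

Lemma dil_mp_path l : 0 < l -> l ^+ 2 * t <= K -> exists2 h : R -> E -> R, mp_paths a b p c K h &
  energy a b p (h 0) = F (l ^+ 2 * t) /\ forall s, energy a b p (h s) <= F t.
Proof.
move=> l0 lK; have [hu _ _] := ouc; have [h M D _] := dilP l0 hu.
have h0 : dil_path (ln l) uc 0 = dil l uc by rewrite /dil_path mul0r addr0 lnK.
exists (dil_path (ln l) uc); last split.
- split; first by apply: (dil_path_sphere); split.
    by rewrite h0 D Duc.
  rewrite /dil_path mul1r addrC subrK energy_dil ?expR_gt0//.
  rewrite -expRM_natl mulr1 (mulrC _ t); exact: (fiber_neg a0 b0 t0 tmax).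
- by rewrite h0 energy_dil.
- move=> s; rewrite /dil_path energy_dil ?expR_gt0//; apply: (fiber_le tmax).
  by rewrite mulr_gt0// exprn_gt0// expR_gt0.
Qed.

Lemma mp_level_le (h : R -> E -> R) : mp_paths a b p c K h -> (forall s, energy a b p (h s) <= F t) ->
  (mp_level (N := N) a b p c K <= (F t)%:E)%E.
Proof.
move=> hp hF; apply: (@le_trans _ _ (ereal_sup [set (energy a b p (h s))%:E | s in `[0, 1]%classic])).
  by apply: ereal_inf_lbound; exists h.
by apply: ge_ereal_sup => _ [s _ <-]; rewrite lee_fin.
Qed.

(* If [t <= K], the dilation path starting at [uc] itself contradicts the geometry. *)
Lemma mp_geometry_lt : mp_geometry (N := N) a b p c K -> K < t.
Proof.
move=> [K0 geo]; rewrite ltNge; apply/negP => tK.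
have [|h hp [h0 hF]] := @dil_mp_path 1 ltr01; first by rewrite expr1n mul1r.
have := lt_le_trans (geo h hp) (mp_level_le hp hF).
by rewrite h0 expr1n mul1r lte_fin gt_max ltxx.
Qed.

Lemma mp_levelE : mp_geometry (N := N) a b p c K -> mp_level (N := N) a b p c K = (F t)%:E.
Proof.
move=> geo; have Kt := mp_geometry_lt geo; have [K0 _] := geo.
apply/eqP; rewrite eq_le; apply/andP; split.
  (* With this initial dilation the path starts at Dirichlet energy exactly [K], the largest value
     that [mp_paths] allows. *)
  have l0 : 0 < Num.sqrt (K / t) by rewrite sqrtr_gt0 divr_gt0.
  have [|h hp [_ hF]] := @dil_mp_path (Num.sqrt (K / t)) l0.
    by rewrite sqr_sqrtr ?divr_ge0 ?(ltW K0) ?(ltW t0)// divfK// lt0r_neq0.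
  exact: mp_level_le hp hF.
apply: le_ereal_inf_tmp => _ [h [[hs hc] hK h1] <-].
have s0 : (0 : R) \in `[0, 1] by rewrite in_itv /= lexx ler01.
have s1 : (1 : R) \in `[0, 1] by rewrite in_itv /= lexx ler01.
(* Negative energy at the end of the path is incompatible with a Dirichlet energy in []0, t]], by
   [fiber_pos] and [energy_ge]. *)
have D1 : t < dirichlet (h 1).
  have [hu Mu] := hs 1 s1; rewrite ltNge; apply/negP => le.
  have D0 : 0 < dirichlet (h 1) by apply: (dirichlet_gt0 hu); rewrite [nsq _]Mu exprn_gt0.
  have := fiber_pos a0 b0 t0 tmax (s := dirichlet (h 1)); rewrite D0 le => /(_ isT) pos.
  by have := lt_le_trans pos (energy_ge (hs 1 s1)); rewrite ltNge (ltW h1).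
have [||s s01 Ds] := @IVT R (fun s => dirichlet (h s)) 0 1 t ler01.
- exact: (dirichlet_path_continuous (conj hs hc)).
- exact: (min_max_between (le_trans hK (ltW Kt)) (ltW D1)).
apply: (@le_trans _ _ (energy a b p (h s))%:E); last by apply: ereal_sup_ubound; exists s.
by rewrite lee_fin -Ds; exact: energy_ge (hs s s01).
Qed.

(** Criticality of [t] identifies the gradient multiplier of [opt_EL], after normalization, with
    [a + b * t]; the multiplier of the mass term gives [mu], which is negative because [beta] is
    positive. *)
Lemma opt_kirchhoff : exists2 mu : R, mu < 0 & kirchhoff_solution a b p mu uc.
Proof.
have [hu _ _] := ouc; have q0 := q_gt0.
exists (- (2 * beta * Cst / q * (t `^ k * (c ^+ 2) `^ (beta - 1)))).
  rewrite oppr_lt0 mulr_gt0 ?mulr_gt0 ?powR_gt0 ?exprn_gt0 ?invr_gt0//.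
apply: (weak_solution_intro hu) => phi hp; rewrite Duc.
have e := opt_EL ouc hp; rewrite Duc Muc in e.
have i1 := itg_mul (H1_L2 hu) (H1_L2 hp); have i2 := itg_dpw hu hp.
set nu := 2 * beta * Cst / q * _.
have -> : \int[leb]_x ((- (`|uc x| `^ p * uc x) - - nu * uc x) * phi x)
   = nu * dot uc phi - \int[leb]_x (dpw (uc x) * phi x).
  rewrite -(intZ _ i1) -(intB (itgZ _ i1) i2); apply: eq_Rintegral => x _.
  rewrite !fE /dpowp; move: (`|uc x| `^ p) (uc x) (phi x) => u1 u2 u3; ring.
have crit := fiber_crit t0 tmax.
have tk : t `^ k = t * t `^ (k - 1).
  have -> : t * t `^ (k - 1) = t `^ 1 * t `^ (k - 1) by rewrite powRr1// ltW.
  by rewrite -powRD ?(lt0r_neq0 t0) ?implybT// addrC subrK.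
exact: kirchhoff_arith q0 t0 crit tk e (erefl nu).
Qed.

(** Once equality holds in the Gagliardo-Nirenberg inequality, the energy of [u] is the value of the
    fiber at its Dirichlet energy, and strictness of the maximum leaves only [t]. *)
Lemma critical_opt u : constrained_critical a b p c u -> energy a b p u = F t -> opt u /\ dirichlet u = t.
Proof.
move=> [[hu Mu] [mu hE]] Eu; have Mu' : nsq u = c ^+ 2 := Mu; have q0 := q_gt0.
have EL := critical_EL a0 b0 hu hE.
have D0 : 0 < dirichlet u by apply: (dirichlet_gt0 hu); rewrite Mu' exprn_gt0.
have A0 : 0 < a + b * dirichlet u by rewrite addr_gt0// mulr_gt0.
have poh := pohozaev A0 C0 hu EL.
have e : (a + b * dirichlet u) * dirichlet u = 2 * k * (1 / q * Bp u).
  have -> : 2 * k * (1 / q * Bp u) = q^-1 * (2 * k * Bp u) by ring.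
  by rewrite -poh mulKf// lt0r_neq0.
have B1 : 1 / q * Bp u <= G * dirichlet u `^ k.
  by have := energy_ge (conj hu Mu); rewrite /energy /fiber lerD2l lerN2.
have E2 := fiber_equality a0 b0 t0 D0 e Eu B1.
have ou : opt u.
  apply: (opt_of_energy (conj hu Mu)); rewrite /fiber -E2; exact: erefl.
split; first exact: ou.
have [e'|ne] := eqVneq (dirichlet u) t; first exact: e'.
exfalso; have := tmax D0 ne; rewrite -(energy_opt ou Mu') Eu; exact: (elimF idP (ltxx _)).
Qed.

End level.
End mountain_pass.

End mountain_pass_level.

(** * Conclusion *)

Lemma exponent_conditions (R : realType) (N : nat) (p : R) : (1 <= N <= 3)%N -> 0 < p ->
  (p%:E < critical_exponent R N - 2%:E)%E -> 8 / N%:R <= p ->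
  [/\ (N = 3%N -> p + 2 < 6), 0 < (p + 2) / 2 - N%:R * p / 4 & 2 <= N%:R * p / 4].
Proof.
move=> hN p0 sub p8.
have hq : N = 3%N -> p + 2 < 6.
  by move=> N3; move: sub; rewrite /critical_exponent N3 /= -EFinB lte_fin; lra.
split=> //.
  have : [|| N == 1%N, N == 2%N | N == 3%N] by case: N hN {sub p8 hq} => [|[|[|[|]]]].
  case/or3P => /eqP e; rewrite e; [lra|lra|have := hq e; lra].
have NR : 0 < N%:R :> R by rewrite ltr0n; case/andP: hN.
by move: p8; rewrite ler_pdivrMr// mulrC; lra.
Qed.

Lemma ubar_dil (R : realType) (N : nat) (c t : R) (Q : 'rV[R]_N -> R) :
  ubar c t Q = dil (Num.sqrt t / c) ((c / normL2 Q) *: Q).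
Proof.
apply/funext => x; rewrite /ubar /dil !fE /= !fE.
by move: (_ `^ _) (Q _) (normL2 Q) => A B C; ring.
Qed.

(** The energy is even, so the opposite of a critical point is again one at the same level: hence
    the two alternatives in the uniqueness clause. The identification with [u_c] is made for the
    absolute value of [u], and [opt_sign] then decides between [u] and its opposite. *)
Theorem theorem1p2 (R : realType) (N : nat) (a b p c : R)
  (Q : 'rV[R]_N -> R) (t K : R)
  (a_gt0 : 0 < a) (b_gt0 : 0 < b) (N_range : (1 <= N <= 3)%N)
  (p_gt0 : 0 < p) (p_subcritical : (p%:E < critical_exponent R N - 2%:E)%E)
  (c_gt0 : 0 < c)
  (QP : is_Q p Q)
  (pcP : 8 / N%:R < p \/ (p = 8 / N%:R /\ c_star N b (normL2 Q) < c))
  (tP : unique_maximum_point (f_p N a b p c (normL2 Q)) t)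
  (KP : mp_geometry (N := N) a b p c K) :
  let gamma := mp_level (N := N) a b p c K in
  let u_c := ubar c t Q in
  [/\ gamma = (f_p N a b p c (normL2 Q) t)%:E,
      sphere c u_c /\ (energy a b p u_c)%:E = gamma,
      exists2 mu : R, mu < 0 & kirchhoff_solution a b p mu u_c &
      forall u : 'rV[R]_N -> R,
        constrained_critical a b p c u -> (energy a b p u)%:E = gamma ->
        is_translate u u_c \/ is_translate (\- u) u_c].
Proof.
move=> gamma u_c; pose i0 : 'I_N := Ordinal (proj1 (andP N_range)).
have p8 : 8 / N%:R <= p by case: pcP => [/ltW//|[->]].
have [hq hb hk] := exponent_conditions N_range p_gt0 p_subcritical p8.
have [m [m0 mp oQ MQ DQ]] := Q_opt p_gt0 N_range hq hb hk QP.
have [hQ MQ0 _] := oQ; have C0 := Cst_gt0 p_gt0 N_range hq hQ MQ0.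
have nQ : normL2 Q = m by rewrite /normL2 [normL2_sq Q]MQ sqrtr_sqr gtr0_norm.
have [t0 tmx] := tP; have fE' := f_pE p_gt0 a b c_gt0 C0 mp.
have tmax : forall s, 0 < s -> s != t ->
    fiber p (N := N) a b (Cst p (N := N) / (p + 2) * (c ^+ 2) `^ ((p + 2) / 2 - N%:R * p / 4)) s <
    fiber p (N := N) a b (Cst p (N := N) / (p + 2) * (c ^+ 2) `^ ((p + 2) / 2 - N%:R * p / 4)) t.
  by move=> s s0 st; rewrite -!fE'; have := tmx s s0 st; rewrite nQ.
pose l := Num.sqrt t / c.
have l0 : 0 < l by rewrite divr_gt0// sqrtr_gt0.
have cm0 : 0 < c / m by rewrite divr_gt0.
have ucE : u_c = dil l ((c / m) *: Q) by rewrite /u_c ubar_dil nQ.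
have hz := H1Z (c / m) hQ.
have [hd Md Dd _] := dilP p_gt0 N_range hq l0 hz.
have lc : l * c = Num.sqrt t by rewrite /l divfK// lt0r_neq0.
have ouc : opt p u_c.
  by rewrite ucE; apply: (opt_dil p_gt0 N_range hq l0); exact: (optZ p_gt0 N_range hq (lt0r_neq0 cm0)).
have Muc : l2sq (@lebesgue_rV R N) u_c = c ^+ 2.
  by rewrite ucE Md (nsqZ _ (H1_L2 hQ)) MQ; field; exact: lt0r_neq0.
have Duc : dirichlet u_c = t.
  rewrite ucE Dd (dirichletZ _ hQ) DQ -[RHS](sqr_sqrtr (ltW t0)) -lc; field; exact: lt0r_neq0.
have lvl := mp_levelE p_gt0 N_range hq hb hk a_gt0 b_gt0 c_gt0 t0 tmax ouc Muc Duc KP.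
have Euc := energy_opt p_gt0 a b ouc Muc; rewrite Duc in Euc.
split.
- by rewrite /gamma lvl nQ fE'.
- by split; [split; [case: ouc|exact: Muc]|rewrite /gamma lvl Euc].
- exact: (opt_kirchhoff p_gt0 N_range hq hb c_gt0 t0 C0 tmax ouc Muc Duc).
move=> u cu; rewrite /gamma lvl => -[Eu].
have [ou Du] := critical_opt p_gt0 N_range hq hb hk a_gt0 b_gt0 c_gt0 t0 C0 tmax cu Eu.
have [[hu Mu] _] := cu.
have [oa Da] := opt_abs p_gt0 N_range hq hb hk ou.
have Ma : l2sq (@lebesgue_rV R N) (fun x => `|u x|) = c ^+ 2.
  by rewrite -Mu; apply: eq_Rintegral => x _; rewrite real_normK ?num_real.
have Da' : dirichlet (fun x => `|u x|) = (l * c) ^+ 2 by rewrite Da Du lc sqr_sqrtr// ltW.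
have [y hy] := opt_unique p_gt0 N_range hq hb hk QP m0 mp C0 c_gt0 l0 oa (fun x => normr_ge0 (u x)) Ma Da'.
have uE x : u_c x = c * l `^ (N%:R / 2) / m * Q (l *: x) by rewrite /u_c /ubar nQ.
case: (opt_sign p_gt0 N_range hq hb hk i0 ou) => sg; [left|right]; exists y;
  by apply: filterS2 sg hy => x /= e1 e2; rewrite e1 e2 uE.
Qed.
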